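(* Let $\alpha\ge-1$ and let $(\varepsilon_n)_{n\ge1}$ be a non-increasing sequence of positive real numbers with limit zero. Then there exists an injective Schur function $\varphi$ such that $\varphi(0)=0$ and $C_\varphi:\mathfrak{B}_\alpha\to\mathfrak{B}_\alpha$ is compact, i.e. $a_n(C_\varphi)\to0$, but $$\liminf_{n\to\infty}\frac{a_n(C_\varphi)}{\varepsilon_n}>0 .$$ Equivalently, there is $\delta>0$, independent of $n$, such that $a_n(C_\varphi)\ge\delta\,\varepsilon_n$ for all $n\ge1$.
   Context: $\mathbb{D}$ is the open unit disk with normalized area measure $dA=\frac{dx\,dy}{\pi}$. For $\alpha>-1$, $\mathfrak{B}_\alpha$ is the weighted Bergman space of analytic functions $f$ on $\mathbb{D}$ with $\|f\|_\alpha^2=(\alpha+1)\int_{\mathbb{D}}|f(z)|^2(1-|z|^2)^\alpha\,dA(z)<\infty$; for $\alpha=-1$, $\mathfrak{B}_{-1}=H^2$ is the Hardy space with $\|\sum a_nz^n\|^2=\sum|a_n|^2$. A Schur function is a non-constant analytic map $\varphi:\mathbb{D}\to\mathbb{D}$; $C_\varphi f=f\circ\varphi$ (always bounded on $\mathfrak{B}_\alpha$). For a bounded operator $T$ between Hilbert spaces, $a_n(T)=\inf\{\|T-R\|:\ \operatorname{rank}R<n\}$, $n\ge1$. *)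

(* Defs.v *)
From HB Require Import structures.
From mathcomp Require Import all_boot all_order all_algebra complex.
From mathcomp Require Import all_classical all_reals all_analysis.
Import Order.TTheory GRing.Theory Num.Theory.
Import numFieldNormedType.Exports.

Set Implicit Arguments.
Unset Strict Implicit.
Unset Printing Implicit Defensive.

Local Open Scope classical_set_scope.
Local Open Scope ring_scope.

(* Packing R[i] as a numClosedFieldType gives it the topology, the normed
   module structure over itself, and hence complex differentiability, that the
   analysis library attaches to every abstract numFieldType. *)
Definition cplx (R : realType) : numClosedFieldType := R[i]%C.

Definition mkC (R : realType) (x y : R) : cplx R := (x +i* y)%C.

(* The modulus as an element of R (the norm of R[i] takes values in R[i]). *)
Definition modulus (R : realType) (z : cplx R) : R := ComplexField.Normc.normc z.

Definition disk (R : realType) := {z : cplx R | `|z| < 1}.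

Lemma disk0_subproof (R : realType) : `|0 : cplx R| < 1.
Proof. by rewrite normr0 ltr01. Qed.

Definition disk0 (R : realType) : disk R := exist _ 0 (disk0_subproof R).

(* The disk is open, so neither differentiability at its points nor integrals
   over it depend on the value 0 chosen outside. *)
Definition ext (R : realType) (f : disk R -> cplx R) (z : cplx R) : cplx R :=
  if insub z is Some w then f w else 0.

Definition analytic (R : realType) (f : disk R -> cplx R) : Prop :=
  forall z : disk R, derivable (ext f) (val z) 1.

Definition schur (R : realType) (phi : disk R -> disk R) : Prop :=
  analytic (fun z => val (phi z)) /\ ~ (exists c, forall z, phi z = c).

Definition comp_op (R : realType) (phi : disk R -> disk R)
  (f : disk R -> cplx R) : disk R -> cplx R := f \o phi.

Definition power_series (R : realType) (f : disk R -> cplx R)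
    (a : nat -> cplx R) : Prop :=
  forall z : disk R, series (fun n => a n * val z ^+ n) @ \oo --> f z.

(* The coefficients are unique, and exist when f is analytic. *)
Definition taylor (R : realType) (f : disk R -> cplx R) : nat -> cplx R :=
  get (power_series f).

Definition hardy_norm2 (R : realType) (f : disk R -> cplx R) : \bar R :=
  (\sum_(0 <= n <oo) (modulus (taylor f n) ^+ 2)%:E)%E.

(* The factor pi^-1 normalizes area measure so that the disk has measure 1. *)
Definition bergman_norm2 (R : realType) (alpha : R) (f : disk R -> cplx R) :
    \bar R :=
  ((alpha + 1)%:E * (pi^-1%:E *
     \int[lebesgue_measure \x lebesgue_measure]_(p in
         [set p : R * R | (p.1 ^+ 2 + p.2 ^+ 2 < 1)%R])
       (modulus (ext f (mkC p.1 p.2)) ^+ 2 *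
        (1 - (p.1 ^+ 2 + p.2 ^+ 2)) `^ alpha)%:E))%E.

(* The case alpha = -1 is the Hardy space H^2. *)
Definition bergman_norm (R : realType) (alpha : R) (f : disk R -> cplx R) :
    \bar R :=
  sqrte (if alpha == -1 then hardy_norm2 f else bergman_norm2 alpha f).

Definition bergman_space (R : realType) (alpha : R) : set (disk R -> cplx R) :=
  [set f | analytic f /\ (bergman_norm alpha f < +oo)%E].

(* Operators on a linear subspace H of E, normed by N, are given by functions
   E -> E of which only the restriction to H matters. *)
Section Operators.
Variables (R : realType) (K : numFieldType) (E : lmodType K).
Variables (H : set E) (N : E -> \bar R).

Definition opnorm (T : E -> E) : \bar R :=
  ereal_sup [set N (T f) | f in [set f | H f /\ (N f <= 1)%E]].

Definition bounded_operator (T : E -> E) : Prop :=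
  [/\ forall f, H f -> H (T f),
      forall (c : K) f g, H f -> H g -> T (c *: f + g) = c *: T f + T g
    & (opnorm T < +oo)%E].

Definition compact_operator (T : E -> E) : Prop :=
  bounded_operator T /\
  forall u : nat -> E, (forall k, H (u k)) ->
    (exists M : R, forall k, (N (u k) <= M%:E)%E) ->
    exists s : nat -> nat, increasing_seq s /\
      exists2 g, H g & (N (T (u (s k)) - g) @[k --> \oo] --> 0)%E.

(* The range is contained in the span of fewer than n vectors. *)
Definition rank_lt (T : E -> E) (n : nat) : Prop :=
  exists m (e : 'I_m -> E), (m < n)%N /\
    forall f, H f -> exists c : 'I_m -> K, T f = \sum_i c i *: e i.

(* Meaningful for n >= 1; the value at n = 0 is +oo. *)
Definition approx_number (T : E -> E) (n : nat) : \bar R :=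
  ereal_inf [set opnorm (fun f => T f - S f) |
    S in [set S | bounded_operator S /\ rank_lt S n]].

End Operators.

(* Main.v *)
Require Import Defs.
From HB Require Import structures.
From mathcomp Require Import all_boot all_order all_algebra complex.
From mathcomp Require Import all_classical all_reals all_analysis.
From mathcomp Require Import separable cyclotomic cyclic measurable_realfun.
From mathcomp Require Import ring lra.
Import Order.TTheory GRing.Theory Num.Theory.
Import numFieldNormedType.Exports.

Set Implicit Arguments.
Unset Strict Implicit.
Unset Printing Implicit Defensive.

Local Open Scope classical_set_scope.
Local Open Scope ring_scope.

(** The symbol is a convex combination phi = sum_j p_j chi_j of the Moebius maps
    chi_j(z) = t_j z / (1 - (1 - t_j) z), which fix 0 and 1; here t_0 = 1 and the
    t_j decrease very fast to 0. On the interval [0, 1) the distance of phi(r) to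
    the boundary is

      1 - phi(r) = (1 - r) sum_j p_j / (1 - (1 - t_j) r),

    and |phi(z)| <= phi(|z|) everywhere. Since sum_j p_j / t_j diverges, phi has
    infinite slope at 1, the only point where it reaches the circle; this makes
    C_phi compact. The divergence may be arbitrarily slow, and then C_phi is
    barely compact: this is what gives the lower bound. Difference quotients of
    all chi_j lie in one half plane, so phi is injective (phi_inj).

    All norms are read on Taylor coefficients: the square of the norm is
    sum_n w_n |a_n|^2 with w_n = 1 for the Hardy space and w_n a multiple of the
    moment int_0^1 t^n (1 - t)^alpha dt for the Bergman spaces (bergman_norm2E).
    This needs Taylor expansions of differentiable functions (taylor_exists,
    from Goursat's theorem), and polar integration in the plane. Circle means
    are treated as limits of averages over roots of unity (parseval).

    Compactness. It suffices that composition is small in norm on functions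
    vanishing to high order at 0: then truncating Taylor series gives finite rank
    approximations (approx_cvg0, comp_compact). Littlewood's principle bounds the
    square mean of F o phi on the circle of radius r by that of F on a circle of
    radius phi(r). For alpha > -1 one integrates this over r, and the
    infinite slope at the boundary makes the result small
    (comp_small_bergman). For alpha = -1 this is not enough, as the Hardy norm
    sees only the boundary. There the identity

      1 - chi(z) chi(w)^* = (t (1 - z w^* ) + (1 - t) (1 - z) (1 - w)^* )
                            / ((1 - (1 - t) z) (1 - (1 - t) w)^* )

    shows that, in the sense of positive kernels, 1 / (1 - z w^* ) dominates
    h(z) h(w)^* / (1 - phi(z) phi(w)^* ) for multipliers h that are arbitrarily
    large near 1. By duality F -> h (F o phi) is a contraction (avg_contract),
    so F o phi is small near 1, while away from 1 the values of phi stay in a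
    smaller disc (hardy_small).

    Lower bound. Let x_j = 1 - t_j and y_j = phi(x_j), and let kap(r^2) be the
    squared norm of the reproducing kernel at r. If the t_j decrease fast enough,
    the normalised kernels at the points x_j, and also those at the points y_j,
    are almost orthonormal. An operator of rank below n annihilates a combination
    g of the kernels at y_1, ..., y_n. Pairing the values
    (g o phi)(x_j) = g(y_j) with the coefficients of g shows that the norm of
    g o phi is at least half the smallest ratio
    sqrt (kap(y_j^2) / kap(x_j^2)), j <= n, times the norm of g (approx_lower).
    The weights satisfy a doubling condition, so this ratio decreases at most
    like a power of ell_j, where 1 - y_j <= (ell_j + 1) t_j and ell_j is, up to a
    constant factor, the sum of p_i / t_i over i <= j. These sums are chosen so
    slowly growing that the ratio is at least a constant multiple of eps_j
    (kap_ratio, lam_kap). *)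

(** * The complex field through its real coordinates *)
Section Modulus.
Variable R : realType.
Local Notation C := (cplx R).
Implicit Types (z w : C) (x y : R).

Definition rc (x : R) : C := mkC x 0.
Definition re (z : C) : R := complex.Re z.
Definition im (z : C) : R := complex.Im z.

HB.instance Definition _ := GRing.RMorphism.copy rc (real_complex R).

Lemma rc0 : rc 0 = 0. Proof. by []. Qed.
Lemma rc1 : rc 1 = 1. Proof. by []. Qed.
Lemma rcD x y : rc (x + y) = rc x + rc y. Proof. exact: (rmorphD rc). Qed.
Lemma rcB x y : rc (x - y) = rc x - rc y. Proof. exact: (rmorphB rc). Qed.
Lemma rcM x y : rc (x * y) = rc x * rc y. Proof. exact: (rmorphM rc). Qed.
Lemma rcX x n : rc (x ^+ n) = rc x ^+ n. Proof. exact: (rmorphXn rc). Qed.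
Lemma rcV x : rc x^-1 = (rc x)^-1. Proof. exact: (fmorphV rc). Qed.
Lemma rc_nat n : rc n%:R = n%:R. Proof. exact: (rmorph_nat rc). Qed.
Lemma rc_sum I (r : seq I) (P : pred I) (F : I -> R) :
  rc (\sum_(i <- r | P i) F i) = \sum_(i <- r | P i) rc (F i).
Proof. exact: (rmorph_sum rc). Qed.

Lemma normcE z : `|z| = rc (modulus z).
Proof. by []. Qed.

Lemma rc_inj : injective rc.
Proof. by move=> x y []. Qed.

Lemma ler_rc x y : (rc x <= rc y) = (x <= y).
Proof. exact: lecR. Qed.

Lemma ltr_rc x y : (rc x < rc y) = (x < y).
Proof. exact: ltcR. Qed.

Lemma mkCE z : z = mkC (re z) (im z).
Proof. by case: z. Qed.

Lemma reD z w : re (z + w) = re z + re w. Proof. by case: z; case: w. Qed.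
Lemma imD z w : im (z + w) = im z + im w. Proof. by case: z; case: w. Qed.
Lemma reN z : re (- z) = - re z. Proof. by case: z. Qed.
Lemma imN z : im (- z) = - im z. Proof. by case: z. Qed.
Lemma reB z w : re (z - w) = re z - re w. Proof. by rewrite reD reN. Qed.
Lemma imB z w : im (z - w) = im z - im w. Proof. by rewrite imD imN. Qed.
Lemma reM z w : re (z * w) = re z * re w - im z * im w.
Proof. by case: z; case: w. Qed.
Lemma imM z w : im (z * w) = re z * im w + im z * re w.
Proof. by case: z; case: w. Qed.
Lemma re_rc x : re (rc x) = x. Proof. by []. Qed.
Lemma im_rc x : im (rc x) = 0. Proof. by []. Qed.
Lemma re_conj z : re z^* = re z. Proof. by case: z. Qed.
Lemma im_conj z : im z^* = - im z. Proof. by case: z. Qed.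
Lemma conj_rc x : (rc x)^* = rc x.
Proof. by rewrite [LHS]mkCE re_conj im_conj re_rc im_rc oppr0. Qed.

Lemma modulus_ge0 z : 0 <= modulus z.
Proof. by rewrite -ler_rc -normcE rc0 normr_ge0. Qed.
Hint Resolve modulus_ge0 : core.

Lemma modulus0 : modulus (0 : C) = 0.
Proof. by apply: rc_inj; rewrite -normcE normr0 rc0. Qed.
Lemma modulus1 : modulus (1 : C) = 1.
Proof. by apply: rc_inj; rewrite -normcE normr1 rc1. Qed.
Lemma modulusM z w : modulus (z * w) = modulus z * modulus w.
Proof. by apply: rc_inj; rewrite rcM -!normcE normrM. Qed.
Lemma modulusN z : modulus (- z) = modulus z.
Proof. by apply: rc_inj; rewrite -!normcE normrN. Qed.
Lemma modulusB z w : modulus (z - w) = modulus (w - z).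
Proof. by rewrite -modulusN opprB. Qed.
Lemma modulusX z n : modulus (z ^+ n) = modulus z ^+ n.
Proof. by apply: rc_inj; rewrite rcX -!normcE normrX. Qed.
Lemma modulusV z : modulus z^-1 = (modulus z)^-1.
Proof. exact: ComplexField.Normc.normcV. Qed.
Lemma modulus_conj z : modulus z^* = modulus z.
Proof. by apply: rc_inj; rewrite -!normcE norm_conjC. Qed.
Lemma modulus_rc x : modulus (rc x) = `|x|.
Proof. by rewrite /modulus /= expr0n addr0 sqrtr_sqr. Qed.
Lemma modulus_eq0 z : (modulus z == 0) = (z == 0).
Proof.
by rewrite -[z == 0]normr_eq0 normcE -(inj_eq rc_inj) rc0.
Qed.
Lemma modulus_gt0 z : (0 < modulus z) = (z != 0).
Proof. by rewrite lt_neqAle modulus_ge0 andbT eq_sym modulus_eq0. Qed.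
Lemma le_modulusD z w : modulus (z + w) <= modulus z + modulus w.
Proof. by rewrite -ler_rc rcD -!normcE ler_normD. Qed.
Lemma le_modulusB z w : modulus (z - w) <= modulus z + modulus w.
Proof. by rewrite -[in leRHS](modulusN w) le_modulusD. Qed.
Lemma le_modulus_dist z w : modulus z - modulus w <= modulus (z - w).
Proof. by rewrite lerBlDr -[in leLHS](subrK w z) le_modulusD. Qed.
Lemma le_modulus_sum I (r : seq I) (P : pred I) (F : I -> C) :
  modulus (\sum_(i <- r | P i) F i) <= \sum_(i <- r | P i) modulus (F i).
Proof.
elim/big_ind2 : _ => //; first by rewrite modulus0.
by move=> a b c d h1 h2; apply: le_trans (le_modulusD _ _) (lerD h1 h2).
Qed.

Lemma sqr_modulus z : modulus z ^+ 2 = re z ^+ 2 + im z ^+ 2.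
Proof. by case: z => a b; rewrite /modulus /= sqr_sqrtr // addr_ge0 ?sqr_ge0. Qed.
Lemma mul_conj z : z * z^* = rc (modulus z ^+ 2).
Proof. by rewrite rcX -normcE normCK. Qed.
Lemma le_re z : `|re z| <= modulus z.
Proof.
rewrite -ler_sqr ?nnegrE // sqr_modulus real_normK ?num_real //.
by rewrite lerDl sqr_ge0.
Qed.
Lemma le_im z : `|im z| <= modulus z.
Proof.
rewrite -ler_sqr ?nnegrE // sqr_modulus real_normK ?num_real //.
by rewrite lerDr sqr_ge0.
Qed.
Lemma le_modulus_reim z : modulus z <= `|re z| + `|im z|.
Proof.
rewrite -ler_sqr ?nnegrE ?addr_ge0 // sqr_modulus sqrrD !real_normK ?num_real //.
have : 0 <= `|re z| * `|im z| by rewrite mulr_ge0.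
rewrite -mulr_natl; lra.
Qed.


(** Limits in the complex field in terms of the real-valued modulus, in which
    all estimates below are made. *)
Lemma cvgCP (T : Type) (F : set_system T) (FF : Filter F) (f : T -> C) (l : C) :
  f @ F --> l <->
  (forall e : R, 0 < e -> \forall t \near F, modulus (l - f t) < e).
Proof.
split=> [/cvgrPdist_lt h e e0|h].
  have /h : (0 : C) < rc e by rewrite -rc0 ltr_rc.
  by apply: filterS => t; rewrite normcE ltr_rc.
apply/cvgrPdist_lt => e e0.
have [er ep] : e = rc (re e) /\ 0 < re e.
  case: e e0 => a b; rewrite ltcE /= => /andP[/eqP -> a0]; split=> //.
have := h _ ep; apply: filterS => t; rewrite normcE er ltr_rc //.
Qed.

Lemma cvg_re (T : Type) (F : set_system T) (FF : Filter F) (f : T -> C) (l : C) :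
  f @ F --> l -> (fun t => re (f t)) @ F --> re l.
Proof.
move=> /cvgCP h; apply/cvgrPdist_lt => e e0; have := h _ e0.
by apply: filterS => t; apply: le_lt_trans; rewrite -reB le_re.
Qed.

Lemma cvg_im (T : Type) (F : set_system T) (FF : Filter F) (f : T -> C) (l : C) :
  f @ F --> l -> (fun t => im (f t)) @ F --> im l.
Proof.
move=> /cvgCP h; apply/cvgrPdist_lt => e e0; have := h _ e0.
by apply: filterS => t; apply: le_lt_trans; rewrite -imB le_im.
Qed.

Lemma cvg_mkC (T : Type) (F : set_system T) (FF : Filter F) (f : T -> C) (a b : R) :
  (fun t => re (f t)) @ F --> a -> (fun t => im (f t)) @ F --> b ->
  f @ F --> mkC a b.
Proof.
move=> /cvgrPdist_lt ha /cvgrPdist_lt hb; apply/cvgCP => e e0.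
have e2 : 0 < e / 2 by rewrite divr_gt0.
near=> t; apply: le_lt_trans (le_modulus_reim _) _.
rewrite reB imB /= [e](splitr e); apply: ltrD; near: t; [exact: ha|exact: hb].
Unshelve. all: by end_near. Qed.

Lemma cvg_modulus (T : Type) (F : set_system T) (FF : Filter F) (f : T -> C) (l : C) :
  f @ F --> l -> (fun t => modulus (f t)) @ F --> modulus l.
Proof.
move=> /cvgCP h; apply/cvgrPdist_lt => e e0; have := h _ e0.
apply: filterS => t; apply: le_lt_trans.
rewrite ler_norml le_modulus_dist andbT.
by rewrite lerNl opprB modulusB le_modulus_dist.
Qed.

Lemma cvg_rc (T : Type) (F : set_system T) (FF : Filter F) (f : T -> R) (l : R) :
  f @ F --> l -> (fun t => rc (f t)) @ F --> rc l.
Proof.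
move=> h; apply: cvg_mkC; first exact: h.
by rewrite (_ : (fun _ => _) = cst 0) //; exact: cvg_cst.
Qed.

Lemma re_sum I (r : seq I) (P : pred I) (F : I -> C) :
  re (\sum_(i <- r | P i) F i) = \sum_(i <- r | P i) re (F i).
Proof. by apply: (big_morph re reD). Qed.
Lemma im_sum I (r : seq I) (P : pred I) (F : I -> C) :
  im (\sum_(i <- r | P i) F i) = \sum_(i <- r | P i) im (F i).
Proof. by apply: (big_morph im imD). Qed.

(** Completeness is used coordinate by coordinate: both real series are
    dominated by b. *)
Lemma abs_cvgC (u : nat -> C) (b : nat -> R) :
  (forall n, modulus (u n) <= b n) -> cvgn (series b) ->
  exists l : C, series u @ \oo --> l.
Proof.
move=> ub cb.
have b0 n : 0 <= b n by apply: le_trans (ub n).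
have cre : cvgn (series (fun n => re (u n))).
  apply: normed_cvg; apply: series_le_cvg cb => //= n.
  by apply: le_trans (ub n); rewrite le_re.
have cim : cvgn (series (fun n => im (u n))).
  apply: normed_cvg; apply: series_le_cvg cb => //= n.
  by apply: le_trans (ub n); rewrite le_im.
exists (mkC (limn (series (fun n => re (u n)))) (limn (series (fun n => im (u n))))).
apply: cvg_mkC.
  rewrite (_ : (fun _ => _) = series (fun n => re (u n))) //.
  by apply/funext => n; rewrite /series /= re_sum.
rewrite (_ : (fun _ => _) = series (fun n => im (u n))) //.
by apply/funext => n; rewrite /series /= im_sum.
Qed.

End Modulus.
#[global] Hint Extern 0 (is_true (0 <= modulus _)) => exact: modulus_ge0 : core.
Arguments re {R} z.
Arguments im {R} z.
Arguments rc {R} x.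

(** * Integrals of complex functions of a real variable *)
Section ComplexIntegral.
Variable R : realType.
Local Notation C := (cplx R).
Local Notation leb := (@lebesgue_measure R).
Implicit Types (g h : R -> C) (a b c : R).

Definition cont_on a b g := forall x, a <= x <= b -> g @ x --> g x.

Lemma cont_onD a b g h : cont_on a b g -> cont_on a b h ->
  cont_on a b (fun x => g x + h x).
Proof. by move=> gc hc x xab; apply: cvgD; [exact: gc|exact: hc]. Qed.

Lemma cont_onM a b g h : cont_on a b g -> cont_on a b h ->
  cont_on a b (fun x => g x * h x).
Proof. by move=> gc hc x xab; apply: cvgM; [exact: gc|exact: hc]. Qed.

Lemma cont_on_cst a b (c : C) : cont_on a b (fun=> c).
Proof. by move=> x _; exact: cvg_cst. Qed.

Lemma within_re a b g : cont_on a b g -> {within `[a, b], continuous (re \o g)}.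
Proof.
move=> gc; apply: continuous_in_subspaceT => x.
by rewrite inE /= in_itv /= => xab; apply: cvg_re; exact: gc.
Qed.

Lemma within_im a b g : cont_on a b g -> {within `[a, b], continuous (im \o g)}.
Proof.
move=> gc; apply: continuous_in_subspaceT => x.
by rewrite inE /= in_itv /= => xab; apply: cvg_im; exact: gc.
Qed.

Lemma integrable_re a b g : cont_on a b g ->
  leb.-integrable `[a, b] (EFin \o (re \o g)).
Proof.
move=> gc; apply: continuous_compact_integrable; first exact: segment_compact.
exact: within_re.
Qed.

Lemma integrable_im a b g : cont_on a b g ->
  leb.-integrable `[a, b] (EFin \o (im \o g)).
Proof.
move=> gc; apply: continuous_compact_integrable; first exact: segment_compact.
exact: within_im.
Qed.

Lemma integrable_mull a b (r : R) (f : R -> R) :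
  leb.-integrable `[a, b] (EFin \o f) ->
  leb.-integrable `[a, b] (EFin \o (fun x => r * f x)).
Proof.
move=> fi; rewrite (_ : _ \o _ = (fun x => r%:E * (EFin \o f) x)%E).
  by apply: integrableZl.
by apply/funext => x /=; rewrite EFinM.
Qed.

Definition cint a b g : C :=
  mkC (\int[leb]_(x in `[a, b]) (re \o g) x) (\int[leb]_(x in `[a, b]) (im \o g) x).

Lemma eq_cint a b g h : (forall x, a <= x <= b -> g x = h x) ->
  cint a b g = cint a b h.
Proof.
move=> gh; congr mkC; apply: eq_Rintegral => x;
  by rewrite inE /= in_itv /= => /gh /= ->.
Qed.

Lemma cintD a b g h : cont_on a b g -> cont_on a b h ->
  cint a b (fun x => g x + h x) = cint a b g + cint a b h.
Proof.
move=> gc hc; rewrite [RHS]mkCE reD imD /=; congr mkC.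
  rewrite -RintegralD //; [|exact: integrable_re..].
  by apply: eq_Rintegral => x _; rewrite /= reD.
rewrite -RintegralD //; [|exact: integrable_im..].
by apply: eq_Rintegral => x _; rewrite /= imD.
Qed.

Lemma cintZ a b (c : C) g : cont_on a b g ->
  cint a b (fun x => c * g x) = c * cint a b g.
Proof.
move=> gc; rewrite [RHS]mkCE reM imM /=.
have ir := integrable_re gc; have ii := integrable_im gc.
rewrite -!RintegralZl // -RintegralB //; [|exact: integrable_mull..].
rewrite -RintegralD //; [|exact: integrable_mull..].
congr mkC; apply: eq_Rintegral => x _ /=.
  by rewrite reM.
by rewrite imM.
Qed.

Lemma le_Rint_cst a b (f : R -> R) (M : R) : a <= b ->
  leb.-integrable `[a, b] (EFin \o f) ->
  (forall x, a <= x <= b -> `|f x| <= M) ->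
  `|\int[leb]_(x in `[a, b]) f x| <= M * (b - a).
Proof.
move=> ab fi fM; apply: le_trans (le_normr_Rintegral _ fi) _ => //.
have -> : M * (b - a) = \int[leb]_(x in `[a, b]) M.
  rewrite Rintegral_cst //= lebesgue_measure_itv /= lte_fin.
  by case: ltgtP ab => // -> _; rewrite subrr.
apply: le_Rintegral => //.
- exact: integrable_norm.
- apply: (continuous_compact_integrable (f := fun=> M)); first exact: segment_compact.
  by apply: continuous_subspaceT; exact: cst_continuous.
Qed.

(** The factor 2 comes from estimating the two coordinates separately. *)
Lemma le_cint a b g (M : R) : a <= b -> cont_on a b g ->
  (forall x, a <= x <= b -> modulus (g x) <= M) ->
  modulus (cint a b g) <= 2 * M * (b - a).
Proof.
move=> ab gc gM; apply: le_trans (le_modulus_reim _) _.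
rewrite -mulrA mulr_natl mulr2n; apply: lerD; apply: le_Rint_cst => //.
- exact: integrable_re.
- by move=> x /gM; apply: le_trans; exact: le_re.
- exact: integrable_im.
- by move=> x /gM; apply: le_trans; exact: le_im.
Qed.

Lemma Rint_cat a b c (f : R -> R) : a <= b -> b <= c ->
  leb.-integrable `[a, c] (EFin \o f) ->
  \int[leb]_(x in `[a, c]) f x =
  \int[leb]_(x in `[a, b]) f x + \int[leb]_(x in `[b, c]) f x.
Proof.
move=> ab bc fi.
have fi2 : leb.-integrable `]b, c] (EFin \o f).
  apply: integrableS fi => // x /=; rewrite !in_itv /= => /andP[bx ->].
  by rewrite (le_trans ab) // ltW.
rewrite -(Rintegral_itv_obnd_cbnd fi2) -(Rintegral_itvB fi); last 2 first.
  by rewrite bnd_simp.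
  by rewrite bnd_simp.
by rewrite addrC subrK.
Qed.

Lemma cint_cat a b c g : a <= b -> b <= c -> cont_on a c g ->
  cint a c g = cint a b g + cint b c g.
Proof.
move=> ab bc gc; rewrite [RHS]mkCE reD imD /=; congr mkC; apply: Rint_cat => //.
  exact: integrable_re.
exact: integrable_im.
Qed.

Lemma cint_FTC a b g (G : R -> C) : a <= b -> cont_on a b g ->
  (forall x : R, is_derive x (1 : R) (re \o G) (re (g x))) ->
  (forall x : R, is_derive x (1 : R) (im \o G) (im (g x))) ->
  cint a b g = G b - G a.
Proof.
move=> ab gc dr di.
case: (ltgtP a b) ab => // [ab _|-> _]; last first.
  by rewrite subrr [RHS]mkCE /cint set_itv1 !Rintegral_set1.
have loc (F f : R -> R) : (forall x : R, is_derive x (1 : R) F (f x)) -> derivable_oo_LRcontinuous F a b.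
  move=> dF; have cF x : {for x, continuous F}.
    by apply: differentiable_continuous; apply/derivable1_diffP; case: (dF x).
  split.
  - by move=> x _; case: (dF x).
  - by apply: cvg_at_right_filter; exact: cF.
  - by apply: cvg_at_left_filter; exact: cF.
rewrite [RHS]mkCE reB imB /cint /Rintegral; congr mkC.
  rewrite (continuous_FTC2 ab (within_re gc) (loc _ _ dr)) //.
  by move=> x _; rewrite derive1E; case: (dr x) => _ ->.
rewrite (continuous_FTC2 ab (within_im gc) (loc _ _ di)) //.
by move=> x _; rewrite derive1E; case: (di x) => _ ->.
Qed.

End ComplexIntegral.

(** * Goursat's theorem on polar sectors *)
Section Goursat.
Variable R : realType.
Local Notation C := (cplx R).
Implicit Types (f g : C -> C) (a b c d r t x y : R) (z w : C).

Lemma half_iter_small (K e : R) : 0 < e -> exists n, K / 2 ^+ n < e.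
Proof.
move=> e0; exists (Num.bound (K / e)).
have := upper_nthrootP (leqnn (Num.bound (K / e))).
by rewrite ltr_pdivrMr // ltr_pdivrMr ?exprn_gt0 // mulrC.
Qed.

(** Goursat's subdivision argument. A rectangle without the property has a
    quarter without it; the nested rectangles obtained in this way shrink to a
    point, around which all small rectangles have the property. *)
Lemma quartering (P : R -> R -> R -> R -> Prop) a b c d :
  a <= b -> c <= d ->
  (forall a' b' c' d', a <= a' -> a' <= b' -> b' <= b ->
     c <= c' -> c' <= d' -> d' <= d ->
     let m := (a' + b') / 2 in let n := (c' + d') / 2 in
     P a' m c' n -> P m b' c' n -> P a' m n d' -> P m b' n d' -> P a' b' c' d') ->
  (forall x y, a <= x <= b -> c <= y <= d -> exists2 e, 0 < e &
     forall a' b' c' d', a <= a' -> a' <= x -> x <= b' -> b' <= b ->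
     c <= c' -> c' <= y -> y <= d' -> d' <= d ->
     b' - a' < e -> d' - c' < e -> P a' b' c' d') ->
  P a b c d.
Proof.
move=> ab cd her loc; apply: contrapT => nP.
pose ok (Q : R * R * (R * R)) :=
  [/\ a <= Q.1.1, Q.1.1 <= Q.1.2 & Q.1.2 <= b] /\
  [/\ c <= Q.2.1, Q.2.1 <= Q.2.2 & Q.2.2 <= d].
pose bad Q := ok Q /\ ~ P Q.1.1 Q.1.2 Q.2.1 Q.2.2.
pose child (Q Q' : R * R * (R * R)) :=
  [/\ Q.1.1 <= Q'.1.1, Q'.1.2 <= Q.1.2, Q.2.1 <= Q'.2.1 & Q'.2.2 <= Q.2.2] /\
  Q'.1.2 - Q'.1.1 = (Q.1.2 - Q.1.1) / 2 /\ Q'.2.2 - Q'.2.1 = (Q.2.2 - Q.2.1) / 2.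
have step Q : exists Q', bad Q -> bad Q' /\ child Q Q'.
  case: (pselect (bad Q)) => [bQ|]; last by move=> nbad; exists Q.
  case: Q bQ => -[a' b'] [c' d'] [[/= [h1 h2 h3] [h4 h5 h6]] nPQ].
  apply: contrapT => nex; apply: nPQ.
  have key Q' : ok Q' -> child ((a', b'), (c', d')) Q' -> P Q'.1.1 Q'.1.2 Q'.2.1 Q'.2.2.
    move=> okQ chQ; apply: contrapT => nP'; apply: nex; exists Q' => _.
    by split.
  apply: her => //.
  - apply: (key ((a', (a' + b') / 2), (c', (c' + d') / 2))); rewrite /ok /child /=;
      repeat split; lra.
  - apply: (key (((a' + b') / 2, b'), (c', (c' + d') / 2))); rewrite /ok /child /=;
      repeat split; lra.
  - apply: (key ((a', (a' + b') / 2), ((c' + d') / 2, d'))); rewrite /ok /child /=;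
      repeat split; lra.
  - apply: (key (((a' + b') / 2, b'), ((c' + d') / 2, d'))); rewrite /ok /child /=;
      repeat split; lra.
have [h hP] := choice step.
pose Q n := iter n h ((a, b), (c, d)).
have badQ n : bad (Q n).
  elim: n => [|n IH]; last by case: (hP _ IH).
  by split.
have chQ n : child (Q n) (Q n.+1) by case: (hP _ (badQ n)).
have mono (u : nat -> R) : (forall n, u n <= u n.+1) -> nondecreasing_seq u.
  by move=> uS; apply/nondecreasing_seqP.
have la : nondecreasing_seq (fun n => (Q n).1.1).
  by apply: mono => n; case: (chQ n) => -[].
have lc : nondecreasing_seq (fun n => (Q n).2.1).
  by apply: mono => n; case: (chQ n) => -[].
have ub : nonincreasing_seq (fun n => (Q n).1.2).
  by apply/nonincreasing_seqP => n; case: (chQ n) => -[].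
have ud : nonincreasing_seq (fun n => (Q n).2.2).
  by apply/nonincreasing_seqP => n; case: (chQ n) => -[].
have nest (l u : nat -> R) : nondecreasing_seq l -> nonincreasing_seq u ->
    (forall n, l n <= u n) -> exists x, forall n, l n <= x <= u n.
  move=> lm um lu.
  have le m n : l m <= u n.
    apply: (le_trans (lm _ _ (leq_maxl m n))); apply: le_trans (lu _) _.
    by apply: um; exact: leq_maxr.
  have cl : cvgn l.
    by apply: nondecreasing_is_cvgn => //; exists (u 0%N) => _ [n _ <-].
  exists (limn l) => n; rewrite nondecreasing_cvgn_le //=.
  by apply: limr_le => //; near=> m.
have [x xP] := nest _ _ la ub (fun n => let: conj (conj (And3 _ h _) _) _ := badQ n in h).
have [y yP] := nest _ _ lc ud (fun n => let: conj (conj _ (And3 _ h _)) _ := badQ n in h).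
have [e e0 eP] := loc x y (xP 0%N) (yP 0%N).
have wa n : (Q n).1.2 - (Q n).1.1 = (b - a) / 2 ^+ n.
  elim: n => [|n IH]; first by rewrite expr0 divr1.
  by case: (chQ n) => _ [-> _]; rewrite IH exprS invfM; ring.
have wc n : (Q n).2.2 - (Q n).2.1 = (d - c) / 2 ^+ n.
  elim: n => [|n IH]; first by rewrite expr0 divr1.
  by case: (chQ n) => _ [_ ->]; rewrite IH exprS invfM; ring.
have [n nP'] := half_iter_small ((b - a) + (d - c)) e0.
have [[[h1 h2 h3] [h4 h5 h6]] nPQ] := badQ n.
apply: nPQ; case/andP: (xP n) => ? ?; case/andP: (yP n) => ? ?.
have p2 : 0 < (2 ^+ n)^-1 :> R by rewrite invr_gt0 exprn_gt0.
apply: eP => //.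
  rewrite wa; apply: le_lt_trans nP'; rewrite ler_pM2r //; lra.
rewrite wc; apply: le_lt_trans nP'; rewrite ler_pM2r //; lra.
Unshelve. all: by end_near. Qed.

Definition iC : C := mkC 0 1.
Definition expi (t : R) : C := mkC (cos t) (sin t).
Definition pol (r t : R) : C := rc r * expi t.

Lemma modulus_expi t : modulus (expi t) = 1.
Proof. by rewrite /modulus /= cos2Dsin2 sqrtr1. Qed.

Lemma modulus_iC : modulus iC = 1.
Proof. by rewrite /modulus /= expr0n expr1n add0r sqrtr1. Qed.

Lemma modulus_pol r t : modulus (pol r t) = `|r|.
Proof. by rewrite modulusM modulus_expi mulr1 modulus_rc. Qed.

Lemma expi_cvg t : expi @ t --> expi t.
Proof. by apply: cvg_mkC; [exact: continuous_cos|exact: continuous_sin]. Qed.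

Lemma pol_cvg_t r t : pol r @ t --> pol r t.
Proof. by apply: cvgM; [exact: cvg_cst|exact: expi_cvg]. Qed.

Lemma pol_cvg_r r t : pol^~ t @ r --> pol r t.
Proof. by apply: cvgM; [apply: cvg_rc; exact: cvg_id|exact: cvg_cst]. Qed.

Definition cder (G g : R -> C) := forall x,
  is_derive x (1 : R) (re \o G) (re (g x)) /\ is_derive x (1 : R) (im \o G) (im (g x)).

Lemma cder_cst (A : C) : cder (fun=> A) (fun=> 0).
Proof.
by move=> x; split; apply: is_derive_eq (is_derive_cst _ _ _) _.
Qed.

Lemma cderD (G g H h : R -> C) : cder G g -> cder H h ->
  cder (fun x => G x + H x) (fun x => g x + h x).
Proof.
move=> dG dH x; have [G1 G2] := dG x; have [H1 H2] := dH x.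
rewrite reD imD; split.
  rewrite (_ : re \o _ = (re \o G) + (re \o H)); last first.
    by apply/funext => u; rewrite /= reD.
  exact: is_deriveD.
rewrite (_ : im \o _ = (im \o G) + (im \o H)); last first.
  by apply/funext => u; rewrite /= imD.
exact: is_deriveD.
Qed.

Lemma cderM (G g H h : R -> C) : cder G g -> cder H h ->
  cder (fun x => G x * H x) (fun x => g x * H x + G x * h x).
Proof.
move=> dG dH x; have [G1 G2] := dG x; have [H1 H2] := dH x.
rewrite reD imD !reM !imM; split.
  rewrite (_ : re \o _ = (re \o G) * (re \o H) - (im \o G) * (im \o H)); last first.
    by apply/funext => u; rewrite /= reM.
  apply: (is_derive_eq (is_deriveB (is_deriveM G1 H1) (is_deriveM G2 H2))).
  rewrite /GRing.scale /=.
  repeat (move: (re _) => ?); repeat (move: (im _) => ?); ring.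
rewrite (_ : im \o _ = (re \o G) * (im \o H) + (im \o G) * (re \o H)); last first.
  by apply/funext => u; rewrite /= imM.
apply: (is_derive_eq (is_deriveD (is_deriveM G1 H2) (is_deriveM G2 H1))).
rewrite /GRing.scale /=.
repeat (move: (re _) => ?); repeat (move: (im _) => ?); ring.
Qed.

Lemma cder_rc : cder rc (fun=> 1).
Proof.
move=> x; split; first exact: is_derive_id.
exact: is_derive_cst.
Qed.

Lemma cder_expi : cder expi (fun t => iC * expi t).
Proof.
move=> x; split.
  by apply: (is_derive_eq (is_derive_cos x)); rewrite reM /= mul0r mul1r sub0r.
by apply: (is_derive_eq (is_derive_sin x)); rewrite imM /= mul0r mul1r add0r.
Qed.

Lemma eq_cder (G g g' : R -> C) : (forall x, g x = g' x) -> cder G g -> cder G g'.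
Proof. by move=> e dG x; rewrite -e; exact: dG. Qed.

Lemma cder_pol_t r : cder (pol r) (fun t => iC * pol r t).
Proof.
apply: eq_cder (cderM (cder_cst (rc r)) cder_expi) => t.
by rewrite /pol /=; ring.
Qed.

Lemma cder_pol_r t : cder (pol^~ t) (fun=> expi t).
Proof.
apply: eq_cder (cderM cder_rc (cder_cst (expi t))) => r.
by rewrite mul1r mulr0 addr0.
Qed.

Lemma cint_cder a b (g G : R -> C) : a <= b -> cont_on a b g -> cder G g ->
  cint a b g = G b - G a.
Proof. by move=> ab gc dG; apply: cint_FTC => // x; case: (dG x). Qed.

Lemma expi_lip s t : modulus (expi s - expi t) <= 2 * `|s - t|.
Proof.
wlog st : s t / t <= s.
  move=> H; case/orP: (le_total s t) => st; last exact: H.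
  by rewrite modulusB distrC; exact: H.
have co : cont_on t s (fun t => iC * expi t).
  by move=> x _; apply: cvgM; [exact: cvg_cst|exact: expi_cvg].
rewrite -(cint_cder st co cder_expi) ger0_norm ?subr_ge0 //.
apply: le_trans (le_cint (M := 1) st co _) _; last by rewrite mulr1.
by move=> x _; rewrite modulusM modulus_iC modulus_expi mulr1.
Qed.

(** The integral of f dz along the boundary of a polar sector. Sectors play the
    role of the rectangles in the usual proof, since the whole disc is a sector
    and its boundary integral is a circle integral. *)
Definition sector f r1 r2 t1 t2 : C :=
  cint r1 r2 (fun r => f (pol r t1) * expi t1)
  + cint t1 t2 (fun t => f (pol r2 t) * (iC * pol r2 t))
  - cint r1 r2 (fun r => f (pol r t2) * expi t2)
  - cint t1 t2 (fun t => f (pol r1 t) * (iC * pol r1 t)).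

Definition sector_cont f r1 r2 t1 t2 := forall r t,
  r1 <= r <= r2 -> t1 <= t <= t2 -> f @ pol r t --> f (pol r t).

Lemma radial_cont f r1 r2 t1 t2 t : sector_cont f r1 r2 t1 t2 ->
  t1 <= t <= t2 -> cont_on r1 r2 (fun r => f (pol r t) * expi t).
Proof.
move=> fc tt r rr; apply: cvgM; last exact: cvg_cst.
by apply: (@cvg_comp _ _ _ (pol^~ t) f); [exact: pol_cvg_r|exact: fc].
Qed.

Lemma arc_cont f r1 r2 t1 t2 r : sector_cont f r1 r2 t1 t2 ->
  r1 <= r <= r2 -> cont_on t1 t2 (fun t => f (pol r t) * (iC * pol r t)).
Proof.
move=> fc rr t tt; apply: cvgM; last first.
  by apply: cvgM; [exact: cvg_cst|exact: pol_cvg_t].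
by apply: (@cvg_comp _ _ _ (pol r) f); [exact: pol_cvg_t|exact: fc].
Qed.

Lemma sector_contW f r1 r2 t1 t2 r1' r2' t1' t2' :
  r1 <= r1' -> r2' <= r2 -> t1 <= t1' -> t2' <= t2 ->
  sector_cont f r1 r2 t1 t2 -> sector_cont f r1' r2' t1' t2'.
Proof.
move=> h1 h2 h3 h4 fc r t /andP[? ?] /andP[? ?]; apply: fc; lra.
Qed.

Lemma sector_r_cat f r1 r2 r3 t1 t2 : r1 <= r2 -> r2 <= r3 -> t1 <= t2 ->
  sector_cont f r1 r3 t1 t2 ->
  sector f r1 r3 t1 t2 = sector f r1 r2 t1 t2 + sector f r2 r3 t1 t2.
Proof.
move=> r12 r23 t12 fc; rewrite /sector.
rewrite !(cint_cat r12 r23); first by repeat (move: (cint _ _ _) => ?); ring.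
  by apply: radial_cont fc _; rewrite t12 lexx.
by apply: radial_cont fc _; rewrite t12 lexx.
Qed.

Lemma sector_t_cat f r1 r2 t1 t2 t3 : r1 <= r2 -> t1 <= t2 -> t2 <= t3 ->
  sector_cont f r1 r2 t1 t3 ->
  sector f r1 r2 t1 t3 = sector f r1 r2 t1 t2 + sector f r1 r2 t2 t3.
Proof.
move=> r12 t12 t23 fc; rewrite /sector.
rewrite !(cint_cat t12 t23); first by repeat (move: (cint _ _ _) => ?); ring.
  by apply: arc_cont fc _; rewrite r12 lexx.
by apply: arc_cont fc _; rewrite r12 lexx.
Qed.

Lemma sectorD f g r1 r2 t1 t2 : r1 <= r2 -> t1 <= t2 ->
  sector_cont f r1 r2 t1 t2 -> sector_cont g r1 r2 t1 t2 ->
  sector (fun z => f z + g z) r1 r2 t1 t2 =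
  sector f r1 r2 t1 t2 + sector g r1 r2 t1 t2.
Proof.
move=> r12 t12 fc gc; rewrite /sector.
have E1 t : t1 <= t <= t2 ->
    cint r1 r2 (fun r => (f (pol r t) + g (pol r t)) * expi t) =
    cint r1 r2 (fun r => f (pol r t) * expi t) + cint r1 r2 (fun r => g (pol r t) * expi t).
  move=> tt; rewrite -cintD; [|exact: radial_cont fc tt|exact: radial_cont gc tt].
  by apply: eq_cint => r _; rewrite mulrDl.
have E2 r : r1 <= r <= r2 ->
    cint t1 t2 (fun t => (f (pol r t) + g (pol r t)) * (iC * pol r t)) =
    cint t1 t2 (fun t => f (pol r t) * (iC * pol r t)) +
    cint t1 t2 (fun t => g (pol r t) * (iC * pol r t)).
  move=> rr; rewrite -cintD; [|exact: arc_cont fc rr|exact: arc_cont gc rr].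
  by apply: eq_cint => t _; rewrite mulrDl.
by rewrite !E1 ?E2 ?lexx ?r12 ?t12 //; repeat (move: (cint _ _ _) => ?); ring.
Qed.

Lemma sector_bound f r1 r2 t1 t2 (M : R) : 0 <= r1 -> r1 <= r2 -> r2 <= 1 -> t1 <= t2 ->
  sector_cont f r1 r2 t1 t2 ->
  (forall r t, r1 <= r <= r2 -> t1 <= t <= t2 -> modulus (f (pol r t)) <= M) ->
  modulus (sector f r1 r2 t1 t2) <= 4 * M * ((r2 - r1) + (t2 - t1)).
Proof.
move=> r10 r12 r21 t12 fc fM.
have Er t : t1 <= t <= t2 ->
    modulus (cint r1 r2 (fun r => f (pol r t) * expi t)) <= 2 * M * (r2 - r1).
  move=> tt; apply: le_cint => //; first exact: radial_cont fc tt.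
  by move=> r rr; rewrite modulusM modulus_expi mulr1; exact: fM.
have Et r : r1 <= r <= r2 ->
    modulus (cint t1 t2 (fun t => f (pol r t) * (iC * pol r t))) <= 2 * M * (t2 - t1).
  move=> rr; apply: le_cint => //; first exact: arc_cont fc rr.
  move=> t tt; rewrite !modulusM modulus_iC mul1r modulus_expi mulr1 modulus_rc.
  rewrite -[leRHS]mulr1; apply: ler_pM => //; first exact: fM.
  by case/andP: rr => h1 h2; rewrite ger0_norm; lra.
rewrite /sector; apply: le_trans (le_modulusB _ _) _.
apply: le_trans (lerD (le_modulusB _ _) (lexx _)) _.
apply: le_trans (lerD (lerD (le_modulusD _ _) (lexx _)) (lexx _)) _.
have := Er t1; have := Er t2; have := Et r1; have := Et r2; rewrite !lexx r12 t12.
repeat (move: (modulus _) => ?).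
move=> /(_ isT) h1 /(_ isT) h2 /(_ isT) h3 /(_ isT) h4.
lra.
Qed.

Lemma sector_affine (A B : C) r1 r2 t1 t2 : r1 <= r2 -> t1 <= t2 ->
  sector (fun z => A + B * z) r1 r2 t1 t2 = 0.
Proof.
move=> r12 t12.
have pc : sector_cont (fun z => A + B * z) r1 r2 t1 t2.
  move=> r t _ _.
  have cc (K : C) : (fun _ : C => K) @ pol r t --> K.
    exact: (@cvg_cst _ _ _ _ (nbhs_filter (pol r t))).
  exact: (cvgD (cc A) (cvgM (cc B) (@cvg_id _ _))).
pose P (z : C) := A * z + B / 2 * (z * z).
have dP (p p' : R -> C) : cder p p' ->
    cder (fun x => P (p x)) (fun x => (A + B * p x) * p' x).
  move=> dp; have h := cderD (cderM (cder_cst A) dp)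
    (cderM (cder_cst (B / 2)) (cderM dp dp)).
  by refine (eq_cder _ h) => x /=; field.
have Er t : t1 <= t <= t2 ->
    cint r1 r2 (fun r => (A + B * pol r t) * expi t) = P (pol r2 t) - P (pol r1 t).
  move=> tt; apply: (cint_cder r12 _ (dP _ _ (cder_pol_r t))).
  exact: radial_cont pc tt.
have Et r : r1 <= r <= r2 ->
    cint t1 t2 (fun t => (A + B * pol r t) * (iC * pol r t)) = P (pol r t2) - P (pol r t1).
  move=> rr; apply: (cint_cder t12 _ (dP _ _ (cder_pol_t r))).
  exact: arc_cont pc rr.
rewrite /sector /= !Er ?Et ?lexx ?r12 ?t12 //.
ring.
Qed.

End Goursat.

Section Derivable.
Variable R : realType.
Local Notation C := (cplx R).
Implicit Types (f g : C -> C) (z w : C).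

Lemma nbhsCP (z : C) (P : set C) :
  nbhs z P <-> (exists2 d : R, 0 < d & forall x : C, modulus (x - z) < d -> P x).
Proof.
split.
  move=> /nbhs_normP[e /= e0 h].
  have [er ep] : e = rc (re e) /\ 0 < re e.
    case: e e0 {h} => a b; rewrite ltcE /= => /andP[/eqP -> a0]; split=> //.
  exists (re e) => // x xd; apply: h => /=.
  by rewrite er modulusB in xd *; rewrite -ltr_rc in xd.
move=> [d d0 h]; apply/nbhs_normP; exists (rc d); first by move: d0; rewrite -ltr_rc.
by move=> x /= xd; apply: h; rewrite modulusB -ltr_rc.
Qed.

(** First order expansion with a remainder measured by the modulus; this is
    complex differentiability in a form suited to estimates. *)
Definition expands f z (d : C) := forall e : R, 0 < e -> exists2 dl : R, 0 < dl &
  forall w, modulus (w - z) < dl ->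
  modulus (f w - (f z + d * (w - z))) <= e * modulus (w - z).

Lemma derivable_expands f z : derivable f z 1 -> exists d, expands f z d.
Proof.
move=> /cvg_ex[/= d fd]; exists d => e e0.
have /cvgCP/(_ _ e0) := fd.
rewrite /dnbhs /within /= => /nbhsCP[dl dl0 h]; exists dl => // w wz.
have [->|wnz] := eqVneq w z.
  by rewrite subrr mulr0 addr0 subrr modulus0 mulr0.
have wz0 : w - z != 0 by rewrite subr_eq0.
have := h (w - z); rewrite subr0 => /(_ wz wz0) /ltW.
rewrite /= -[_ *: 1]/((w - z) * 1) mulr1 subrK => h'.
have -> : f w - (f z + d * (w - z)) =
  - ((d - (w - z)^-1 * (f w - f z)) * (w - z)) by field.
by rewrite modulusN modulusM ler_wpM2r.
Qed.

Lemma expands_derivable f z d : expands f z d -> derivable f z 1.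
Proof.
move=> fd; apply/cvg_ex; exists d; apply/cvgCP => e e0.
have [dl dl0 h] := fd (e / 2) (divr_gt0 e0 (ltr0n _ 2)).
rewrite /dnbhs /within /=; apply/nbhsCP; exists dl => // x.
rewrite subr0 => xd x0; rewrite /= -[_ *: 1]/(x * 1) mulr1.
have := h (x + z); rewrite addrK => /(_ xd) h'.
have -> : d - x^-1 *: (f (x + z) - f z) = - (f (x + z) - (f z + d * x)) / x.
  by rewrite -[_ *: _]/(x^-1 * _); field.
have xp : 0 < modulus x by rewrite modulus_gt0.
rewrite modulusM modulusN modulusV ltr_pdivrMr //.
by apply: le_lt_trans h' _; rewrite ltr_pM2r // ltr_pdivrMr // ltr_pMr // ltr1n.
Qed.

Lemma expands_cvg f z d : expands f z d -> f @ z --> f z.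
Proof.
move=> fd; apply/(cvgCP (nbhs_filter z)) => e e0; apply/nbhsCP.
have [dl dl0 h] := fd 1 ltr01.
pose K := modulus d + 1.
have K0 : 0 < K by rewrite /K ltr_wpDl.
exists (Num.min dl (e / K)) => [|x].
  by rewrite lt_min dl0 divr_gt0.
rewrite lt_min => /andP[x1 x2].
have -> : f z - f x = - (f x - (f z + d * (x - z))) - d * (x - z) by ring.
apply: le_lt_trans (le_modulusB _ _) _.
rewrite modulusN modulusM.
apply: le_lt_trans (lerD (h _ x1) (lexx _)) _.
by rewrite -mulrDl -ltr_pdivlMl ?ltr_wpDr // mulrC [1 + _]addrC.
Qed.

Lemma derivable_cvg f z : derivable f z 1 -> f @ z --> f z.
Proof. by move=> /derivable_expands[d]; exact: expands_cvg. Qed.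

(** A bound by a multiple of the squared sum of the side lengths passes from the
    four quarters of a sector to the whole, and it holds for small sectors
    because the affine part of f integrates to zero. *)
Lemma goursat f (r1 r2 t1 t2 : R) : 0 <= r1 -> r1 <= r2 -> r2 <= 1 -> t1 <= t2 ->
  (forall r t, r1 <= r <= r2 -> t1 <= t <= t2 -> derivable f (pol r t) 1) ->
  sector f r1 r2 t1 t2 = 0.
Proof.
move=> r10 r12 r21 t12 df.
have fc : sector_cont f r1 r2 t1 t2 by move=> r t rr tt; apply: derivable_cvg; exact: df.
apply/eqP; rewrite -modulus_eq0; apply/eqP; apply: le_anti; rewrite modulus_ge0 andbT.
apply/ler_addgt0Pr => e e0; rewrite add0r.
pose L := (r2 - r1) + (t2 - t1); pose e' := e / (L ^+ 2 + 1).
have L2 : 0 < L ^+ 2 + 1 by rewrite ltr_wpDl ?sqr_ge0.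
have e'0 : 0 < e' by rewrite divr_gt0.
suff : modulus (sector f r1 r2 t1 t2) <= e' * L ^+ 2.
  move/le_trans; apply; rewrite /e' mulrAC ler_pdivrMr //.
  by rewrite ler_pM2l // lerDl.
pose P a b c d := modulus (sector f a b c d) <= e' * ((b - a) + (d - c)) ^+ 2.
apply: (quartering (P := P)) => //.
  move=> a b c d ha hab hb hc hcd hd m n; rewrite /P => P1 P2 P3 P4.
  have hm : a <= m <= b by rewrite /m; move: hab; clear; lra.
  have hn : c <= n <= d by rewrite /n; move: hcd; clear; lra.
  case/andP: hm => am mb; case/andP: hn => cn nd.
  have sc : sector_cont f a b c d by apply: sector_contW fc.
  rewrite (sector_r_cat am mb hcd sc).
  rewrite (sector_t_cat am cn nd); last by apply: sector_contW sc => //; exact: le_refl.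
  rewrite (sector_t_cat mb cn nd); last by apply: sector_contW sc => //; exact: le_refl.
  apply: le_trans (le_modulusD _ _) _.
  apply: le_trans (lerD (le_modulusD _ _) (le_modulusD _ _)) _.
  apply: le_trans (lerD (lerD P1 P3) (lerD P2 P4)) _.
  by rewrite le_eqVlt; apply/orP; left; apply/eqP; rewrite /m /n; field.
move=> x y xr yt.
have [d fd] := derivable_expands (df _ _ xr yt).
have [dl dl0 h] := fd (e' / 8) (divr_gt0 e'0 (ltr0n _ 8)).
exists (dl / 4); first by rewrite divr_gt0.
move=> a b c d' ha hax hxb hb hc hcy hyd hd wab wcd; rewrite /P.
set z := pol x y in fd h.
have fcs : sector_cont f a b c d' by apply: sector_contW fc.
pose p (w : C) := (f z - d * z) + d * w.
have pc : sector_cont p a b c d'.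
  move=> r t _ _.
  have cc (K : C) : (fun _ : C => K) @ pol r t --> K.
    exact: (@cvg_cst _ _ _ _ (nbhs_filter (pol r t))).
  exact: (cvgD (cc _) (cvgM (cc _) (@cvg_id _ _))).
have gc : sector_cont (fun w => f w - p w) a b c d'.
  by move=> r t rr tt; exact: (cvgB (fcs r t rr tt) (pc r t rr tt)).
have ab' : a <= b := le_trans hax hxb.
have cd' : c <= d' := le_trans hcy hyd.
have -> : sector f a b c d' = sector (fun w => f w - p w) a b c d'.
  have fE : f = (fun w => (f w - p w) + p w) by apply/funext => w; rewrite subrK.
  rewrite [in LHS]fE.
  by rewrite (sectorD ab' cd' gc pc) sector_affine ?addr0.
have wp : 0 <= (b - a) + (d' - c) by rewrite addr_ge0 ?subr_ge0.
have a0 : 0 <= a := le_trans r10 ha.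
have b1 : b <= 1 := le_trans hb r21.
apply: le_trans (sector_bound (M := e' / 8 * (2 * ((b - a) + (d' - c)))) a0 ab' b1 cd' gc _) _;
  last first.
  by rewrite le_eqVlt; apply/orP; left; apply/eqP; field.
move=> r t /andP[ar rb] /andP[ct td].
have dist : modulus (pol r t - z) <= 2 * ((b - a) + (d' - c)).
  have -> : pol r t - z = rc (r - x) * expi t + rc x * (expi t - expi y).
    by rewrite /z /pol rcB; ring.
  apply: le_trans (le_modulusD _ _) _.
  rewrite !modulusM modulus_expi mulr1 !modulus_rc.
  have xx : `|x| <= 1.
    by rewrite ger0_norm ?(le_trans a0 hax) // (le_trans hxb).
  have h1 : `|r - x| <= b - a.
    by rewrite ler_norml; move: ar rb hax hxb; clear; lra.
  have h2 : `|t - y| <= d' - c.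
    by rewrite ler_norml; move: ct td hcy hyd; clear; lra.
  have h3 : `|x| * modulus (expi t - expi y) <= 1 * (2 * `|t - y|).
    by apply: ler_pM => //; exact: expi_lip.
  by move: h1 h2 h3 ab' cd'; clear; lra.
have -> : f (pol r t) - p (pol r t) = f (pol r t) - (f z + d * (pol r t - z)).
  by rewrite /p; ring.
apply: le_trans (h _ _) _.
  by apply: le_lt_trans dist _; move: wab wcd; clear; lra.
by rewrite ler_pM2l // divr_gt0.
Qed.

End Derivable.

(** * Cauchy's formula and Taylor series on the disc *)
Section Taylor.
Variable R : realType.
Local Notation C := (cplx R).
Implicit Types (f g : C -> C) (z w : C) (r t : R).
Local Notation pi2 := (pi *+ 2 : R).

Lemma pi2_gt0 : 0 < pi2. Proof. by rewrite pmulrn_lgt0 // pi_gt0. Qed.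

Lemma expi0 : expi (0 : R) = 1.
Proof. by rewrite /expi cos0 sin0. Qed.

Lemma expi_2pi : expi pi2 = 1.
Proof. by rewrite /expi cos2pi sin2pi. Qed.

Lemma pol_2pi r : pol r pi2 = pol r 0.
Proof. by rewrite /pol expi_2pi expi0. Qed.

Lemma pol0 t : pol 0 t = 0 :> C.
Proof. by rewrite /pol rc0 mul0r. Qed.

Lemma cos_eq1 (x : R) : - pi2 < x < pi2 -> cos x = 1 -> x = 0.
Proof.
wlog x0 : x / 0 <= x.
  move=> H; case/orP: (le_total 0 x) => x0 /andP[h1 h2]; first by apply: H => //; rewrite h1.
  move=> c; apply: oppr_inj; rewrite oppr0; apply: H; rewrite ?oppr_ge0 ?cosN //.
  by rewrite ltrN2 h2 /= ltrNl.
move=> /andP[_ xpi] cx; apply/eqP; apply: contraT => xn0.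
have xp : 0 < x by rewrite lt_neqAle eq_sym xn0.
have : 0 < sin (x / 2).
  apply: sin_gt0_pi; rewrite divr_gt0 //= ltr_pdivrMr //.
  by rewrite mulr_natr.
have : cos ((x / 2) *+ 2) = 1 by rewrite -[_ *+ 2]mulr_natr divfK.
rewrite cos_mulr2n => h.
have : cos (x / 2) ^+ 2 = 1 by lra.
have := cos2Dsin2 (x / 2) => h1 h2.
have /eqP : sin (x / 2) ^+ 2 = 0 by lra.
by rewrite sqrf_eq0 => /eqP ->; rewrite ltxx.
Qed.

Lemma expi_inj_in (t th : R) : 0 <= t <= pi2 -> 0 < th < pi2 -> expi t = expi th -> t = th.
Proof.
move=> t1 t2 [ec es]; apply/eqP; rewrite -subr_eq0; apply/eqP.
apply: cos_eq1; first by have := pi2_gt0; lra.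
by rewrite cosB ec es -!expr2 cos2Dsin2.
Qed.

Lemma polar z : z != rc (modulus z) ->
  exists2 th, 0 < th < pi2 & z = pol (modulus z) th.
Proof.
move=> znr.
have rp : 0 < modulus z.
  by rewrite modulus_gt0; apply: contraNneq znr => ->; rewrite modulus0.
set r := modulus z in rp znr *.
pose a := re z / r; pose b := im z / r.
have ab : a ^+ 2 + b ^+ 2 = 1.
  by rewrite /a /b !exprMn -mulrDl -sqr_modulus exprVn divff // expf_neq0 // gt_eqF.
have a1 : -1 <= a <= 1.
  by rewrite -ler_norml -(@expr_le1 _ 2) // real_normK ?num_real // -ab lerDl sqr_ge0.
have [/andP[t0 tpi] ct] := acos_def a1.
have st : sin (acos a) = `|b|.
  by rewrite sin_acos // -ab addrC addKr sqrtr_sqr.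
suff [th h1 [h2 h3]] : exists2 th, 0 <= th <= pi2 & cos th = a /\ sin th = b.
  have zE : z = pol r th.
    rewrite [LHS]mkCE [RHS]mkCE /pol reM imM /= !mul0r subr0 addr0 h2 h3 /a /b.
    by rewrite ![r * _]mulrC !divfK ?gt_eqF.
  exists th => //; case/andP: h1 => h0; rewrite !le_eqVlt in h0 *.
  case/orP: h0 => [/eqP th0|->].
    by move: znr; rewrite [z in z != _]zE -th0 /pol expi0 mulr1 eqxx.
  case/orP => [/eqP th0|->] //.
  by move: znr; rewrite [z in z != _]zE th0 /pol expi_2pi mulr1 eqxx.
have pp := pi_gt0 R.
have [b0|b0] := leP 0 b.
  exists (acos a); first by rewrite t0 /= (le_trans tpi) // mulr2n lerDl ltW.
  by split=> //; rewrite st ger0_norm.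
exists (pi2 - acos a).
  by rewrite subr_ge0 lerBlDr lerDl t0 andbT (le_trans tpi) // mulr2n lerDl ltW.
split; first by rewrite cosB cos2pi sin2pi mul0r mul1r addr0.
by rewrite sinB cos2pi sin2pi mul0r mul1r sub0r st ltr0_norm // opprK.
Qed.

Definition hol f := forall z, modulus z < 1 -> derivable f z 1.

Definition circle_int f r := cint 0 pi2 (fun t => f (pol r t) * (iC R * pol r t)).

Lemma sector_full f r1 r2 : sector f r1 r2 0 pi2 = circle_int f r2 - circle_int f r1.
Proof.
rewrite /sector -/(circle_int f r2) -/(circle_int f r1) expi_2pi expi0.
rewrite (_ : (fun r => f (pol r pi2) * 1) = (fun r => f (pol r 0) * 1)).
  by ring.
by apply/funext => r; rewrite pol_2pi.
Qed.

(** An annulus, cut along a radius, is a sector. *)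
Lemma circle_int_cst f r1 r2 : 0 <= r1 -> r1 <= r2 -> r2 <= 1 ->
  (forall z, r1 <= modulus z <= r2 -> derivable f z 1) -> circle_int f r1 = circle_int f r2.
Proof.
move=> r10 r12 r21 df; apply/esym/eqP; rewrite -subr_eq0 -sector_full goursat //.
  by have := pi2_gt0; exact: ltW.
move=> r t rr _; apply: df; rewrite modulus_pol ger0_norm //.
by case/andP: rr => h _; exact: le_trans h.
Qed.

Lemma circle_int0 f : circle_int f 0 = 0.
Proof.
have p0 := ltW pi2_gt0.
rewrite /circle_int (@eq_cint _ _ _ _ (fun=> 0)).
  by rewrite (cint_cder p0 (@cont_on_cst _ _ _ _) (cder_cst 0)) subrr.
by move=> t _; rewrite pol0 !mulr0.
Qed.

(** The circle integral still vanishes when differentiability fails at one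
    point but continuity does not: the sector around that point has small
    perimeter and carries a bounded integrand. *)
Lemma circle_int_punctured g (rho r th : R) :
  0 < rho -> rho < r -> r < 1 -> 0 < th < pi2 ->
  (forall z, modulus z < 1 -> g @ z --> g z) ->
  (forall z, modulus z < 1 -> z != pol rho th -> derivable g z 1) ->
  circle_int g r = 0.
Proof.
move=> rho0 rhor r1 /[dup] thI /andP[th0 thpi] gc dg.
set z0 := pol rho th in dg.
have r0 : 0 <= r by apply: ltW; apply: lt_trans rhor.
have p0 := ltW pi2_gt0.
have sc : sector_cont g 0 r 0 pi2.
  move=> s t /andP[s0 sr] _; apply: gc.
  by rewrite modulus_pol ger0_norm // (le_lt_trans sr).
have ne s t : 0 <= s -> 0 <= t <= pi2 -> pol s t = z0 -> s = rho /\ t = th.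
  move=> s0 tt e; have := congr1 (@modulus R) e.
  rewrite /z0 !modulus_pol !ger0_norm ?(ltW rho0) // => sE; split=> //.
  apply: expi_inj_in => //; apply: (mulfI _ (etrans e _)); last by rewrite sE.
  by rewrite -modulus_eq0 modulus_rc normr_eq0 sE gt_eqF.
have good a b c d : 0 <= a -> a <= b -> b <= r -> 0 <= c -> c <= d -> d <= pi2 ->
    (rho < a \/ b < rho) \/ (th < c \/ d < th) -> sector g a b c d = 0.
  move=> a0 ab br c0 cd dp h; apply: goursat => //; first by apply: le_trans br _; exact: ltW.
  move=> s t /andP[as_ sb] /andP[ct td]; apply: dg.
    by rewrite modulus_pol ger0_norm; lra.
  apply/eqP => /ne h2; have [||? ?] := h2; lra.
have [dl dl0 hM] : exists2 dl, 0 < dl & forall z, modulus (z - z0) < dl -> modulus (g z) <= modulus (g z0) + 1.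
  have z01 : modulus z0 < 1 by rewrite modulus_pol ger0_norm ?(ltW rho0) // (lt_trans rhor).
  have /(cvgCP (nbhs_filter z0))/(_ 1 ltr01) := gc _ z01.
  move=> /nbhsCP[dl dl0 h]; exists dl => // z /h.
  rewrite modulusB => h'.
  have -> : g z = (g z - g z0) + g z0 by rewrite subrK.
  by apply: le_trans (le_modulusD _ _) _; rewrite addrC lerD2l ltW.
set M := modulus (g z0) + 1 in hM.
have M0 : 0 < M by rewrite ltr_wpDl.
have -> : circle_int g r = sector g 0 r 0 pi2 by rewrite sector_full circle_int0 subr0.
apply/eqP; rewrite -modulus_eq0; apply/eqP; apply: le_anti; rewrite modulus_ge0 andbT.
apply/ler_addgt0Pr => e e0; rewrite add0r.
pose m := Num.min (Num.min (rho / 2) ((r - rho) / 2)) (Num.min (th / 2) ((pi2 - th) / 2)).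
pose eta := Num.min m (Num.min (dl / 4) (e / (16 * M))).
have eta0 : 0 < eta by rewrite !lt_min !divr_gt0 ?mulr_gt0 ?subr_gt0.
have [e1 [e2 [e3 [e4 [e5 e6]]]]] : eta <= rho / 2 /\ eta <= (r - rho) / 2 /\
    eta <= th / 2 /\ eta <= (pi2 - th) / 2 /\ eta <= dl / 4 /\ eta <= e / (16 * M).
  have := lexx eta; rewrite {2}/eta {1}/m !le_min.
  by move=> /andP[/andP[/andP[-> ->] /andP[-> ->]] /andP[-> ->]].
have scW a b c d : 0 <= a -> b <= r -> 0 <= c -> d <= pi2 -> sector_cont g a b c d.
  by move=> *; apply: sector_contW sc.
rewrite (sector_t_cat (t2 := th - eta)) //; try lra.
rewrite (good 0 r 0) ?add0r //; try lra.
rewrite (sector_t_cat (t2 := th + eta)) //; try lra; last by apply: scW; lra.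
rewrite (good 0 r (th + eta)) ?addr0 //; try lra.
rewrite (sector_r_cat (r2 := rho - eta)) //; try lra; last by apply: scW; lra.
rewrite (good 0 (rho - eta)) ?add0r //; try lra.
rewrite (sector_r_cat (r2 := rho + eta)) //; try lra; last by apply: scW; lra.
rewrite (good (rho + eta) r) ?addr0 //; try lra.
apply: le_trans (sector_bound (M := M) _ _ _ _ _ _) _; try lra.
- by apply: scW; lra.
- move=> s t /andP[s1 s2] /andP[t1 t2]; apply: hM.
  have -> : pol s t - z0 = rc (s - rho) * expi t + rc rho * (expi t - expi th).
    by rewrite /z0 /pol rcB; ring.
  apply: le_lt_trans (le_modulusD _ _) _.
  rewrite !modulusM modulus_expi mulr1 !modulus_rc.
  have h1 : `|s - rho| <= eta by rewrite ler_norml; lra.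
  have h2 : `|t - th| <= eta by rewrite ler_norml; lra.
  have h3 : `|rho| * modulus (expi t - expi th) <= 1 * (2 * `|t - th|).
    by apply: ler_pM => //; [rewrite ger0_norm; lra|exact: expi_lip].
  lra.
- have : M * eta <= M * (e / (16 * M)) by rewrite ler_pM2l.
  have -> : M * (e / (16 * M)) = e / 16 by field; rewrite gt_eqF.
  lra.
Qed.

Lemma circle_cont f r : (forall z, modulus z = `|r| -> f @ z --> f z) ->
  cont_on 0 pi2 (fun t => f (pol r t)).
Proof.
move=> fc t _; apply: (@cvg_comp _ _ _ (pol r) f); first exact: pol_cvg_t.
by apply: fc; rewrite modulus_pol.
Qed.

Lemma circle_bounded f r : (forall z, modulus z = `|r| -> f @ z --> f z) ->
  exists2 M : R, 0 <= M & forall t, 0 <= t <= pi2 -> modulus (f (pol r t)) <= M.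
Proof.
move=> fc; have p0 := ltW pi2_gt0.
have cc : {within `[0, pi2], continuous (fun t => modulus (f (pol r t)))}.
  apply: continuous_in_subspaceT => t; rewrite inE /= in_itv /= => tt.
  by apply: cvg_modulus; exact: (circle_cont fc).
have [c _ h] := EVT_max p0 cc.
exists (modulus (f (pol r c))) => // t tt; apply: h; exact: tt.
Qed.

(** Up to the factor 2 pi, the k-th Cauchy coefficient of f. *)
Definition coefint f k r := cint 0 pi2 (fun t => f (pol r t) * (pol r t)^-1 ^+ k).

Lemma derivable_negpow f k z : z != 0 -> derivable f z 1 ->
  derivable (fun w => f w * w^-1 ^+ k) z 1.
Proof.
move=> z0 df.
have h1 : derivable (fun w : C => w^-1) z 1.
  exact: (@derivableV _ _ (fun w : C => w) z 1 z0 (@derivable_id _ _ z 1)).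
have h2 := @derivableX _ _ _ k _ _ h1.
have h3 := derivableM df h2.
rewrite (_ : (fun _ => _) = (f * (fun w : C => w^-1) ^+ k)) //.
by apply/funext => w; rewrite fctE /=; congr (_ * _); elim: (k) => // m IH; rewrite !exprS IH.
Qed.

(** The integrand is, up to a constant, z times a function that is holomorphic
    off the origin, so the integral does not depend on the circle. *)
Lemma coefint_cst f k r1 r2 : hol f -> 0 < r1 -> r1 <= r2 -> r2 < 1 ->
  coefint f k r1 = coefint f k r2.
Proof.
move=> df r10 r12 r21.
pose F z := f z * z^-1 ^+ k.+1.
have dF z : r1 <= modulus z <= r2 -> derivable F z 1.
  move=> /andP[h1 h2]; apply: derivable_negpow; last by apply: df; exact: le_lt_trans r21.
  by rewrite -modulus_gt0; exact: lt_le_trans h1.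
have FJ r : r1 <= r <= r2 -> circle_int F r = iC R * coefint f k r.
  move=> /andP[rr1 rr2]; have rp := lt_le_trans r10 rr1.
  rewrite /coefint -cintZ; last first.
    apply: (circle_cont (f := fun z => f z * z^-1 ^+ k)) => z zr.
    apply: derivable_cvg; apply: derivable_negpow; rewrite -?modulus_gt0 ?zr ?ger0_norm ?(ltW rp) //.
    by apply: df; rewrite zr ger0_norm ?(ltW rp) // (le_lt_trans rr2).
  apply: eq_cint => t _; rewrite /F exprS.
  have : pol r t != 0 by rewrite -modulus_gt0 modulus_pol ger0_norm // ltW.
  by move=> p; field.
have iC0 : iC R != 0 by rewrite -modulus_gt0 modulus_iC.
have JJ : circle_int F r1 = circle_int F r2 by apply: circle_int_cst => //; exact: ltW.
have F1 : circle_int F r1 = iC R * coefint f k r1 by apply: FJ; rewrite lexx r12.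
have F2 : circle_int F r2 = iC R * coefint f k r2 by apply: FJ; rewrite lexx r12.
by move: JJ; rewrite F1 F2; exact: mulfI.
Qed.

Lemma coefint1 k r : 0 < r -> r < 1 ->
  coefint (fun=> 1) k r = if k == 0%N then rc pi2 else 0.
Proof.
have p0 := ltW pi2_gt0.
have cst0 : coefint (fun=> 1) 0 r = rc pi2.
  rewrite /coefint (@eq_cint _ _ _ _ (fun=> 1)); last by move=> t _; rewrite mul1r.
  by rewrite (cint_cder p0 (@cont_on_cst _ _ _ _) (@cder_rc R)) subr0.
case: k => [//|k] r0 r1 /=.
have hol1 : hol (fun=> 1 : C) by move=> z _; exact: derivable_cst.
have scl s : 0 < s -> coefint (fun=> 1) k.+1 s = rc (s^-1 ^+ k.+1) * cint 0 pi2 (fun t => (expi t)^-1 ^+ k.+1).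
  move=> s0; rewrite -cintZ; last first.
    move=> t _; apply: (@cvg_comp _ _ _ (@expi R) (fun w : C => w^-1 ^+ k.+1)); first exact: expi_cvg.
    apply: (derivable_cvg (f := fun w => w^-1 ^+ k.+1)).
    have e0 : expi t != 0 by rewrite -modulus_gt0 modulus_expi.
    rewrite (_ : (fun w => _) = (fun w => 1 * w^-1 ^+ k.+1)); last by apply/funext => w; rewrite mul1r.
    by apply: derivable_negpow => //; exact: derivable_cst.
  by apply: eq_cint => t _; rewrite mul1r /pol invfM exprMn rcX rcV.
have r20 : 0 < r / 2 by rewrite divr_gt0.
have := coefint_cst k.+1 hol1 r20 (_ : r / 2 <= r) r1.
rewrite !scl // => /(_ _) h.
have /eqP := h (ltac:(lra)).
rewrite -subr_eq0 -mulrBl mulf_eq0 => /orP[|/eqP ->]; last by rewrite mulr0.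
rewrite -rcB -modulus_eq0 modulus_rc normr_eq0 invfM invrK exprMn.
rewrite -[X in _ - X]mulr1 -mulrBr mulf_eq0 expf_eq0 /= invr_eq0 gt_eqF //=.
by rewrite subr_eq0 => /eqP/(congr1 (fun x => x - 1)) /eqP; rewrite subrr subr_eq0 gt_eqF // exprn_egt1 // ltr1n.
Qed.

End Taylor.

Section TaylorSeries.
Variable R : realType.
Local Notation C := (cplx R).
Implicit Types (f g : C -> C) (z w : C) (r t : R).
Local Notation pi2 := (pi *+ 2 : R).

Lemma cvg_pow (T : Type) (F : set_system T) (FF : Filter F) (h : T -> C) (a : C) n :
  h @ F --> a -> (fun x => h x ^+ n) @ F --> a ^+ n.
Proof.
move=> ha; elim: n => [|n IH].
  by rewrite expr0; exact: cvg_cst.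
have E : (fun x => h x ^+ n.+1) = (fun x => h x * h x ^+ n).
  by apply/funext => x; rewrite exprS.
by rewrite E exprS; exact: (cvgM ha IH).
Qed.

Lemma cvg_csum (T : Type) (F : set_system T) (FF : Filter F) (h : nat -> T -> C)
  (a : nat -> C) n : (forall k, h k @ F --> a k) ->
  (fun x => \sum_(k < n) h k x) @ F --> \sum_(k < n) a k.
Proof.
move=> ha; elim: n => [|n IH].
  have E : (fun x => \sum_(k < 0) h k x) = cst 0.
    by apply/funext => x; rewrite big_ord0.
  by rewrite E big_ord0; exact: cvg_cst.
have E : (fun x => \sum_(k < n.+1) h k x) = (fun x => \sum_(k < n) h k x + h n x).
  by apply/funext => x; rewrite big_ord_recr.
by rewrite E big_ord_recr; exact: (cvgD IH (ha n)).
Qed.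

Lemma cvg_poly (a : nat -> C) n z :
  (fun w => \sum_(k < n) a k * w ^+ k) @ z --> \sum_(k < n) a k * z ^+ k.
Proof.
apply: (@cvg_csum C (nbhs z) (nbhs_filter z) (fun k (w : C) => a k * w ^+ k)
  (fun k => a k * z ^+ k)) => k.
have h1 := @cvg_pow C (nbhs z) (nbhs_filter z) id z k (@cvg_id _ _).
have h2 : (fun _ : C => a k) @ z --> a k := @cvg_cst _ _ _ _ (nbhs_filter z).
exact: (cvgM h2 h1).
Qed.

Section Remainder.
Variables (f : C -> C) (r : R) (z0 : C).
Hypothesis (holf : hol f) (z0r : modulus z0 < r) (r1 : r < 1).
Hypothesis z0np : z0 != rc (modulus z0).

Let rho := modulus z0.
Let rho0 : 0 < rho.
Proof.
rewrite /rho modulus_gt0; apply: contraNneq z0np => ->.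
by rewrite modulus0 rc0.
Qed.
Let r0 : 0 < r. Proof. exact: lt_trans z0r. Qed.

Let circle_ne z : modulus z = `|r| -> z != 0 /\ z - z0 != 0.
Proof.
rewrite ger0_norm ?(ltW r0) // => zr; split.
  by rewrite -modulus_gt0 zr.
rewrite subr_eq0; apply/eqP => e; move: z0r; rewrite -e zr ltxx //.
Qed.

Let hf (n : nat) (z : C) : C := (f z - f z0) * (z0 * z^-1) ^+ n * (z * (z - z0)^-1).

Let cst_cvg (z K : C) : (fun _ : C => K) @ z --> K.
Proof. exact: (@cvg_cst _ _ _ _ (nbhs_filter z)). Qed.

Let id_cvg (z : C) : (fun w : C => w) @ z --> z.
Proof. exact: cvg_id. Qed.

Let inv_cvg (z : C) (h : C -> C) : h z != 0 -> h @ z --> h z ->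
  (fun w : C => (h w)^-1) @ z --> (h z)^-1.
Proof. by move=> h0 hc; exact: (@cvgV _ _ _ (nbhs_filter z) _ _ h0 hc). Qed.

Let f_cvg z : modulus z = `|r| -> f @ z --> f z.
Proof.
by move=> zr; apply: derivable_cvg; apply: holf; rewrite zr ger0_norm // ltW.
Qed.

Let diff_cvg n z : modulus z = `|r| ->
  (fun z => (f z - f z0) * (z0 * z^-1) ^+ n) @ z --> (f z - f z0) * (z0 * z^-1) ^+ n.
Proof.
move=> zr; have [z_0 z_z0] := circle_ne zr.
have hv := @inv_cvg z (fun w => w) z_0 (@id_cvg z).
have hm : (fun w : C => z0 * w^-1) @ z --> z0 * z^-1 by exact: (cvgM (@cst_cvg z z0) hv).
have hp : (fun w : C => (z0 * w^-1) ^+ n) @ z --> (z0 * z^-1) ^+ n.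
  exact: (@cvg_pow C (nbhs z) (nbhs_filter z) _ _ n hm).
have hb : (fun w : C => f w - f z0) @ z --> f z - f z0.
  exact: (cvgB (@f_cvg z zr) (@cst_cvg z (f z0))).
exact: (cvgM hb hp).
Qed.

Let hf_cvg n z : modulus z = `|r| -> hf n @ z --> hf n z.
Proof.
move=> zr; have [z_0 z_z0] := circle_ne zr.
have hd : (fun w : C => (w - z0)^-1) @ z --> (z - z0)^-1.
  exact: (@inv_cvg z (fun w => w - z0) z_z0 (cvgB (@id_cvg z) (@cst_cvg z z0))).
exact: (cvgM (@diff_cvg n z zr) (cvgM (@id_cvg z) hd)).
Qed.

(* The remainder after n terms in Cauchy's formula. That T 0 vanishes is the
   removability of the singularity of the difference quotient at z0. *)
Let T n := cint 0 pi2 (fun t => hf n (pol r t)).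

Let pol_ne t : pol r t != 0 /\ pol r t - z0 != 0.
Proof. by apply: circle_ne; rewrite modulus_pol. Qed.

Let T0 : T 0%N = 0.
Proof.
have [d fd] := derivable_expands (holf (lt_trans z0r r1)).
pose g z := if z == z0 then d else (f z - f z0) * (z - z0)^-1.
have [th thI zE] := polar z0np.
have q_der z : modulus z < 1 -> z != z0 -> derivable g z 1.
  move=> z1 zn; have zz : z - z0 != 0 by rewrite subr_eq0.
  have h1 : derivable (fun w : C => w - z0) z 1.
    exact: (derivableB (@derivable_id _ _ z 1) (derivable_cst z0 z 1)).
  have h2 := @derivableV _ _ (fun w : C => w - z0) z 1 zz h1.
  have h3 := derivableB (holf z1) (derivable_cst (f z0) z 1).
  have h4 := derivableM h3 h2.
  apply: near_eq_derivable h4; apply/nbhsCP.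
  exists (modulus (z - z0)); first by rewrite modulus_gt0.
  move=> w wz; rewrite /g; case: eqP => // e.
  by move: wz; rewrite e modulusB ltxx.
have gcv z : modulus z < 1 -> g @ z --> g z.
  move=> z1; have [->|zn] := eqVneq z z0; last by apply: derivable_cvg; exact: q_der.
  apply/(cvgCP (nbhs_filter z0)) => e e0; apply/nbhsCP.
  have [dl dl0 h] := fd (e / 2) (divr_gt0 e0 (ltr0n _ 2)).
  exists dl => // w wz; rewrite /g eqxx; case: eqP => [_|/eqP wn].
    by rewrite subrr modulus0.
  have ww : w - z0 != 0 by rewrite subr_eq0.
  have -> : d - (f w - f z0) * (w - z0)^-1 = - ((f w - (f z0 + d * (w - z0))) * (w - z0)^-1).
    by field.
  have wp : 0 < modulus (w - z0) by rewrite modulus_gt0.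
  rewrite modulusN modulusM modulusV ltr_pdivrMr //.
  by apply: le_lt_trans (h _ wz) _; rewrite ltr_pM2r // ltr_pdivrMr // ltr_pMr // ltr1n.
have Jg : circle_int g r = 0.
  apply: (circle_int_punctured rho0 z0r r1 thI gcv) => z z1; rewrite -zE; exact: q_der.
have JT : circle_int g r = iC R * T 0%N.
  rewrite /T -cintZ; last exact: (circle_cont (@hf_cvg 0)).
  apply: eq_cint => t _; have [p1 p2] := pol_ne t.
  rewrite /g /hf expr0 mulr1; case: eqP => [e|_]; last by ring.
  by move: p2; rewrite e subrr eqxx.
have iC0 : iC R != 0 by rewrite -modulus_gt0 modulus_iC.
by apply/eqP; move/eqP: JT; rewrite Jg eq_sym mulf_eq0 (negbTE iC0).
Qed.

Let cf_cvg k z : modulus z = `|r| -> (fun z => f z * z^-1 ^+ k) @ z --> f z * z^-1 ^+ k.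
Proof.
move=> zr; have [z_0 _] := circle_ne zr.
have hv := @inv_cvg z (fun w => w) z_0 (@id_cvg z).
exact: (cvgM (@f_cvg z zr) (@cvg_pow C (nbhs z) (nbhs_filter z) _ _ k hv)).
Qed.

Let one_cvg k z : modulus z = `|r| -> (fun z : C => 1 * z^-1 ^+ k) @ z --> 1 * z^-1 ^+ k.
Proof.
move=> zr; have [z_0 _] := circle_ne zr.
have hv := @inv_cvg z (fun w => w) z_0 (@id_cvg z).
exact: (cvgM (@cst_cvg z 1) (@cvg_pow C (nbhs z) (nbhs_filter z) _ _ k hv)).
Qed.

Let TS n : T n.+1 = T n - z0 ^+ n * (coefint f n r - f z0 * coefint (fun=> 1) n r).
Proof.
have c1 := circle_cont (@cf_cvg n); have c2 := circle_cont (@one_cvg n).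
have c2' : cont_on 0 pi2 (fun t => - f z0 * (1 * (pol r t)^-1 ^+ n)).
  exact: (cont_onM (@cont_on_cst _ _ _ _) c2).
have c0 := cont_onD c1 c2'.
have c0' : cont_on 0 pi2 (fun t => z0 ^+ n *
    (f (pol r t) * (pol r t)^-1 ^+ n + - f z0 * (1 * (pol r t)^-1 ^+ n))).
  exact: (cont_onM (@cont_on_cst _ _ _ _) c0).
have E0 := cintD c1 c2'; rewrite (cintZ (- f z0) c2) mulNr in E0.
have c4 := circle_cont (@hf_cvg n.+1).
have E1 := cintD c4 c0'; rewrite (cintZ (z0 ^+ n) c0) E0 in E1.
have E2 : T n = cint 0 pi2 (fun t => hf n.+1 (pol r t) + z0 ^+ n *
    (f (pol r t) * (pol r t)^-1 ^+ n + - f z0 * (1 * (pol r t)^-1 ^+ n))).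
  apply: eq_cint => t _; rewrite /hf; have [p1 p2] := pol_ne t.
  move: p1 p2; rewrite exprS; set u := pol r t; set F := f u; set F0 := f z0.
  move: (F) (F0) => A B; rewrite exprMn; move: (z0 ^+ n) (u^-1 ^+ n) => X Y p1 p2.
  by field; rewrite p1 p2.
by rewrite E2 E1 -/(T n.+1) -/(coefint f n r) -/(coefint (fun=> 1) n r) addrK.
Qed.

Lemma taylor_remainder (M : R) :
  (forall t, 0 <= t <= pi2 -> modulus (f (pol r t)) <= M) ->
  forall n, (0 < n)%N ->
  modulus (f z0 - \sum_(k < n) (coefint f k r / rc pi2) * z0 ^+ k) <=
  2 * (M + modulus (f z0)) * (modulus z0 / r) ^+ n * (r / (r - modulus z0)).
Proof.
move=> hM n n0.
have TE m : T m = - \sum_(k < m) z0 ^+ k * (coefint f k r - f z0 * coefint (fun=> 1) k r).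
  elim: m => [|m IH]; first by rewrite big_ord0 oppr0 T0.
  by rewrite TS IH big_ord_recr /= opprD.
have p2 : rc pi2 != 0 :> C.
  by rewrite -modulus_gt0 modulus_rc normr_gt0 gt_eqF // pi2_gt0.
have E : rc pi2 * (f z0 - \sum_(k < n) (coefint f k r / rc pi2) * z0 ^+ k) = T n.
  rewrite TE; case: n n0 => // n _.
  rewrite big_ord_recl [in RHS]big_ord_recl !expr0 !mul1r !mulr1 coefint1 //=.
  set A := \sum_(i < n) (_ / _ * _); set B := \sum_(i < n) _.
  have -> : B = rc pi2 * A.
    rewrite /A /B mulr_sumr; apply: eq_bigr => i _.
    by rewrite coefint1 //= mulr0 subr0 mulrA [rc pi2 * _]mulrC divfK // mulrC.
  by clearbody A; move: (rc _) p2 => P p2; field.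
have pp := pi2_gt0 R.
have nE : modulus (T n) = pi2 * modulus (f z0 - \sum_(k < n) (coefint f k r / rc pi2) * z0 ^+ k).
  by rewrite -E modulusM modulus_rc ger0_norm // ltW.
rewrite -(ler_pM2l pp) -nE.
apply: le_trans (le_cint (M := (M + modulus (f z0)) * (modulus z0 / r) ^+ n * (r / (r - modulus z0))) (ltW pp) (circle_cont (@hf_cvg n)) _) _.
  move=> t tt; rewrite /hf !modulusM modulusX modulusM !modulusV modulus_expi mulr1 modulus_rc modulus_pol.
  rewrite ger0_norm ?(ltW r0) //.
  have rz : 0 < r - modulus z0 by rewrite subr_gt0.
  have pz : r - modulus z0 <= modulus (pol r t - z0).
    by apply: le_trans (le_modulus_dist _ _); rewrite modulus_pol ger0_norm // ltW.
  apply: ler_pM => //.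
  - by rewrite mulr_ge0 // exprn_ge0 // divr_ge0 // ltW.
  - by rewrite mulr_ge0 ?invr_ge0 ?(ltW r0).
  - apply: ler_pM => //; first by rewrite exprn_ge0 // divr_ge0 // ltW.
    by apply: le_trans (le_modulusB _ _) _; rewrite lerD2r; exact: hM.
  - rewrite ler_pM2l // lef_pV2 ?posrE //; exact: lt_le_trans pz.
by rewrite subr0 le_eqVlt; apply/orP; left; apply/eqP; ring.
Qed.

End Remainder.

(** The removability argument cuts the disc along the positive axis, so it is
    carried out for points off this axis; the remaining points are limits of
    such points. *)
Lemma near_not_positive (z0 : C) (dl : R) : 0 < dl ->
  exists2 w, modulus (w - z0) < dl & w != rc (modulus w).
Proof.
move=> dl0.
have wE : modulus (rc (dl / 2) * iC R) < dl.
  rewrite modulusM modulus_iC mulr1 modulus_rc ger0_norm ?ltW ?divr_gt0 //.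
  by rewrite ltr_pdivrMr // ltr_pMr // ltr1n.
have [e|n] := eqVneq z0 (rc (modulus z0)); last first.
  by exists z0 => //; rewrite subrr modulus0.
exists (z0 + rc (dl / 2) * iC R); first by rewrite addrC addKr.
apply/eqP => /(congr1 im); rewrite e im_rc imD im_rc imM /= mulr1 mul0r addr0 add0r.
by apply/eqP; rewrite gt_eqF // divr_gt0.
Qed.

(** The remainder in Cauchy's formula decays geometrically, at a rate (q / r)^n
    that is uniform near z0. *)
Theorem taylor_exists f : hol f ->
  exists a : nat -> C, forall z, modulus z < 1 ->
    series (fun n => a n * z ^+ n) @ \oo --> f z.
Proof.
move=> hf; pose a k := coefint f k (1 / 2) / rc pi2.
exists a => z0 z01.
pose q := (1 + modulus z0) / 2; pose r := (1 + q) / 2.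
have [z0q qr r1 r12] : [/\ modulus z0 < q, q < r, r < 1 & 1 / 2 < r].
  by have := modulus_ge0 z0; rewrite /r /q => h; split; move: z01 h; clear; lra.
have q0 : 0 < q by exact: le_lt_trans z0q.
have r0 : 0 < r by exact: lt_trans qr.
have aE k : coefint f k r / rc pi2 = a k.
  by rewrite /a (@coefint_cst R f k (1 / 2) r) // ltW // divr_gt0.
clearbody a.
have fcz : f @ z0 --> f z0 by apply: derivable_cvg; exact: hf.
have [M M0 hM] : exists2 M : R, 0 <= M & forall t, 0 <= t <= pi2 -> modulus (f (pol r t)) <= M.
  apply: circle_bounded => z zr; apply: derivable_cvg; apply: hf.
  by rewrite zr ger0_norm // ltW.
have key n : (0 < n)%N -> modulus (f z0 - \sum_(k < n) a k * z0 ^+ k) <=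
    2 * (M + (modulus (f z0) + 1)) * (q / r) ^+ n * (r / (r - q)).
  move=> n0; apply/ler_addgt0Pr => e e0.
  have h1 : (fun z => f z - \sum_(k < n) a k * z ^+ k) @ z0 -->
      f z0 - \sum_(k < n) a k * z0 ^+ k.
    by have h0 := @cvg_poly a n z0; exact: (cvgB fcz h0).
  have /(cvgCP (nbhs_filter z0))/(_ _ e0)/nbhsCP[d1 d10 hd1] := h1.
  have /(cvgCP (nbhs_filter z0))/(_ _ ltr01)/nbhsCP[d2 d20 hd2] := fcz.
  pose dl := Num.min (Num.min d1 d2) (q - modulus z0).
  have dl0 : 0 < dl by rewrite !lt_min d10 d20 subr_gt0.
  have [w wz wn] := near_not_positive z0 dl0.
  move: wz; rewrite !lt_min => /andP[/andP[w1 w2] w3].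
  have wq : modulus w < q.
    have -> : w = (w - z0) + z0 by rewrite subrK.
    by apply: le_lt_trans (le_modulusD _ _) _; rewrite -ltrBrDr.
  have wr := lt_trans wq qr.
  have fw : modulus (f w) <= modulus (f z0) + 1.
    have -> : f w = (f w - f z0) + f z0 by rewrite subrK.
    apply: le_trans (le_modulusD _ _) _; rewrite addrC lerD2l ltW // modulusB.
    exact: hd2.
  have := taylor_remainder hf wr r1 wn hM n0.
  have -> : \sum_(k < n) (coefint f k r / rc pi2) * w ^+ k = \sum_(k < n) a k * w ^+ k.
    by apply: eq_bigr => k _; congr (_ * _); exact: aE.
  move=> hw.
  have -> : f z0 - \sum_(k < n) a k * z0 ^+ k =
     (f z0 - \sum_(k < n) a k * z0 ^+ k - (f w - \sum_(k < n) a k * w ^+ k)) +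
     (f w - \sum_(k < n) a k * w ^+ k) by rewrite subrK.
  apply: le_trans (le_modulusD _ _) _.
  rewrite [leRHS]addrC; apply: lerD; first by apply: ltW; exact: hd1.
  apply: le_trans hw _.
  have A1 : 0 <= 2 * (M + modulus (f w)) by rewrite mulr_ge0 ?addr_ge0.
  have A2 : 0 <= modulus w / r by rewrite divr_ge0 // ltW.
  have A3 : 0 <= r / (r - modulus w) by rewrite divr_ge0 ?subr_ge0 ?(ltW wr) // ltW.
  apply: (ler_pM (mulr_ge0 A1 (exprn_ge0 n A2)) A3).
    apply: (ler_pM A1 (exprn_ge0 n A2)).
      by rewrite ler_pM2l // lerD2l.
    have A4 : modulus w / r <= q / r by rewrite ler_pM2r ?invr_gt0 // ltW.
    by rewrite lerXn2r // nnegrE divr_ge0 // ltW.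
  rewrite ler_pM2l // lef_pV2 ?posrE ?subr_gt0 //.
  by rewrite lerD2l lerN2 ltW.
pose K := 2 * (M + (modulus (f z0) + 1)) * (r / (r - q)).
apply/cvgCP => e e0.
have gq : (fun n => K * (q / r) ^+ n) @ \oo --> (0 : R).
  rewrite -[X in _ --> X](mulr0 K); apply: cvgM; first exact: cvg_cst.
  apply: cvg_expr; have A5 : 0 <= q / r by rewrite divr_ge0 // ltW.
  by rewrite ger0_norm // ltr_pdivrMr // mul1r.
have /cvgrPdist_lt/(_ _ e0) gn := gq.
near=> n.
rewrite /series /= big_mkord.
apply: le_lt_trans (key n _) _; first by near: n; exact: nbhs_infty_gt.
have : `|0 - K * (q / r) ^+ n| < e by near: n; exact: gn.
rewrite sub0r normrN; apply: le_lt_trans; rewrite /K.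
apply: le_trans (ler_norm _); rewrite le_eqVlt; apply/orP; left; apply/eqP; ring.
Unshelve. all: by end_near. Qed.

End TaylorSeries.

(** * Power series *)
Section PowerSeries.
Variable R : realType.
Local Notation C := (cplx R).
Implicit Types (F G : C -> C) (a b : nat -> C) (z w : C) (r t : R) (u v : nat -> R).

Lemma le_pow (x y : R) n : 0 <= x -> x <= y -> x ^+ n <= y ^+ n.
Proof. by move=> x0 xy; apply: lerXn2r; rewrite ?nnegrE // (le_trans x0). Qed.

Lemma seriesE u n : series u n = \sum_(k < n) u k.
Proof. by rewrite /series /= big_mkord. Qed.

Lemma seriesCE (u : nat -> C) n : series u n = \sum_(k < n) u k.
Proof. by rewrite /series /= big_mkord. Qed.

Lemma cvg_seriesZ (k : R) u : cvgn (series u) -> cvgn (series (fun n => k * u n)).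
Proof. by move=> uc; have := @is_cvg_seriesZ R u k uc; exact. Qed.

Lemma nneg_series_nd u : (forall n, 0 <= u n) -> nondecreasing_seq (series u).
Proof. by move=> u0; apply: nondecreasing_series => n _ _. Qed.

Lemma nneg_series_cvg u (B : R) : (forall n, 0 <= u n) ->
  (forall n, \sum_(k < n) u k <= B) -> cvgn (series u).
Proof.
move=> u0 uB; apply: nondecreasing_is_cvgn; first exact: nneg_series_nd.
by exists B => _ [n _ <-]; rewrite seriesE.
Qed.

Lemma nneg_series_lim_le u (B : R) : (forall n, 0 <= u n) ->
  (forall n, \sum_(k < n) u k <= B) -> limn (series u) <= B.
Proof.
move=> u0 uB; apply: limr_le; first exact: nneg_series_cvg uB.
by near=> n; rewrite seriesE.
Unshelve. all: by end_near. Qed.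

Lemma nneg_series_le_lim u n : (forall n, 0 <= u n) -> cvgn (series u) ->
  \sum_(k < n) u k <= limn (series u).
Proof.
move=> u0 uc; rewrite -seriesE; apply: nondecreasing_cvgn_le => //.
exact: nneg_series_nd.
Qed.

Lemma nneg_series_lim_ge0 u : (forall n, 0 <= u n) -> cvgn (series u) ->
  0 <= limn (series u).
Proof.
by move=> u0 uc; have := nneg_series_le_lim 0 u0 uc; rewrite big_ord0.
Qed.

Lemma le_series_cvg u v : (forall n, 0 <= u n) -> (forall n, u n <= v n) ->
  cvgn (series v) -> cvgn (series u).
Proof.
move=> u0 uv vc; apply: series_le_cvg vc => // n.
exact: le_trans (u0 n) (uv n).
Qed.

Lemma cvgC_unique (T : Type) (F : set_system T) (FF : ProperFilter F) (h : T -> C) (x y : C) :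
  h @ F --> x -> h @ F --> y -> x = y.
Proof. by move=> hx hy; apply: (cvg_unique (@norm_hausdorff _ _) hx hy). Qed.

Lemma tail_bound (u : nat -> C) (l : C) (b : nat -> R) m :
  series u @ \oo --> l -> (forall n, modulus (u n) <= b n) -> cvgn (series b) ->
  modulus (l - \sum_(k < m) u k) <= limn (series b) - \sum_(k < m) b k.
Proof.
move=> ul ub bc.
have b0 n : 0 <= b n by apply: le_trans (ub n).
have h1 : (fun n => modulus (series u n - \sum_(k < m) u k)) @ \oo --> modulus (l - \sum_(k < m) u k).
  apply: cvg_modulus.
  have cc : (fun _ : nat => \sum_(k < m) u k) @ \oo --> \sum_(k < m) u k by exact: cvg_cst.
  exact: (cvgB ul cc).
apply: (cvgr_to_le h1); near=> n.
have mn : (m <= n)%N by near: n; exact: nbhs_infty_ge.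
have -> : series u n - \sum_(k < m) u k = \sum_(m <= k < n) u k.
  by rewrite /series /= (big_cat_nat _ mn) //= big_mkord addrAC subrr add0r.
apply: le_trans (le_modulus_sum _ _ _) _.
rewrite lerBrDr.
apply: (@le_trans _ _ (series b n)); last first.
  by apply: nondecreasing_cvgn_le => //; exact: nneg_series_nd.
rewrite /series /= [in leRHS](big_cat_nat _ mn) //= [leRHS]addrC big_mkord lerD2r.
by apply: ler_sum => k _.
Unshelve. all: by end_near. Qed.

Lemma tail_cvg0 (b : nat -> R) : cvgn (series b) ->
  (fun m => limn (series b) - \sum_(k < m) b k) @ \oo --> (0 : R).
Proof.
move=> bc; rewrite -[X in _ --> X](subrr (limn (series b))).
have E : (fun m => \sum_(k < m) b k) = series b by apply/funext => m; rewrite seriesE.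
have h : (fun m => \sum_(k < m) b k) @ \oo --> limn (series b) by rewrite E.
have cc : (fun _ : nat => limn (series b)) @ \oo --> limn (series b) by exact: cvg_cst.
exact: (cvgB cc h).
Qed.

Lemma modulus_nat n : modulus (n%:R : C) = n%:R.
Proof. by rewrite -(rc_nat R) modulus_rc normr_nat. Qed.

Definition pser F a := forall z, modulus z < 1 ->
  series (fun n => a n * z ^+ n) @ \oo --> F z.

Definition abs_coef a := forall r, 0 <= r -> r < 1 ->
  cvgn (series (fun n => modulus (a n) * r ^+ n)).

Lemma cvg_bounded_seq u (l : R) : u @ \oo --> l -> exists2 M : R, 0 < M & forall n, `|u n| <= M.
Proof.
move=> ul; have : bounded_fun u by apply: cvg_seq_bounded; apply/cvg_ex; exists l.
move/ex_strict_bound_gt0 => [M M0 h]; exists M => // n; apply: ltW; exact: h.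
Qed.

Lemma geometric_cvg (M q : R) : 0 <= q -> q < 1 -> cvgn (series (fun n => M * q ^+ n)).
Proof.
move=> q0 q1; have := @is_cvg_geometric_series R M q; rewrite ger0_norm //.
by move=> /(_ q1).
Qed.

(** Cauchy's radius argument: bounded terms at a larger radius give geometric
    decay at a smaller one. *)
Lemma bounded_abs_coef a : (forall r, 0 < r -> r < 1 -> exists M : R, forall n, modulus (a n) * r ^+ n <= M) ->
  abs_coef a.
Proof.
move=> h r r0 r1; pose q := (1 + r) / 2.
have q0 : 0 < q by rewrite /q; lra.
have q1 : q < 1 by rewrite /q; lra.
have [M hM] := h _ q0 q1.
apply: (@le_series_cvg _ (fun n => M * (r / q) ^+ n)).
- by move=> n; rewrite mulr_ge0 // exprn_ge0.
- move=> n; rewrite exprMn exprVn mulrCA -[leLHS]mul1r.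
  have qn : q ^+ n != 0 by rewrite expf_neq0 // gt_eqF.
  rewrite [leRHS](_ : _ = (M / q ^+ n) * r ^+ n); last by ring.
  rewrite mul1r; apply: ler_wpM2r; first exact: exprn_ge0.
  by rewrite ler_pdivlMr ?exprn_gt0.
apply: geometric_cvg; first by rewrite divr_ge0 // ltW.
by rewrite ltr_pdivrMr // mul1r /q; lra.
Qed.

Lemma pser_abs F a : pser F a -> abs_coef a.
Proof.
move=> Fa; apply: bounded_abs_coef => r r0 r1.
have rr : modulus (rc r) < 1 by rewrite modulus_rc ger0_norm // ltW.
have c0 : (fun n => a n * rc r ^+ n) @ \oo --> (0 : C).
  by apply: cvg_series_cvg_0; apply/cvg_ex; exists (F (rc r)); exact: Fa.
have [M _ hM] := cvg_bounded_seq (cvg_modulus _ c0); exists M => n.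
have := hM n; rewrite ger0_norm // modulusM modulusX modulus_rc ger0_norm //.
exact: ltW.
Qed.

Lemma abs_coef_pser a : abs_coef a -> exists F, pser F a.
Proof.
move=> aa.
have ex z : exists l : C, modulus z < 1 -> series (fun n => a n * z ^+ n) @ \oo --> l.
  case: (pselect (modulus z < 1)) => [z1|]; last by exists 0.
  have [|l hl] := @abs_cvgC R (fun n => a n * z ^+ n) (fun n => modulus (a n) * modulus z ^+ n)
     _ (aa _ (modulus_ge0 z) z1).
    by move=> n; rewrite modulusM modulusX.
  by exists l.
by have [F hF] := choice ex; exists F.
Qed.

Definition abs_sum a r := limn (series (fun n => modulus (a n) * r ^+ n)).

Definition abs_tail a r m := abs_sum a r - \sum_(k < m) modulus (a k) * r ^+ k.

Lemma abs_tail_cvg a r : abs_coef a -> 0 <= r -> r < 1 ->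
  abs_tail a r @ \oo --> (0 : R).
Proof. by move=> aa r0 r1; apply: tail_cvg0; exact: aa. Qed.

Lemma abs_sum_ge a r m : abs_coef a -> 0 <= r -> r < 1 ->
  \sum_(k < m) modulus (a k) * r ^+ k <= abs_sum a r.
Proof.
move=> aa r0 r1; apply: nneg_series_le_lim; last exact: aa.
by move=> n; rewrite mulr_ge0 // exprn_ge0.
Qed.

Lemma abs_tail_ge0 a r m : abs_coef a -> 0 <= r -> r < 1 -> 0 <= abs_tail a r m.
Proof. by move=> *; rewrite subr_ge0; exact: abs_sum_ge. Qed.

Lemma pser_tail F a z r m : pser F a -> modulus z <= r -> r < 1 ->
  modulus (F z - \sum_(k < m) a k * z ^+ k) <= abs_tail a r m.
Proof.
move=> Fa zr r1; have r0 : 0 <= r by exact: le_trans zr.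
apply: (tail_bound (u := fun n => a n * z ^+ n)).
- by apply: Fa; exact: le_lt_trans r1.
- move=> n; rewrite modulusM modulusX ler_wpM2l //.
  by rewrite lerXn2r ?nnegrE.
- exact: (pser_abs Fa).
Qed.

Lemma pser_le F a z r : pser F a -> modulus z <= r -> r < 1 ->
  modulus (F z) <= abs_sum a r.
Proof.
by move=> Fa zr r1; have := pser_tail 0 Fa zr r1; rewrite /abs_tail !big_ord0 !subr0.
Qed.

Lemma poly_le a z r m : abs_coef a -> modulus z <= r -> r < 1 ->
  modulus (\sum_(k < m) a k * z ^+ k) <= abs_sum a r.
Proof.
move=> aa zr r1; have r0 : 0 <= r by exact: le_trans zr.
apply: le_trans (abs_sum_ge m aa r0 r1).
apply: le_trans (le_modulus_sum _ _ _) _; apply: ler_sum => k _.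
by rewrite modulusM modulusX ler_wpM2l // lerXn2r ?nnegrE.
Qed.


(** Second order Taylor bound for a monomial, uniform on the disc of radius r;
    stated after multiplication by r^2 to avoid negative powers. *)
Lemma pow_expand z w r k : 0 < r -> modulus z <= r -> modulus w <= r ->
  modulus (w ^+ k - (z ^+ k + k%:R * z ^+ k.-1 * (w - z))) * r ^+ 2 <=
  k%:R ^+ 2 * r ^+ k * modulus (w - z) ^+ 2.
Proof.
move=> r0 zr wr; elim: k => [|k IH].
  by rewrite !mulr0n expr0n !expr0 !mul0r addr0 subrr modulus0 !mul0r.
set E := w ^+ k - _ in IH.
have -> : w ^+ k.+1 - (z ^+ k.+1 + k.+1%:R * z ^+ k.+1.-1 * (w - z)) =
    w * E + k%:R * z ^+ k.-1 * (w - z) ^+ 2.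
  rewrite /E; case: k {IH E} => [|k] /=; first by rewrite !expr0 !expr1; ring.
  by rewrite !exprS -!natr1; ring.
have h1 : modulus (w * E + k%:R * z ^+ k.-1 * (w - z) ^+ 2) <=
    r * modulus E + k%:R * r ^+ k.-1 * modulus (w - z) ^+ 2.
  apply: le_trans (le_modulusD _ _) _; rewrite !modulusM !modulusX; apply: lerD.
    by rewrite ler_wpM2r.
  rewrite -expr2 ler_wpM2r ?exprn_ge0 // modulus_nat.
  by rewrite ler_wpM2l // lerXn2r ?nnegrE // ltW.
have r2 : 0 <= r ^+ 2 by rewrite exprn_ge0 // ltW.
apply: le_trans (ler_wpM2r r2 h1) _.
rewrite mulrDl.
have h2 : r * modulus E * r ^+ 2 <= r * (k%:R ^+ 2 * r ^+ k * modulus (w - z) ^+ 2).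
  by rewrite -mulrA ler_pM2l.
apply: le_trans (lerD h2 (lexx _)) _.
set X := modulus (w - z) ^+ 2; have X0 : 0 <= X by rewrite exprn_ge0.
have -> : k%:R * r ^+ k.-1 * X * r ^+ 2 = k%:R * r ^+ k.+1 * X.
  by case: k {IH E h1 h2} => [|k]; rewrite ?mul0r // !exprS /=; ring.
have -> : r * (k%:R ^+ 2 * r ^+ k * X) = k%:R ^+ 2 * r ^+ k.+1 * X by rewrite [r ^+ k.+1]exprS; ring.
rewrite -!mulrDl ler_wpM2r // ler_wpM2r ?exprn_ge0 ?ltW // -natr1.
have := ler0n R k; set n := k%:R => n0; nra.
Qed.

Lemma sq_pow_summable a r : abs_coef a -> 0 < r -> r < 1 ->
  cvgn (series (fun k => k%:R ^+ 2 * (modulus (a k) * r ^+ k))).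
Proof.
move=> aa r0 r1; pose h := (1 - r) / 4; pose q := (1 + h) ^+ 2 * r.
have h0 : 0 < h by rewrite /h; lra.
have q1 : q < 1.
  rewrite /q (_ : r = 1 - 4 * h); last by rewrite /h; field.
  have := mulr_gt0 h0 h0; have := mulr_gt0 (mulr_gt0 h0 h0) h0; nra.
have q0 : 0 <= q by rewrite mulr_ge0 ?exprn_ge0 ?ltW // addr_gt0.
apply: (@le_series_cvg _ (fun k => h ^- 2 * (modulus (a k) * q ^+ k))).
- by move=> n; rewrite !mulr_ge0 // ?exprn_ge0 // ltW.
- move=> k.
  have qE : q ^+ k = ((1 + h) ^+ k) ^+ 2 * r ^+ k by rewrite /q exprMn -!exprM mulnC.
  have b : k%:R * h <= (1 + h) ^+ k.
    elim: k {qE} => [|k IH]; first by rewrite mulr0n mul0r expr0.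
    rewrite exprS mulrDl mul1r -natr1 mulrDl mul1r; apply: lerD => //.
    rewrite -[leLHS]mulr1 ler_pM2l //; apply: exprn_ege1; lra.
  have b2 : k%:R ^+ 2 <= h ^- 2 * ((1 + h) ^+ k) ^+ 2.
    rewrite ler_pdivlMl ?exprn_gt0 // -exprMn [h * _]mulrC.
    by apply: le_pow => //; rewrite mulr_ge0 // ltW.
  have ar : 0 <= modulus (a k) * r ^+ k by rewrite mulr_ge0 ?exprn_ge0 // ltW.
  apply: le_trans (ler_wpM2r ar b2) _.
  by rewrite le_eqVlt; apply/orP; left; apply/eqP; rewrite qE; ring.
by apply: cvg_seriesZ; exact: aa.
Qed.

(** Summing the second order bounds for the monomials. *)
Lemma pser_hol F a : pser F a -> hol F.
Proof.
move=> Fa z z1; have aa := pser_abs Fa.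
pose r := (1 + modulus z) / 2.
have zr : modulus z < r by rewrite /r; lra.
have r1 : r < 1 by rewrite /r; lra.
have r0 : 0 < r by exact: le_lt_trans zr.
have sK := sq_pow_summable aa r0 r1.
set u := (fun k => k%:R ^+ 2 * (modulus (a k) * r ^+ k)) in sK.
have u0 k : 0 <= u k by rewrite !mulr_ge0 // exprn_ge0 // ltW.
pose K := limn (series u).
have K0 : 0 <= K by exact: nneg_series_lim_ge0.
pose D k : C := a k * (k%:R * z ^+ k.-1).
have [d hd] : exists d : C, series D @ \oo --> d.
  apply: (abs_cvgC (b := fun k => r^-1 * u k)); last exact: cvg_seriesZ.
  move=> k; rewrite /D /u !modulusM modulusX modulus_nat.
  case: k => [|k] /=; first by rewrite !mul0r mulr0 expr0n /= mul0r mulr0.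
  have zk : modulus z ^+ k <= r ^+ k by rewrite lerXn2r ?nnegrE // ltW.
  have -> : r^-1 * (k.+1%:R ^+ 2 * (modulus (a k.+1) * r ^+ k.+1)) =
     modulus (a k.+1) * (k.+1%:R ^+ 2 * r ^+ k) by rewrite [r ^+ k.+1]exprS; field; rewrite gt_eqF.
  apply: ler_wpM2l => //; apply: ler_pM => //; first exact: exprn_ge0.
  by rewrite expr2 ler_peMl // ler1n.
apply: (@expands_derivable _ _ _ d) => e e0.
pose K' := K / r ^+ 2.
have K'0 : 0 <= K' by rewrite divr_ge0 // exprn_ge0 // ltW.
exists (Num.min (r - modulus z) (e / (K' + 1))).
  by rewrite lt_min subr_gt0 zr divr_gt0 // ltr_wpDl.
move=> w; rewrite lt_min => /andP[w1 w2].
have wr : modulus w <= r.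
  have -> : w = (w - z) + z by rewrite subrK.
  by apply: le_trans (le_modulusD _ _) _; rewrite -lerBrDr ltW.
have w11 : modulus w < 1 by exact: le_lt_trans r1.
suff : modulus (F w - (F z + d * (w - z))) <= K' * modulus (w - z) ^+ 2.
  move/le_trans; apply; rewrite expr2 mulrA ler_wpM2r //.
  apply: (@le_trans _ _ ((K' + 1) * modulus (w - z))).
    by rewrite ler_wpM2r // lerDl.
  by rewrite mulrC -ler_pdivlMr ?ltr_wpDl // ltW.
have cw := Fa _ w11; have cz := Fa _ z1.
have cc : (fun _ : nat => w - z) @ \oo --> w - z by exact: cvg_cst.
have cl : (fun n => modulus (series (fun k => a k * w ^+ k) n -
      (series (fun k => a k * z ^+ k) n + series D n * (w - z)))) @ \oo -->
      modulus (F w - (F z + d * (w - z))).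
  apply: cvg_modulus; exact: (cvgB cw (cvgD cz (cvgM hd cc))).
apply: (cvgr_to_le cl); near=> n.
rewrite !seriesCE mulr_suml -big_split /= -sumrB.
apply: le_trans (le_modulus_sum _ _ _) _.
have r2 : 0 < r ^+ 2 by rewrite exprn_gt0.
apply: (@le_trans _ _ (\sum_(k < n) u k / r ^+ 2 * modulus (w - z) ^+ 2)).
  apply: ler_sum => k _.
  have -> : a k * w ^+ k - (a k * z ^+ k + D k * (w - z)) =
      a k * (w ^+ k - (z ^+ k + k%:R * z ^+ k.-1 * (w - z))) by rewrite /D; ring.
  rewrite modulusM /u.
  have := pow_expand k r0 (ltW zr) wr; rewrite -ler_pdivlMr // => h.
  apply: le_trans (ler_wpM2l (modulus_ge0 _) h) _.
  by rewrite le_eqVlt; apply/orP; left; apply/eqP; ring.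
rewrite -!mulr_suml ler_wpM2r ?exprn_ge0 // ler_pM2r ?invr_gt0 //.
exact: nneg_series_le_lim.
Unshelve. all: by end_near. Qed.

End PowerSeries.

(** * Square means on circles *)
Section Parseval.
Variable R : realType.
Local Notation C := (cplx R).
Implicit Types (F G : C -> C) (a b : nat -> C) (z w : C) (r t : R) (N : nat).

Lemma prim_root_ex N : exists w : C, (0 < N)%N -> N.-primitive_root w.
Proof.
case: N => [|n]; first by exists 0.
have [s ps] := closed_field_poly_normal ('X^(n.+1) - 1 : {poly C}).
rewrite (monicP _) ?monicXnsubC // scale1r in ps.
have s1 : all n.+1.-unity_root s by apply/allP => z; rewrite -root_prod_XsubC -ps.
have us : uniq s.
  by rewrite -separable_prod_XsubC -ps separable_Xn_sub_1 // pnatr_eq0.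
have ss : (n < size s)%N.
  by rewrite -ltnS -(size_prod_XsubC s id) -ps size_XnsubC.
have hp := has_prim_root (ltn0Sn n) s1 us ss.
by case/hasP: hp => w _ wp; exists w.
Qed.

Definition omega N : C := projT1 (cid (prim_root_ex N)).

Lemma omega_prim N : (0 < N)%N -> N.-primitive_root (omega N).
Proof. by rewrite /omega; case: cid. Qed.

Lemma omegaN N : (0 < N)%N -> omega N ^+ N = 1.
Proof. by move=> N0; apply: prim_expr_order; exact: omega_prim. Qed.

Lemma modulus_omega N : (0 < N)%N -> modulus (omega N) = 1.
Proof.
move=> N0; have := congr1 (@modulus R) (omegaN N0).
by rewrite modulusX modulus1 => /eqP; rewrite pexpr_eq1 // => /eqP.
Qed.

Lemma modulus_omegaX N j : (0 < N)%N -> modulus (omega N ^+ j) = 1.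
Proof. by move=> N0; rewrite modulusX modulus_omega // expr1n. Qed.

(** Averages over roots of unity replace integrals over circles: the characters
    of a finite cyclic group are orthogonal. *)
Lemma omega_orth N k l : (k < N)%N -> (l < N)%N ->
  \sum_(j < N) (omega N ^+ j) ^+ k * ((omega N ^+ j) ^+ l)^* =
  if k == l then N%:R else 0.
Proof.
move=> kN lN; have N0 : (0 < N)%N by exact: leq_ltn_trans kN.
have un j : (omega N ^+ j) * (omega N ^+ j)^* = 1.
  by rewrite mul_conj modulus_omegaX // expr1n rc1.
case: eqP => [->|/eqP kl].
  rewrite (eq_bigr (fun=> 1)); first by rewrite sumr_const card_ord.
  by move=> j _; rewrite mul_conj !modulusX modulus_omega // !expr1n rc1.
pose x := omega N ^+ k * (omega N ^+ l)^*.
rewrite (eq_bigr (fun j : 'I_N => x ^+ j)); last first.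
  move=> j _; rewrite /x exprMn -!exprM [(k * j)%N]mulnC; congr (_ * _).
  by rewrite -rmorphXn -exprM mulnC.
have xN : x ^+ N = 1.
  rewrite /x exprMn -rmorphXn -!exprM ![(_ * N)%N]mulnC !exprM omegaN // !expr1n.
  by rewrite rmorph1 mulr1.
have x1 : x - 1 != 0.
  rewrite subr_eq0; apply: contra kl => /eqP e.
  have : omega N ^+ k = omega N ^+ l.
    rewrite -[LHS]mulr1 -(un l) mulrCA mulrC; have := e; rewrite /x => ->.
    by rewrite mul1r.
  by move/eqP; rewrite (eq_prim_root_expr (omega_prim N0)) !modn_small.
by apply: (mulfI x1); rewrite -subrX1 xN subrr mulr0.
Qed.

Lemma dft_parseval N (b : nat -> C) :
  \sum_(j < N) modulus (\sum_(k < N) b k * (omega N ^+ j) ^+ k) ^+ 2 =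
  N%:R * \sum_(k < N) modulus (b k) ^+ 2.
Proof.
apply: (@rc_inj R); rewrite rcM rc_nat !rc_sum mulr_sumr.
transitivity (\sum_(j < N) \sum_(k < N) \sum_(l < N)
   b k * (b l)^* * ((omega N ^+ j) ^+ k * ((omega N ^+ j) ^+ l)^*)).
  apply: eq_bigr => j _; rewrite -mul_conj rmorph_sum mulr_suml; apply: eq_bigr => k _.
  rewrite mulr_sumr; apply: eq_bigr => l _; rewrite rmorphM /=.
  by rewrite mulrACA.
rewrite exchange_big /=; apply: eq_bigr => k _.
transitivity (\sum_(l < N) \sum_(j < N)
   b k * (b l)^* * ((omega N ^+ j) ^+ k * ((omega N ^+ j) ^+ l)^*)).
  by rewrite exchange_big.
transitivity (\sum_(l < N) b k * (b l)^* * (if k == l :> nat then N%:R else 0)).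
  by apply: eq_bigr => l _; rewrite -mulr_sumr omega_orth.
rewrite (bigD1 k) //= big1 ?addr0 => [|l lk].
  by rewrite eqxx mul_conj mulrC.
rewrite ifF ?mulr0 //; apply/negbTE; rewrite eq_sym; exact: lk.
Qed.

Definition avg F z N : R := N%:R^-1 * \sum_(j < N) modulus (F (z * omega N ^+ j)) ^+ 2.

(** Partial sums of the square mean over the circle |z|^2 = t, by coefficients. *)
Definition M2part a t N : R := \sum_(k < N) modulus (a k) ^+ 2 * t ^+ k.

Definition M2 a t : R := limn (series (fun k => modulus (a k) ^+ 2 * t ^+ k)).

Lemma avg_poly a z N : (0 < N)%N ->
  avg (fun w => \sum_(k < N) a k * w ^+ k) z N = M2part a (modulus z ^+ 2) N.
Proof.
move=> N0; rewrite /avg.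
have -> : \sum_(j < N) modulus (\sum_(k < N) a k * (z * omega N ^+ j) ^+ k) ^+ 2 =
   \sum_(j < N) modulus (\sum_(k < N) (a k * z ^+ k) * (omega N ^+ j) ^+ k) ^+ 2.
  apply: eq_bigr => j _; congr (modulus _ ^+ 2); apply: eq_bigr => k _.
  by rewrite exprMn mulrA.
rewrite (dft_parseval _ (fun k => a k * z ^+ k)) mulrA mulVf ?mul1r; last by rewrite pnatr_eq0 -lt0n.
by apply: eq_bigr => k _; rewrite modulusM modulusX exprMn -!exprM mulnC.
Qed.

Lemma M2_term_ge0 a t n : 0 <= t -> 0 <= modulus (a n) ^+ 2 * t ^+ n.
Proof. by move=> t0; rewrite mulr_ge0 // exprn_ge0. Qed.

Lemma M2_cvg a t : abs_coef a -> 0 <= t -> t < 1 ->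
  cvgn (series (fun k => modulus (a k) ^+ 2 * t ^+ k)).
Proof.
move=> aa t0 t1; pose r := Num.sqrt t.
have r0 : 0 <= r by rewrite sqrtr_ge0.
have tr : t = r ^+ 2 by rewrite sqr_sqrtr.
have r1 : r < 1 by rewrite -(@ltr_pXn2r _ 2) ?nnegrE // -tr expr1n.
apply: (@le_series_cvg _ _ (fun k => abs_sum a r * (modulus (a k) * r ^+ k))).
- by move=> n; exact: M2_term_ge0.
- move=> n; rewrite tr -exprM mulnC exprM -exprMn expr2.
  have an0 : 0 <= modulus (a n) * r ^+ n by rewrite mulr_ge0 // exprn_ge0.
  apply: ler_wpM2r => //.
  apply: le_trans (abs_sum_ge n.+1 aa r0 r1); rewrite big_ord_recr /= lerDr.
  by apply: sumr_ge0 => k _; rewrite mulr_ge0 // exprn_ge0.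
by apply: cvg_seriesZ; exact: aa.
Qed.

Lemma M2part_le a t N : abs_coef a -> 0 <= t -> t < 1 -> M2part a t N <= M2 a t.
Proof.
move=> aa t0 t1; apply: nneg_series_le_lim; last exact: M2_cvg.
by move=> n; exact: M2_term_ge0.
Qed.

Lemma M2part_cvg a t : abs_coef a -> 0 <= t -> t < 1 -> M2part a t @ \oo --> M2 a t.
Proof.
move=> aa t0 t1.
have E : M2part a t = series (fun k => modulus (a k) ^+ 2 * t ^+ k).
  by apply/funext => n; rewrite seriesE.
by rewrite E; exact: M2_cvg.
Qed.

Lemma sq_modulus_dist (x y : C) (e S : R) : modulus (x - y) <= e ->
  modulus x <= S -> modulus y <= S ->
  `|modulus x ^+ 2 - modulus y ^+ 2| <= e * (2 * S).
Proof.
move=> xy xS yS; rewrite subr_sqr normrM; apply: ler_pM => //.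
  rewrite ler_norml; apply/andP; split.
    by rewrite lerNl opprB; apply: le_trans xy; rewrite modulusB le_modulus_dist.
  by apply: le_trans xy; exact: le_modulus_dist.
by rewrite ger0_norm ?addr_ge0 // mulr_natl mulr2n lerD.
Qed.

(** The average over the N-th roots of unity is exact for the Taylor polynomial
    of degree below N; the error is controlled by the tail of the absolutely
    convergent series, uniformly on the disc of radius r. *)
Lemma parseval_dist F a z r N : pser F a -> modulus z <= r -> r < 1 -> (0 < N)%N ->
  `|avg F z N - M2part a (modulus z ^+ 2) N| <= abs_tail a r N * (2 * abs_sum a r).
Proof.
move=> Fa zr r1 N0; rewrite -avg_poly // /avg -mulrBr -sumrB normrM.
have Np : 0 < N%:R :> R by rewrite ltr0n.
rewrite ger0_norm ?invr_ge0 ?ler0n // ler_pdivrMl //.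
apply: le_trans (ler_norm_sum _ _ _) _.
set B := abs_tail _ _ _ * _.
apply: (@le_trans _ _ (\sum_(j < N) B)); last first.
  by rewrite sumr_const card_ord mulr_natl.
have aa := pser_abs Fa.
apply: ler_sum => j _; have zj : modulus (z * omega N ^+ j) <= r.
  by rewrite modulusM modulus_omegaX // mulr1.
apply: sq_modulus_dist.
- exact: pser_tail.
- exact: pser_le.
- exact: poly_le.
Qed.

Theorem parseval F a z : pser F a -> modulus z < 1 ->
  avg F z @ \oo --> M2 a (modulus z ^+ 2).
Proof.
move=> Fa z1; have aa := pser_abs Fa.
have t0 : 0 <= modulus z ^+ 2 by rewrite exprn_ge0.
have t1 : modulus z ^+ 2 < 1 by rewrite exprn_ilt1.
have c1 := M2part_cvg aa t0 t1.
have c2 : (fun N => abs_tail a (modulus z) N * (2 * abs_sum a (modulus z))) @ \oo --> (0 : R).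
  rewrite -[X in _ --> X](mul0r (2 * abs_sum a (modulus z))).
  have cc : (fun _ : nat => 2 * abs_sum a (modulus z)) @ \oo --> 2 * abs_sum a (modulus z) by exact: cvg_cst.
  exact: (cvgM (abs_tail_cvg aa (modulus_ge0 z) z1) cc).
have c3 : (fun N => avg F z N - M2part a (modulus z ^+ 2) N) @ \oo --> (0 : R).
  apply/cvgrPdist_le => e e0; move/cvgrPdist_le : c2 => /(_ _ e0) c2.
  near=> N; rewrite sub0r normrN.
  have N0 : (0 < N)%N by near: N; exact: nbhs_infty_gt.
  apply: le_trans (parseval_dist Fa (lexx _) z1 N0) _.
  apply: le_trans (ler_norm _) _; rewrite -normrN -sub0r.
  by near: N; exact: c2.
have c4 : (fun N => avg F z N - M2part a (modulus z ^+ 2) N + M2part a (modulus z ^+ 2) N)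
    @ \oo --> 0 + M2 a (modulus z ^+ 2) by exact: (cvgD c3 c1).
rewrite add0r in c4.
have E : avg F z = (fun N => avg F z N - M2part a (modulus z ^+ 2) N + M2part a (modulus z ^+ 2) N).
  by apply/funext => N; rewrite subrK.
by rewrite E.
Unshelve. all: by end_near. Qed.

Lemma rc_lt1 r : 0 <= r -> r < 1 -> modulus (rc r) < 1.
Proof. by move=> r0 r1; rewrite modulus_rc ger0_norm. Qed.

(** Pointwise domination on a circle dominates the square means. *)
Lemma circle_mono F G a b r (K : R) : pser F a -> pser G b -> 0 <= r -> r < 1 ->
  (forall z, modulus z = r -> modulus (F z) <= K * modulus (G z)) ->
  M2 a (r ^+ 2) <= K ^+ 2 * M2 b (r ^+ 2).
Proof.
move=> Fa Gb r0 r1 FG.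
have rr := rc_lt1 r0 r1.
have E : modulus (rc r) = r by rewrite modulus_rc ger0_norm.
have c1 := parseval Fa rr; have c2 := parseval Gb rr; rewrite E in c1 c2.
have cc : (fun _ : nat => K ^+ 2) @ \oo --> K ^+ 2 by exact: cvg_cst.
apply: (ler_cvg_to c1 (cvgM cc c2)); near=> N.
have N0 : (0 < N)%N by near: N; exact: nbhs_infty_gt.
rewrite /= /avg mulrCA ler_pM2l ?invr_gt0 ?ltr0n // mulr_sumr; apply: ler_sum => j _.
rewrite -exprMn; apply: le_pow => //; apply: FG.
by rewrite modulusM modulus_omegaX // mulr1.
Unshelve. all: by end_near. Qed.

Lemma circle_bound F a r (K : R) : pser F a -> 0 <= r -> r < 1 ->
  (forall z, modulus z = r -> modulus (F z) <= K) -> M2 a (r ^+ 2) <= K ^+ 2.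
Proof.
move=> Fa r0 r1 FK.
have rr := rc_lt1 r0 r1.
have E : modulus (rc r) = r by rewrite modulus_rc ger0_norm.
have c1 := parseval Fa rr; rewrite E in c1.
apply: (cvgr_to_le c1); near=> N.
have N0 : (0 < N)%N by near: N; exact: nbhs_infty_gt.
rewrite /= /avg ler_pdivrMl ?ltr0n //.
apply: (@le_trans _ _ (\sum_(j < N) K ^+ 2)); last by rewrite sumr_const card_ord mulr_natl.
apply: ler_sum => j _; apply: le_pow => //; apply: FK.
by rewrite modulusM modulus_omegaX // mulr1.
Unshelve. all: by end_near. Qed.

(** Cauchy's estimate, as one term of the square mean. *)
Lemma coef_le F a r (K : R) n : pser F a -> 0 <= r -> r < 1 -> 0 <= K ->
  (forall z, modulus z = r -> modulus (F z) <= K) -> modulus (a n) * r ^+ n <= K.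
Proof.
move=> Fa r0 r1 K0 FK.
have t1 : r ^+ 2 < 1 by rewrite exprn_ilt1.
have t0 : 0 <= r ^+ 2 by rewrite exprn_ge0.
rewrite -(@ler_pXn2r _ 2) ?nnegrE // ?mulr_ge0 ?exprn_ge0 //.
apply: le_trans (circle_bound Fa r0 r1 FK).
apply: le_trans (M2part_le n.+1 (pser_abs Fa) t0 t1).
rewrite /M2part big_ord_recr /= exprMn -!exprM mulnC lerDr.
by apply: sumr_ge0 => k _; exact: M2_term_ge0.
Qed.

Lemma pserB F G a b : pser F a -> pser G b ->
  pser (fun z => F z - G z) (fun n => a n - b n).
Proof.
move=> Fa Gb z z1.
have E : series (fun n => (a n - b n) * z ^+ n) =
    (fun n => series (fun n => a n * z ^+ n) n - series (fun n => b n * z ^+ n) n).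
  apply/funext => n; rewrite !seriesCE -sumrB.
  by apply: eq_bigr => k _; rewrite mulrBl.
rewrite E; exact: (cvgB (Fa z z1) (Gb z z1)).
Qed.

Lemma pserD F G a b : pser F a -> pser G b ->
  pser (fun z => F z + G z) (fun n => a n + b n).
Proof.
move=> Fa Gb z z1.
have E : series (fun n => (a n + b n) * z ^+ n) =
    (fun n => series (fun n => a n * z ^+ n) n + series (fun n => b n * z ^+ n) n).
  apply/funext => n; rewrite !seriesCE -big_split.
  by apply: eq_bigr => k _; rewrite mulrDl.
rewrite E; exact: (cvgD (Fa z z1) (Gb z z1)).
Qed.

Lemma pserZ F a (c : C) : pser F a -> pser (fun z => c * F z) (fun n => c * a n).
Proof.
move=> Fa z z1.
have cc : (fun _ : nat => c) @ \oo --> c by exact: cvg_cst.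
have E : series (fun n => (c * a n) * z ^+ n) =
    (fun n => c * series (fun n => a n * z ^+ n) n).
  apply/funext => n; rewrite !seriesCE mulr_sumr.
  by apply: eq_bigr => k _; rewrite mulrA.
rewrite E; exact: (cvgM cc (Fa z z1)).
Qed.

(** The coefficients of the difference satisfy Cauchy's estimate with bound 0. *)
Lemma pser_unique F a b : pser F a -> pser F b -> a = b.
Proof.
move=> Fa Fb; apply/funext => n; apply/eqP; rewrite -subr_eq0 -modulus_eq0.
have h := pserB Fa Fb.
have r0 : (0 : R) <= 1 / 2 by lra.
have r1 : (1 / 2 : R) < 1 by lra.
have := coef_le n h r0 r1 (lexx 0).
have z0 z : modulus z = 1 / 2 -> modulus (F z - F z) <= 0 by move=> _; rewrite subrr modulus0.
move=> /(_ z0) h1; have p : 0 < (1 / 2 : R) ^+ n by rewrite exprn_gt0.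
by apply/eqP; apply: le_anti; rewrite modulus_ge0 andbT -(ler_pM2r p) mul0r.
Qed.

Lemma pser_poly a m : (forall n, (m <= n)%N -> a n = 0) ->
  pser (fun z => \sum_(k < m) a k * z ^+ k) a.
Proof.
move=> a0 z _; apply/(cvgCP _) => e e0; near=> n.
have mn : (m <= n)%N by near: n; exact: nbhs_infty_ge.
have -> : series (fun n => a n * z ^+ n) n = \sum_(k < m) a k * z ^+ k.
  have tl : \sum_(m <= k < n) a k * z ^+ k = 0.
    by rewrite big_nat big1 // => k /andP[mk _]; rewrite a0 // mul0r.
  by rewrite /series /= (big_cat_nat _ mn) //= tl addr0 big_mkord.
by rewrite subrr modulus0.
Unshelve. all: by end_near. Qed.

Lemma eq_pser F G a : (forall z, modulus z < 1 -> F z = G z) -> pser F a -> pser G a.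
Proof. by move=> FG Fa z z1; rewrite -FG //; exact: Fa. Qed.

End Parseval.

(** * Plane Lebesgue measure and radial functions *)
Section Affine.
Variable R : realType.
Local Notation leb := (@lebesgue_measure R).
Local Open Scope ereal_scope.

Definition affine (s c : R) (x : measurableTypeR R) : measurableTypeR R := (s * x + c)%R.

Lemma measurable_affine (s c : R) : measurable_fun [set: measurableTypeR R] (affine s c).
Proof. by apply: measurable_funD => //; apply: measurable_funM. Qed.

Definition image_measure d1 d2 (T1 : measurableType d1) (T2 : measurableType d2)
    (m : {measure set T1 -> \bar R}) (f : T1 -> T2) (mf : measurable_fun [set: T1] f) :
    {measure set T2 -> \bar R} :=
  measure_function_pushforward__canonical__measure_function_Measure m mf.

(** Both measures agree on intervals. *)
Lemma lebesgue_measure_affine (s c : R) (s0 : (0 <= s)%R) (A : set (measurableTypeR R)) : (0 < s)%R -> measurable A ->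
  leb A = mscale (NngNum s0) (image_measure leb (measurable_affine s c)) A.
Proof.
move=> sp; apply: lebesgue_measure_unique => _ [[a b]] _ <-.
have pre : affine s c @^-1` `]a, b]%classic = `](a - c) / s, (b - c) / s]%classic%R.
  apply/seteqP; split=> x; rewrite /= !in_itv /= /affine ltr_pdivrMr // ler_pdivlMr //;
    by rewrite ltrBlDr lerBrDr mulrC.
rewrite -[RHS]/(s%:E * leb (affine s c @^-1` `]a, b]%classic)) pre.
rewrite !lebesgue_measure_itv /= !lte_fin ltr_pM2r ?invr_gt0 // ltrD2r.
case: ifP => _; last by rewrite mule0.
by rewrite -!EFinB -EFinM; congr EFin; field; rewrite gt_eqF.
Qed.

Lemma ge0_integral_affine (s c : R) (f : R -> \bar R) : (0 < s)%R ->
  measurable_fun [set: R] f -> (forall x, 0 <= f x) ->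
  \int[leb]_x f x = s%:E * \int[leb]_x f (s * x + c)%R.
Proof.
move=> s0 mf f0.
have sge := ltW s0.
have m0 := measurable_affine s c.
transitivity (\int[mscale (NngNum sge) (image_measure leb (measurable_affine s c))]_x f x).
  by apply: eq_measure_integral => //= A mA _; exact: lebesgue_measure_affine.
rewrite ge0_integral_mscale //; congr (_ * _).
by rewrite ge0_integral_pushforward //; exact: measurable_affine.
Qed.

Lemma ge0_integral_opp (f : R -> \bar R) :
  measurable_fun [set: R] f -> (forall x, 0 <= f x) ->
  \int[leb]_x f x = \int[leb]_x f (- x)%R.
Proof.
move=> mf f0.
transitivity (\int[pushforward leb (-%R : _ -> measurableTypeR R)]_x f x).
  by apply: eq_measure_integral => //= A mA _; rewrite lebesgue_measureN.
by rewrite ge0_integral_pushforward.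
Qed.

Lemma ge0_integral_affine_norm (s c : R) (f : R -> \bar R) : (s != 0)%R ->
  measurable_fun [set: R] f -> (forall x, 0 <= f x) ->
  \int[leb]_x f x = `|s|%:E * \int[leb]_x f (s * x + c)%R.
Proof.
move=> s0 mf f0; have [sp|] := ltrP 0 s.
  by rewrite gtr0_norm //; exact: ge0_integral_affine.
rewrite le_eqVlt (negbTE s0) /= => sn.
have ns : (0 < - s)%R by rewrite oppr_gt0.
rewrite ltr0_norm // (ge0_integral_affine c ns mf f0); congr (_ * _).
rewrite [RHS]ge0_integral_opp //.
  by apply: eq_integral => x _; rewrite mulrN mulNr.
by apply: (measurableT_comp mf); exact: measurable_affine.
Qed.

End Affine.

Section Plane.
Variable R : realType.
Local Notation leb := (@lebesgue_measure R).
Local Notation leb2 := (leb \x leb)%E.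
Local Notation RR := (measurableTypeR R).
Local Open Scope ereal_scope.

Lemma measurable_pairf (f g : RR * RR -> RR) :
  measurable_fun [set: RR * RR] f -> measurable_fun [set: RR * RR] g ->
  measurable_fun [set: RR * RR] (fun p => (f p, g p)).
Proof. by move=> mf mg; apply/measurable_fun_pairP. Qed.

Lemma measurable_lin (a b c : R) : measurable_fun [set: RR * RR] (fun p : RR * RR => a * p.1 + b * p.2 + c)%R.
Proof.
apply: measurable_funD => //; apply: measurable_funD; apply: measurable_funM => //.
Qed.

Lemma measurable_linmap (H : RR * RR -> \bar R) (a b c d : R) :
  measurable_fun [set: RR * RR] H ->
  measurable_fun [set: RR * RR] (fun p : RR * RR => H (a * p.1 + b * p.2, c * p.1 + d * p.2)%R).
Proof.
move=> mH; apply: (measurableT_comp mH); apply: measurable_pairf.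
  by have := measurable_lin a b 0; apply: eq_measurable_fun => p _; rewrite addr0.
by have := measurable_lin c d 0; apply: eq_measurable_fun => p _; rewrite addr0.
Qed.

Lemma measurable_section1 (H : RR * RR -> \bar R) (x : R) :
  measurable_fun [set: RR * RR] H -> measurable_fun [set: RR] (fun y => H (x, y)).
Proof. by move=> mH; apply: measurableT_comp mH _; exact: pair1_measurable. Qed.

Lemma measurable_section2 (H : RR * RR -> \bar R) (y : R) :
  measurable_fun [set: RR * RR] H -> measurable_fun [set: RR] (fun x => H (x, y)).
Proof. by move=> mH; apply: measurableT_comp mH _; exact: pair2_measurable. Qed.

(** Plane Lebesgue measure is invariant under rotations. Both substitutions
    are one-dimensional: first the abscissa, then the ordinate. *)
Lemma ge0_integral_rotation (a b : R) (H : RR * RR -> \bar R) : (a ^+ 2 + b ^+ 2 = 1)%R ->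
  measurable_fun [set: RR * RR] H -> (forall p, 0 <= H p) ->
  \int[leb2]_p H (a * p.1 - b * p.2, b * p.1 + a * p.2)%R = \int[leb2]_p H p.
Proof.
move=> ab mH H0.
pose H' (p : RR * RR) := H (a * p.1 - b * p.2, b * p.1 + a * p.2)%R.
have mH' : measurable_fun [set: RR * RR] H'.
  have := measurable_linmap a (- b) b a mH.
  by apply: eq_measurable_fun => p _; rewrite /H' mulNr.
have H'0 p : 0 <= H' p by exact: H0.
rewrite -[LHS]/(\int[leb2]_p H' p) (fubini_tonelli2 _ mH' H'0) (fubini_tonelli1 _ mH H0).
rewrite /fubini_G /fubini_F.
have [a0|a0] := eqVneq a 0%R.
  have b1 : (`|b| = 1)%R.
    by apply/eqP; rewrite -(@pexpr_eq1 _ _ 2) // real_normK ?num_real // -ab a0 expr0n /= add0r.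
  have b0 : (b != 0)%R by rewrite -normr_eq0 b1 oner_eq0.
  transitivity (\int[leb]_y \int[leb]_v H (- b * y, v)%R).
    apply: eq_integral => y _.
    rewrite (ge0_integral_affine_norm 0 b0 (measurable_section1 (- b * y)%R mH)) // b1 mul1e.
    by apply: eq_integral => x _; rewrite /H' a0 !mul0r add0r addr0 mulNr.
  have nb0 : (- b != 0)%R by rewrite oppr_eq0.
  have mG : measurable_fun [set: RR] (fun u => \int[leb]_v H (u, v)).
    exact: (@measurable_fun_fubini_tonelli_F _ _ _ _ _ leb _ mH H0).
  rewrite (ge0_integral_affine_norm 0 nb0 mG); last by move=> x; exact: integral_ge0.
  rewrite normrN b1 mul1e; apply: eq_integral => y _.
  by rewrite addr0.
have na : (0 < `|a|)%R by rewrite normr_gt0.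
pose K (p : RR * RR) := H (p.1, b / a * p.1 + a^-1 * p.2)%R.
have mK : measurable_fun [set: RR * RR] K.
  have := measurable_linmap 1 0 (b / a) a^-1 mH.
  by apply: eq_measurable_fun => p _; rewrite /K mul1r mul0r addr0.
have K0 p : 0 <= K p by exact: H0.
have inner y : `|a|%:E * \int[leb]_x H' (x, y) = \int[leb]_u K (u, y).
  rewrite (ge0_integral_affine_norm (- b * y)%R a0 (measurable_section2 y mK)) //.
  congr (_ * _); apply: eq_integral => x _; rewrite /H' /K /=.
  congr (H (_, _)); first by rewrite mulNr.
  have -> : (b * x + a * y = b * x + (1 - b ^+ 2) / a * y)%R.
    by rewrite -ab addrK expr2 mulfK.
  by field.
have outer u : \int[leb]_v H (u, v) = `|a|^-1%:E * \int[leb]_y K (u, y).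
  have a'0 : (a^-1 != 0)%R by rewrite invr_eq0.
  rewrite (ge0_integral_affine_norm (b / a * u)%R a'0 (measurable_section1 u mH)) // normfV.
  by congr (_ * _); apply: eq_integral => y _; rewrite /K /= addrC.
have mG : measurable_fun [set: RR] (fun u => \int[leb]_y K (u, y)).
  exact: (@measurable_fun_fubini_tonelli_F _ _ _ _ _ leb _ mK K0).
have mG' : measurable_fun [set: RR] (fun y => \int[leb]_u K (u, y)).
  exact: (@measurable_fun_fubini_tonelli_G _ _ _ _ _ leb _ mK K0).
transitivity (\int[leb]_y (`|a|^-1%:E * \int[leb]_u K (u, y))).
  apply: eq_integral => y _; rewrite -inner muleA -EFinM mulVf ?mul1e //.
  by rewrite gt_eqF.
rewrite ge0_integralZl //; last by move=> y _; exact: integral_ge0.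
rewrite -(fubini_tonelli _ mK K0).
rewrite -ge0_integralZl //; last by move=> y _; exact: integral_ge0.
by apply: eq_integral => u _; rewrite outer.
Qed.

Lemma ge0_integral_dilation (s : R) (H : RR * RR -> \bar R) : (0 < s)%R ->
  measurable_fun [set: RR * RR] H -> (forall p, 0 <= H p) ->
  \int[leb2]_p H p = (s ^+ 2)%:E * \int[leb2]_p H (s * p.1, s * p.2)%R.
Proof.
move=> s0 mH H0.
pose H' (p : RR * RR) := H (s * p.1, s * p.2)%R.
have mH' : measurable_fun [set: RR * RR] H'.
  have := measurable_linmap s 0 0 s mH.
  by apply: eq_measurable_fun => p _; rewrite /H' !mul0r addr0 add0r.
have H'0 p : 0 <= H' p by exact: H0.
rewrite -[X in _ * X]/(\int[leb2]_p H' p) (fubini_tonelli1 _ mH' H'0) (fubini_tonelli1 _ mH H0).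
rewrite /fubini_F.
have mG : measurable_fun [set: RR] (fun u => \int[leb]_v H (u, v)).
  exact: (@measurable_fun_fubini_tonelli_F _ _ _ _ _ leb _ mH H0).
have mG' : measurable_fun [set: RR] (fun u => \int[leb]_v H' (u, v)).
  exact: (@measurable_fun_fubini_tonelli_F _ _ _ _ _ leb _ mH' H'0).
rewrite (ge0_integral_affine 0 s0 mG); last by move=> x; exact: integral_ge0.
rewrite expr2 EFinM -muleA; congr (_ * _).
rewrite -ge0_integralZl //; [|by move=> y _; exact: integral_ge0|by rewrite lee_fin ltW].
apply: eq_integral => x _; rewrite addr0.
rewrite (ge0_integral_affine 0 s0 (measurable_section1 (s * x)%R mH)) //.
by congr (_ * _); apply: eq_integral => y _; rewrite addr0.
Qed.

End Plane.

Section Radial.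
Variable R : realType.
Local Notation leb := (@lebesgue_measure R).
Local Notation leb2 := (leb \x leb)%E.
Local Notation RR := (measurableTypeR R).
Local Open Scope ereal_scope.

Definition sqn (p : RR * RR) : RR := (p.1 ^+ 2 + p.2 ^+ 2)%R.

Lemma measurable_sqn : measurable_fun [set: RR * RR] sqn.
Proof.
apply: measurable_funD; apply: measurable_funX.
  exact: measurable_fst.
exact: measurable_snd.
Qed.

Lemma sqn_ge0 p : (0 <= sqn p)%R.
Proof. by rewrite addr_ge0 ?sqr_ge0. Qed.

Definition radial : {measure set RR -> \bar R} := image_measure leb2 measurable_sqn.

Lemma radialE (A : set RR) : radial A = leb2 (sqn @^-1` A).
Proof. by []. Qed.

Definition below (t : R) : \bar R := radial `]-oo, t]%classic.

Lemma measurable_below (t : R) : measurable (sqn @^-1` (`]-oo, t]%classic : set RR)).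
Proof. by rewrite -[X in measurable X]setTI; exact: measurable_sqn. Qed.

Lemma belowE t : below t = \int[leb2]_p (\1_(sqn @^-1` (`]-oo, t]%classic : set RR)) p)%:E.
Proof. by rewrite integral_indic ?setIT //; exact: measurable_below. Qed.

(** Dilations multiply areas by the square of their factor. Together with finiteness
    this determines the areas of all discs up to the constant disk_area. *)
Lemma below_scale (s : R) : (0 < s)%R -> below (s ^+ 2) = (s ^+ 2)%:E * below 1.
Proof.
move=> s0; rewrite !belowE.
have mI : measurable_fun [set: RR * RR] (fun p => (\1_(sqn @^-1` (`]-oo, (s ^+ 2)%R]%classic : set RR)) p)%:E : \bar R).
  by apply/measurable_EFinP; apply: measurable_indic; exact: measurable_below.
rewrite (ge0_integral_dilation s0 mI); last by move=> p; rewrite lee_fin.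
congr (_ * _); apply: eq_integral => p _; rewrite !indicE; congr (_%:R%:E).
congr nat_of_bool; apply/idP/idP; rewrite !inE /= !in_itv /= /sqn /= !exprMn -mulrDr;
  by rewrite -{2}[(s ^+ 2)%R]mulr1 ler_pM2l ?exprn_gt0.
Qed.

Lemma below1_lty : below 1 < +oo.
Proof.
apply: (@le_lt_trans _ _ (leb2 (`[-1, 1]%classic `*` `[-1, 1]%classic)%R)).
  rewrite /below radialE; apply: le_measure; rewrite ?inE.
  - exact: measurable_below.
  - exact: measurableX.
  move=> p; rewrite /= !in_itv /= /sqn => h.
  have h1 := sqr_ge0 p.1; have h2 := sqr_ge0 p.2.
  by split; rewrite -ler_norml -(@expr_le1 _ 2) // real_normK ?num_real //; lra.
rewrite product_measure1E //= !lebesgue_measure_itv /= !lte_fin.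
by rewrite ifT ?lte_mul_pinfty // -?EFinB ?ltry //; lra.
Qed.

Lemma below1_gt0 : 0 < below 1.
Proof.
apply: (@lt_le_trans _ _ (leb2 (`[0, 1/2]%classic `*` `[0, 1/2]%classic)%R)).
  rewrite product_measure1E //= !lebesgue_measure_itv /= !lte_fin ifT ?divr_gt0 //.
  by rewrite -EFinB -EFinM lte_fin subr0 mulr_gt0 ?divr_gt0.
rewrite /below radialE; apply: le_measure; rewrite ?inE.
- exact: measurableX.
- exact: measurable_below.
move=> p; rewrite /= !in_itv /= /sqn => -[/andP[a1 a2] /andP[b1 b2]]; nra.
Qed.

Definition disk_area : R := fine (below 1).

Lemma disk_areaE : below 1 = disk_area%:E.
Proof. by rewrite fineK // ge0_fin_numE ?below1_lty // ltW // below1_gt0. Qed.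

Lemma disk_area_gt0 : (0 < disk_area)%R.
Proof. by rewrite -lte_fin -disk_areaE below1_gt0. Qed.

Lemma below_pos (t : R) : (0 < t)%R -> below t = (t * disk_area)%:E.
Proof.
move=> t0; have s0 : (0 < Num.sqrt t)%R by rewrite sqrtr_gt0.
rewrite -{1}(sqr_sqrtr (ltW t0)) below_scale // sqr_sqrtr ?ltW //.
by rewrite disk_areaE EFinM.
Qed.

Lemma below_mono s t : (s <= t)%R -> below s <= below t.
Proof.
move=> st; apply: le_measure; rewrite ?inE //.
by move=> x /=; rewrite !in_itv /= => test_points; exact: le_trans st.
Qed.

Lemma below_neg (t : R) : (t <= 0)%R -> below t = 0.
Proof.
move=> t0; apply/eqP; rewrite eq_le; apply/andP; split; last exact: measure_ge0.
apply: le_trans (below_mono t0) _.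
apply/lee_addgt0Pr => e e0; rewrite add0e.
have K0 := disk_area_gt0.
apply: le_trans (below_mono (_ : 0 <= e / disk_area)%R) _.
  by rewrite divr_ge0 // ltW.
by rewrite below_pos ?divr_gt0 // divfK // gt_eqF.
Qed.

Lemma belowE_max (t : R) : below t = (Num.max t 0 * disk_area)%:E.
Proof.
have [t0|t0] := leP t 0%R; last by rewrite below_pos.
by rewrite mul0r below_neg.
Qed.

Lemma radial_itv (a b : R) : (a <= b)%R ->
  radial `]a, b]%classic = ((Num.max b 0 - Num.max a 0) * disk_area)%:E.
Proof.
move=> ab; have -> : `]a, b]%classic = `]-oo, b]%classic `\` `]-oo, a]%classic :> set RR.
  apply/seteqP; split=> x /=; rewrite !in_itv /=.
    by move=> /andP[ax ->]; split=> //; apply/negP; rewrite -ltNge.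
  by move=> [-> /negP]; rewrite -ltNge => ->.
rewrite measureD //; last by rewrite -[X in X < _]/(below b) belowE_max ltry.
have -> : `]-oo, b]%classic `&` `]-oo, a]%classic = `]-oo, a]%classic :> set RR.
  apply/seteqP; split=> x /=; rewrite !in_itv /=; first by case.
  by move=> xa; split=> //; exact: le_trans ab.
by rewrite -[LHS]/(below b - below a) !belowE_max -EFinB mulrBl.
Qed.

Lemma invarea_ge0 : (0 <= disk_area^-1)%R.
Proof. by rewrite invr_ge0 ltW // disk_area_gt0. Qed.

Let mneg : measurable (`]-oo, 0[%classic%R : set RR).
Proof. exact: measurable_itv. Qed.

(** In the variable t = |z|^2 area becomes length: both measures agree on
    half-open intervals by the scaling of areas. *)
Lemma radial_pos (A : set RR) : measurable A -> A `<=` `[0, +oo[%classic%R ->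
  leb A = mscale (NngNum invarea_ge0) radial A.
Proof.
move=> mA A0.
pose m : {measure set RR -> \bar R} :=
  measure_add (mscale (NngNum invarea_ge0) radial) (mrestr leb mneg).
have mE (X : set RR) : m X = (disk_area^-1)%:E * radial X + leb (X `&` `]-oo, 0[%classic%R).
  exact: measure_addE.
have K0 := disk_area_gt0.
have h : leb A = m A.
  apply: lebesgue_measure_unique => // _ [[a0 b0]] _ <- /=.
  move: (a0 : R) (b0 : R) => {a0 b0} a b.
  rewrite mE.
  have [ab|ba] := leP a b; last first.
    by rewrite set_itv_ge ?bnd_simp -?leNgt ?(ltW ba) // set0I !measure0 mule0 adde0.
  rewrite radial_itv // -EFinM mulrCA mulVf ?gt_eqF // mulr1.
  have leb_itv (u v : R) (bu bv : bool) : (u <= v)%R ->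
      leb [set` Interval (BSide bu u) (BSide bv v)] = (v - u)%:E.
    move=> uv; rewrite lebesgue_measure_itv /= lte_fin.
    by case: ltgtP uv => // -> _; rewrite subrr.
  rewrite leb_itv //.
  have [b0|b0] := ltP b 0%R.
    have -> : `]a, b]%classic `&` `]-oo, 0[%classic%R = `]a, b]%classic :> set RR.
      apply/seteqP; split=> x /=; rewrite !in_itv /=; first by case.
      by move=> /andP[ax xb]; rewrite ax xb; split=> //; exact: le_lt_trans b0.
    have a0 : (a < 0)%R by exact: le_lt_trans b0.
    by rewrite leb_itv // (max_r (ltW a0)) subrr add0e.
  have [a0|a0] := ltP a 0%R.
    have -> : `]a, b]%classic `&` `]-oo, 0[%classic%R = `]a, 0%R[%classic :> set RR.
      apply/seteqP; split=> x /=; rewrite !in_itv /=; first by case=> /andP[-> _] ->.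
      by move=> /andP[ax x0]; rewrite ax x0 (le_trans (ltW x0)).
    rewrite leb_itv ?ltW // -EFinD; congr EFin.
    by rewrite subr0 sub0r.
  have -> : `]a, b]%classic `&` `]-oo, 0[%classic%R = set0 :> set RR.
    apply/seteqP; split=> x //=; rewrite !in_itv /= => -[/andP[ax _] x0].
    by have := lt_trans ax x0; rewrite ltNge a0.
  by rewrite measure0 adde0.
rewrite h mE (_ : A `&` _ = set0) ?measure0 ?adde0 //.
apply/seteqP; split=> x //= [/A0 /=]; rewrite !in_itv /= andbT => x0.
by rewrite ltNge x0.
Qed.

Lemma ge0_integral_radial (g : RR -> \bar R) : measurable_fun [set: RR] g -> (forall x, 0 <= g x) ->
  \int[leb2]_p g (sqn p) = disk_area%:E * \int[leb]_(t in `[0%R, +oo[) g t.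
Proof.
move=> mg g0.
have E : \int[leb]_(t in `[0%R, +oo[) g t =
    \int[mscale (NngNum invarea_ge0) radial]_(t in `[0%R, +oo[) g t.
  by apply: eq_measure_integral => A mA A0; exact: radial_pos.
rewrite E ge0_integral_mscale //=; last exact: measurable_funS mg.
rewrite muleA -EFinM divff ?gt_eqF ?disk_area_gt0 // mul1e.
rewrite ge0_integral_pushforward //; last 2 first.
- exact: measurable_sqn.
- exact: measurable_funS mg.
rewrite (_ : sqn @^-1` _ = setT) //.
apply/seteqP; split=> p //= _; rewrite in_itv /= andbT; exact: sqn_ge0.
Qed.

End Radial.

(** * Integrals against a radial weight *)
Section Moments.
Variable R : realType.
Local Notation leb := (@lebesgue_measure R).
Local Notation RR := (measurableTypeR R).
Variable alpha : R.
Hypothesis alpha_gt : -1 < alpha.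

(** The Bergman weight in the variable t = |z|^2. *)
Definition vw (t : R) : R := (1 - t) `^ alpha.

Lemma vw_ge0 t : 0 <= vw t.
Proof. exact: powR_ge0. Qed.

Lemma measurable_vw : measurable_fun [set: RR] (vw : RR -> RR).
Proof.
rewrite (_ : vw = (fun x : R => x `^ alpha) \o (affine (-1) 1)); last first.
  by apply/funext => t; rewrite /vw /= /affine mulN1r addrC.
by apply: measurableT_comp; [exact: measurable_powR|exact: measurable_affine].
Qed.

Definition wint (D : set RR) (g : R -> R) : \bar R := (\int[leb]_(t in D) (g t * vw t)%:E)%E.

Lemma measurable_wfun (g : RR -> RR) : measurable_fun [set: RR] g ->
  measurable_fun [set: RR] (fun t => (g t * vw t)%:E).
Proof.
by move=> mg; apply/measurable_EFinP; apply: measurable_funM => //; exact: measurable_vw.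
Qed.

Let a1 : 0 < alpha + 1. Proof. by move: alpha_gt; clear; lra. Qed.

Lemma is_derive_vw (t : R) : t < 1 ->
  is_derive t (1 : R) (fun u : R => - (alpha + 1)^-1 * (1 - u) `^ (alpha + 1)) (vw t).
Proof.
move=> t1; have p : 0 < 1 - t by rewrite subr_gt0.
have h1 : is_derive t (1 : R) (fun u : R => 1 - u) (- 1).
  have -> : - 1 = 0 - 1 :> R by rewrite sub0r.
  exact: is_deriveB.
have h2 := is_derive1_powR (alpha + 1) p.
have h3 : is_derive t (1 : R) ((@powR R ^~ (alpha + 1)) \o (fun u : R => 1 - u))
   ((alpha + 1) * (1 - t) `^ (alpha + 1 - 1) * - 1).
  exact: (@is_derive1_comp R (@powR R ^~ (alpha + 1)) (fun u : R => 1 - u) t _ _ h2 h1).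
apply: is_derive_eq.
rewrite /vw /GRing.scale /= addrK; field; rewrite gt_eqF //.
Qed.

Lemma cvg_vw (t : R) : t < 1 -> vw u @[u --> t] --> vw t.
Proof.
move=> t1; have p : 0 < 1 - t by rewrite subr_gt0.
have h1 : is_derive t (1 : R) (fun u : R => 1 - u) (- 1).
  have -> : - 1 = 0 - 1 :> R by rewrite sub0r.
  exact: is_deriveB.
have h2 := is_derive1_powR alpha p.
have h3 : is_derive t (1 : R) ((@powR R ^~ alpha) \o (fun u : R => 1 - u))
   ((alpha * (1 - t) `^ (alpha - 1)) * - 1).
  exact: (@is_derive1_comp R (@powR R ^~ alpha) (fun u : R => 1 - u) t _ _ h2 h1).
by case: h3 => h3 _; apply: differentiable_continuous; exact/derivable1_diffP.
Qed.

(** Away from the endpoint 1 the weight has an elementary antiderivative; this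
    gives the finiteness of its integral when alpha < 0. *)
Lemma wint_FTC (s : R) : 0 < s -> s < 1 ->
  wint `[0, s]%classic (fun=> 1) = ((1 - (1 - s) `^ (alpha + 1)) / (alpha + 1))%:E.
Proof.
move=> s0 s1; pose G (u : R) := - (alpha + 1)^-1 * (1 - u) `^ (alpha + 1).
have dG u : u <= s -> is_derive u (1 : R) G (vw u).
  by move=> us; apply: is_derive_vw; exact: le_lt_trans s1.
have cG u : u <= s -> G @ u --> G u.
  by move=> /dG[h _]; apply: differentiable_continuous; exact/derivable1_diffP.
rewrite /wint (_ : (fun t => _) = EFin \o vw); last by apply/funext => t; rewrite mul1r.
rewrite (@continuous_FTC2 _ vw G 0 s s0).
- rewrite /G subr0 powR1 -EFinB; congr EFin; field; rewrite gt_eqF //.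
- apply: continuous_in_subspaceT => u; rewrite inE /= in_itv /= => /andP[_ us].
  by apply: cvg_vw; exact: le_lt_trans s1.
- split.
  + by move=> u; rewrite in_itv /= => /andP[_ us]; case: (dG u (ltW us)).
  + by apply: cvg_at_right_filter; apply: cG; exact: ltW.
  + by apply: cvg_at_left_filter; apply: cG.
- by move=> u; rewrite in_itv /= => /andP[_ us]; rewrite derive1E; case: (dG u (ltW us)) => _ ->.
Qed.

Definition ico (a b : R) : set RR := `[a, b[%classic.

Lemma measurable_ico a b : measurable (ico a b).
Proof. exact: measurable_itv. Qed.
Hint Resolve measurable_ico : core.

Lemma ico_exhaust (rho_ : nat -> R) : (forall n, rho_ n < 1) -> nondecreasing_seq rho_ ->
  rho_ @ \oo --> (1 : R) -> \bigcup_n ico 0 (rho_ n) = ico 0 1.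
Proof.
move=> r1 nd rl; apply/seteqP; split=> t /=.
  by move=> [n _]; rewrite /ico /= !in_itv /= => /andP[-> h]; exact: lt_trans (r1 n).
rewrite /ico /= in_itv /= => /andP[t0 t1].
have e0 : 0 < 1 - t by rewrite subr_gt0.
have /cvgrPdist_lt/(_ _ e0)[N _ hN] := rl.
exists N => //=; rewrite in_itv /= t0 /=.
have := hN N (leqnn N); rewrite ger0_norm ?subr_ge0 ?ltW //.
by rewrite ltrD2l ltrN2.
Qed.

Definition rho_ (n : nat) : R := 1 - n.+2%:R^-1.

Lemma rho_lt1 n : rho_ n < 1.
Proof. by rewrite ltrBlDr ltrDl invr_gt0. Qed.

Lemma rho_gt0 n : 0 < rho_ n.
Proof. by rewrite subr_gt0 invf_lt1 // ltr1n. Qed.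

Lemma rho_nd : nondecreasing_seq rho_.
Proof.
apply/nondecreasing_seqP => n; rewrite lerD2l lerN2 lef_pV2 ?posrE //.
by rewrite ler_nat.
Qed.

Lemma rho_cvg : rho_ @ \oo --> (1 : R).
Proof.
rewrite -[X in _ --> X]subr0.
have h : (fun n : nat => n.+2%:R^-1) @ \oo --> (0 : R).
  have := @cvg_harmonic R; rewrite -(cvg_shiftS) /harmonic; exact.
have c : (fun _ : nat => (1 : R)) @ \oo --> (1 : R) by exact: cvg_cst.
exact: (cvgB c h).
Qed.

Lemma wint_le (D : set RR) (g h : R -> R) : measurable D ->
  (forall t, D t -> 0 <= g t) -> (forall t, D t -> g t <= h t) ->
  measurable_fun [set: RR] (g : RR -> RR) -> measurable_fun [set: RR] (h : RR -> RR) ->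
  (wint D g <= wint D h)%E.
Proof.
move=> mD g0 gh mg mh; apply: ge0_le_integral => //.
- by move=> t Dt; rewrite lee_fin mulr_ge0 ?vw_ge0 // g0.
- by apply: measurable_funTS; exact: measurable_wfun.
- by apply: measurable_funTS; exact: measurable_wfun.
- by move=> t Dt; rewrite lee_fin ler_wpM2r ?vw_ge0 // gh.
Qed.

Lemma wint_subset (D E : set RR) (g : R -> R) : measurable D -> measurable E ->
  (forall t, E t -> 0 <= g t) -> measurable_fun [set: RR] (g : RR -> RR) ->
  D `<=` E -> (wint D g <= wint E g)%E.
Proof.
move=> mD mE g0 mg DE; apply: ge0_subset_integral => //.
  by apply: measurable_funTS; exact: measurable_wfun.
by move=> t Et; rewrite lee_fin mulr_ge0 ?vw_ge0 // g0.
Qed.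

Lemma wint_cst_lty : (wint (ico 0 1) (fun=> 1%R) <= (alpha + 1)^-1%:E)%E.
Proof.
rewrite -(ico_exhaust rho_lt1 rho_nd rho_cvg).
have h : ((wint (ico 0 (rho_ i)) (fun=> 1%R)) @[i --> \oo] --> wint (\bigcup_n ico 0 (rho_ n)) (fun=> 1%R))%E.
  apply: ge0_nondecreasing_set_cvg_integral => //.
  - move=> m n mn; rewrite subsetEset => t; rewrite /ico /= !in_itv /= => /andP[-> tm].
    by apply: lt_le_trans tm _; exact: rho_nd.
  - by move=> i; apply: measurable_funTS; apply: measurable_wfun.
  - by move=> i x _; rewrite lee_fin mulr_ge0 ?vw_ge0.
apply: (cvge_to_le h); near=> n.
apply: le_trans (_ : _ <= wint `[0%R, rho_ n]%classic (fun=> 1%R))%E _.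
  apply: wint_subset => //.
  by move=> t; rewrite /ico /= !in_itv /= => /andP[-> /ltW].
rewrite wint_FTC ?rho_lt1 ?rho_gt0 // lee_fin ler_pdivrMr // mulVf ?gt_eqF //.
by rewrite lerBlDr lerDl powR_ge0.
Unshelve. all: by end_near. Qed.

Lemma measurable_pow n : measurable_fun [set: RR] (fun t : RR => t ^+ n : RR).
Proof. by apply: measurable_funX. Qed.

Lemma wint_pow_lty n : (wint (ico 0 1) (fun t => (t ^+ n)%R) < +oo)%E.
Proof.
apply: le_lt_trans (_ : _ <= wint (ico 0 1) (fun=> 1%R))%E _; last first.
  by apply: le_lt_trans wint_cst_lty _; rewrite ltry.
apply: wint_le => //.
- by move=> t; rewrite /ico /= in_itv /= => /andP[t0 _]; rewrite exprn_ge0.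
- by move=> t; rewrite /ico /= in_itv /= => /andP[t0 /ltW t1]; rewrite exprn_ile1.
Qed.

(** The squared Bergman norms of the monomials are multiples of these moments. *)
Definition mom n : R := fine (wint (ico 0 1) (fun t => t ^+ n)).

Lemma wint_ge0 D g : (forall t, D t -> 0 <= g t) -> (0 <= wint D g)%E.
Proof. by move=> g0; apply: integral_ge0 => t Dt; rewrite lee_fin mulr_ge0 ?vw_ge0 // g0. Qed.

Lemma momE n : wint (ico 0 1) (fun t => t ^+ n) = (mom n)%:E.
Proof.
rewrite /mom fineK // ge0_fin_numE ?wint_pow_lty //; apply: wint_ge0 => t.
by rewrite /ico /= in_itv /= => /andP[t0 _]; rewrite exprn_ge0.
Qed.

(** Contracting towards the endpoint 1 multiplies the weighted integral by a
    fixed power of the contraction factor. *)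
Lemma wint_contract (L : R) (g : R -> R) : 1 <= L ->
  (forall t, 0 <= t -> t < 1 -> 0 <= g t) -> measurable_fun [set: RR] (g : RR -> RR) ->
  wint (ico (1 - L^-1) 1) (fun t => g (1 - L * (1 - t))) =
  ((L `^ (alpha + 1))^-1%:E * wint (ico 0 1) g)%E.
Proof.
move=> L1 g0 mg; have L0 : 0 < L by exact: lt_le_trans L1.
rewrite /wint [in RHS]integral_mkcond [in LHS]integral_mkcond.
set f := (X in (_ * integral _ _ X)%E).
have mf : measurable_fun [set: RR] f.
  apply/(measurable_restrictT _ _).1 => //.
  by apply: measurable_funTS; exact: measurable_wfun.
have f0 t : (0 <= f t)%E.
  rewrite /f patchE; case: ifPn => //; rewrite inE /ico /= in_itv /= => /andP[t0 t1].
  by rewrite lee_fin mulr_ge0 ?vw_ge0 // g0.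
rewrite (ge0_integral_affine (1 - L) L0 mf f0) muleA -EFinM.
have mf' : measurable_fun [set: RR] (fun x : RR => f (L * x + (1 - L))).
  by apply: (measurableT_comp mf); exact: measurable_affine.
rewrite -ge0_integralZl //; last by rewrite lee_fin mulr_ge0 ?invr_ge0 ?powR_ge0 // ltW.
apply: eq_integral => t _; rewrite /f !patchE.
have -> : L * t + (1 - L) = 1 - L * (1 - t) by ring.
have -> : (1 - L * (1 - t) \in ico 0 1) = (t \in ico (1 - L^-1) 1).
  apply/idP/idP; rewrite !inE /ico /= !in_itv /=.
    rewrite subr_ge0 ltrBlDr ltrDl pmulr_rgt0 // subr_gt0 => /andP[h ->]; rewrite andbT.
    by rewrite lerBlDr -lerBlDl -ler_pdivlMl ?mulr1 // in h *.
  rewrite subr_ge0 ltrBlDr ltrDl pmulr_rgt0 // subr_gt0 => /andP[h ->]; rewrite andbT.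
  by rewrite -ler_pdivlMl // mulr1 lerBlDl -lerBlDr.
case: ifPn => [|_]; last by rewrite mule0.
rewrite inE /ico /= in_itv /= => /andP[_ t1].
rewrite -EFinM; congr EFin; rewrite /vw.
have -> : 1 - (1 - L * (1 - t)) = L * (1 - t) by ring.
rewrite powRM ?subr_ge0 ?ltW // powRD; last by rewrite gt_eqF ?implybT.
rewrite powRr1 ?ltW //; field.
by rewrite !gt_eqF // powR_gt0.
Qed.

Lemma ge0_wint (g : RR -> RR) (D : set RR) : measurable D -> measurable_fun [set: RR] g ->
  measurable_fun D (fun t => (g t * vw t)%:E).
Proof. by move=> mD mg; apply: measurable_funTS; exact: measurable_wfun. Qed.

Lemma icoP (t : R) : ico 0 1 t -> 0 <= t /\ t < 1.
Proof. by rewrite /ico /= in_itv /= => /andP[]. Qed.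

Lemma ico_sub (a : R) : 0 <= a -> ico a 1 `<=` ico 0 1.
Proof. by move=> a0 t; rewrite /ico /= !in_itv /= => /andP[h ->]; rewrite (le_trans a0 h). Qed.

Lemma mom0_gt0 : 0 < mom 0.
Proof.
have h2 : (0 : R) < 2^-1 by rewrite invr_gt0.
have h3 : (2^-1 : R) < 1 by rewrite invf_lt1 // ltr1n.
have h : (wint `[0%R, (2^-1)%R]%classic (fun=> 1%R) <= wint (ico 0 1) (fun t => (t ^+ 0)%R))%E.
  apply: le_trans (_ : _ <= wint (ico 0 1) (fun=> 1%R))%E _.
    apply: wint_subset => //.
    by move=> t; rewrite /ico /= !in_itv /= => /andP[-> h]; exact: le_lt_trans h3.
  by apply: wint_le.
rewrite momE wint_FTC // lee_fin in h; apply: lt_le_trans h.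
have e1 : 1 `^ (alpha + 1) = 1 :> R by rewrite powR1.
rewrite divr_gt0 // subr_gt0 -[X in _ < X]e1.
apply: gt0_ltr_powR => //; rewrite ?nnegrE ?subr_ge0 ?ltW //.
Qed.

Lemma mom_noninc n : mom n.+1 <= mom n.
Proof.
rewrite -lee_fin -!momE; apply: wint_le => //; try exact: measurable_pow.
  by move=> t /icoP[t0 _]; rewrite exprn_ge0.
move=> t /icoP[t0 t1]; rewrite exprS -[leRHS]mul1r.
by rewrite ler_wpM2r ?exprn_ge0 // ltW.
Qed.

(** Restrict to [x, 1) and bound the monomial below by x^n there; contraction
    computes the total weight of this interval. *)
Lemma mom_lower (x : R) n : 0 <= x -> x < 1 ->
  x ^+ n * ((1 - x) `^ (alpha + 1) * mom 0) <= mom n.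
Proof.
move=> x0 x1; have p : 0 < 1 - x by rewrite subr_gt0.
have p0 := ltW p.
have L1 : 1 <= (1 - x)^-1 by rewrite invf_ge1 // lerBlDr lerDl.
have := @wint_contract (1 - x)^-1 (fun t => t ^+ 0) L1.
rewrite invrK momE subKr => /(_ _ (measurable_pow 0)) h.
rewrite -lee_fin -[leRHS]momE.
have e : ((1 - x)^-1 `^ (alpha + 1))^-1 = (1 - x) `^ (alpha + 1).
  have h' : (1 - x)^-1 `^ (alpha + 1) * (1 - x) `^ (alpha + 1) = 1.
    by rewrite -powRM ?invr_ge0 // mulVf ?gt_eqF // powR1.
  have hp : 0 < (1 - x)^-1 `^ (alpha + 1) by rewrite powR_gt0 // invr_gt0.
  by apply: (mulfI (lt0r_neq0 hp)); rewrite h' mulfV // gt_eqF.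
rewrite EFinM -[in leLHS]e [in leLHS](EFinM _ (mom 0)) -h; last first.
  by move=> *; rewrite expr0.
apply: le_trans (_ : _ <= wint (ico x 1) (fun t => (t ^+ n)%R))%E _; last first.
  apply: wint_subset => //; last exact: ico_sub.
  by move=> t /icoP[t0 _]; rewrite exprn_ge0.
rewrite /wint -ge0_integralZl //; last 3 first.
- by apply: ge0_wint => //; apply: measurable_funX; apply: measurable_cst.
- by move=> t _; rewrite lee_fin mulr_ge0 ?vw_ge0 // expr0.
- by rewrite lee_fin exprn_ge0.
apply: ge0_le_integral => //.
- by move=> t _; rewrite -EFinM lee_fin expr0 mul1r mulr_ge0 ?vw_ge0 ?exprn_ge0.
- apply: measurable_funeM; apply: (@ge0_wint (fun t => (1 - (1 - x)^-1 * (1 - t)) ^+ 0)) => //.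
- by apply: ge0_wint => //; exact: measurable_pow.
move=> t; rewrite /ico /= in_itv /= => /andP[xt _].
rewrite -EFinM lee_fin mul1r ler_wpM2r ?vw_ge0 //.
by rewrite lerXn2r ?nnegrE // (le_trans x0 xt).
Qed.

Lemma mom_gt0 n : 0 < mom n.
Proof.
have h2 : (0 : R) < 2^-1 by rewrite invr_gt0.
have h3 : (2^-1 : R) < 1 by rewrite invf_lt1 // ltr1n.
apply: lt_le_trans (mom_lower n (ltW h2) h3).
by rewrite !mulr_gt0 ?exprn_gt0 ?mom0_gt0 // powR_gt0 // subr_gt0.
Qed.

(** Contraction by the factor 2, since 1 - 2 (1 - t) <= t^2. *)
Lemma mom_doubling n : mom n <= 2 `^ (alpha + 1) * mom (2 * n).
Proof.
have m0 : (0 : R) < 2 `^ (alpha + 1) by rewrite powR_gt0.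
rewrite -ler_pdivrMl // -lee_fin EFinM -!momE -wint_contract //; last 2 first.
- by rewrite ler1n.
- by move=> t t0 _; rewrite exprn_ge0.
have h3 : (0 : R) <= 1 - 2^-1 by rewrite subr_ge0 invf_le1 // ler1n.
apply: le_trans (_ : _ <= wint (ico (1 - 2^-1) 1) (fun t => (t ^+ (2 * n))%R))%E _; last first.
  apply: wint_subset => //; last exact: ico_sub.
  by move=> t /icoP[t0 _]; rewrite exprn_ge0.
have e t : ico (1 - 2^-1) 1 t -> 0 <= 1 - 2 * (1 - t) :> R.
  by rewrite /ico /= in_itv /= => /andP[ht _]; move: ht; lra.
apply: wint_le => //.
- by move=> t /e h; rewrite exprn_ge0.
- move=> t /e h; rewrite exprM lerXn2r ?nnegrE ?sqr_ge0 //.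
  by have := sqr_ge0 (1 - t); rewrite !expr2; lra.
- apply: measurable_funX; apply: measurable_funB => //; apply: measurable_funM => //.
  by apply: measurable_funB.
Qed.

(** Domination of the square means on all circles becomes, by monotone
    convergence on both sides, domination of weighted sums of coefficients. *)
Lemma wint_majorize (p q : nat -> R) (B : R -> R) :
  (forall k, 0 <= p k) -> (forall k, 0 <= q k) ->
  (forall t, 0 <= t -> t < 1 -> 0 <= B t) -> measurable_fun [set: RR] (B : RR -> RR) ->
  (forall t N, 0 <= t -> t < 1 ->
    ((\sum_(k < N) p k * t ^+ k)%:E <= \sum_(0 <= k <oo) (q k * B t ^+ k)%:E)%E) ->
  (\sum_(0 <= k <oo) (p k * mom k)%:E <=
   \sum_(0 <= k <oo) ((q k)%:E * wint (ico 0 1) (fun t => (B t ^+ k)%R)))%E.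
Proof.
move=> p0 q0 B0 mB h.
have mBk k : measurable_fun [set: RR] (fun t : RR => (q k * B t ^+ k)%R : RR).
  by apply: measurable_funM => //; exact: measurable_funX.
have -> : (\sum_(0 <= k <oo) ((q k)%:E * wint (ico 0 1) (fun t => (B t ^+ k)%R)) =
  \int[leb]_(t in ico 0 1) (\sum_(0 <= k <oo) (q k * B t ^+ k * vw t)%:E))%E.
  rewrite integral_nneseries //.
  - apply: eq_eseriesr => k _; rewrite /wint -ge0_integralZl //.
    + by apply: eq_integral => t _; rewrite -EFinM mulrA.
    + by apply: ge0_wint => //; exact: measurable_funX.
    + by move=> t /icoP[t0 t1]; rewrite lee_fin mulr_ge0 ?vw_ge0 // exprn_ge0 // B0.
    + by rewrite lee_fin.
  - by move=> k; exact: ge0_wint.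
  - by move=> k t /icoP[t0 t1]; rewrite lee_fin !mulr_ge0 ?vw_ge0 // exprn_ge0 // B0.
apply: lime_le.
  by apply: is_cvg_ereal_nneg_natsum => k _; rewrite lee_fin mulr_ge0 // ltW ?mom_gt0.
near=> N.
have -> : (\sum_(0 <= k < N) (p k * mom k)%:E =
  \int[leb]_(t in ico 0 1) (\sum_(0 <= k < N) (p k * t ^+ k * vw t)%:E))%E.
  rewrite ge0_integral_sum //.
  - apply: eq_bigr => k _; rewrite EFinM -momE /wint -ge0_integralZl //.
    + by apply: eq_integral => t _; rewrite -EFinM mulrA.
    + by apply: ge0_wint => //; exact: measurable_pow.
    + by move=> t /icoP[t0 t1]; rewrite lee_fin mulr_ge0 ?vw_ge0 // exprn_ge0.
    + by rewrite lee_fin.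
  - by move=> k; apply: ge0_wint => //; apply: measurable_funM => //; exact: measurable_pow.
  - by move=> k t /icoP[t0 t1]; rewrite lee_fin !mulr_ge0 ?vw_ge0 // exprn_ge0.
apply: ge0_le_integral => //.
- by move=> t /icoP[t0 t1]; apply: sume_ge0 => k _; rewrite lee_fin !mulr_ge0 ?vw_ge0 // exprn_ge0.
- apply: emeasurable_sum => k; apply: ge0_wint => //; apply: measurable_funM => //; exact: measurable_pow.
- apply: ge0_emeasurable_sum => // [k t /icoP[t0 t1] _|k _].
    by rewrite lee_fin !mulr_ge0 ?vw_ge0 // exprn_ge0 // B0.
  exact: ge0_wint.
move=> t /icoP[t0 t1].
have -> : (\sum_(0 <= k < N) (p k * t ^+ k * vw t)%:E = (\sum_(k < N) p k * t ^+ k)%:E * (vw t)%:E)%E.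
  rewrite -EFinM mulr_suml -sumEFin big_mkord //.
have -> : (\sum_(0 <= k <oo) (q k * B t ^+ k * vw t)%:E =
   (\sum_(0 <= k <oo) (q k * B t ^+ k)%:E) * (vw t)%:E)%E.
  rewrite muleC -nneseriesZl //; last by move=> k _; rewrite lee_fin mulr_ge0 // exprn_ge0 // B0.
  by apply: eq_eseriesr => k _; rewrite -EFinM mulrC.
by apply: lee_wpmul2r; [rewrite lee_fin vw_ge0|exact: h].
Unshelve. all: by end_near. Qed.

(** Below T0 the integrand is constant, and above T0 it is a contraction of the
    monomial towards the endpoint 1. *)
Lemma wint_majorant (L T0 : R) (B : R -> R) n : 1 <= L -> 0 <= T0 -> T0 < 1 ->
  measurable_fun [set: RR] (B : RR -> RR) ->
  (forall t, t < T0 -> B t = T0) -> (forall t, T0 <= t -> B t = 1 - L * (1 - t)) ->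
  0 <= 1 - L * (1 - T0) ->
  (wint (ico 0 1) (fun t => (B t ^+ n)%R) <=
    (T0 ^+ n * mom 0 + (L `^ (alpha + 1))^-1 * mom n)%:E)%E.
Proof.
move=> L1 T00 T01 mB BT BL BT0; have L0 : 0 < L by exact: lt_le_trans L1.
have -> : ico 0 1 = ico 0 T0 `|` ico T0 1.
  apply/seteqP; split=> t; rewrite /ico /= !in_itv /=.
    by move=> /andP[-> ->]; rewrite andbT /=; case: (ltP t T0); [left|right].
  by case=> /andP[h1 h2]; rewrite ?h1 ?h2 ?andbT ?(lt_trans h2) ?(le_trans T00 h1).
have mBn : measurable_fun [set: RR] (fun t : RR => B t ^+ n : RR) by exact: measurable_funX.
have BB t : T0 <= t -> 0 <= B t.
  move=> h; rewrite BL //; apply: le_trans BT0 _.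
  by rewrite lerD2l lerN2 ler_pM2l // lerD2l lerN2.
have B0 t : 0 <= B t by case: (ltP t T0) => h; [rewrite BT|exact: BB].
rewrite /wint ge0_integral_setU //; last 3 first.
- by apply: ge0_wint => //; apply: measurableU.
- by move=> t _; rewrite lee_fin mulr_ge0 ?vw_ge0 ?exprn_ge0.
- rewrite /disj_set; apply/eqP/seteqP; split=> t //; rewrite /ico /= !in_itv /=.
  by move=> [/andP[_ h1] /andP[h2 _]]; rewrite ltNge h2 in h1.
rewrite EFinD; apply: leeD.
  apply: le_trans (_ : _ <= (T0 ^+ n)%:E * wint (ico 0 1) (fun t => (t ^+ 0)%R))%E _; last first.
    by rewrite momE EFinM.
  rewrite /wint -ge0_integralZl //; last 3 first.
  - by apply: ge0_wint => //; exact: measurable_pow.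
  - by move=> t _; rewrite lee_fin mulr_ge0 ?vw_ge0 // expr0.
  - by rewrite lee_fin exprn_ge0.
  apply: le_trans (_ : _ <= \int[leb]_(t in ico 0 T0) ((T0 ^+ n)%:E * (t ^+ 0 * vw t)%:E))%E _.
    rewrite le_eqVlt; apply/orP; left; apply/eqP; apply: eq_integral => t.
    by rewrite inE /ico /= in_itv /= => /andP[_ h]; rewrite BT // expr0 mul1r -EFinM.
  apply: ge0_subset_integral => //.
  - by apply: measurable_funeM; apply: ge0_wint => //; exact: measurable_pow.
  - by move=> t _; rewrite -EFinM lee_fin !mulr_ge0 ?vw_ge0 ?expr0 // exprn_ge0.
  - by move=> t; rewrite /ico /= !in_itv /= => /andP[-> h]; exact: lt_trans T01.
rewrite EFinM -momE -(@wint_contract L (fun t => t ^+ n)) //; last first.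
  by move=> t t0 _; rewrite exprn_ge0.
have TL : 1 - L^-1 <= T0.
  have : 0 <= L^-1 * (1 - L * (1 - T0)) by rewrite mulr_ge0 // invr_ge0 ltW.
  by rewrite mulrBr mulr1 mulrA mulVf ?gt_eqF // mul1r; move=> h; move: h; lra.
apply: le_trans (_ : _ <= wint (ico T0 1) (fun t => ((1 - L * (1 - t)) ^+ n)%R))%E _.
  rewrite le_eqVlt; apply/orP; left; apply/eqP; apply: eq_integral => t.
  by rewrite inE /ico /= in_itv /= => /andP[h _]; rewrite BL.
apply: wint_subset => //.
- move=> t; rewrite /ico /= in_itv /= => /andP[h _]; rewrite exprn_ge0 //.
  have : 0 <= L * (t - (1 - L^-1)) by rewrite mulr_ge0 ?subr_ge0 // ltW.
  by rewrite !mulrBr mulfV ?gt_eqF // mulr1; lra.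
- apply: measurable_funX; apply: measurable_funB => //; apply: measurable_funM => //.
  by apply: measurable_funB.
- by move=> t; rewrite /ico /= !in_itv /= => /andP[h ->]; rewrite (le_trans TL h).
Qed.

End Moments.

(** * The Bergman norm in terms of Taylor coefficients *)
Section BergmanNorm.
Variable R : realType.
Local Notation leb := (@lebesgue_measure R).
Local Notation leb2 := (leb \x leb)%E.
Local Notation RR := (measurableTypeR R).
Local Notation C := (cplx R).
Variable alpha : R.
Hypothesis alpha_gt : -1 < alpha.
Local Notation vw := (vw alpha).
Local Notation wint := (wint alpha).
Local Notation mom := (mom alpha).

Definition measC (h : RR * RR -> C) :=
  measurable_fun [set: RR * RR] (fun p => re (h p) : RR) /\
  measurable_fun [set: RR * RR] (fun p => im (h p) : RR).

Lemma measC_cst c : measC (fun=> c).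
Proof. by split; apply: measurable_cst. Qed.

Lemma measCD h k : measC h -> measC k -> measC (fun p => h p + k p).
Proof.
move=> [h1 h2] [k1 k2]; split.
  by under eq_fun do rewrite reD; apply: measurable_funD.
by under eq_fun do rewrite imD; apply: measurable_funD.
Qed.

Lemma measCM h k : measC h -> measC k -> measC (fun p => h p * k p).
Proof.
move=> [h1 h2] [k1 k2]; split.
  under eq_fun do rewrite reM; apply: measurable_funB; exact: measurable_funM.
under eq_fun do rewrite imM; apply: measurable_funD; exact: measurable_funM.
Qed.

Lemma measC_id : measC (fun p => mkC p.1 p.2).
Proof. by split; [exact: measurable_fst|exact: measurable_snd]. Qed.

Lemma measC_poly (a : nat -> C) N : measC (fun p => \sum_(k < N) a k * mkC p.1 p.2 ^+ k).
Proof.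
elim: N => [|N IH].
  by have := measC_cst 0; congr measC; apply/funext => p; rewrite big_ord0.
have hX k : measC (fun p => mkC p.1 p.2 ^+ k).
  elim: k => [|k IHk]; first exact: (measC_cst 1).
  by have := measCM measC_id IHk; congr measC; apply/funext => p; rewrite exprS.
have := measCD IH (measCM (measC_cst (a N)) (hX N)); congr measC.
by apply/funext => p; rewrite big_ord_recr.
Qed.

Lemma measurable_sqmod h : measC h ->
  measurable_fun [set: RR * RR] (fun p => modulus (h p) ^+ 2 : RR).
Proof.
move=> [h1 h2]; under eq_fun do rewrite sqr_modulus.
by apply: measurable_funD; exact: measurable_funX.
Qed.

Definition dsk (rho : R) : set (RR * RR) := [set p | sqn p < rho].

Lemma measurable_dsk rho : measurable (dsk rho).
Proof.
have := @measurable_sqn R measurableT _ (measurable_itv `]-oo, rho[).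
by rewrite setTI; congr measurable; apply/seteqP; split=> p; rewrite /dsk /= in_itv.
Qed.
Hint Resolve measurable_dsk : core.
Hint Resolve measurable_ico : core.

Lemma modulus_mkC (p : RR * RR) : modulus (mkC p.1 p.2) ^+ 2 = sqn p.
Proof. by rewrite sqr_modulus. Qed.

Lemma dsk_modulus p rho : dsk rho p -> rho <= 1 -> modulus (mkC p.1 p.2) < 1.
Proof.
rewrite /dsk /= -modulus_mkC => h r1.
by rewrite -(@expr_lt1 _ 2) //; exact: lt_le_trans r1.
Qed.

Lemma measurable_vsqn : measurable_fun [set: RR * RR] (fun p => vw (sqn p) : RR).
Proof. by apply: (measurableT_comp (measurable_vw alpha)); exact: measurable_sqn. Qed.

Variables (F : C -> C) (a : nat -> C).
Hypothesis Fa : pser F a.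

Definition dens (p : RR * RR) : R := modulus (F (mkC p.1 p.2)) ^+ 2 * vw (sqn p).

Lemma measurable_dens rho : rho <= 1 -> measurable_fun (dsk rho) (dens : RR * RR -> RR).
Proof.
move=> r1.
apply: (@measurable_fun_cvg _ _ _ _
  (fun N p => modulus (\sum_(k < N) a k * mkC p.1 p.2 ^+ k) ^+ 2 * vw (sqn p))).
  move=> N; apply: measurable_funTS; apply: measurable_funM; last exact: measurable_vsqn.
  by apply: measurable_sqmod; exact: measC_poly.
move=> p /dsk_modulus/(_ r1) p1.
have h : (fun N => modulus (series (fun n => a n * mkC p.1 p.2 ^+ n) N)) @ \oo --> modulus (F (mkC p.1 p.2)).
  by apply: cvg_modulus; exact: Fa.
have E N : modulus (\sum_(k < N) a k * mkC p.1 p.2 ^+ k) =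
    modulus (series (fun n => a n * mkC p.1 p.2 ^+ n) N) by rewrite seriesCE.
have c : (fun _ : nat => vw (sqn p)) @ \oo --> vw (sqn p) by exact: cvg_cst.
rewrite /dens; under eq_fun do rewrite E expr2.
rewrite expr2; exact: (cvgM (cvgM h h) c).
Qed.

Definition disk_int rho : \bar R := (\int[leb2]_(p in dsk rho) (dens p)%:E)%E.

Lemma dens_ge0 p : 0 <= dens p.
Proof. by rewrite mulr_ge0 ?sqr_ge0 ?vw_ge0. Qed.

Lemma radial_integral rho (g : R -> R) : (forall t, 0 <= t -> t < rho -> 0 <= g t) ->
  measurable_fun [set: RR] (g : RR -> RR) ->
  (\int[leb2]_(p in dsk rho) (g (sqn p) * vw (sqn p))%:E)%E =
  ((disk_area R)%:E * wint (ico 0 rho) g)%E.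
Proof.
move=> g0 mg; pose h := (fun t : RR => (g t * vw t)%:E) \_ (ico 0 rho).
have mh : measurable_fun [set: RR] h.
  apply/(measurable_restrictT _ _).1 => //.
  by apply: ge0_wint => //.
have h0 t : (0 <= h t)%E.
  rewrite /h patchE; case: ifPn => //; rewrite inE /ico /= in_itv /= => /andP[t0 t1].
  by rewrite lee_fin mulr_ge0 ?vw_ge0 // g0.
have := ge0_integral_radial mh h0.
have -> : (\int[leb2]_p h (sqn p) = \int[leb2]_(p in dsk rho) (g (sqn p) * vw (sqn p))%:E)%E.
  rewrite [RHS]integral_mkcond; apply: eq_integral => p _; rewrite /h !patchE.
  have -> // : (sqn p \in ico 0 rho) = (p \in dsk rho).
  by apply/idP/idP; rewrite !inE /ico /dsk /= in_itv /= sqn_ge0.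
move=> ->; congr (_ * _)%E; rewrite /wint integral_mkcond [RHS]integral_mkcond.
apply: eq_integral => t _; rewrite /h !patchE.
have [h2|h2] := boolP (t \in ico 0 rho); last by case: ifP.
have [//|h1] := boolP (t \in `[0%R, +oo[%classic).
by case/negP: h1; move: h2; rewrite !inE /ico /= !in_itv /= => /andP[->].
Qed.

Lemma rotate_mkC (w : C) (p : RR * RR) :
  mkC p.1 p.2 * w = mkC (re w * p.1 - im w * p.2) (im w * p.1 + re w * p.2).
Proof.
rewrite [LHS]mkCE reM imM (_ : re (mkC p.1 p.2) = p.1) // (_ : im (mkC p.1 p.2) = p.2) //.
by congr mkC; ring.
Qed.

(** Rotations preserve plane measure and the weight. *)
Lemma rotate_disk_int rho w : rho <= 1 -> modulus w = 1 ->
  (\int[leb2]_(p in dsk rho) (modulus (F (mkC p.1 p.2 * w)) ^+ 2 * vw (sqn p))%:E)%E = disk_int rho.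
Proof.
move=> r1 w1.
have ab : re w ^+ 2 + im w ^+ 2 = 1 by rewrite -sqr_modulus w1 expr1n.
pose H := (fun p => (dens p)%:E) \_ (dsk rho).
have mH : measurable_fun [set: RR * RR] H.
  apply/(measurable_restrictT _ _).1 => //.
  by apply/measurable_EFinP; exact: measurable_dens.
have H0 p : (0 <= H p)%E.
  by rewrite /H patchE; case: ifPn => // _; rewrite lee_fin dens_ge0.
have := ge0_integral_rotation ab mH H0.
rewrite /disk_int [in X in _ -> X]integral_mkcond [in X in _ -> _ = X]integral_mkcond => <-; apply: eq_integral => p _.
have sE : sqn (re w * p.1 - im w * p.2, im w * p.1 + re w * p.2) = sqn p.
  have -> : sqn p = (re w ^+ 2 + im w ^+ 2) * sqn p by rewrite ab mul1r.
  by rewrite /sqn /=; ring.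
rewrite /H !patchE /dens sE /= -rotate_mkC.
have -> // : ((re w * p.1 - im w * p.2, im w * p.1 + re w * p.2) \in dsk rho) = (p \in dsk rho).
by apply/idP/idP; rewrite !inE /dsk /= sE.
Qed.

Lemma measurable_rotate rho w : rho <= 1 -> modulus w = 1 ->
  measurable_fun (dsk rho) (fun p => (modulus (F (mkC p.1 p.2 * w)) ^+ 2 * vw (sqn p))%:E).
Proof.
move=> r1 w1; apply/measurable_EFinP.
apply: (@measurable_fun_cvg _ _ _ _
  (fun N p => modulus (\sum_(k < N) a k * w ^+ k * mkC p.1 p.2 ^+ k) ^+ 2 * vw (sqn p))).
  move=> N; apply: measurable_funTS; apply: measurable_funM; last exact: measurable_vsqn.
  by apply: measurable_sqmod; exact: (measC_poly (fun k => a k * w ^+ k)).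
move=> p /dsk_modulus/(_ r1) p1.
have pw : modulus (mkC p.1 p.2 * w) < 1 by rewrite modulusM w1 mulr1.
have h : (fun N => modulus (series (fun n => a n * (mkC p.1 p.2 * w) ^+ n) N)) @ \oo --> modulus (F (mkC p.1 p.2 * w)).
  by apply: cvg_modulus; exact: Fa.
have E N : modulus (\sum_(k < N) a k * w ^+ k * mkC p.1 p.2 ^+ k) =
    modulus (series (fun n => a n * (mkC p.1 p.2 * w) ^+ n) N).
  by rewrite seriesCE; congr modulus; apply: eq_bigr => k _; rewrite exprMn; ring.
have c : (fun _ : nat => vw (sqn p)) @ \oo --> vw (sqn p) by exact: cvg_cst.
under eq_fun do rewrite E expr2.
rewrite expr2; exact: (cvgM (cvgM h h) c).
Qed.

Lemma disk_int_ge0 rho : (0 <= disk_int rho)%E.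
Proof. by apply: integral_ge0 => p _; rewrite lee_fin dens_ge0. Qed.

Lemma sum_const_ereal (x : \bar R) N : (0 <= x)%E -> (\sum_(j < N) x = N%:R%:E * x)%E.
Proof.
move=> x0; elim: N => [|N IH]; first by rewrite big_ord0 mul0e.
by rewrite big_ord_recr IH /= -[X in (_ + X)%E]mul1e -ge0_muleDl // -EFinD natr1.
Qed.

(** By rotation invariance the square modulus may be replaced by its averages
    over roots of unity, which are close to radial functions. *)
Lemma avg_disk_int rho N : rho <= 1 -> (0 < N)%N ->
  (\int[leb2]_(p in dsk rho) (avg F (mkC p.1 p.2) N * vw (sqn p))%:E)%E = disk_int rho.
Proof.
move=> r1 N0; have Np : N%:R != 0 :> R by rewrite pnatr_eq0 -lt0n.
under eq_integral do rewrite /avg -mulrA mulr_suml EFinM -sumEFin.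
rewrite ge0_integralZl //.
- rewrite ge0_integral_sum //.
  + rewrite (eq_bigr (fun=> disk_int rho)) => [|j _]; last by rewrite rotate_disk_int // modulus_omegaX.
    by rewrite sum_const_ereal ?disk_int_ge0 // muleA -EFinM mulVf // mul1e.
  + by move=> j; apply: measurable_rotate => //; rewrite modulus_omegaX.
  + by move=> j p _; rewrite lee_fin mulr_ge0 ?sqr_ge0 ?vw_ge0.
- apply: emeasurable_sum => j; apply: measurable_rotate => //; rewrite modulus_omegaX //.
- by move=> p _; apply: sume_ge0 => j _; rewrite lee_fin mulr_ge0 ?sqr_ge0 ?vw_ge0.
Qed.

Lemma measurable_avg rho N : rho <= 1 -> (0 < N)%N ->
  measurable_fun (dsk rho) (fun p => (avg F (mkC p.1 p.2) N * vw (sqn p))%:E).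
Proof.
move=> r1 N0; under eq_fun do rewrite /avg -mulrA mulr_suml EFinM -sumEFin.
apply: measurable_funeM; apply: emeasurable_sum => j; apply: measurable_rotate => //.
by rewrite modulus_omegaX.
Qed.

Lemma avg_ge0 (z : C) N : 0 <= avg F z N.
Proof. by rewrite mulr_ge0 ?invr_ge0 // sumr_ge0 // => j _; rewrite sqr_ge0. Qed.

Lemma measurable_M2part N : measurable_fun [set: RR] (fun t : RR => M2part a t N : RR).
Proof.
apply: measurable_sum => k; apply: measurable_funM => //; exact: measurable_pow.
Qed.

Lemma M2part_ge0 t N : 0 <= t -> 0 <= M2part a t N.
Proof. by move=> t0; apply: sumr_ge0 => k _; exact: M2_term_ge0. Qed.

Lemma wint_M2part N (e : R) rho : 0 <= e -> rho <= 1 ->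
  (wint (ico 0 rho) (fun t => (M2part a t N + e)%R) <=
   \sum_(k < N) (modulus (a k) ^+ 2 * mom k)%:E + (e * mom 0)%:E)%E.
Proof.
move=> e0 r1; have -> : (\sum_(k < N) (modulus (a k) ^+ 2 * mom k)%:E + (e * mom 0)%:E =
    wint (ico 0 1) (fun t => (M2part a t N + e)%R))%E.
  rewrite /wint; under [in RHS]eq_integral do rewrite mulrDl EFinD.
  rewrite ge0_integralD //.
  - congr (_ + _)%E.
      rewrite /M2part; under [in RHS]eq_integral do rewrite mulr_suml -sumEFin.
      rewrite ge0_integral_sum //.
      + apply: eq_bigr => k _; rewrite EFinM -momE // /wint -ge0_integralZl //.
        * by apply: eq_integral => t _; rewrite -EFinM mulrA.
        * by apply: ge0_wint => //; exact: measurable_pow.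
        * by move=> t /icoP[t0 t1]; rewrite lee_fin mulr_ge0 ?vw_ge0 // exprn_ge0.
        * by rewrite lee_fin sqr_ge0.
      + move=> k; apply: ge0_wint => //.
        by apply: measurable_funM => //; exact: measurable_pow.
      + by move=> k t /icoP[t0 t1]; rewrite lee_fin mulr_ge0 ?vw_ge0 // M2_term_ge0.
    rewrite EFinM -momE // /wint -ge0_integralZl //.
    + by apply: eq_integral => t _; rewrite -EFinM expr0 mul1r.
    + by apply: ge0_wint => //; exact: measurable_pow.
    + by move=> t _; rewrite lee_fin mulr_ge0 ?vw_ge0 // expr0.
  - by move=> t /icoP[t0 _]; rewrite lee_fin mulr_ge0 ?vw_ge0 // M2part_ge0.
  - by apply: ge0_wint => //; exact: measurable_M2part.
  - by move=> t _; rewrite lee_fin mulr_ge0 ?vw_ge0.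
  - by apply: ge0_wint => //.
apply: wint_subset => //.
- by move=> t /icoP[t0 _]; rewrite addr_ge0 // M2part_ge0.
- by apply: measurable_funD => //; exact: measurable_M2part.
- by move=> t; rewrite /ico /= !in_itv /= => /andP[-> h]; exact: lt_le_trans r1.
Qed.

Lemma rho_sub rho rho' : rho <= rho' -> dsk rho `<=` dsk rho'.
Proof. by move=> h p; rewrite /dsk /= => /lt_le_trans; apply. Qed.

Lemma tail_dsk rho N p : 0 < rho -> rho < 1 -> (0 < N)%N -> dsk rho p ->
  `|avg F (mkC p.1 p.2) N - M2part a (sqn p) N| <=
  abs_tail a (Num.sqrt rho) N * (2 * abs_sum a (Num.sqrt rho)).
Proof.
move=> r0 r1 N0 h; rewrite -modulus_mkC; apply: parseval_dist => //.
  rewrite -(@ler_pXn2r _ 2) ?nnegrE ?sqrtr_ge0 ?modulus_ge0 // modulus_mkC sqr_sqrtr ?ltW //.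
by rewrite -[X in _ < X](@sqrtr1 R) ltr_sqrt.
Qed.

Definition err rho N := abs_tail a (Num.sqrt rho) N * (2 * abs_sum a (Num.sqrt rho)).

Lemma sqrt_lt1 (rho : R) : rho < 1 -> Num.sqrt rho < 1.
Proof. by move=> r1; rewrite -[X in _ < X](@sqrtr1 R) ltr_sqrt. Qed.

Lemma err_ge0 rho N : rho < 1 -> 0 <= err rho N.
Proof.
move=> r1; have aa := pser_abs Fa; have s1 := sqrt_lt1 r1.
rewrite mulr_ge0 ?mulr_ge0 ?abs_tail_ge0 ?sqrtr_ge0 //.
by have := abs_sum_ge 0 aa (sqrtr_ge0 _) s1; rewrite big_ord0.
Qed.

Lemma err_cvg rho : rho < 1 -> err rho @ \oo --> (0 : R).
Proof.
move=> r1; rewrite -[X in _ --> X](mul0r (2 * abs_sum a (Num.sqrt rho))).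
have h := abs_tail_cvg (pser_abs Fa) (sqrtr_ge0 rho) (sqrt_lt1 r1).
have c : (fun _ : nat => 2 * abs_sum a (Num.sqrt rho)) @ \oo --> 2 * abs_sum a (Num.sqrt rho).
  exact: cvg_cst.
exact: (cvgM h c).
Qed.

(** On a disc of radius below 1 the averages differ from the partial sums of the
    square mean by at most err, which tends to 0. *)
Lemma disk_int_upper rho N : 0 < rho -> rho < 1 -> (0 < N)%N ->
  (disk_int rho <= (disk_area R)%:E *
    (\sum_(k < N) (modulus (a k) ^+ 2 * mom k)%:E + (err rho N * mom 0)%:E))%E.
Proof.
move=> r0 r1 N0; have e0 := err_ge0 N r1.
have d0 : (0 <= (disk_area R)%:E)%E by rewrite lee_fin ltW // disk_area_gt0.
apply: le_trans (_ : _ <= (disk_area R)%:E * wint (ico 0 rho) (fun t => (M2part a t N + err rho N)%R))%E _; last first.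
  by apply: lee_wpmul2l => //; apply: wint_M2part => //; exact: ltW.
have mg : measurable_fun [set: RR] (fun t : RR => M2part a t N + err rho N : RR).
  by apply: measurable_funD => //; exact: measurable_M2part.
rewrite -radial_integral //; last by move=> t t0 _; rewrite addr_ge0 // M2part_ge0.
rewrite -(avg_disk_int (ltW r1) N0); apply: ge0_le_integral => //.
- by move=> p _; rewrite lee_fin mulr_ge0 ?vw_ge0 ?avg_ge0.
- by apply: measurable_avg => //; exact: ltW.
- apply/measurable_EFinP; apply: measurable_funTS; apply: measurable_funM; last exact: measurable_vsqn.
  by apply: (measurableT_comp mg); exact: measurable_sqn.
move=> p h; rewrite lee_fin ler_wpM2r ?vw_ge0 //.
by have /ler_normlW := tail_dsk r0 r1 N0 h; rewrite lerBlDl.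
Qed.

Lemma disk_int_le rho : rho <= 1 -> (disk_int rho <= disk_int 1)%E.
Proof.
move=> r1; apply: ge0_subset_integral => //.
- by apply/measurable_EFinP; exact: measurable_dens.
- by move=> p _; rewrite lee_fin dens_ge0.
- exact: rho_sub.
Qed.

Lemma M2part_mono t m N : 0 <= t -> (m <= N)%N -> M2part a t m <= M2part a t N.
Proof.
move=> t0 mN; rewrite /M2part -!(big_mkord xpredT (fun k => modulus (a k) ^+ 2 * t ^+ k)).
rewrite (big_cat_nat _ mN) //= lerDl; apply: sumr_ge0 => k _; exact: M2_term_ge0.
Qed.

Lemma disk_int_lower rho m N : 0 < rho -> rho < 1 -> (0 < N)%N -> (m <= N)%N ->
  ((disk_area R)%:E * wint (ico 0 rho) (fun t => M2part a t m) <=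
   disk_int rho + (disk_area R * (err rho N * mom 0))%:E)%E.
Proof.
move=> r0 r1 N0 mN; have e0 := err_ge0 N r1.
rewrite -radial_integral //; last 2 first.
- by move=> t t0 _; rewrite M2part_ge0.
- exact: measurable_M2part.
apply: le_trans (_ : _ <= \int[leb2]_(p in dsk rho)
   ((avg F (mkC p.1 p.2) N * vw (sqn p))%:E + (err rho N * vw (sqn p))%:E))%E _.
  have me : measurable_fun (dsk rho) (fun p => (err rho N * vw (sqn p))%:E).
    apply/measurable_EFinP; apply: measurable_funTS; apply: measurable_funM => //.
    exact: measurable_vsqn.
  apply: ge0_le_integral => //.
  - by move=> p _; rewrite lee_fin mulr_ge0 ?vw_ge0 ?M2part_ge0 ?sqn_ge0.
  - apply/measurable_EFinP; apply: measurable_funTS; apply: measurable_funM; last exact: measurable_vsqn.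
    by apply: (measurableT_comp (measurable_M2part m)); exact: measurable_sqn.
  - by apply: emeasurable_funD => //; apply: measurable_avg => //; exact: ltW.
  move=> p h; rewrite -EFinD lee_fin -mulrDl ler_wpM2r ?vw_ge0 //.
  apply: le_trans (M2part_mono (sqn_ge0 p) mN) _.
  have := tail_dsk r0 r1 N0 h; rewrite distrC => /ler_normlW.
  by rewrite lerBlDl.
rewrite ge0_integralD //.
- rewrite (avg_disk_int (ltW r1) N0); apply: leeD => //.
  rewrite (@radial_integral rho (fun=> err rho N)) // EFinM; apply: lee_wpmul2l.
    by rewrite lee_fin ltW // disk_area_gt0.
  have := @wint_M2part 0 (err rho N) rho e0 (ltW r1); rewrite big_ord0 add0e => h.
  apply: le_trans h; rewrite le_eqVlt; apply/orP; left; apply/eqP.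
  by congr wint; apply/funext => t; rewrite /M2part big_ord0 add0r.
- by move=> p _; rewrite lee_fin mulr_ge0 ?vw_ge0 ?avg_ge0.
- by apply: measurable_avg => //; exact: ltW.
- by move=> p _; rewrite lee_fin mulr_ge0 ?vw_ge0.
- apply/measurable_EFinP; apply: measurable_funTS; apply: measurable_funM => //.
  exact: measurable_vsqn.
Qed.

Lemma dsk_exhaust : \bigcup_n dsk (rho_ R n) = dsk 1.
Proof.
apply/seteqP; split=> p; first by move=> [n _]; apply: rho_sub; exact: ltW (rho_lt1 R n).
rewrite /dsk /= => p1; have : ico 0 1 (sqn p) by rewrite /ico /= in_itv /= sqn_ge0.
rewrite -(ico_exhaust (@rho_lt1 R) (@rho_nd R) (@rho_cvg R)) => -[n _].
by rewrite /ico /= in_itv /= => /andP[_ h]; exists n.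
Qed.

Lemma disk_int_cvg : (disk_int (rho_ R n) @[n --> \oo] --> disk_int 1)%E.
Proof.
rewrite /disk_int -dsk_exhaust; apply: ge0_nondecreasing_set_cvg_integral => //.
- by move=> m n mn; rewrite subsetEset; apply: rho_sub; exact: rho_nd.
- by move=> n; apply/measurable_EFinP; apply: measurable_dens; exact: ltW (rho_lt1 R n).
- by move=> n p _; rewrite lee_fin dens_ge0.
Qed.

Lemma disk_int1E : disk_int 1 = (\sum_(0 <= k <oo) (modulus (a k) ^+ 2 * (disk_area R * mom k))%:E)%E.
Proof.
have d0 := @disk_area_gt0 R.
have m0 k : 0 < mom k by exact: mom_gt0.
have S m : ((disk_area R)%:E * \sum_(k < m) (modulus (a k) ^+ 2 * mom k)%:E =
    \sum_(0 <= k < m) (modulus (a k) ^+ 2 * (disk_area R * mom k))%:E)%E.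
  rewrite sumEFin -EFinM mulr_sumr -sumEFin big_mkord.
  by apply: eq_bigr => k _; rewrite mulrCA.
have T0 k : (0 <= (modulus (a k) ^+ 2 * (disk_area R * mom k))%:E)%E.
  by rewrite lee_fin mulr_ge0 ?sqr_ge0 // mulr_ge0 // ltW.
apply/eqP; rewrite eq_le; apply/andP; split.
  apply: (cvge_to_le disk_int_cvg); near=> n.
  have [r0 r1] := (rho_gt0 R n, rho_lt1 R n).
  apply/lee_addgt0Pr => e e0.
  have [N [N0 hN]] : exists N, (0 < N)%N /\ disk_area R * (err (rho_ R n) N * mom 0) <= e.
    have q0 : 0 < e / (disk_area R * mom 0) by rewrite divr_gt0 // mulr_gt0.
    have /cvgrPdist_le/(_ _ q0)[N _ hN] := err_cvg r1.
    exists N.+1; split => //; have /= := hN N.+1 (leqnSn N).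
    rewrite sub0r normrN ger0_norm ?err_ge0 // ler_pdivlMr ?mulr_gt0 //.
    by rewrite mulrCA.
  apply: le_trans (disk_int_upper r0 r1 N0) _.
  rewrite ge0_muleDr; last 2 first.
  - by apply: sume_ge0 => k _; rewrite lee_fin mulr_ge0 ?sqr_ge0 // ltW.
  - by rewrite lee_fin mulr_ge0 ?err_ge0 // ltW.
  rewrite S -EFinM; apply: leeD; last by rewrite lee_fin.
  by apply: nneseries_lim_ge => k _ _.
apply: lime_le.
  by apply: is_cvg_ereal_nneg_natsum => k _.
near=> m; rewrite -S.
have step rho : 0 < rho -> rho < 1 ->
    ((disk_area R)%:E * wint (ico 0 rho) (fun t => M2part a t m) <= disk_int 1)%E.
  move=> r0 r1; apply/lee_addgt0Pr => e e0.
  have q0 : 0 < e / (disk_area R * mom 0) by rewrite divr_gt0 // mulr_gt0.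
  have /cvgrPdist_le/(_ _ q0)[N _ hN] := err_cvg r1.
  have /= := hN (maxn N m).+1 (leqW (leq_maxl _ _)).
  rewrite sub0r normrN ger0_norm ?err_ge0 // ler_pdivlMr ?mulr_gt0 // => h.
  apply: le_trans (@disk_int_lower rho m (maxn N m).+1 r0 r1 isT (leqW (leq_maxr _ _))) _.
  by apply: leeD; [apply: disk_int_le; exact: ltW|rewrite lee_fin mulrCA].
have -> : (\sum_(k < m) (modulus (a k) ^+ 2 * mom k)%:E = wint (ico 0 1) (fun t => M2part a t m))%E.
  rewrite /wint /M2part; under [in RHS]eq_integral do rewrite mulr_suml -sumEFin.
  rewrite ge0_integral_sum //.
  + apply: eq_bigr => k _; rewrite EFinM -momE // /wint -ge0_integralZl //.
    * by apply: eq_integral => t _; rewrite -EFinM mulrA.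
    * by apply: ge0_wint => //; exact: measurable_pow.
    * by move=> t /icoP[t0 t1]; rewrite lee_fin mulr_ge0 ?vw_ge0 // exprn_ge0.
    * by rewrite lee_fin sqr_ge0.
  + move=> k; apply: ge0_wint => //.
    by apply: measurable_funM => //; exact: measurable_pow.
  + by move=> k t /icoP[t0 t1]; rewrite lee_fin mulr_ge0 ?vw_ge0 // M2_term_ge0.
have h : (wint (ico 0 (rho_ R i)) (fun t => M2part a t m) @[i --> \oo] -->
     wint (ico 0 1) (fun t => M2part a t m))%E.
  rewrite -[in X in _ --> X](ico_exhaust (@rho_lt1 R) (@rho_nd R) (@rho_cvg R)).
  apply: ge0_nondecreasing_set_cvg_integral => //.
  - move=> i j ij; rewrite subsetEset => t; rewrite /ico /= !in_itv /= => /andP[-> tm].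
    by apply: lt_le_trans tm _; exact: rho_nd.
  - by move=> i; apply: ge0_wint => //; exact: measurable_M2part.
  - move=> i t; rewrite /ico /= in_itv /= => /andP[t0 _].
    by rewrite lee_fin mulr_ge0 ?vw_ge0 ?M2part_ge0.
have d1 : (disk_area R)%:E \is a fin_num by [].
have h' := cvgeZl d1 h.
apply: (cvge_to_le h'); near=> i; apply: step; [exact: rho_gt0|exact: rho_lt1].
Unshelve. all: by end_near. Qed.

End BergmanNorm.

(** Monomials are orthogonal on discs centred at the origin, so the area integral
    is a weighted sum of squared coefficients. *)
Theorem bergman_norm2E (R : realType) (alpha : R) (f : disk R -> cplx R) a :
  -1 < alpha -> pser (ext f) a ->
  bergman_norm2 alpha f = (\sum_(0 <= n <oo)
    (modulus (a n) ^+ 2 * ((alpha + 1) * (pi^-1 * (disk_area R * mom alpha n))))%:E)%E.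
Proof.
move=> al fa; have d0 := @disk_area_gt0 R.
have a1 : 0 <= alpha + 1 by lra.
have p1 : 0 <= (pi : R)^-1 by rewrite invr_ge0 ltW // pi_gt0.
rewrite /bergman_norm2.
have T0 k : (0 <= (modulus (a k) ^+ 2 * (disk_area R * mom alpha k))%:E)%E.
  by rewrite lee_fin mulr_ge0 ?sqr_ge0 // mulr_ge0 // ltW // mom_gt0.
have := disk_int1E al fa; rewrite /disk_int /dens /dsk /vw /sqn => ->.
rewrite muleA -EFinM -nneseriesZl //.
  by apply: eq_eseriesr => k _; rewrite -EFinM; congr EFin; ring.
Qed.

(** * Littlewood's subordination principle *)
Section Littlewood.
Variable R : realType.
Local Notation C := (cplx R).
Implicit Types (F G phi : C -> C) (a b : nat -> C) (z w : C) (r t : R).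

Definition selfmap phi := hol phi /\ forall z, modulus z < 1 -> modulus (phi z) < 1.

Lemma holM F G : hol F -> hol G -> hol (fun z => F z * G z).
Proof. by move=> hF hG z z1; apply: derivableM; [exact: hF|exact: hG]. Qed.

Lemma holD F G : hol F -> hol G -> hol (fun z => F z + G z).
Proof. by move=> hF hG z z1; apply: derivableD; [exact: hF|exact: hG]. Qed.

Lemma hol_cst (c : C) : hol (fun=> c).
Proof. by move=> z _; exact: derivable_cst. Qed.

Lemma hol_comp F phi : hol F -> selfmap phi -> hol (fun z => F (phi z)).
Proof.
move=> hF [hp p1] z z1.
have h1 : differentiable phi z by apply/derivable1_diffP; exact: hp.
have h2 : differentiable F (phi z) by apply/derivable1_diffP; apply: hF; exact: p1.
by apply/derivable1_diffP; exact: (differentiable_comp h1 h2).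
Qed.

Lemma hol_pow F n : hol F -> hol (fun z => F z ^+ n).
Proof.
move=> hF; elim: n => [|n IH]; first exact: hol_cst.
have -> : (fun z => F z ^+ n.+1) = (fun z => F z * F z ^+ n) by apply/funext => z; rewrite exprS.
exact: holM.
Qed.

Lemma hol_sum (F : nat -> C -> C) n : (forall k, hol (F k)) -> hol (fun z => \sum_(k < n) F k z).
Proof.
move=> hF; elim: n => [|n IH].
  have -> : (fun z => \sum_(k < 0) F k z) = (fun=> 0) by apply/funext => z; rewrite big_ord0.
  exact: hol_cst.
have -> : (fun z => \sum_(k < n.+1) F k z) = (fun z => \sum_(k < n) F k z + F n z).
  by apply/funext => z; rewrite big_ord_recr.
exact: (@holD (fun z => \sum_(k < n) F k z) (F n) IH (hF n)).
Qed.

Lemma hol_poly a n phi : hol phi -> hol (fun z => \sum_(k < n) a k * phi z ^+ k).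
Proof.
move=> hp; apply: (@hol_sum (fun k z => a k * phi z ^+ k)) => k.
exact: (@holM (fun=> a k) (fun z => phi z ^+ k) (@hol_cst _) (@hol_pow _ _ hp)).
Qed.

Lemma hol_pser F : hol F -> exists a, pser F a.
Proof. exact: taylor_exists. Qed.

Lemma pser0 F a : pser F a -> F 0 = a 0.
Proof.
move=> Fa; have m0 : modulus (0 : C) < 1 by rewrite modulus0.
have h := Fa 0 m0; apply: (@cvgC_unique R nat _ _ _ _ _ h).
have c : (fun _ : nat => a 0) @ \oo --> a 0 by exact: cvg_cst.
apply: cvg_trans c; apply: near_eq_cvg; near=> n.
have n0 : (0 < n)%N by near: n; exact: nbhs_infty_ge.
rewrite -(prednK n0) seriesCE big_ord_recl expr0 mulr1 big1 ?addr0 // => i _.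
by rewrite exprS mul0r mulr0.
Unshelve. all: by end_near. Qed.

Lemma M2_shift a b (c : C) t : abs_coef a -> abs_coef b -> 0 <= t -> t < 1 ->
  a 0 = c -> b 0 = 0 -> (forall k, a k.+1 = b k.+1) -> M2 a t = modulus c ^+ 2 + M2 b t.
Proof.
move=> aa ab t0 t1 ac b0 E.
have h n : M2part a t n.+1 = modulus c ^+ 2 + M2part b t n.+1.
  rewrite /M2part !big_ord_recl ac b0 modulus0 expr0n /= mul0r add0r expr0 mulr1.
  by congr (_ + _); apply: eq_bigr => i _; rewrite /= E.
have h1 := M2part_cvg aa t0 t1; have h2 := M2part_cvg ab t0 t1.
have c1 : (fun _ : nat => modulus c ^+ 2) @ \oo --> modulus c ^+ 2 by exact: cvg_cst.
have h3 : (fun n => modulus c ^+ 2 + M2part b t n) @ \oo --> modulus c ^+ 2 + M2 b t by exact: (cvgD c1 h2).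
have h1' : (fun n => M2part a t n.+1) @ \oo --> M2 a t by rewrite (cvg_shiftS (M2part a t)).
have h3' : (fun n => modulus c ^+ 2 + M2part b t n.+1) @ \oo --> modulus c ^+ 2 + M2 b t.
  by rewrite (cvg_shiftS (fun n => modulus c ^+ 2 + M2part b t n)).
have E2 : (fun n => M2part a t n.+1) = (fun n => modulus c ^+ 2 + M2part b t n.+1).
  by apply/funext => n; rewrite h.
by rewrite E2 in h1'; exact: (cvg_unique _ h1' h3').
Qed.

(** Induction on the degree. Since phi 0 = 0, the constant term is orthogonal to
    the rest, which is phi times the composition of a polynomial of lower degree;
    on the circle the factor phi costs at most rr. *)
Lemma littlewood_poly n a b phi r rr : selfmap phi -> phi 0 = 0 -> 0 <= r -> r < 1 ->
  (forall z, modulus z = r -> modulus (phi z) <= rr) ->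
  pser (fun z => \sum_(k < n) a k * phi z ^+ k) b -> M2 b (r ^+ 2) <= M2part a (rr ^+ 2) n.
Proof.
move=> [hp p1] p0 r0 r1 pr; have t0 : 0 <= r ^+ 2 by rewrite exprn_ge0.
have t1 : r ^+ 2 < 1 by rewrite exprn_ilt1.
have rr0 : 0 <= rr.
  by apply: le_trans (pr (rc r) _); rewrite ?modulus_ge0 // modulus_rc ger0_norm.
elim: n a b => [|n IH] a b h.
  have := @circle_bound R _ b r 0 h r0 r1; rewrite /M2part big_ord0 expr0n /=; apply => z _.
  by rewrite big_ord0 modulus0.
have [b' h'] := hol_pser (@hol_poly (fun k : nat => a k.+1) n phi hp).
have [d hd] := hol_pser (holM hp (@hol_poly (fun k : nat => a k.+1) n phi hp)).
have d0 : d 0 = 0 by rewrite -(pser0 hd) p0 mul0r.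
pose e k : C := if k == 0%N then a 0 else 0.
have he : pser (fun z => \sum_(k < 1) e k * z ^+ k) e by apply: pser_poly => -[].
have hs := pserD he hd.
have Eb : b = (fun k => e k + d k).
  apply: (@pser_unique R _ _ _ h); apply: eq_pser hs => z z1.
  rewrite big_ord_recl big_ord0 addr0 expr0 mulr1 /e /= [RHS]big_ord_recl expr0 mulr1.
  by congr (_ + _); rewrite mulr_sumr; apply: eq_bigr => i _ /=; rewrite exprS mulrCA.
rewrite (M2_shift (pser_abs h) (pser_abs hd) t0 t1 (c := a 0)) //; last 2 first.
- by rewrite Eb d0 addr0.
- by move=> k; rewrite Eb /e /= add0r.
rewrite /M2part big_ord_recl expr0 mulr1 lerD2l.
apply: le_trans (circle_mono (K := rr) hd h' r0 r1 _) _.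
  by move=> z zr; rewrite modulusM ler_wpM2r ?modulus_ge0 // pr.
have := IH (fun k => a k.+1) b' h'; rewrite /M2part => h2.
apply: le_trans (ler_wpM2l (exprn_ge0 2 rr0) h2) _.
by rewrite mulr_sumr; apply: ler_sum => i _; rewrite lift0 [rr ^+ 2 ^+ i.+1]exprS mulrCA.
Qed.

Lemma cvg_rsum (u : nat -> nat -> R) (l : nat -> R) m : (forall k, u ^~ k @ \oo --> l k) ->
  (fun N => \sum_(k < m) u N k) @ \oo --> \sum_(k < m) l k.
Proof.
move=> h; elim: m => [|m IH].
  by under eq_fun do rewrite big_ord0; rewrite big_ord0; exact: cvg_cst.
by under eq_fun do rewrite big_ord_recr; rewrite big_ord_recr; exact: (cvgD IH (h m)).
Qed.

(** The coefficients of the compositions with Taylor polynomials converge, by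
    Cauchy's estimate for the tails. *)
Theorem littlewood F a b phi r rr m : selfmap phi -> phi 0 = 0 -> 0 <= r -> r < 1 ->
  (forall z, modulus z = r -> modulus (phi z) <= rr) -> rr < 1 ->
  pser F a -> pser (fun z => F (phi z)) b -> M2part b (r ^+ 2) m <= M2 a (rr ^+ 2).
Proof.
move=> sp p0 r0 r1 pr rr1 Fa Gb; have [hp p1] := sp.
have rr0 : 0 <= rr.
  by apply: le_trans (pr (rc r) _); rewrite ?modulus_ge0 // modulus_rc ger0_norm.
have t0 : 0 <= r ^+ 2 by rewrite exprn_ge0.
have t1 : r ^+ 2 < 1 by rewrite exprn_ilt1.
have s0 : 0 <= rr ^+ 2 by rewrite exprn_ge0.
have s1 : rr ^+ 2 < 1 by rewrite exprn_ilt1.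
have aa := pser_abs Fa.
have /choice[bN hbN] : forall N, exists b', pser (fun z => \sum_(k < N) a k * phi z ^+ k) b'.
  by move=> N; apply: hol_pser; exact: hol_poly.
have close N k : modulus (b k - bN N k) * r ^+ k <= abs_tail a rr N.
  have t00 := abs_tail_ge0 N aa rr0 rr1.
  apply: (@coef_le R _ _ r _ k (pserB Gb (hbN N)) r0 r1 t00).
  by move=> z zr; apply: pser_tail => //; exact: pr.
have ck k : (fun N => modulus (bN N k) * r ^+ k) @ \oo --> modulus (b k) * r ^+ k.
  apply/cvgrPdist_le => e e0.
  have /cvgrPdist_le/(_ _ e0)[N0 _ hN] := abs_tail_cvg aa rr0 rr1.
  exists N0 => // N NN; rewrite -mulrBl normrM (ger0_norm (exprn_ge0 k r0)).
  apply: le_trans (_ : _ <= abs_tail a rr N) _; last first.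
    by have /= := hN N NN; rewrite sub0r normrN => h; apply: le_trans h; exact: ler_norm.
  apply: le_trans (close N k); rewrite ler_wpM2r ?exprn_ge0 //.
  by rewrite ler_norml le_modulus_dist andbT lerNl opprB modulusB le_modulus_dist.
have cs : (fun N => M2part (bN N) (r ^+ 2) m) @ \oo --> M2part b (r ^+ 2) m.
  have sq (c : nat -> C) : M2part c (r ^+ 2) m = \sum_(k < m) (modulus (c k) * r ^+ k) * (modulus (c k) * r ^+ k).
    by apply: eq_bigr => k _; rewrite -exprM mulnC exprM -exprMn expr2.
  under eq_fun do rewrite sq.
  rewrite sq; exact: (@cvg_rsum (fun N k => modulus (bN N k) * r ^+ k * (modulus (bN N k) * r ^+ k))
    (fun k => modulus (b k) * r ^+ k * (modulus (b k) * r ^+ k)) m (fun k => cvgM (ck k) (ck k))).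
apply: (cvgr_to_le cs); near=> N.
apply: le_trans (M2part_le m (pser_abs (hbN N)) t0 t1) _.
apply: le_trans (littlewood_poly sp p0 r0 r1 pr (hbN N)) _.
exact: M2part_le.
Unshelve. all: by end_near. Qed.

End Littlewood.

(** * The symbol *)
Section Symbol.
Variable R : realType.
Local Notation C := (cplx R).
Implicit Types (z w : C) (r : R) (j J : nat).
Variables (p t : nat -> R).
Hypothesis p_ge0 : forall j, 0 <= p j.
Hypothesis t_gt0 : forall j, 0 < t j.
Hypothesis t_le1 : forall j, t j <= 1.
Hypothesis t_noninc : forall i j, (i <= j)%N -> t j <= t i.
Hypothesis t_0 : t 0 = 1.
Hypothesis p_0 : 0 < p 0.
Hypothesis p_sum : series p @ \oo --> (1 : R).

(** The Moebius map that fixes 0 and 1 and has its pole at 1 / (1 - t j). As t j decreases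
    its slope (t j)^-1 at the fixed point 1 grows. *)
Definition chi j z : C := rc (t j) * z / (1 - rc (1 - t j) * z).

(** Partial sums of a convex combination of the maps chi j, since the p j sum
   to 1. *)
Definition phiJ J z : C := \sum_(j < J) rc (p j) * chi j z.

Definition phi z : C := lim (phiJ ^~ z @ \oo).

Lemma one_sub_modulus j z : modulus z < 1 ->
  1 - modulus z <= modulus (1 - rc (1 - t j) * z).
Proof.
move=> z1; apply: le_trans (le_modulus_dist _ _).
rewrite modulus1 modulusM modulus_rc lerD2l lerN2 ger0_norm ?subr_ge0 //.
by rewrite ler_piMl ?modulus_ge0 // gerBl ltW.
Qed.

Lemma t_le_sub j z : modulus z < 1 -> t j <= modulus (1 - rc (1 - t j) * z).
Proof.
move=> z1; apply: le_trans (le_modulus_dist _ _).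
rewrite modulus1 modulusM modulus_rc ger0_norm ?subr_ge0 //.
have : (1 - t j) * modulus z <= 1 - t j by rewrite ler_piMr ?subr_ge0 // ltW.
lra.
Qed.

Lemma chi_den0 j z : modulus z < 1 -> 1 - rc (1 - t j) * z != 0.
Proof.
by move=> z1; rewrite -modulus_gt0; apply: lt_le_trans (t_le_sub j z1).
Qed.

Lemma chi_le j z : modulus z < 1 -> modulus (chi j z) <= modulus z.
Proof.
move=> z1; rewrite /chi !modulusM modulusV modulus_rc gtr0_norm //.
have d : 0 < modulus (1 - rc (1 - t j) * z) by rewrite modulus_gt0 chi_den0.
by rewrite ler_pdivrMr // mulrC ler_wpM2l ?modulus_ge0 // t_le_sub.
Qed.

Lemma phi_term_le j z : modulus z < 1 -> modulus (rc (p j) * chi j z) <= p j.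
Proof.
move=> z1; rewrite modulusM modulus_rc ger0_norm // ler_piMr //.
exact: le_trans (chi_le j z1) (ltW z1).
Qed.

Lemma p_cvg : cvgn (series p).
Proof. by apply/cvg_ex; exists 1. Qed.

Lemma limp : limn (series p) = 1.
Proof. exact: cvg_lim p_sum. Qed.

Lemma psum_le J : \sum_(j < J) p j <= 1.
Proof. by rewrite -limp; apply: nneg_series_le_lim => //; exact: p_cvg. Qed.

Lemma phi_cvg z : modulus z < 1 -> phiJ ^~ z @ \oo --> phi z.
Proof.
move=> z1; have := @abs_cvgC R (fun j => rc (p j) * chi j z).
rewrite /phi; have -> : phiJ ^~ z = series (fun j => rc (p j) * chi j z).
  by apply/funext => J; rewrite seriesCE.
move=> h; apply/cvg_ex; apply: (h p) => [j|]; [exact: phi_term_le|exact: p_cvg].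
Qed.

Lemma phi_tail J z : modulus z < 1 -> modulus (phi z - phiJ J z) <= 1 - \sum_(j < J) p j.
Proof.
move=> z1; rewrite -limp; apply: (@tail_bound R (fun j => rc (p j) * chi j z)).
- have := phi_cvg z1; have -> // : phiJ ^~ z = series (fun j => rc (p j) * chi j z).
  by apply/funext => n; rewrite seriesCE.
- by move=> j; exact: phi_term_le.
- exact: p_cvg.
Qed.

(** Closed inequalities pass from the partial sums to the symbol. *)
Lemma phi_limit_le z (g : C -> R) (b : R) : modulus z < 1 ->
  (g (phiJ J z) @[J --> \oo] --> g (phi z)) ->
  (forall J, g (phiJ J z) <= b) -> g (phi z) <= b.
Proof. by move=> z1 h hb; apply: (cvgr_to_le h); near=> J. Unshelve. all: by end_near. Qed.

Lemma modulus_phi_cvg z : modulus z < 1 -> modulus (phiJ J z) @[J --> \oo] --> modulus (phi z).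
Proof. by move=> z1; apply: cvg_modulus; exact: phi_cvg. Qed.

Lemma phi_le z : modulus z < 1 -> modulus (phi z) <= modulus z.
Proof.
move=> z1; apply: (phi_limit_le z1 (modulus_phi_cvg z1)) => J.
apply: le_trans (le_modulus_sum _ _ _) _.
apply: le_trans (_ : \sum_(j < J) p j * modulus z <= _).
  apply: ler_sum => j _; rewrite modulusM modulus_rc ger0_norm // ler_wpM2l //.
  exact: chi_le.
by rewrite -mulr_suml ler_piMl ?modulus_ge0 // psum_le.
Qed.

Lemma phi0 : phi 0 = 0.
Proof.
have m0 : modulus (0 : C) < 1 by rewrite modulus0.
by apply/eqP; rewrite -modulus_eq0 eq_le modulus_ge0 andbT -[leRHS](@modulus0 R) phi_le.
Qed.

Lemma chi_sub j z w : modulus z < 1 -> modulus w < 1 ->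
  chi j w - chi j z =
  (w - z) * (rc (t j) / ((1 - rc (1 - t j) * z) * (1 - rc (1 - t j) * w))).
Proof.
move=> z1 w1; have := chi_den0 j z1; have := chi_den0 j w1.
rewrite /chi rcB rc1; move: (rc (t j)) => T h1 h2; field.
by rewrite h1 h2.
Qed.

Lemma phi_hol : hol phi.
Proof.
move=> z z1; pose q := 1 - modulus z; have q0 : 0 < q by rewrite subr_gt0.
pose u j := rc (p j) * (rc (t j) / (1 - rc (1 - t j) * z) ^+ 2).
have tq j : modulus (rc (t j) / (1 - rc (1 - t j) * z) ^+ 2) <= q ^- 2.
  rewrite modulusM modulus_rc gtr0_norm // modulusV modulusX.
  have h := one_sub_modulus j z1; rewrite -/q in h.
  have : (modulus (1 - rc (1 - t j) * z) ^+ 2)^-1 <= q ^- 2.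
    rewrite lef_pV2 ?posrE ?exprn_gt0 //; first by apply: le_pow => //; exact: ltW.
    by rewrite modulus_gt0 chi_den0.
  move=> h'; rewrite -[leRHS]mul1r; apply: ler_pM => //; first exact: ltW.
  by rewrite invr_ge0 exprn_ge0 ?modulus_ge0.
have uq j : modulus (u j) <= q ^- 2 * p j.
  by rewrite modulusM modulus_rc ger0_norm // mulrC ler_wpM2r.
have cu : cvg (series u @ \oo).
  apply/cvg_ex; apply: (@abs_cvgC R u (fun j => q ^- 2 * p j)); first exact: uq.
  by apply: cvg_seriesZ; exact: p_cvg.
pose d : C := lim (series u @ \oo).
have K0 : 0 < 2 * q ^- 3 by rewrite mulr_gt0 // invr_gt0 exprn_gt0.
apply: (@expands_derivable R phi z d) => e e0.
exists (Num.min (q / 2) (e / (2 * q ^- 3))).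
  have h1 : 0 < q / 2 by rewrite divr_gt0.
  have h2 := divr_gt0 e0 K0.
  by rewrite lt_min h1 h2.
move=> w; rewrite lt_min => /andP[wz1 wz2].
have mw : modulus w <= modulus z + modulus (w - z).
  by rewrite -[in leLHS](subrK z w) addrC le_modulusD.
have w1 : modulus w < 1 by move: wz1 mw; rewrite /q; lra.
have wq : q / 2 <= 1 - modulus w by move: wz1 mw; rewrite /q; lra.
have bound J : modulus (phiJ J w - (phiJ J z + series u J * (w - z))) <=
    2 * q ^- 3 * modulus (w - z) ^+ 2.
  have -> : phiJ J w - (phiJ J z + series u J * (w - z)) =
     \sum_(j < J) rc (p j) * ((w - z) ^+ 2 * (rc (1 - t j) * (rc (t j) / (1 - rc (1 - t j) * z) ^+ 2)
        * (1 - rc (1 - t j) * w)^-1)).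
    rewrite /phiJ seriesCE opprD addrA -sumrB mulr_suml -sumrB; apply: eq_bigr => j _.
    rewrite -mulrBr (chi_sub j z1 w1) /u.
    have := chi_den0 j z1; have := chi_den0 j w1.
    rewrite rcB rc1; move: (rc (t j)) (rc (p j)) => T P h1 h2; field.
    by rewrite h1 h2.
  apply: le_trans (le_modulus_sum _ _ _) _.
  apply: le_trans (_ : \sum_(j < J) p j * (2 * q ^- 3 * modulus (w - z) ^+ 2) <= _); last first.
    have B0 : 0 <= 2 * q ^- 3 * modulus (w - z) ^+ 2.
      by apply: mulr_ge0; [exact: ltW|rewrite exprn_ge0 ?modulus_ge0].
    by rewrite -mulr_suml ler_piMl // psum_le.
  apply: ler_sum => j _; rewrite modulusM modulus_rc ger0_norm // ler_wpM2l //.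
  rewrite modulusM modulusX mulrC ler_wpM2r ?exprn_ge0 ?modulus_ge0 //.
  rewrite modulusM (modulusM (rc (1 - t j))) modulus_rc ger0_norm ?subr_ge0 //.
  have -> : 2 * q ^- 3 = 1 * q ^- 2 * (q / 2)^-1.
    by field; rewrite gt_eqF.
  apply: ler_pM; rewrite ?mulr_ge0 ?modulus_ge0 ?subr_ge0 //.
    apply: ler_pM; rewrite ?mulr_ge0 ?modulus_ge0 ?subr_ge0 //.
    by rewrite gerBl ltW.
  rewrite modulusV lef_pV2 ?posrE ?modulus_gt0 ?chi_den0 ?divr_gt0 //.
  exact: le_trans wq (one_sub_modulus j w1).
have lim_ : modulus (phiJ J w - (phiJ J z + series u J * (w - z))) @[J --> \oo] -->
    modulus (phi w - (phi z + d * (w - z))).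
  have h1 := phi_cvg w1; have h2 := phi_cvg z1.
  have c : (fun _ : nat => w - z) @ \oo --> w - z by exact: cvg_cst.
  by apply: cvg_modulus; exact: (cvgB h1 (cvgD h2 (cvgM cu c))).
apply: le_trans (_ : 2 * q ^- 3 * modulus (w - z) ^+ 2 <= _).
  by apply: (cvgr_to_le lim_); near=> J.
rewrite expr2 mulrA ler_wpM2r ?modulus_ge0 // mulrC -ler_pdivlMr //.
exact: ltW.
Unshelve. all: by end_near. Qed.

Lemma phi_selfmap : selfmap phi.
Proof. by split; [exact: phi_hol|move=> z z1; exact: le_lt_trans (phi_le z1) z1]. Qed.

Lemma invC z : z^-1 = z^* * rc (modulus z ^+ 2)^-1.
Proof.
have [->|z0] := eqVneq z 0; first by rewrite invr0 conjC0 mul0r.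
have h := mul_conj z.
have z1 : z^* != 0 by rewrite conjC_eq0.
by rewrite rcV -h; field; rewrite z0 z1.
Qed.

Lemma reV z : re z^-1 = re z / modulus z ^+ 2.
Proof. by rewrite invC reM re_rc im_rc mulr0 subr0 re_conj. Qed.

Lemma imV z : im z^-1 = - im z / modulus z ^+ 2.
Proof. by rewrite invC imM re_rc im_rc mulr0 add0r im_conj. Qed.

(** The difference quotient of chi j. *)
Definition slope j z w : C := rc (t j) / ((1 - rc (1 - t j) * z) * (1 - rc (1 - t j) * w)).

Lemma reZ (k : R) z : re (rc k * z) = k * re z.
Proof. by rewrite reM re_rc im_rc mul0r subr0. Qed.

Lemma imZ (k : R) z : im (rc k * z) = k * im z.
Proof. by rewrite imM re_rc im_rc mul0r addr0. Qed.

Lemma re1 : re (1 : C) = 1. Proof. by []. Qed.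
Lemma im1 : im (1 : C) = 0. Proof. by []. Qed.

Lemma sub_re j z : modulus z < 1 -> 0 < 1 - (1 - t j) * re z.
Proof.
move=> z1; have h1 := le_re z; rewrite subr_gt0.
have h2 : re z < 1 by apply: le_lt_trans z1; exact: le_trans (ler_norm _) h1.
have h3 := t_gt0 j; have h4 := t_le1 j.
have [h5|h5] := lerP (re z) 0; first by apply: le_lt_trans ltr01; rewrite mulr_ge0_le0 ?subr_ge0.
have : 0 < t j * re z by rewrite mulr_gt0.
move: h2; lra.
Qed.

Lemma slope_re j z w : modulus z < 1 -> modulus w < 1 -> im z * im w <= 0 -> 0 <= re (slope j z w).
Proof.
move=> z1 w1 h; rewrite /slope reZ reV; apply: mulr_ge0; first exact: ltW.
apply: divr_ge0; last by rewrite exprn_ge0 ?modulus_ge0.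
rewrite reM !reB !imB re1 im1 !reZ !imZ !sub0r mulrNN.
have h1 := sub_re j z1; have h2 := sub_re j w1.
have h3 : 0 <= - ((1 - t j) ^+ 2 * (im z * im w)) by rewrite oppr_ge0 mulr_ge0_le0 ?sqr_ge0.
have h4 : 0 <= (1 - (1 - t j) * re z) * (1 - (1 - t j) * re w) by rewrite mulr_ge0 ?ltW.
apply: le_trans (addr_ge0 h4 h3) _; rewrite expr2; lra.
Qed.

Lemma slope_im j z w : modulus z < 1 -> modulus w < 1 ->
  im (slope j z w) = t j * (1 - t j) *
   (im w * (1 - (1 - t j) * re z) + im z * (1 - (1 - t j) * re w)) /
   modulus ((1 - rc (1 - t j) * z) * (1 - rc (1 - t j) * w)) ^+ 2.
Proof.
move=> z1 w1; rewrite /slope imZ imV !mulrA; congr (_ / _).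
rewrite imM !reB !imB re1 im1 !reZ !imZ; ring.
Qed.

Lemma slope_den j z w : modulus z < 1 -> modulus w < 1 ->
  0 < modulus ((1 - rc (1 - t j) * z) * (1 - rc (1 - t j) * w)) ^+ 2.
Proof. by move=> z1 w1; rewrite exprn_gt0 // modulus_gt0 mulf_neq0 ?chi_den0. Qed.

Lemma slope_im_gt0 j z w : modulus z < 1 -> modulus w < 1 -> t j < 1 -> 0 < im z -> 0 < im w ->
  0 < im (slope j z w).
Proof.
move=> z1 w1 t1 iz iw; rewrite slope_im // divr_gt0 ?slope_den //.
by rewrite !mulr_gt0 ?subr_gt0 // addr_gt0 // mulr_gt0 // sub_re.
Qed.

Lemma slope_im_ge0 j z w : modulus z < 1 -> modulus w < 1 -> 0 < im z -> 0 < im w ->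
  0 <= im (slope j z w).
Proof.
move=> z1 w1 iz iw; have := t_le1 j; rewrite le_eqVlt => /orP[/eqP e|h].
  by rewrite slope_im // e subrr mulr0 !mul0r.
exact: ltW (slope_im_gt0 z1 w1 h iz iw).
Qed.

Lemma slope_conj j z w : im (slope j z w) = - im (slope j z^* w^*).
Proof.
rewrite -im_conj /slope; congr im.
move: (conj_rc (t j)) (conj_rc (1 - t j)); move: (rc (t j)) (rc (1 - t j)) => T A hT hA.
by rewrite rmorphM fmorphV rmorphM !rmorphB !rmorphM rmorph1 /= !conjCK hT hA.
Qed.

Definition slopeJ J z w := \sum_(j < J) rc (p j) * slope j z w.

Lemma phiJ_sub J z w : modulus z < 1 -> modulus w < 1 ->
  phiJ J w - phiJ J z = (w - z) * slopeJ J z w.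
Proof.
move=> z1 w1; rewrite /phiJ /slopeJ -sumrB mulr_sumr; apply: eq_bigr => j _.
by rewrite -mulrBr chi_sub // mulrCA.
Qed.

Lemma slopeJ_cvg0 z w : modulus z < 1 -> modulus w < 1 -> phi z = phi w -> z != w ->
  slopeJ J z w @[J --> \oo] --> (0 : C).
Proof.
move=> z1 w1 e zw.
have h : (fun J => (w - z)^-1 * (phiJ J w - phiJ J z)) @ \oo --> (0 : C).
  have E0 : (w - z)^-1 * (phi w - phi z) = 0 by rewrite e subrr mulr0.
  rewrite -[X in _ --> X]E0.
  have c : (fun _ : nat => (w - z)^-1) @ \oo --> (w - z)^-1 by exact: cvg_cst.
  exact: (cvgM c (cvgB (phi_cvg w1) (phi_cvg z1))).
have E : (fun J => slopeJ J z w) = (fun J => (w - z)^-1 * (phiJ J w - phiJ J z)).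
  by apply/funext => J; rewrite phiJ_sub // mulKf // subr_eq0 eq_sym.
by rewrite E.
Qed.

Lemma cvg0_contra (u : nat -> R) (c : R) : u @ \oo --> (0 : R) -> 0 < c ->
  (exists N, forall n, (N <= n)%N -> c <= u n) -> False.
Proof.
move=> u0 c0 [N h]; have : c <= 0.
  by apply: (cvgr_to_ge u0); exists N.
by rewrite leNgt c0.
Qed.

Lemma sum_ge_term (u : nat -> R) j J : (forall i, 0 <= u i) -> (j < J)%N ->
  u j <= \sum_(i < J) u i.
Proof.
move=> u0 jJ; rewrite (bigD1 (Ordinal jJ)) //= lerDl; apply: sumr_ge0 => i _; exact: u0.
Qed.

(** The sum of the slopes of the summands cannot vanish: if the points lie in
    opposite closed half planes every slope has nonnegative real part, and if
    they lie in the same open half plane all slopes point to one side of the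
    real axis. *)
Lemma phi_inj z w : (exists2 j, 0 < p j & t j < 1) -> modulus z < 1 -> modulus w < 1 ->
  phi z = phi w -> z = w.
Proof.
move=> [j pj tj] z1 w1 e; apply/eqP/negP => /negP zw.
have S0 := slopeJ_cvg0 z1 w1 e zw.
have imJ x y J : im (slopeJ J x y) = \sum_(i < J) p i * im (slope i x y).
  by rewrite /slopeJ im_sum; apply: eq_bigr => i _; rewrite imZ.
have pos x y : modulus x < 1 -> modulus y < 1 -> 0 < im x -> 0 < im y ->
    (fun J => im (slopeJ J x y)) @ \oo --> (0 : R) -> False.
  move=> x1 y1 ix iy; under eq_fun do rewrite imJ; move=> h.
  apply: (cvg0_contra h (c := p j * im (slope j x y))).
    by rewrite mulr_gt0 // slope_im_gt0.
  exists j.+1 => n jn; apply: (sum_ge_term (u := fun i => p i * im (slope i x y))) => // i.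
  by rewrite mulr_ge0 // slope_im_ge0.
have hi : (fun J => im (slopeJ J z w)) @ \oo --> (0 : R) by exact: (cvg_im _ S0).
have [h|h] := lerP (im z * im w) 0.
  have : (fun J => re (slopeJ J z w)) @ \oo --> (0 : R) by exact: (cvg_re _ S0).
  have -> : (fun J => re (slopeJ J z w)) = (fun J => \sum_(i < J) p i * re (slope i z w)).
    by apply/funext => J; rewrite /slopeJ re_sum; apply: eq_bigr => i _; rewrite reZ.
  move=> hr; apply: (cvg0_contra hr p_0); exists 1%N => n n1.
  have <- : p 0 * re (slope 0 z w) = p 0.
    by rewrite /slope t_0 subrr rc0 !mul0r subr0 mulr1 invr1 mulr1 re_rc mulr1.
  apply: (sum_ge_term (u := fun i => p i * re (slope i z w))) => // i.
  by rewrite mulr_ge0 // slope_re.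
have [iz|iz] := ltP 0 (im z).
  by apply: (pos z w) => //; rewrite -(pmulr_rgt0 _ iz).
have iz' : im z < 0.
  by rewrite lt_neqAle iz andbT; apply: contraTneq h => ->; rewrite mul0r ltxx.
apply: (pos z^* w^*); rewrite ?modulus_conj //.
- by rewrite im_conj oppr_gt0.
- by rewrite im_conj oppr_gt0 -(nmulr_rgt0 _ iz').
have -> : (fun J => im (slopeJ J z^* w^*)) = (fun J => - im (slopeJ J z w)).
  apply/funext => J; rewrite !imJ -sumrN; apply: eq_bigr => i _.
  by rewrite (slope_conj i z w) mulrN opprK.
by rewrite -[X in _ --> X]oppr0; exact: (cvgN hi).
Qed.

Definition phiR r : R := re (phi (rc r)).

Definition chiR j r : R := t j * r / (1 - (1 - t j) * r).

Lemma chi_rc j r : chi j (rc r) = rc (chiR j r).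
Proof. by rewrite /chi /chiR !(rcM, rcV, rcB, rc1). Qed.

Lemma phiJ_rc J r : phiJ J (rc r) = rc (\sum_(j < J) p j * chiR j r).
Proof. by rewrite rc_sum; apply: eq_bigr => j _; rewrite chi_rc rcM. Qed.

Lemma phi_rc r : 0 <= r -> r < 1 -> phi (rc r) = rc (phiR r).
Proof.
move=> r0 r1; have m1 := rc_lt1 r0 r1.
rewrite [LHS]mkCE /phiR; congr mkC.
have h : (fun J => im (phiJ J (rc r))) @ \oo --> im (phi (rc r)) by exact: (cvg_im _ (phi_cvg m1)).
have c : (fun J => im (phiJ J (rc r))) @ \oo --> (0 : R).
  by under eq_fun do rewrite phiJ_rc im_rc; exact: cvg_cst.
exact: (cvg_unique _ h c).
Qed.

Lemma phiR_tail J r : 0 <= r -> r < 1 ->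
  `|phiR r - \sum_(j < J) p j * chiR j r| <= 1 - \sum_(j < J) p j.
Proof.
move=> r0 r1; have m1 := rc_lt1 r0 r1.
apply: le_trans (phi_tail J m1); rewrite phi_rc // phiJ_rc -rcB modulus_rc //.
Qed.

Lemma chiR_den j r : 0 <= r -> r < 1 -> 0 < 1 - (1 - t j) * r.
Proof.
move=> r0 r1; have := sub_re j (rc_lt1 r0 r1); rewrite re_rc //.
Qed.

Lemma chiR_gap j r : 0 <= r -> r < 1 -> 1 - chiR j r = (1 - r) / (1 - (1 - t j) * r).
Proof.
by move=> r0 r1; rewrite /chiR; field; rewrite gt_eqF // chiR_den.
Qed.

Lemma sum_gap J r : 0 <= r -> r < 1 ->
  \sum_(j < J) p j * ((1 - r) / (1 - (1 - t j) * r)) =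
  \sum_(j < J) p j - \sum_(j < J) p j * chiR j r.
Proof.
move=> r0 r1; rewrite -sumrB; apply: eq_bigr => j _.
by rewrite -chiR_gap // mulrBr mulr1.
Qed.

(** The boundary distance 1 - phi(r) is (1 - r) times the sum of
    p j / (1 - (1 - t j) r); gap_ge and gap_le bound it by partial sums. *)
Lemma gap_ge J r : 0 <= r -> r < 1 ->
  \sum_(j < J) p j * ((1 - r) / (1 - (1 - t j) * r)) <= 1 - phiR r.
Proof.
move=> r0 r1; rewrite sum_gap //; have /ler_normlW := phiR_tail J r0 r1.
lra.
Qed.

Lemma gap_le (B : R) r : 0 <= r -> r < 1 ->
  (forall J, \sum_(j < J) p j / (1 - (1 - t j) * r) <= B) -> 1 - phiR r <= (1 - r) * B.
Proof.
move=> r0 r1 hB.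
have h : (fun J => (1 - r) * B + 2 * (1 - \sum_(j < J) p j)) @ \oo --> (1 - r) * B.
  have E0 : (1 - r) * B + 2 * (1 - 1) = (1 - r) * B by rewrite subrr mulr0 addr0.
  rewrite -[X in _ --> X]E0.
  have E : (fun J => \sum_(j < J) p j) = series p by apply/funext => J; rewrite seriesE.
  have c1 : (fun _ : nat => (1 - r) * B) @ \oo --> (1 - r) * B by exact: cvg_cst.
  have c2 : (fun _ : nat => (2 : R)) @ \oo --> (2 : R) by exact: cvg_cst.
  have c3 : (fun _ : nat => (1 : R)) @ \oo --> (1 : R) by exact: cvg_cst.
  have c4 : (fun J => \sum_(j < J) p j) @ \oo --> (1 : R) by rewrite E.
  exact: (cvgD c1 (cvgM c2 (cvgB c3 c4))).
apply: (cvgr_to_ge h); near=> J.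
have := sum_gap J r0 r1; have := phiR_tail J r0 r1; rewrite distrC => /ler_normlW h1 h2.
have h3 : \sum_(j < J) p j * ((1 - r) / (1 - (1 - t j) * r)) <= (1 - r) * B.
  apply: le_trans (_ : (1 - r) * \sum_(j < J) p j / (1 - (1 - t j) * r) <= _).
    by rewrite mulr_sumr; apply: ler_sum => j _; rewrite mulrCA.
  by rewrite ler_wpM2l // subr_ge0 ltW.
move: h1 h2 h3; lra.
Unshelve. all: by end_near. Qed.

Lemma chi_le_chiR j z : modulus z < 1 -> modulus (chi j z) <= chiR j (modulus z).
Proof.
move=> z1; rewrite /chi /chiR !modulusM modulusV modulus_rc gtr0_norm //.
have d := chiR_den j (modulus_ge0 z) z1.
apply: ler_wpM2l; first by apply: mulr_ge0; rewrite ?modulus_ge0 // ltW.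
rewrite lef_pV2 ?posrE ?modulus_gt0 ?chi_den0 //.
apply: le_trans (le_modulus_dist _ _).
by rewrite modulus1 modulusM modulus_rc ger0_norm ?subr_ge0.
Qed.

Lemma phi_le_phiR z : modulus z < 1 -> modulus (phi z) <= phiR (modulus z).
Proof.
move=> z1; have m1 : modulus (rc (modulus z)) < 1 by apply: rc_lt1; rewrite ?modulus_ge0.
have h1 := modulus_phi_cvg z1.
have h2 : (fun J => re (phiJ J (rc (modulus z)))) @ \oo --> phiR (modulus z).
  exact: (cvg_re _ (phi_cvg m1)).
apply: (ler_cvg_to h1 h2); near=> J.
rewrite phiJ_rc re_rc; apply: le_trans (le_modulus_sum _ _ _) _; apply: ler_sum => j _.
by rewrite modulusM modulus_rc ger0_norm // ler_wpM2l // chi_le_chiR.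
Unshelve. all: by end_near. Qed.

Lemma phiR_ge0 r : 0 <= r -> r < 1 -> 0 <= phiR r.
Proof.
move=> r0 r1; apply: le_trans (modulus_ge0 (phi (rc r))) _.
have := phi_le_phiR (rc_lt1 r0 r1); rewrite modulus_rc ger0_norm //.
Qed.

Lemma phiR_le r : 0 <= r -> r < 1 -> phiR r <= r.
Proof.
move=> r0 r1; have := phi_le (rc_lt1 r0 r1).
by rewrite phi_rc // !modulus_rc !ger0_norm // phiR_ge0.
Qed.

Lemma phi_gap j z : modulus z < 1 -> p j * (1 - modulus (chi j z)) <= 1 - modulus (phi z).
Proof.
move=> z1; apply: le_trans (_ : \sum_(i < j.+1) p i * (1 - modulus (chi i z)) <= _).
  apply: (sum_ge_term (u := fun i => p i * (1 - modulus (chi i z)))) => // i.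
  by rewrite mulr_ge0 // subr_ge0; exact: le_trans (chi_le i z1) (ltW z1).
have h1 := phi_tail j.+1 z1.
have h2 : modulus (phi z) <= modulus (phiJ j.+1 z) + modulus (phi z - phiJ j.+1 z).
  by rewrite -[in leLHS](subrK (phiJ j.+1 z) (phi z)) addrC le_modulusD.
have h3 : modulus (phiJ j.+1 z) <= \sum_(i < j.+1) p i * modulus (chi i z).
  apply: le_trans (le_modulus_sum _ _ _) _; apply: ler_sum => i _.
  by rewrite modulusM modulus_rc ger0_norm.
have -> : \sum_(i < j.+1) p i * (1 - modulus (chi i z)) =
    \sum_(i < j.+1) p i - \sum_(i < j.+1) p i * modulus (chi i z).
  by rewrite -sumrB; apply: eq_bigr => i _; rewrite mulrBr mulr1.
move: h1 h2 h3; lra.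
Qed.

(** When t j < 1 the map chi j touches the unit circle only at the point 1. *)
Lemma chi_gap j z : modulus z < 1 ->
  (1 - t j) * modulus (1 - z) ^+ 2 / 8 <= 1 - modulus (chi j z).
Proof.
move=> z1; set D := modulus (1 - rc (1 - t j) * z).
have D0 : 0 < D by rewrite /D modulus_gt0 chi_den0.
have D2 : D <= 2.
  apply: le_trans (le_modulusB _ _) _; rewrite modulus1 modulusM modulus_rc ger0_norm ?subr_ge0 //.
  have : (1 - t j) * modulus z <= 1.
    apply: mulr_ile1; rewrite ?subr_ge0 ?modulus_ge0 //; last exact: ltW.
    by rewrite gerBl ltW.
  lra.
have e : D ^+ 2 - (t j * modulus z) ^+ 2 =
    t j * (1 - modulus z ^+ 2) + (1 - t j) * modulus (1 - z) ^+ 2.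
  rewrite /D exprMn !sqr_modulus !reB !imB reZ imZ re1 im1; ring.
have c : modulus (chi j z) = t j * modulus z / D.
  by rewrite /chi !modulusM modulusV modulus_rc gtr0_norm.
set X := modulus (chi j z) in c *.
have X1 : X <= 1 by exact: le_trans (chi_le j z1) (ltW z1).
have X0 : 0 <= X by rewrite /X modulus_ge0.
have XD : X * D = t j * modulus z by rewrite c divfK // gt_eqF.
have P0 : 0 <= t j * (1 - modulus z ^+ 2).
  by apply: mulr_ge0; [exact: ltW|rewrite subr_ge0 exprn_ile1 ?modulus_ge0 // ltW].
have e' : (1 - t j) * modulus (1 - z) ^+ 2 <= D ^+ 2 * (1 - X ^+ 2).
  rewrite mulrBr mulr1 -exprMn (mulrC D) XD e; move: P0; lra.
have D4 : D ^+ 2 <= 4.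
  have -> : 4 = 2 ^+ 2 :> R by rewrite -natrX.
  by apply: le_pow => //; exact: ltW.
have X2 : 1 - X ^+ 2 <= 2 * (1 - X).
  have : 0 <= (1 - X) * (1 - X) by rewrite mulr_ge0 ?subr_ge0.
  rewrite expr2; lra.
have X3 : 0 <= 1 - X ^+ 2 by rewrite subr_ge0 exprn_ile1.
have : D ^+ 2 * (1 - X ^+ 2) <= 4 * (2 * (1 - X)) by apply: ler_pM => //; rewrite sqr_ge0.
move: e'; lra.
Qed.

(** Divergence of the sum of p_j / t_j makes the quotient of boundary distances
    blow up at the point 1. *)
Lemma gap_blowup (L : R) : (forall K : R, exists J, K <= \sum_(j < J) p j / t j) ->
  exists r0 : R, [/\ 0 <= r0, r0 < 1 & forall r, r0 <= r -> r < 1 -> L * (1 - r) <= 1 - phiR r].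
Proof.
move=> hdiv; have [J hJ] := hdiv (2 * L); exists (1 - t J); split.
- by rewrite subr_ge0.
- by rewrite gtrBl.
move=> r rJ r1; have r0 : 0 <= r by apply: le_trans rJ; rewrite subr_ge0.
apply: le_trans (gap_ge J r0 r1).
apply: le_trans (_ : \sum_(j < J) p j / t j / 2 * (1 - r) <= _).
  rewrite -mulr_suml -mulr_suml; apply: ler_wpM2r; first by rewrite subr_ge0 ltW.
  by move: hJ; lra.
apply: ler_sum => j _.
have -> : p j / t j / 2 * (1 - r) = p j * ((1 - r) / (2 * t j)) by field; rewrite gt_eqF.
apply: ler_wpM2l => //; apply: ler_wpM2l; first by rewrite subr_ge0 ltW.
rewrite lef_pV2 ?posrE ?chiR_den ?mulr_gt0 //.
have h1 : t J <= t j by apply: t_noninc; exact: ltnW.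
have h2 : 0 <= t j * (1 - r) by rewrite mulr_ge0 ?subr_ge0 // ltW.
by move: h1 h2 rJ; lra.
Qed.

End Symbol.

(** * Smallness of composition on the Hardy space *)
Section CauchySchwarz.
Variable R : realType.

Lemma cauchy_schwarz (I : finType) (p x y : I -> R) : (forall i, 0 <= p i) ->
  (\sum_i p i * (x i * y i)) ^+ 2 <= (\sum_i p i * x i ^+ 2) * (\sum_i p i * y i ^+ 2).
Proof.
move=> p0; set P := \sum_i p i * (x i * y i).
set X := \sum_i p i * x i ^+ 2; set Y := \sum_i p i * y i ^+ 2.
have Y0 : 0 <= Y by apply: sumr_ge0 => i _; rewrite mulr_ge0 ?sqr_ge0.
have X0 : 0 <= X by apply: sumr_ge0 => i _; rewrite mulr_ge0 ?sqr_ge0.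
have key : 0 <= Y * (X * Y - P ^+ 2).
  have -> : Y * (X * Y - P ^+ 2) = \sum_i p i * (Y * x i - P * y i) ^+ 2.
    have -> : \sum_i p i * (Y * x i - P * y i) ^+ 2 =
       \sum_i (Y ^+ 2 * (p i * x i ^+ 2) - (2 * Y * P) * (p i * (x i * y i)) + P ^+ 2 * (p i * y i ^+ 2)).
      by apply: eq_bigr => i _; ring.
    rewrite big_split sumrB /= -!mulr_sumr -/X -/Y -/P; ring.
  by apply: sumr_ge0 => i _; rewrite mulr_ge0 ?sqr_ge0.
have [Yp|] := ltP 0 Y; first by move: key; rewrite pmulr_rge0 // subr_ge0.
move=> Yn; have Ye : Y = 0 by apply/eqP; rewrite eq_le Yn Y0.
have z i : p i * y i ^+ 2 = 0.
  have /eqP := Ye; rewrite /Y psumr_eq0 => [/allP h|j _]; last by rewrite mulr_ge0 ?sqr_ge0.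
  by apply/eqP; exact: (implyP (h i (mem_index_enum i))).
have -> : P = 0.
  apply: big1 => i _; have /eqP := z i; rewrite mulf_eq0 sqrf_eq0 => /orP[]/eqP->.
    by rewrite mul0r.
  by rewrite !mulr0.
by rewrite expr0n /= mulr_ge0.
Qed.

End CauchySchwarz.

Section Hardy.
Variable R : realType.
Local Notation C := (cplx R).
Implicit Types (z : C) (r : R) (j J M : nat).
Variables (p t : nat -> R).
Hypothesis p_ge0 : forall j, 0 <= p j.
Hypothesis t_gt0 : forall j, 0 < t j.
Hypothesis t_le1 : forall j, t j <= 1.
Hypothesis t_noninc : forall i j, (i <= j)%N -> t j <= t i.
Hypothesis t_0 : t 0 = 1.
Hypothesis p_0 : 0 < p 0.
Hypothesis p_sum : series p @ \oo --> (1 : R).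
Local Notation phi := (phi p t).
Local Notation phiJ := (phiJ p t).
Local Notation chi := (chi t).
Local Notation a j := (rc (1 - t j)).

Lemma modulus_sum_sq_le (I : finType) (q : I -> R) (A B : I -> C) : (forall i, 0 <= q i) ->
  modulus (\sum_i rc (q i) * (A i * B i)) ^+ 2 <=
  (\sum_i q i * modulus (A i) ^+ 2) * (\sum_i q i * modulus (B i) ^+ 2).
Proof.
move=> q0; apply: le_trans (cauchy_schwarz (fun i => modulus (A i)) (fun i => modulus (B i)) q0).
apply: le_pow; first exact: modulus_ge0.
apply: le_trans (le_modulus_sum _ _ _) _; apply: ler_sum => i _.
by rewrite !modulusM modulus_rc ger0_norm.
Qed.

Section Points.
Variables (N : nat) (w : 'I_N -> C).
Hypothesis w1 : forall i, modulus (w i) < 1.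
Implicit Types v : 'I_N -> C.

Definition szego_part M v : R := \sum_(m < M) modulus (\sum_i v i * (w i)^* ^+ m) ^+ 2.

Definition szego_formC v : C := \sum_i \sum_k v i * (v k)^* * (1 - (w i)^* * w k)^-1.

(** The squared Hardy norm of the combination of Szegoe kernels at the points
    w i with coefficients v; szego_part truncates the power series. *)
Definition szego_form v : R := re (szego_formC v).

Lemma ww1 i k : modulus ((w i)^* * w k) < 1.
Proof.
rewrite modulusM modulus_conj; apply: le_lt_trans (w1 i).
by rewrite ler_piMr ?modulus_ge0 // ltW.
Qed.

Lemma modulus_lt1_sub z : modulus z < 1 -> 1 - z != 0.
Proof.
by move=> z1; apply/eqP => /subr0_eq e; move: z1; rewrite -e modulus1 ltxx.
Qed.

Lemma geom_cvg z : modulus z < 1 -> \sum_(m < M) z ^+ m @[M --> \oo] --> (1 - z)^-1.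
Proof.
move=> z1; have d := modulus_lt1_sub z1.
have E M : \sum_(m < M) z ^+ m = (1 - z)^-1 * (1 - z ^+ M).
  apply: (mulfI d); rewrite mulVKf //.
  by rewrite -[1 in RHS](expr1n _ M) subrXX; congr (_ * _); apply: eq_bigr => i _; rewrite expr1n mul1r.
have E0 : (1 - z)^-1 * (1 - 0) = (1 - z)^-1 by rewrite subr0 mulr1.
have -> : (fun M => \sum_(m < M) z ^+ m) = (fun M => (1 - z)^-1 * (1 - z ^+ M)).
  by apply/funext => M; rewrite E.
rewrite -[X in _ --> X]E0.
have c1 : (fun _ : nat => (1 - z)^-1) @ \oo --> (1 - z)^-1 by exact: cvg_cst.
have c2 : (fun _ : nat => (1 : C)) @ \oo --> (1 : C) by exact: cvg_cst.
have c3 : (fun M => z ^+ M) @ \oo --> (0 : C).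
  apply/cvgCP => e e0.
  have : (fun M => modulus z ^+ M) @ \oo --> (0 : R).
    by apply: cvg_expr; rewrite ger0_norm ?modulus_ge0.
  move=> /cvgrPdist_lt/(_ _ e0)[M0 _ h]; exists M0 => // M MM.
  by have := h M MM; rewrite /= sub0r normrN ger0_norm ?exprn_ge0 ?modulus_ge0 // sub0r modulusN modulusX.
exact: (cvgM c1 (cvgB c2 c3)).
Qed.

Lemma rc_szego_part M v : rc (szego_part M v) =
  \sum_i \sum_k v i * (v k)^* * \sum_(m < M) ((w i)^* * w k) ^+ m.
Proof.
rewrite /szego_part rc_sum.
have E (m : 'I_M) : rc (modulus (\sum_i v i * (w i)^* ^+ m) ^+ 2) =
    \sum_i \sum_k v i * (v k)^* * ((w i)^* * w k) ^+ m.
  rewrite -mul_conj mulr_suml; apply: eq_bigr => i _.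
  rewrite rmorph_sum mulr_sumr; apply: eq_bigr => k _.
  by rewrite rmorphM rmorphXn /= conjCK exprMn; ring.
under eq_bigr do rewrite E.
rewrite exchange_big; apply: eq_bigr => i _; rewrite exchange_big; apply: eq_bigr => k _.
by rewrite mulr_sumr.
Qed.

Lemma cvg_Csum (I : finType) (u : nat -> I -> C) (l : I -> C) :
  (forall i, u ^~ i @ \oo --> l i) -> (fun n => \sum_i u n i) @ \oo --> \sum_i l i.
Proof.
move=> h; rewrite /index_enum; elim: (locked_with _ _) => [|i s IH].
  by under eq_fun do rewrite big_nil; rewrite big_nil; exact: cvg_cst.
by under eq_fun do rewrite big_cons; rewrite big_cons; exact: (cvgD (h i) IH).
Qed.

Lemma szego_part_cvg v : szego_part M v @[M --> \oo] --> szego_form v.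
Proof.
have h : (fun M => rc (szego_part M v)) @ \oo --> szego_formC v.
  under eq_fun do rewrite rc_szego_part.
  apply: (@cvg_Csum _ (fun M i => \sum_k v i * (v k)^* * \sum_(m < M) ((w i)^* * w k) ^+ m)) => i.
  apply: (@cvg_Csum _ (fun M k => v i * (v k)^* * \sum_(m < M) ((w i)^* * w k) ^+ m)) => k.
  have c : (fun _ : nat => v i * (v k)^*) @ \oo --> v i * (v k)^* by exact: cvg_cst.
  exact: (cvgM c (geom_cvg (ww1 i k))).
exact: (cvg_re _ h).
Qed.

Lemma szego_part_le v M : szego_part M v <= szego_form v.
Proof.
apply: (cvgr_to_ge (@szego_part_cvg v)); exists M => // M' /= MM.
rewrite /szego_part -!(big_mkord xpredT (fun m => modulus (\sum_i v i * (w i)^* ^+ m) ^+ 2)).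
by rewrite (big_cat_nat _ MM) //= lerDl; apply: sumr_ge0 => k _; rewrite sqr_ge0.
Qed.

Lemma szego_form_ge0 v : 0 <= szego_form v.
Proof. by have := szego_part_le v 0; rewrite /szego_part big_ord0. Qed.

(** How the adjoint of multiplication by g acts on combinations of kernels. *)
Definition twist (g : C -> C) v : 'I_N -> C := fun i => v i * (g (w i))^*.

Definition szego_value j v : C := \sum_i v i / (1 - a j * (w i)^*).

Lemma w1c i : modulus (w i)^* < 1. Proof. by rewrite modulus_conj. Qed.

(** Under twisting by chi j the Szegoe kernel loses a rank one kernel plus a
    positive multiple of a twisted Szegoe kernel; this rests on
    1 - chi(z) chi(w)^* = (t (1 - z w^* ) + (1 - t) (1 - z) (1 - w)^* )
                          / ((1 - (1 - t) z) (1 - (1 - t) w)^* ). *)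
Lemma szego_formC_chi j v : szego_formC v - szego_formC (twist (chi j) v) =
  rc (t j * modulus (szego_value j v) ^+ 2) +
  a j * szego_formC (fun i => v i * ((1 - (w i)^*) / (1 - a j * (w i)^*))).
Proof.
rewrite rcM -mul_conj /szego_value rmorph_sum mulr_suml !mulr_sumr /szego_formC -sumrB -big_split /=.
apply: eq_bigr => i _; rewrite mulrA !mulr_sumr -sumrB -big_split /=.
apply: eq_bigr => k _.
have h1 := modulus_lt1_sub (ww1 i k).
have h2 := chi_den0 t_gt0 t_le1 j (w1c i).
have h3 := chi_den0 t_gt0 t_le1 j (w1 k).
have e : (1 - a j * (w k)^*)^* = 1 - a j * w k.
  move: (conj_rc (1 - t j)); move: (a j) => A hA.
  by rewrite rmorphB rmorph1 rmorphM /= conjCK hA.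
have e3 : (chi j (w i))^* = rc (t j) * (w i)^* / (1 - a j * (w i)^*).
  rewrite /chi; move: (conj_rc (1 - t j)) (conj_rc (t j)).
  move: (a j) (rc (t j)) => A T hA hT.
  by rewrite rmorphM fmorphV rmorphM rmorphB rmorph1 rmorphM /= hA hT.
have e4 : ((1 - (w k)^*) / (1 - a j * (w k)^*))^* = (1 - w k) / (1 - a j * w k).
  by rewrite rmorphM fmorphV /= e rmorphB rmorph1 /= conjCK.
have e5 : (v k / (1 - a j * (w k)^*))^* = (v k)^* / (1 - a j * w k) by rewrite rmorphM fmorphV /= e.
have e6 : (v k * (chi j (w k))^*)^* = (v k)^* * chi j (w k) by rewrite rmorphM /= conjCK.
have e7 : (v k * ((1 - (w k)^*) / (1 - a j * (w k)^*)))^* =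
    (v k)^* * ((1 - w k) / (1 - a j * w k)) by rewrite rmorphM /= e4.
rewrite /twist e6 e7 e5 e3 /chi.
move: h1 h2 h3; have -> : a j = 1 - rc (t j) by rewrite rcB rc1.
move: (rc (t j)) ((w i)^*) (w k) (v i) ((v k)^*) => T X Y V W h1 h2 h3; field.
by rewrite h1 h2 h3.
Qed.

Lemma szego_form_chi j v : t j * modulus (szego_value j v) ^+ 2 <= szego_form v - szego_form (twist (chi j) v).
Proof.
have := congr1 (@re R) (szego_formC_chi j v); rewrite reB reD re_rc reM re_rc im_rc mul0r subr0.
rewrite -/(szego_form v) -/(szego_form (twist (chi j) v)) => ->.
by rewrite lerDl mulr_ge0 ?subr_ge0 // szego_form_ge0.
Qed.

(** Convexity of the square. *)
Lemma szego_form_phiJ J v : szego_form (twist (phiJ J) v) <= \sum_(j < J) p j * szego_form (twist (chi j) v).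
Proof.
have h1 := @szego_part_cvg (twist (phiJ J) v).
have h2 : (fun M => \sum_(j < J) p j * szego_part M (twist (chi j) v)) @ \oo -->
    \sum_(j < J) p j * szego_form (twist (chi j) v).
  apply: (@cvg_rsum R (fun M j => p j * szego_part M (twist (chi j) v)) (fun j => p j * szego_form (twist (chi j) v))) => j.
  have c : (fun _ : nat => p j) @ \oo --> p j by exact: cvg_cst.
  exact: (cvgM c (@szego_part_cvg (twist (chi j) v))).
apply: (ler_cvg_to h1 h2); near=> M.
rewrite /szego_part; under [leRHS]eq_bigr do rewrite mulr_sumr.
rewrite exchange_big; apply: ler_sum => m _.
have -> : \sum_i twist (phiJ J) v i * (w i)^* ^+ m =
   \sum_(j < J) rc (p j) * (1 * \sum_i twist (chi j) v i * (w i)^* ^+ m).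
  rewrite /twist /phiJ; under eq_bigr do rewrite rmorph_sum mulr_sumr mulr_suml.
  rewrite exchange_big; apply: eq_bigr => j _; rewrite mul1r mulr_sumr.
  by apply: eq_bigr => i _; rewrite rmorphM /= conj_rc; ring.
apply: le_trans (modulus_sum_sq_le _ _ _) _; first by move=> j; exact: p_ge0.
apply: ler_piMl; first by apply: sumr_ge0 => j _; rewrite mulr_ge0 ?sqr_ge0.
apply: le_trans (psum_le p_ge0 p_sum J); apply: ler_sum => j _.
by rewrite modulus1 expr1n mulr1.
Unshelve. all: by end_near. Qed.

Lemma szego_form_phiJ_drop J0 J v : (J0 <= J)%N ->
  \sum_(j < J0) p j * t j * modulus (szego_value j v) ^+ 2 <= szego_form v - szego_form (twist (phiJ J) v).
Proof.
move=> JJ; have h := szego_form_phiJ J v.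
apply: le_trans (_ : \sum_(j < J) p j * (szego_form v - szego_form (twist (chi j) v)) <= _).
  apply: le_trans (_ : \sum_(j < J) p j * t j * modulus (szego_value j v) ^+ 2 <= _).
    rewrite -!(big_mkord xpredT (fun j => p j * t j * modulus (szego_value j v) ^+ 2)).
    rewrite (big_cat_nat _ JJ) //= lerDl; apply: sumr_ge0 => k _.
    by rewrite mulr_ge0 ?sqr_ge0 // mulr_ge0 // ltW.
  by apply: ler_sum => j _; rewrite -mulrA ler_wpM2l // szego_form_chi.
have -> : \sum_(j < J) p j * (szego_form v - szego_form (twist (chi j) v)) =
   (\sum_(j < J) p j) * szego_form v - \sum_(j < J) p j * szego_form (twist (chi j) v).
  by rewrite mulr_suml -sumrB; apply: eq_bigr => j _; rewrite mulrBr.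
have : (\sum_(j < J) p j) * szego_form v <= szego_form v by rewrite ler_piMl ?szego_form_ge0 ?(psum_le p_ge0 p_sum).
by move: h; lra.
Qed.

Lemma szego_form_phi_drop J0 v :
  \sum_(j < J0) p j * t j * modulus (szego_value j v) ^+ 2 <= szego_form v - szego_form (twist phi v).
Proof.
have h : (fun J => szego_form (twist (phiJ J) v)) @ \oo --> szego_form (twist phi v).
  have hc : (fun J => szego_formC (twist (phiJ J) v)) @ \oo --> szego_formC (twist phi v).
    apply: (@cvg_Csum _ (fun J i => \sum_k twist (phiJ J) v i * (twist (phiJ J) v k)^* * (1 - (w i)^* * w k)^-1)) => i.
    apply: (@cvg_Csum _ (fun J k => twist (phiJ J) v i * (twist (phiJ J) v k)^* * (1 - (w i)^* * w k)^-1)) => k.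
    have cj z : modulus z < 1 -> (fun J => (phiJ J z)^*) @ \oo --> (phi z)^*.
      move=> z1; have h : (fun J => phiJ J z) @ \oo --> phi z by exact: phi_cvg.
      apply/cvgCP => e e0; have /cvgCP/(_ _ e0) := h.
      by apply: filterS => J; rewrite -rmorphB modulus_conj.
    have cv (i' : 'I_N) : (fun J => twist (phiJ J) v i') @ \oo --> twist phi v i'.
      have c : (fun _ : nat => v i') @ \oo --> v i' by exact: cvg_cst.
      exact: (cvgM c (cj _ (w1 i'))).
    have cvc (i' : 'I_N) : (fun J => (twist (phiJ J) v i')^*) @ \oo --> (twist phi v i')^*.
      apply/cvgCP => e e0; have /cvgCP/(_ _ e0) := cv i'.
      by apply: filterS => J; rewrite -rmorphB modulus_conj.
    have c : (fun _ : nat => (1 - (w i)^* * w k)^-1) @ \oo --> (1 - (w i)^* * w k)^-1 by exact: cvg_cst.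
    exact: (cvgM (cvgM (cv i) (cvc k)) c).
  exact: (cvg_re _ hc).
have c : (fun _ : nat => szego_form v) @ \oo --> szego_form v by exact: cvg_cst.
by apply: (cvgr_to_ge (cvgB c h)); exists J0 => // J /= JJ; exact: szego_form_phiJ_drop.
Qed.

Variables (J0 : nat) (beta : R).
Hypothesis beta_le : beta ^+ 2 * (\sum_(j < J0) p j / t j) <= 1.

(** A multiplier that is large near the point 1, normalised by beta so that the
    rank one losses dominate it. *)
Definition hsum z : C := \sum_(j < J0) rc (beta * p j) / (1 - a j * z).

(** Cauchy's inequality gathers the rank one losses of the maps chi j into one
    rank one loss. *)
Lemma szego_form_phi v : modulus (\sum_i v i * (hsum (w i))^*) ^+ 2 <= szego_form v - szego_form (twist phi v).
Proof.
apply: le_trans (szego_form_phi_drop J0 v).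
have -> : \sum_i v i * (hsum (w i))^* =
    \sum_(j < J0) rc (p j * t j) * (rc (beta / t j) * szego_value j v).
  rewrite /hsum; under eq_bigr do rewrite rmorph_sum mulr_sumr.
  rewrite exchange_big; apply: eq_bigr => j _; rewrite /szego_value !mulr_sumr; apply: eq_bigr => i _ /=.
  have -> : (rc (beta * p j) / (1 - a j * w i))^* = rc (beta * p j) / (1 - a j * (w i)^*).
    move: (conj_rc (1 - t j)) (conj_rc (beta * p j)).
    move: (a j) (rc (beta * p j)) => A B hA hB.
    by rewrite rmorphM fmorphV rmorphB rmorph1 rmorphM /= hA hB.
  have -> : beta * p j = p j * t j * (beta / t j) by field; rewrite gt_eqF.
  by rewrite !rcM; ring.
apply: le_trans (modulus_sum_sq_le _ _ _) _.
  by move=> j; rewrite mulr_ge0 // ltW.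
apply: ler_piMl; first by apply: sumr_ge0 => j _; rewrite mulr_ge0 ?sqr_ge0 // mulr_ge0 // ltW.
apply: le_trans beta_le; rewrite mulr_sumr; apply: ler_sum => j _.
rewrite modulus_rc real_normK ?num_real // le_eqVlt; apply/orP; left; apply/eqP.
by field; rewrite gt_eqF.
Qed.

(** Twisting repeatedly by phi, the losses telescope. *)
Lemma szego_form_iter M v :
  \sum_(n < M) modulus (\sum_i v i * (hsum (w i))^* * (phi (w i))^* ^+ n) ^+ 2 <= szego_form v.
Proof.
apply: le_trans (_ : szego_form v - szego_form (fun i => v i * (phi (w i))^* ^+ M) <= _); last first.
  by rewrite gerBl szego_form_ge0.
elim: M => [|M IH].
  rewrite big_ord0 subr_ge0 le_eqVlt; apply/orP; left; apply/eqP.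
  by congr szego_form; apply/funext => i; rewrite expr0 mulr1.
rewrite big_ord_recr /=.
have h := szego_form_phi (fun i => v i * (phi (w i))^* ^+ M).
have e1 : twist phi (fun i => v i * (phi (w i))^* ^+ M) = (fun i => v i * (phi (w i))^* ^+ M.+1).
  by apply/funext => i; rewrite /twist exprSr mulrA.
rewrite e1 in h.
have e2 : \sum_i v i * (phi (w i))^* ^+ M * (hsum (w i))^* =
    \sum_i v i * (hsum (w i))^* * (phi (w i))^* ^+ M by apply: eq_bigr => i _; rewrite mulrAC.
by rewrite e2 in h; move: IH h; lra.
Qed.

End Points.

Section Average.
Variables (J0 : nat) (beta : R).
Hypothesis beta_le : beta ^+ 2 * (\sum_(j < J0) p j / t j) <= 1.
Local Notation h := (hsum J0 beta).

(** At equally spaced points the moments of v are periodic up to the factor r^N,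
    so the form is a geometric series in a discrete Fourier transform. *)
Lemma szego_form_circle (N : nat) r (v : 'I_N -> C) : (0 < N)%N -> 0 <= r -> r < 1 ->
  szego_form (fun i : 'I_N => rc r * omega R N ^+ i) v <=
  N%:R * \sum_i modulus (v i) ^+ 2 / (1 - r ^+ (2 * N)).
Proof.
move=> N0 r0 r1; set w := (fun i : 'I_N => rc r * omega R N ^+ i).
have w1 i : modulus (w i) < 1.
  by rewrite /w modulusM modulus_omegaX // mulr1 modulus_rc ger0_norm.
set E := N%:R * \sum_i modulus (v i) ^+ 2.
pose D m := modulus (\sum_i v i * (w i)^* ^+ m) ^+ 2.
have wc (i : 'I_N) m : (w i)^* ^+ m = rc (r ^+ m) * ((omega R N ^+ m) ^+ i)^*.
  by rewrite /w rmorphM /= conj_rc rmorphXn /= exprMn -rcX -exprM -!rmorphXn /= mulnC exprM.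
have D_lt : \sum_(m < N) D m <= E.
  pose v' (k : nat) : C := if insub k is Some i then (v i)^* else 0.
  have v'E (i : 'I_N) : v' i = (v i)^* by rewrite /v' valK.
  apply: le_trans (_ : \sum_(j < N) modulus (\sum_(k < N) v' k * (omega R N ^+ j) ^+ k) ^+ 2 <= _).
    apply: ler_sum => m _; rewrite /D; apply: le_pow; first exact: modulus_ge0.
    have -> : \sum_i v i * (w i)^* ^+ m = rc (r ^+ m) * (\sum_(k < N) v' k * (omega R N ^+ m) ^+ k)^*.
      rewrite rmorph_sum mulr_sumr; apply: eq_bigr => i _.
      by rewrite rmorphM /= v'E conjCK wc; ring.
    rewrite modulusM modulus_conj modulus_rc ger0_norm ?exprn_ge0 //.
    by rewrite ler_piMl ?modulus_ge0 // exprn_ile1 // ltW.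
  rewrite dft_parseval /E; under eq_bigr do rewrite v'E modulus_conj.
  exact: lexx.
have shift m : D (N + m)%N = r ^+ (2 * N) * D m.
  rewrite /D.
  have -> : \sum_i v i * (w i)^* ^+ (N + m) = rc (r ^+ N) * \sum_i v i * (w i)^* ^+ m.
    rewrite mulr_sumr; apply: eq_bigr => i _; rewrite exprD wc omegaN // expr1n rmorph1; ring.
  by rewrite modulusM modulus_rc ger0_norm ?exprn_ge0 // exprMn -exprM mulnC.
have q1 : r ^+ (2 * N) < 1 by rewrite exprn_ilt1 // -lt0n muln_gt0.
have step M : szego_part w (N + M) v <= E + r ^+ (2 * N) * szego_part w M v.
  rewrite /szego_part big_split_ord /=; apply: lerD; first exact: D_lt.
  by rewrite mulr_sumr; apply: ler_sum => m _; rewrite -/(D _) -/(D _) shift.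
have lim1 : szego_form w v <= E + r ^+ (2 * N) * szego_form w v.
  apply: (cvgr_to_le (@szego_part_cvg _ w w1 v)); exists N => // M /= NM.
  rewrite -(subnKC NM); apply: le_trans (step _) _; rewrite lerD2l.
  by apply: ler_wpM2l; [rewrite exprn_ge0|exact: szego_part_le].
by rewrite -mulr_suml mulrA -/E ler_pdivlMr ?subr_gt0 //; move: lim1; lra.
Qed.

(** Multiplication by h after composition with phi is contractive for the
    averages over equally spaced points; this is the dual form of the kernel
    inequality. *)
Lemma avg_contract F (f : nat -> C) (A : R) (N : nat) r : pser F f ->
  (forall n, \sum_(k < n) modulus (f k) ^+ 2 <= A) -> (0 < N)%N -> 0 <= r -> r < 1 ->
  avg (fun z => h z * F (phi z)) (rc r) N <= A / (1 - r ^+ (2 * N)).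
Proof.
move=> Ff fA N0 r0 r1; set w := (fun i : 'I_N => rc r * omega R N ^+ i).
have w1 i : modulus (w i) < 1.
  by rewrite /w modulusM modulus_omegaX // mulr1 modulus_rc ger0_norm.
have A0 : 0 <= A by have := fA 0; rewrite big_ord0.
pose G z := h z * F (phi z).
set E := avg _ _ _.
have Np : 0 < N%:R :> R by rewrite ltr0n.
pose v (i : 'I_N) : C := rc (N%:R^-1) * G (w i).
have EE : N%:R * \sum_i modulus (v i) ^+ 2 = E.
  rewrite /E /avg !mulr_sumr; apply: eq_bigr => i _.
  rewrite /v modulusM modulus_rc ger0_norm ?invr_ge0 // exprMn /G /w.
  by rewrite mulrA; congr (_ * _); field; rewrite gt_eqF.
have E0 : 0 <= E by rewrite -EE mulr_ge0 // sumr_ge0 // => i _; rewrite sqr_ge0.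
have q1 : r ^+ (2 * N) < 1 by rewrite exprn_ilt1 // -lt0n muln_gt0.
have Qv : szego_form w v <= E / (1 - r ^+ (2 * N)).
  by have := szego_form_circle v N0 r0 r1; rewrite -mulr_suml mulrA EE.
pose c k := \sum_i v i * (h (w i))^* * (phi (w i))^* ^+ k.
have pw i : modulus (phi (w i)) < 1.
  by apply: le_lt_trans (w1 i); apply: phi_le.
have cE : (fun n => \sum_(k < n) (f k)^* * c k) @ \oo --> rc E.
  have -> : rc E = \sum_i v i * (h (w i))^* * (F (phi (w i)))^*.
    rewrite -EE rcM rc_nat rc_sum mulr_sumr; apply: eq_bigr => i _.
    rewrite -mul_conj {2}/v rmorphM /= conj_rc rcV rc_nat /G rmorphM /=.
    by field; rewrite -(rc_nat R) -modulus_gt0 modulus_rc gtr0_norm.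
  have -> : (fun n => \sum_(k < n) (f k)^* * c k) =
     (fun n => \sum_i v i * (h (w i))^* * (series (fun k => f k * phi (w i) ^+ k) n)^*).
    apply/funext => n; under eq_bigr do rewrite /c mulr_sumr.
    rewrite exchange_big; apply: eq_bigr => i _.
    have -> : (series (fun k => f k * phi (w i) ^+ k) n)^* = \sum_(k < n) (f k)^* * (phi (w i))^* ^+ k.
      by rewrite seriesCE rmorph_sum; apply: eq_bigr => k _; rewrite rmorphM rmorphXn.
    by rewrite mulr_sumr; apply: eq_bigr => k _ /=; ring.
  apply: (@cvg_Csum _ (fun n i => v i * (h (w i))^* * (series (fun k => f k * phi (w i) ^+ k) n)^*)) => i.
  have c1 : (fun _ : nat => v i * (h (w i))^*) @ \oo --> v i * (h (w i))^* by exact: cvg_cst.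
  have c2 : (fun n => (series (fun k => f k * phi (w i) ^+ k) n)^*) @ \oo --> (F (phi (w i)))^*.
    have c3 : series (fun k => f k * phi (w i) ^+ k) @ \oo --> F (phi (w i)) by exact: Ff.
    apply/cvgCP => e e0; have /cvgCP/(_ _ e0) := c3.
    by apply: filterS => n; rewrite -rmorphB modulus_conj.
  exact: (cvgM c1 c2).
have bound n : modulus (\sum_(k < n) (f k)^* * c k) ^+ 2 <= A * (E / (1 - r ^+ (2 * N))).
  have := @modulus_sum_sq_le 'I_n (fun=> 1) (fun k => (f k)^*) (fun k => c k) (fun=> ler01).
  under eq_bigr do rewrite rc1 mul1r.
  move=> hcs; apply: le_trans hcs _; apply: ler_pM.
  - by apply: sumr_ge0 => k _; rewrite mulr_ge0 ?sqr_ge0.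
  - by apply: sumr_ge0 => k _; rewrite mulr_ge0 ?sqr_ge0.
  - by under eq_bigr do rewrite mul1r modulus_conj; exact: fA.
  - under eq_bigr do rewrite mul1r.
    by apply: le_trans Qv; exact: (szego_form_iter w1 beta_le).
have cm : (fun n => modulus (\sum_(k < n) (f k)^* * c k) ^+ 2) @ \oo --> E ^+ 2.
  have c1 : (fun n => modulus (\sum_(k < n) (f k)^* * c k)) @ \oo --> E.
    have -> : E = modulus (rc E) by rewrite modulus_rc ger0_norm.
    by apply: cvg_modulus; exact: cE.
  under eq_fun do rewrite expr2.
  rewrite expr2; exact: (cvgM c1 c1).
have h2 : E ^+ 2 <= A * (E / (1 - r ^+ (2 * N))).
  by apply: (cvgr_to_le cm); near=> n.
have [Ep|] := ltP 0 E; last by move=> En; apply: le_trans En _; rewrite divr_ge0 // subr_ge0 ltW.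
by move: h2; rewrite expr2 [A * _]mulrCA (ler_pM2l Ep).
Unshelve. all: by end_near. Qed.

(** Cauchy's inequality against the tail of a geometric series. *)
Lemma pser_small F (f : nat -> C) (A rho : R) m z : pser F f ->
  (forall n, \sum_(k < n) modulus (f k) ^+ 2 <= A) -> (forall k, (k < m)%N -> f k = 0) ->
  0 <= rho -> rho < 1 -> modulus z <= rho ->
  modulus (F z) ^+ 2 <= A * (rho ^+ (2 * m) / (1 - rho ^+ 2)).
Proof.
move=> Ff fA f0 rho0 rho1 zr; have z1 := le_lt_trans zr rho1.
have s1 : rho ^+ 2 < 1 by rewrite exprn_ilt1.
have sp : 0 < 1 - rho ^+ 2 by rewrite subr_gt0.
have cm : (fun n => modulus (\sum_(k < n) f k * z ^+ k) ^+ 2) @ \oo --> modulus (F z) ^+ 2.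
  have c1 : (fun n => modulus (\sum_(k < n) f k * z ^+ k)) @ \oo --> modulus (F z).
    have -> : (fun n => modulus (\sum_(k < n) f k * z ^+ k)) =
      (fun n => modulus (series (fun k => f k * z ^+ k) n)).
      by apply/funext => n; rewrite seriesCE.
    by apply: cvg_modulus; exact: Ff.
  under eq_fun do rewrite expr2.
  rewrite expr2; exact: (cvgM c1 c1).
apply: (cvgr_to_le cm); exists m => // n /= mn.
have -> : \sum_(k < n) f k * z ^+ k =
    \sum_(k < n) rc 1 * (f k * (if (m <= k)%N then z ^+ k else 0)).
  apply: eq_bigr => k _; rewrite rc1 mul1r; case: leqP => // km.
  by rewrite f0 // !mul0r.
apply: le_trans (@modulus_sum_sq_le 'I_n (fun=> 1) _ _ (fun=> ler01)) _.
apply: ler_pM.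
- by apply: sumr_ge0 => k _; rewrite mulr_ge0 ?sqr_ge0.
- by apply: sumr_ge0 => k _; rewrite mulr_ge0 ?sqr_ge0.
- by under eq_bigr do rewrite mul1r; exact: fA.
have g0 k : 0 <= 1 * modulus (if (m <= k)%N then z ^+ k else 0) ^+ 2.
  by rewrite mul1r sqr_ge0.
rewrite -(big_mkord xpredT (fun k => 1 * modulus (if (m <= k)%N then z ^+ k else 0) ^+ 2)).
rewrite (big_cat_nat _ mn) //= big_nat big1 ?add0r => [|k /andP[_ km]]; last first.
  by rewrite ifN -?ltnNge // modulus0 expr0n /= mulr0.
rewrite -{1}(add0n m) big_addn ler_pdivlMr // mulr_suml.
apply: le_trans (_ : \sum_(0 <= k < n - m) rho ^+ (2 * m) * ((rho ^+ 2) ^+ k - (rho ^+ 2) ^+ k.+1) <= _).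
  apply: ler_sum => k _; rewrite leq_addl mul1r modulusX.
  have -> : (rho ^+ 2) ^+ k - (rho ^+ 2) ^+ k.+1 = (rho ^+ 2) ^+ k * (1 - rho ^+ 2).
    by rewrite [_ ^+ k.+1]exprSr; ring.
  rewrite mulrA; apply: ler_wpM2r; first exact: ltW.
  rewrite -!exprM -exprD -mulnDr (mulnC _ 2) (addnC k); apply: le_pow => //.
rewrite -mulr_sumr ler_piMr ?exprn_ge0 // -[leRHS](expr0 (rho ^+ 2)).
have -> : \sum_(0 <= k < n - m) (rho ^+ 2 ^+ k - rho ^+ 2 ^+ k.+1) =
    - \sum_(0 <= k < n - m) (rho ^+ 2 ^+ k.+1 - rho ^+ 2 ^+ k).
  by rewrite -sumrN; apply: eq_bigr => k _; rewrite opprB.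
by rewrite telescope_sumr // opprB gerBl exprn_ge0 // exprn_ge0.
Qed.

(** At each sample point either the multiplier exceeds K, or the symbol lies in
    the disc of radius rho, where F is small. *)
Lemma hardy_mean F (f b : nat -> C) (A K rho : R) m r : pser F f ->
  (forall n, \sum_(k < n) modulus (f k) ^+ 2 <= A) -> (forall k, (k < m)%N -> f k = 0) ->
  0 < K -> 0 <= rho -> rho < 1 ->
  (forall z, modulus z < 1 -> K <= modulus (h z) \/ modulus (phi z) <= rho) ->
  pser (fun z => F (phi z)) b -> 0 <= r -> r < 1 ->
  M2 b (r ^+ 2) <= A * (K ^- 2 + rho ^+ (2 * m) / (1 - rho ^+ 2)).
Proof.
move=> Ff fA f0 K0 rho0 rho1 hK Gb r0 r1.
have A0 : 0 <= A by have := fA 0; rewrite big_ord0.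
have sp : 0 < 1 - rho ^+ 2 by rewrite subr_gt0 exprn_ilt1.
set B := A * (rho ^+ (2 * m) / (1 - rho ^+ 2)).
have B0 : 0 <= B by rewrite mulr_ge0 // divr_ge0 ?exprn_ge0 // ltW.
have rr := rc_lt1 r0 r1.
have c1 : avg (fun z => F (phi z)) (rc r) @ \oo --> M2 b (r ^+ 2).
  by have := parseval Gb rr; rewrite modulus_rc ger0_norm.
have c2 : (fun N => K ^- 2 * (A / (1 - (r ^+ 2) ^+ N)) + B) @ \oo --> A * (K ^- 2 + rho ^+ (2 * m) / (1 - rho ^+ 2)).
  have -> : A * (K ^- 2 + rho ^+ (2 * m) / (1 - rho ^+ 2)) = K ^- 2 * (A / (1 - 0)) + B.
    by rewrite subr0 divr1 /B mulrDr mulrC.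
  have d1 : (fun _ : nat => K ^- 2) @ \oo --> K ^- 2 by exact: cvg_cst.
  have d2 : (fun _ : nat => A) @ \oo --> A by exact: cvg_cst.
  have d3 : (fun _ : nat => B) @ \oo --> B by exact: cvg_cst.
  have d4 : (fun _ : nat => (1 : R)) @ \oo --> (1 : R) by exact: cvg_cst.
  have d5 : (fun N => (r ^+ 2) ^+ N) @ \oo --> (0 : R).
    by apply: cvg_expr; rewrite ger0_norm ?exprn_ge0 // exprn_ilt1.
  have n0 : (1 - 0 : R) != 0 by rewrite subr0 oner_neq0.
  exact: (cvgD (cvgM d1 (cvgM d2 (cvgV n0 (cvgB d4 d5)))) d3).
apply: (ler_cvg_to c1 c2); exists 1%N => // N /= N0.
have := avg_contract Ff fA N0 r0 r1; rewrite exprM => hc.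
apply: le_trans (_ : K ^- 2 * avg (fun z => h z * F (phi z)) (rc r) N + B <= _); last first.
  by rewrite lerD2r ler_wpM2l // invr_ge0 exprn_ge0 // ltW.
have Np : 0 < N%:R :> R by rewrite ltr0n.
have -> : B = N%:R^-1 * \sum_(j < N) B.
  by rewrite sumr_const card_ord -[B *+ N]mulr_natl mulKf // gt_eqF.
rewrite /avg [K ^- 2 * _]mulrCA -mulrDr [K ^- 2 * _]mulr_sumr -big_split /=.
apply: ler_wpM2l; first by rewrite invr_ge0 ltW.
apply: ler_sum => j _; set z := rc r * omega R N ^+ j.
have z1 : modulus z < 1 by rewrite /z modulusM modulus_omegaX // mulr1.
have [hz|pz] := hK z z1.
  apply: le_trans (_ : K ^- 2 * modulus (h z * F (phi z)) ^+ 2 <= _); last by rewrite lerDl.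
  rewrite modulusM exprMn mulrA ler_peMl ?sqr_ge0 //.
  by rewrite -exprVn -exprMn exprn_ege1 // mulrC ler_pdivlMr // mul1r.
apply: le_trans (pser_small Ff fA f0 rho0 rho1 pz) _.
by rewrite lerDr mulr_ge0 ?sqr_ge0 // invr_ge0 exprn_ge0 // ltW.
Qed.

End Average.

(** Near the point 1 the summands of the multiplier are close to beta p j / t j. *)
Lemma hsum_large J0 (beta delta : R) z : 0 <= beta -> modulus z < 1 ->
  (forall j, (j < J0)%N -> delta <= t j / 4) -> modulus (1 - z) <= delta ->
  beta * (\sum_(j < J0) p j / t j) / 4 <= modulus (hsum J0 beta z).
Proof.
move=> b0 z1 dt zd; apply: le_trans (le_trans (ler_norm _) (le_re _)).
rewrite /hsum re_sum mulr_sumr mulr_suml; apply: ler_sum => j _.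
have dj := le_trans zd (dt j (ltn_ord j)).
have e : 1 - a j * z = rc (t j) + a j * (1 - z) by rewrite rcB rc1; ring.
have a0 : 0 <= 1 - t j by rewrite subr_ge0.
have a1 : 1 - t j <= 1 by rewrite gerBl ltW.
have m0 := modulus_ge0 (1 - z).
have am : (1 - t j) * modulus (1 - z) <= modulus (1 - z) by rewrite ler_piMl.
have h1 : modulus (1 - a j * z) <= t j * 5 / 4.
  rewrite e; apply: le_trans (le_modulusD _ _) _.
  rewrite modulusM !modulus_rc gtr0_norm // ger0_norm //.
  by move: dj am; lra.
have h2 : t j * 3 / 4 <= re (1 - a j * z).
  rewrite e reD re_rc reZ.
  have h3 : - modulus (1 - z) <= (1 - t j) * re (1 - z).
    rewrite lerNl; apply: le_trans am; rewrite -mulrN ler_wpM2l //.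
    by apply: le_trans (le_re _); rewrite -normrN ler_norm.
  by move: dj h3; lra.
have D0 : 0 < modulus (1 - a j * z) by rewrite modulus_gt0 chi_den0.
rewrite reZ reV.
have -> : beta * (p j / t j) / 4 = beta * p j * ((4 * t j)^-1) by field; rewrite gt_eqF.
apply: ler_wpM2l; first by rewrite mulr_ge0.
have tj := t_gt0 j.
rewrite ler_pdivlMr ?exprn_gt0 // mulrC ler_pdivrMr ?mulr_gt0 //.
apply: le_trans (_ : (t j * 5 / 4) ^+ 2 <= _); first by apply: le_pow => //; exact: ltW.
apply: le_trans (_ : t j * 3 / 4 * (4 * t j) <= _); last by apply: ler_wpM2r => //; rewrite mulr_ge0 // ltW.
have : 0 <= t j * t j by rewrite mulr_ge0 // ltW.
by rewrite expr2; lra.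
Qed.

(** Partial sums at radius 1 are limits of partial sums at smaller radii. *)
Lemma M2part_limit b n (A : R) : (forall r, 0 <= r -> r < 1 -> M2part b (r ^+ 2) n <= A) ->
  \sum_(k < n) modulus (b k) ^+ 2 <= A.
Proof.
move=> bound.
have c : (fun i => M2part b (rho_ R i ^+ 2) n) @ \oo --> \sum_(k < n) modulus (b k) ^+ 2.
  have -> : \sum_(k < n) modulus (b k) ^+ 2 = \sum_(k < n) modulus (b k) ^+ 2 * (1 ^+ 2) ^+ k.
    by apply: eq_bigr => k _; rewrite !expr1n mulr1.
  apply: (@cvg_rsum R (fun i k => modulus (b k) ^+ 2 * (rho_ R i ^+ 2) ^+ k) (fun k => modulus (b k) ^+ 2 * (1 ^+ 2) ^+ k)) => k.
  have c1 : (fun _ : nat => modulus (b k) ^+ 2) @ \oo --> modulus (b k) ^+ 2 by exact: cvg_cst.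
  have c3 l : (fun i => rho_ R i ^+ l) @ \oo --> (1 : R) ^+ l.
    elim: l => [|l IH]; first by exact: cvg_cst.
    under eq_fun do rewrite exprS.
    rewrite exprS; exact: (cvgM (@rho_cvg R) IH).
  under eq_fun do rewrite -exprM.
  rewrite -exprM; exact: (cvgM c1 (c3 _)).
apply: (cvgr_to_le c); near=> i; apply: bound; last exact: rho_lt1.
by apply: ltW; exact: rho_gt0.
Unshelve. all: by end_near. Qed.

(** Near the point 1 the multiplier is large, so that composition is small
    there; away from 1 the symbol stays in a smaller disc, where functions
    vanishing to high order at 0 are small. *)
Theorem hardy_small (eta : R) : (forall K : R, exists J, K <= \sum_(j < J) p j / t j) ->
  (exists2 j, 0 < p j & t j < 1) -> 0 < eta ->
  exists m, forall F (f b : nat -> C) (A : R), pser F f ->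
    (forall n, \sum_(k < n) modulus (f k) ^+ 2 <= A) -> (forall k, (k < m)%N -> f k = 0) ->
    pser (fun z => F (phi z)) b -> forall n, \sum_(k < n) modulus (b k) ^+ 2 <= eta * A.
Proof.
move=> hdiv [j pj tj] eta0.
pose Z0 := 32 / eta; have Z0p : 0 < Z0 by rewrite divr_gt0.
have [J0 hJ] := hdiv Z0; set Z := \sum_(j < J0) p j / t j in hJ.
have Zp : 0 < Z by exact: lt_le_trans hJ.
pose s := Num.sqrt Z; have sp : 0 < s by rewrite sqrtr_gt0.
have s2 : s ^+ 2 = Z by rewrite sqr_sqrtr // ltW.
pose beta := s^-1; have b0 : 0 <= beta by rewrite invr_ge0 ltW.
have hb : beta ^+ 2 * Z <= 1 by rewrite /beta -s2 -exprMn mulVf ?expr1n // gt_eqF.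
pose delta := t J0 / 4; have d0 : 0 < delta by rewrite divr_gt0.
pose K := s / 4; have K0 : 0 < K by rewrite divr_gt0.
pose g := p j * ((1 - t j) * delta ^+ 2 / 8).
have g0 : 0 < g by rewrite !mulr_gt0 ?subr_gt0 ?exprn_gt0 // invr_gt0.
pose rho := Num.max 0 (1 - g).
have rho0 : 0 <= rho by rewrite le_max lexx.
have rho1 : rho < 1 by rewrite gt_max ltr01 gtrBl.
have hK z : modulus z < 1 -> K <= modulus (hsum J0 beta z) \/ modulus (phi z) <= rho.
  move=> z1; have [zd|zd] := lerP (modulus (1 - z)) delta.
    left; apply: le_trans (hsum_large b0 z1 _ zd).
      rewrite /K ler_pM2r ?invr_gt0 // /beta -/Z -s2 expr2 mulKf // gt_eqF //.
    by move=> i iJ; rewrite /delta ler_pM2r ?invr_gt0 // t_noninc // ltnW.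
  right; rewrite le_max; apply/orP; right.
  have h1 := phi_gap p_ge0 t_gt0 t_le1 p_sum j z1.
  have h2 := chi_gap t_gt0 t_le1 j z1.
  have h3 : g <= p j * (1 - modulus (chi j z)).
    apply: ler_wpM2l => //; apply: le_trans h2.
    rewrite ler_pM2r ?invr_gt0 // ler_wpM2l ?subr_ge0 //; apply: le_pow; exact: ltW.
  by move: h1 h3; lra.
have [m hm] : exists m, rho ^+ (2 * m) / (1 - rho ^+ 2) <= eta / 2.
  have q0 : 0 < 1 - rho ^+ 2 by rewrite subr_gt0 exprn_ilt1.
  have : (fun N => (rho ^+ 2) ^+ N) @ \oo --> (0 : R).
    by apply: cvg_expr; rewrite ger0_norm ?exprn_ge0 // exprn_ilt1.
  have e0 : 0 < eta / 2 * (1 - rho ^+ 2) by rewrite mulr_gt0 // divr_gt0.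
  move=> /cvgrPdist_le/(_ _ e0)[N _ hN]; exists N.
  have := hN N (leqnn N); rewrite /= sub0r normrN ger0_norm ?exprn_ge0 ?exprn_ge0 //.
  by rewrite ler_pdivrMr // exprM.
exists m => F f b A Ff fA f0 Gb n.
have A0 : 0 <= A by have := fA 0; rewrite big_ord0.
have bound r : 0 <= r -> r < 1 -> M2part b (r ^+ 2) n <= eta * A.
  move=> r0 r1; have t0' : 0 <= r ^+ 2 by rewrite exprn_ge0.
  have t1' : r ^+ 2 < 1 by rewrite exprn_ilt1.
  apply: le_trans (M2part_le n (pser_abs Gb) t0' t1') _.
  apply: le_trans (hardy_mean hb Ff fA f0 K0 rho0 rho1 hK Gb r0 r1) _.
  rewrite mulrC; apply: ler_wpM2r => //.
  have : K ^- 2 <= eta / 2.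
    have -> : K ^- 2 = 16 / Z by rewrite /K -s2; field; rewrite gt_eqF.
    rewrite ler_pdivrMr //; move: hJ; rewrite /Z0 ler_pdivrMr //; lra.
  by move: hm; lra.
by apply: M2part_limit => r; exact: bound.
Qed.

End Hardy.

(** * Composition operators on weighted coefficient spaces *)
Section Coefficients.
Variable R : realType.
Local Notation C := (cplx R).
Local Notation fns := (disk R -> C).
Implicit Types (f g : fns) (a b d : nat -> C) (F G : C -> C) (c : R) (m n k : nat).

Lemma in_disk (z : C) : modulus z < 1 -> `|z| < 1.
Proof. by rewrite normcE -(rc1 R) ltr_rc. Qed.

Lemma diskP (z : disk R) : modulus (val z) < 1.
Proof. by rewrite -ltr_rc -(normcE (val z)); exact: (valP z). Qed.

Definition mkdisk (z : C) (z1 : modulus z < 1) : disk R := exist _ z (in_disk z1).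

Definition res F : fns := fun z => F (val z).

Lemma ext_val f (z : disk R) : ext f (val z) = f z.
Proof. by rewrite /ext valK. Qed.

Lemma extE f z (z1 : modulus z < 1) : ext f z = f (mkdisk z1).
Proof. by rewrite -[z]/(val (mkdisk z1)) ext_val. Qed.

Lemma ext_res F z : modulus z < 1 -> ext (res F) z = F z.
Proof. by move=> z1; rewrite (extE _ z1). Qed.

Lemma pser_of F f a : pser F a -> (forall z, modulus z < 1 -> ext f z = F z) -> pser (ext f) a.
Proof. by move=> Fa h z z1; rewrite h //; exact: Fa. Qed.

Lemma power_seriesP f a : power_series f a <-> pser (ext f) a.
Proof.
split=> h z; first by move=> z1; rewrite (extE f z1); exact: (h (mkdisk z1)).
by have := h _ (diskP z); rewrite ext_val.
Qed.

Lemma taylorE f a : pser (ext f) a -> taylor f = a.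
Proof.
move=> fa; have h : power_series f (taylor f).
  by apply: (@getPex _ (power_series f)); exists a; apply/power_seriesP.
by apply: (@pser_unique R (ext f)) => //; apply/power_seriesP.
Qed.

Lemma analytic_pser f : analytic f -> pser (ext f) (taylor f).
Proof.
move=> fa; have h : hol (ext f).
  by move=> z z1; have := fa (mkdisk z1).
by have [a ha] := hol_pser h; rewrite (taylorE ha).
Qed.

Lemma pser_analytic f a : pser (ext f) a -> analytic f.
Proof. by move=> fa z; apply: (pser_hol fa); exact: diskP. Qed.

Lemma pser_lin (k : C) f g a b : pser (ext f) a -> pser (ext g) b ->
  pser (ext (k *: f + g)) (fun n => k * a n + b n).
Proof.
move=> fa gb; have h := pserD (pserZ (c := k) fa) gb; apply: (@pser_of _ _ _ h) => z z1.
by rewrite !(extE _ z1).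
Qed.

Lemma pser_sub f g a b : pser (ext f) a -> pser (ext g) b ->
  pser (ext (f - g)) (fun n => a n - b n).
Proof.
move=> fa gb; have h := pserB fa gb; apply: (@pser_of _ _ _ h) => z z1.
by rewrite !(extE _ z1).
Qed.

Variables (alpha : R) (w : nat -> R).
Hypothesis w_gt0 : forall n, 0 < w n.
Hypothesis w_noninc : forall n, w n.+1 <= w n.
Hypothesis w_lower : forall x : R, 0 <= x -> x < 1 -> exists2 e : R, 0 < e & forall n, e * x ^+ n <= w n.
Hypothesis normE : forall f a, pser (ext f) a ->
  bergman_norm alpha f = sqrte (\sum_(0 <= n <oo) (modulus (a n) ^+ 2 * w n)%:E)%E.

Local Notation H := (bergman_space alpha).
Local Notation N := (bergman_norm alpha).

(** Norms are handled through real bounds on the partial sums. *)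
Definition norm2_le a c := forall n, \sum_(k < n) modulus (a k) ^+ 2 * w k <= c.

Lemma norm2_le_term_ge0 a k : 0 <= modulus (a k) ^+ 2 * w k.
Proof. by rewrite mulr_ge0 ?sqr_ge0 // ltW. Qed.

Lemma norm2_le_ge0 a c : norm2_le a c -> 0 <= c.
Proof. by move=> /(_ 0); rewrite big_ord0. Qed.

Lemma norm2_le_weaken a c c' : c <= c' -> norm2_le a c -> norm2_le a c'.
Proof. by move=> cc h n; exact: le_trans (h n) cc. Qed.

Lemma norm2_le_normP f a c : pser (ext f) a -> 0 <= c -> norm2_le a (c ^+ 2) -> (N f <= c%:E)%E.
Proof.
move=> fa c0 h; rewrite (normE fa).
have -> : c%:E = sqrte (c ^+ 2)%:E by rewrite /sqrte /= sqrtr_sqr ger0_norm.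
rewrite lee_sqrt ?lee_fin ?sqr_ge0 //; apply: lime_le.
  by apply: is_cvg_ereal_nneg_natsum => k _; rewrite lee_fin norm2_le_term_ge0.
by near=> n; rewrite sumEFin lee_fin big_mkord; exact: h.
Unshelve. all: by end_near. Qed.

Lemma norm_norm2_le f a c : pser (ext f) a -> 0 <= c -> (N f <= c%:E)%E -> norm2_le a (c ^+ 2).
Proof.
move=> fa c0; rewrite (normE fa).
have -> : c%:E = sqrte (c ^+ 2)%:E by rewrite /sqrte /= sqrtr_sqr ger0_norm.
rewrite lee_sqrt ?lee_fin ?sqr_ge0 // => h n; rewrite -lee_fin; apply: le_trans h.
rewrite -sumEFin -(big_mkord xpredT (fun k => (modulus (a k) ^+ 2 * w k)%:E)).
by apply: nneseries_lim_ge => k _ _; rewrite lee_fin norm2_le_term_ge0.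
Qed.

Lemma normge0 f : (0 <= N f)%E.
Proof. exact: sqrte_ge0. Qed.

Lemma H_norm2_le f : H f -> exists2 c : R, 0 <= c & norm2_le (taylor f) (c ^+ 2).
Proof.
move=> [fa fN]; have ge := normge0 f.
have fin : N f \is a fin_num by rewrite ge0_fin_numE.
exists (fine (N f)); first exact: fine_ge0.
by apply: norm_norm2_le; [exact: analytic_pser|exact: fine_ge0|rewrite fineK].
Qed.

Lemma norm2_le_H f a c : pser (ext f) a -> norm2_le a c -> H f.
Proof.
move=> fa h; split; first exact: pser_analytic fa.
have c0 := norm2_le_ge0 h.
have : (N f <= (Num.sqrt c)%:E)%E by apply: norm2_le_normP fa _ _; rewrite ?sqrtr_ge0 // sqr_sqrtr.
by move=> h'; apply: le_lt_trans h' _; rewrite ltry.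
Qed.

Lemma norm2_le_coef a c n : norm2_le a c -> modulus (a n) ^+ 2 * w n <= c.
Proof.
move=> h; apply: le_trans (h n.+1); rewrite big_ord_recr /= lerDr.
by apply: sumr_ge0 => k _; exact: norm2_le_term_ge0.
Qed.

Lemma norm2_le_abs a c : norm2_le a c -> abs_coef a.
Proof.
move=> h; apply: bounded_abs_coef => r r0 r1.
have s1 : r ^+ 2 < 1 by rewrite exprn_ilt1 // ltW.
have [e e0 he] := w_lower (exprn_ge0 2 (ltW r0)) s1.
exists (1 + c / e) => n; set x := modulus (a n) * r ^+ n.
have h1 : x ^+ 2 <= c / e.
  rewrite ler_pdivlMr //; apply: le_trans (norm2_le_coef n h).
  rewrite /x exprMn -mulrA; apply: ler_wpM2l; first exact: sqr_ge0.
  by rewrite mulrC -exprM mulnC exprM.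
have : 0 <= (x - 1) ^+ 2 by exact: sqr_ge0.
by move: h1; rewrite !expr2; have := sqr_ge0 x; rewrite expr2; lra.
Qed.

Lemma norm2_le_exists a c : norm2_le a c -> exists f : fns, pser (ext f) a.
Proof.
move=> h; have [F Fa] := abs_coef_pser (norm2_le_abs h); exists (res F).
by apply: (@pser_of _ _ _ Fa) => z z1; rewrite ext_res.
Qed.

Lemma norm2_leD a b (c e : R) : norm2_le a c -> norm2_le b e -> norm2_le (fun n => a n + b n) (2 * c + 2 * e).
Proof.
move=> ha hb n.
apply: le_trans (_ : 2 * (\sum_(k < n) modulus (a k) ^+ 2 * w k) + 2 * (\sum_(k < n) modulus (b k) ^+ 2 * w k) <= _).
  rewrite !mulr_sumr -big_split /=; apply: ler_sum => k _.
  rewrite !mulrA -mulrDl; apply: ler_wpM2r; first exact: ltW.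
  apply: le_trans (_ : (modulus (a k) + modulus (b k)) ^+ 2 <= _).
    by apply: le_pow; [exact: modulus_ge0|exact: le_modulusD].
  by have := sqr_ge0 (modulus (a k) - modulus (b k)); rewrite !expr2; lra.
by have := ha n; have := hb n; lra.
Qed.

Lemma norm2_leZ (k : C) a c : norm2_le a c -> norm2_le (fun n => k * a n) (modulus k ^+ 2 * c).
Proof.
move=> ha n; apply: le_trans (ler_wpM2l (sqr_ge0 (modulus k)) (ha n)).
rewrite mulr_sumr; apply: ler_sum => i _.
by rewrite modulusM exprMn -mulrA.
Qed.

Lemma norm2_leB a b (c e : R) : norm2_le a c -> norm2_le b e -> norm2_le (fun n => a n - b n) (2 * c + 2 * e).
Proof.
move=> ha hb; have := norm2_leD ha (norm2_leZ (-1) hb).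
rewrite modulusN modulus1 expr1n mul1r.
have -> // : (fun n => a n + -1 * b n) = (fun n => a n - b n).
by apply/funext => n; rewrite mulN1r.
Qed.

Definition low m a n : C := if (n < m)%N then a n else 0.
Definition high m a n : C := if (n < m)%N then 0 else a n.

Lemma norm2_le_low m a c : norm2_le a c -> norm2_le (low m a) c.
Proof.
move=> h n; apply: le_trans (h n); apply: ler_sum => k _.
rewrite /low; case: ifP => // _; rewrite modulus0 expr0n /= mul0r; exact: norm2_le_term_ge0.
Qed.

Lemma norm2_le_high m a c : norm2_le a c -> norm2_le (high m a) c.
Proof.
move=> h n; apply: le_trans (h n); apply: ler_sum => k _.
rewrite /high; case: ifP => // _; rewrite modulus0 expr0n /= mul0r; exact: norm2_le_term_ge0.
Qed.

Lemma high0 m a k : (k < m)%N -> high m a k = 0.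
Proof. by rewrite /high => ->. Qed.

Lemma low_high m a n : a n = low m a n + high m a n.
Proof. by rewrite /low /high; case: ifP; rewrite ?addr0 ?add0r. Qed.

Lemma taylor_lin (k : C) f g : H f -> H g ->
  taylor (k *: f + g) = (fun n => k * taylor f n + taylor g n).
Proof. by move=> [fa _] [ga _]; apply: taylorE; apply: pser_lin; exact: analytic_pser. Qed.

Lemma H_lin (k : C) f g : H f -> H g -> H (k *: f + g).
Proof.
move=> hf hg; have [c _ hc] := H_norm2_le hf; have [c' _ hc'] := H_norm2_le hg.
have [fa _] := hf; have [ga _] := hg.
exact: (@norm2_le_H (k *: f + g) _ _ (@pser_lin k _ _ _ _ (analytic_pser fa) (analytic_pser ga)) (norm2_leD (norm2_leZ k hc) hc')).
Qed.

Lemma H0 : H 0.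
Proof.
have z : pser (ext (0 : fns)) (fun=> 0).
  have := @pser_poly R (fun=> 0) 0 (fun _ _ => erefl); apply: eq_pser => x x1.
  by rewrite big_ord0 (extE _ x1).
apply: (norm2_le_H z (c := 0)) => n; rewrite big1 // => k _.
by rewrite modulus0 expr0n /= mul0r.
Qed.

Lemma norm0 : (N (0%R : fns) <= 1%:E)%E.
Proof.
have z : pser (ext (0 : fns)) (fun=> 0).
  have := @pser_poly R (fun=> 0) 0 (fun _ _ => erefl); apply: eq_pser => x x1.
  by rewrite big_ord0 (extE _ x1).
apply: (norm2_le_normP z) => // n; rewrite big1 // => k _.
by rewrite modulus0 expr0n /= mul0r.
Qed.

Lemma opnorm_le (T : fns -> fns) c : 0 <= c ->
  (forall f, H f -> norm2_le (taylor f) 1 -> (N (T f) <= c%:E)%E) -> (opnorm H N T <= c%:E)%E.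
Proof.
move=> c0 h; apply: ge_ereal_sup => _ [f [Hf Nf] <-]; apply: h => //.
have [fa _] := Hf.
by have := @norm_norm2_le f (taylor f) 1 (analytic_pser fa) ler01 Nf; rewrite expr1n.
Qed.

Lemma opnorm_ge0 (T : fns -> fns) : (0 <= opnorm H N T)%E.
Proof.
apply: le_trans (normge0 (T 0)) _; apply: ereal_sup_ubound; exists 0 => //; split; first exact: H0.
exact: norm0.
Qed.

Lemma approx_ge0 (T : fns -> fns) n : (0 <= approx_number H N T n)%E.
Proof. by apply: le_ereal_inf_tmp => _ [S _ <-]; exact: opnorm_ge0. Qed.

Lemma ereal_cvg0 (u : nat -> \bar R) : (forall n, (0 <= u n)%E) ->
  (forall e : R, 0 < e -> \forall n \near \oo, (u n <= e%:E)%E) -> u @ \oo --> 0%E.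
Proof.
move=> u0 h; have fin : \forall n \near \oo, u n \is a fin_num.
  have := h 1 ltr01; apply: filterS => n hn; rewrite ge0_fin_numE //.
  by apply: le_lt_trans hn _; rewrite ltry.
apply/fine_cvgP; split => //; apply/cvgrPdist_le => e e0.
near=> n.
have hn : (u n <= e%:E)%E by near: n; exact: h.
have hf : u n \is a fin_num by near: n.
by rewrite sub0r normrN ger0_norm /= ?fine_ge0 // -lee_fin fineK.
Unshelve. all: by end_near. Qed.

Variables (phi : disk R -> disk R) (Phi : C -> C).
Hypothesis phiE : forall z, val (phi z) = Phi (val z).
Hypothesis self : selfmap Phi.
Hypothesis contr : forall F a b c, pser F a -> pser (fun z => F (Phi z)) b -> norm2_le a c -> norm2_le b c.
Hypothesis small : forall eta : R, 0 < eta -> exists m, forall F a b c, pser F a -> norm2_le a c ->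
  (forall k, (k < m)%N -> a k = 0) -> pser (fun z => F (Phi z)) b -> norm2_le b (eta * c).

Lemma ext_comp f z : modulus z < 1 -> ext (comp_op phi f) z = ext f (Phi z).
Proof.
move=> z1; rewrite (extE _ z1) /comp_op /= -ext_val; congr ext.
by rewrite phiE.
Qed.

Lemma pser_comp f a : pser (ext f) a -> exists2 b, pser (ext (comp_op phi f)) b &
  pser (fun z => ext f (Phi z)) b.
Proof.
move=> fa; have hh : hol (fun z => ext f (Phi z)) := @hol_comp R (ext f) Phi (pser_hol fa) self.
have [b hb] := hol_pser hh; exists b; last exact: hb.
by apply: (@pser_of _ _ _ hb) => z z1; rewrite ext_comp.
Qed.

Lemma comp_nb f a c : pser (ext f) a -> norm2_le a c ->
  exists2 b, pser (ext (comp_op phi f)) b & norm2_le b c.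
Proof. by move=> fa ha; have [b h1 h2] := pser_comp fa; exists b => //; exact: (contr fa h2). Qed.

Lemma comp_H f : H f -> H (comp_op phi f).
Proof.
move=> Hf; have [c _ hc] := H_norm2_le Hf; have [fa _] := Hf.
by have [b h1 h2] := comp_nb (analytic_pser fa) hc; exact: norm2_le_H h1 h2.
Qed.

Lemma comp_lin (k : C) f g : comp_op phi (k *: f + g) = k *: comp_op phi f + comp_op phi g.
Proof. by []. Qed.

Lemma comp_bounded : bounded_operator H N (comp_op phi).
Proof.
split; [exact: comp_H|by move=> k f g _ _; exact: comp_lin|].
apply: (@le_lt_trans _ _ 1%:E); last by rewrite ltry.
apply: opnorm_le => // f [fa _] h.
have [b h1 h2] := comp_nb (analytic_pser fa) h.
by apply: (norm2_le_normP h1) => //; rewrite expr1n.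
Qed.

Definition trunc m f : fns := fun z => \sum_(k < m) taylor f k * val z ^+ k.

Lemma trunc_pser m f : pser (ext (trunc m f)) (low m (taylor f)).
Proof.
have h : pser (fun z => \sum_(k < m) low m (taylor f) k * z ^+ k) (low m (taylor f)).
  by apply: pser_poly => n mn; rewrite /low ltnNge mn.
apply: (@pser_of _ _ _ h) => z z1.
by rewrite (extE _ z1) /trunc; apply: eq_bigr => k _; rewrite /low ltn_ord.
Qed.

Definition truncop m f : fns := comp_op phi (trunc m f).

Lemma truncop_bounded m : bounded_operator H N (truncop m).
Proof.
split.
- move=> f Hf; apply: comp_H; have [c _ hc] := H_norm2_le Hf.
  exact: (@norm2_le_H (trunc m f) _ _ (@trunc_pser m f) (norm2_le_low m hc)).
- move=> k f g Hf Hg; rewrite /truncop -comp_lin; congr comp_op; apply/funext => z.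
  rewrite /trunc taylor_lin //.
  transitivity (k * (\sum_(i < m) taylor f i * val z ^+ i) + \sum_(i < m) taylor g i * val z ^+ i) => //.
  by rewrite mulr_sumr -big_split; apply: eq_bigr => i _ /=; rewrite mulrDl mulrA.
- apply: (@le_lt_trans _ _ 1%:E); last by rewrite ltry.
  apply: opnorm_le => // f [fa _] h.
  have [b h1 h2] := comp_nb (@trunc_pser m f) (norm2_le_low m h).
  by apply: (norm2_le_normP h1) => //; rewrite expr1n.
Qed.

Lemma truncop_rank m n : (m < n)%N -> rank_lt H (truncop m) n.
Proof.
move=> mn; exists m, (fun i : 'I_m => (fun z => val (phi z) ^+ i) : fns); split => // f _.
exists (fun i : 'I_m => taylor f i); apply/funext => z.
rewrite fct_sumE; exact: eq_bigr.
Qed.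

(** The difference is composition restricted to functions vanishing to order m
    at 0. *)
Lemma truncop_close (e : R) : 0 < e -> exists m, (opnorm H N (fun f => (comp_op phi f - truncop m f)%R) <= e%:E)%E.
Proof.
move=> e0; have [m hm] := small (exprn_gt0 2 e0); exists m; apply: opnorm_le; first exact: ltW.
move=> f [fa _] h.
have -> : comp_op phi f - truncop m f = comp_op phi (f - trunc m f) by [].
have fp := pser_sub (analytic_pser fa) (@trunc_pser m f).
have E : (fun n => taylor f n - low m (taylor f) n) = high m (taylor f).
  by apply/funext => n; rewrite {1}(low_high m (taylor f) n) addrC addKr.
rewrite E in fp; have [b h1 h2] := pser_comp fp.
apply: (norm2_le_normP h1); first exact: ltW.
by rewrite -[X in norm2_le _ X]mulr1; apply: (hm _ _ _ _ fp (norm2_le_high m h) _ h2) => k; exact: high0.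
Qed.

Theorem approx_cvg0 : approx_number H N (comp_op phi) n @[n --> \oo] --> 0%E.
Proof.
apply: ereal_cvg0 => [n|e e0]; first exact: approx_ge0.
have [m hm] := truncop_close e0; exists m.+1 => // n /= mn.
apply: le_trans hm; apply: ereal_inf_lbound; exists (truncop m) => //; split.
  exact: truncop_bounded.
exact: truncop_rank.
Qed.

(** Bounded coefficient sequences have a common limit along an ultrafilter; an
    index approximating the first j limits within 1 / (j + 1) exists beyond any
    given one. *)
Lemma diagonal_subsequence (u : nat -> nat -> C) (B : nat -> R) :
  (forall k n, modulus (u k n) <= B n) ->
  exists (g : nat -> C) (s : nat -> nat), increasing_seq s /\
    (forall j n, (n < j)%N -> modulus (u (s j) n - g n) <= j.+1%:R^-1) /\
    (exists (U : set_system nat), ProperFilter U /\ forall n, u ^~ n @ U --> g n).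
Proof.
move=> uB; have [U [UU Uoo]] := ultraFilterLemma (@eventually_filter).
have real_lim (v : nat -> R) (b : R) : (forall k, `|v k| <= b) -> exists l : R, v @ U --> l.
  move=> vb.
  have PF : ProperFilter (v @ U) by exact: fmap_proper_filter.
  have mem : (v @ U) (`[- b, b]%classic).
    by apply: (@filterE _ U) => k /=; rewrite in_itv /= -ler_norml.
  have [l [_ hl]] := segment_compact PF mem.
  exists l => V Vl; have [//|hc] := in_ultra_setVsetC (v @^-1` V) UU.
  have [x [/= h1 h2]] := hl (~` V) V hc Vl; by [].
have /choice[g hg] : forall n, exists l : C, u ^~ n @ U --> l.
  move=> n.
  have [x hx] := real_lim (fun k => re (u k n)) (B n) (fun k => le_trans (le_re _) (uB k n)).
  have [y hy] := real_lim (fun k => im (u k n)) (B n) (fun k => le_trans (le_im _) (uB k n)).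
  by exists (mkC x y); apply: cvg_mkC.
have near_ j : U [set k | forall n, (n < j)%N -> modulus (u k n - g n) <= j.+1%:R^-1].
  have e0 : 0 < j.+1%:R^-1 :> R by rewrite invr_gt0.
  have h i : U [set k | forall n, (n < i)%N -> modulus (u k n - g n) <= j.+1%:R^-1].
    elim: i => [|i IH]; first by apply: filterE.
    have /cvgCP/(_ _ e0) hi := hg i.
    apply: filterS (filterI IH hi) => k [h1 h2] n; rewrite ltnS leq_eqVlt => /orP[/eqP->|/h1 //].
    by rewrite modulusB; exact: ltW.
  exact: h.
have /choice[sel hsel] : forall jK : nat * nat, exists k, (jK.2 <= k)%N /\
    forall n, (n < jK.1)%N -> modulus (u k n - g n) <= jK.1.+1%:R^-1.
  move=> [j K] /=.
  have hK : U [set k | (K <= k)%N] by apply: Uoo; exists K.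
  have [k [h1 h2]] : exists k, ([set k | (K <= k)%N] `&`
      [set k | forall n, (n < j)%N -> modulus (u k n - g n) <= j.+1%:R^-1]) k.
    by apply: (@filter_ex _ U); apply: filterI; [exact: hK|exact: near_].
  by exists k.
pose s := fix s (j : nat) := match j with O => sel (0%N, 0%N) | S i => sel (i.+1, (s i).+1) end.
exists g, s; split.
  by apply/increasing_seqP => n; have [h _] := hsel (n.+1, (s n).+1); rewrite ltEnat.
split; last by exists U; split => //; exact: ultra_proper.
by move=> j; case: j => [|j] n nj //; have [_ h] := hsel (j.+1, (s j).+1); exact: h.
Qed.

(** A bounded sequence has a subsequence whose coefficients converge. Along it
    the differences split into a part of degree below m, which tends to 0, and
    a part vanishing to order m, on which composition is small. *)
Theorem comp_compact : compact_operator H N (comp_op phi).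
Proof.
split; first exact: comp_bounded.
move=> u Hu [M hM].
have M0 : 0 <= M by have := le_trans (normge0 (u 0)) (hM 0); rewrite lee_fin.
pose al k := taylor (u k).
have pa k : pser (ext (u k)) (al k) by have [h _] := Hu k; exact: analytic_pser.
have na k : norm2_le (al k) (M ^+ 2) by exact: (norm_norm2_le (pa k) M0 (hM k)).
have bd k n : modulus (al k n) <= 1 + M ^+ 2 / w n.
  have : modulus (al k n) ^+ 2 <= M ^+ 2 / w n by rewrite ler_pdivlMr // norm2_le_coef.
  have := sqr_ge0 (modulus (al k n)); have := sqr_ge0 (modulus (al k n) - 1).
  by rewrite !expr2; lra.
have [g [s [sinc [sg [U [PU Ug]]]]]] := diagonal_subsequence bd.
exists s; split => //.
have ng : norm2_le g (M ^+ 2).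
  move=> n.
  have c : (fun k => \sum_(i < n) modulus (al k i) ^+ 2 * w i) @ U --> \sum_(i < n) modulus (g i) ^+ 2 * w i.
    have ci i : (fun k => modulus (al k i) ^+ 2 * w i) @ U --> modulus (g i) ^+ 2 * w i.
      have c1 : (fun k => modulus (al k i)) @ U --> modulus (g i).
        by apply: cvg_modulus; exact: Ug.
      have c2 : (fun _ : nat => w i) @ U --> w i by exact: cvg_cst.
      under eq_fun do rewrite expr2.
      rewrite expr2; exact: (cvgM (cvgM c1 c1) c2).
    elim: n => [|n IH].
      by under eq_fun do rewrite big_ord0; rewrite big_ord0; exact: cvg_cst.
    by under eq_fun do rewrite big_ord_recr; rewrite big_ord_recr; exact: (cvgD IH (ci n)).
  by apply: (cvgr_to_le c); apply: filterE => k; exact: na.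
have [G Gg] := norm2_le_exists ng.
exists (comp_op phi G); first by apply: comp_H; exact: norm2_le_H Gg ng.
apply: ereal_cvg0 => [k|e e0]; first exact: normge0.
pose eta := e ^+ 2 / (4 * (4 * M ^+ 2 + 1)).
have M2 : 0 <= M ^+ 2 by exact: sqr_ge0.
have Dp : 0 < 4 * (4 * M ^+ 2 + 1) by lra.
have eta0 : 0 < eta by rewrite divr_gt0 ?exprn_gt0.
have [m hm] := small eta0.
have e4 : 0 < e ^+ 2 / 4 by rewrite divr_gt0 ?exprn_gt0.
have q0 : 0 < e ^+ 2 / 4 / (m%:R * w 0 + 1).
  by rewrite divr_gt0 // ltr_wpDl // mulr_ge0 // ltW.
have /cvgrPdist_lt/(_ _ q0)[K _ hK] := @cvg_harmonic R.
exists (maxn K m) => // k /=; rewrite geq_max => /andP[Kk mk].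
have -> : comp_op phi (u (s k)) - comp_op phi G = comp_op phi (u (s k) - G) by [].
pose d n := al (s k) n - g n.
have pd : pser (ext (u (s k) - G)) d := pser_sub (pa (s k)) Gg.
have nd : norm2_le d (4 * M ^+ 2).
  by apply: norm2_le_weaken (norm2_leB (na (s k)) ng); lra.
have [F1 p1] := norm2_le_exists (norm2_le_low m nd); have [F2 p2] := norm2_le_exists (norm2_le_high m nd).
have [b1 _ h1] := pser_comp p1; have [b2 _ h2] := pser_comp p2.
have [b hb1 hb2] := pser_comp pd.
have bE : b = (fun n => b1 n + b2 n).
  apply: (@pser_unique R _ _ _ hb2); apply: (@eq_pser R _ _ _ _ (pserD h1 h2)) => z z1.
  have zz := self.2 z z1.
  have c1 := p1 _ zz; have c2 := p2 _ zz; have c3 := pd _ zz.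
  have c4 : series (fun n => d n * Phi z ^+ n) @ \oo --> ext F1 (Phi z) + ext F2 (Phi z).
    have -> : series (fun n => d n * Phi z ^+ n) =
       (fun N => series (fun n => low m d n * Phi z ^+ n) N + series (fun n => high m d n * Phi z ^+ n) N).
      apply/funext => n; rewrite !seriesCE -big_split /=; apply: eq_bigr => i _.
      by rewrite {1}(low_high m d i) mulrDl.
    exact: (cvgD c1 c2).
  exact: (@cvgC_unique R nat \oo _ _ _ _ c4 c3).
have nlow : norm2_le (low m d) (e ^+ 2 / 4).
  have hk := hK k Kk.
  rewrite /= sub0r normrN ger0_norm in hk; last by rewrite /harmonic /= invr_ge0.
  move=> n; apply: le_trans (_ : \sum_(i < m) k.+1%:R^-1 * w 0 <= _); last first.
    rewrite sumr_const card_ord -[X in X <= _]mulr_natl.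
    rewrite ltr_pdivlMr in hk; last by rewrite ltr_wpDl // mulr_ge0 // ltW.
    apply: ltW; apply: le_lt_trans hk; rewrite /harmonic /= mulrDr mulr1 mulrCA lerDl invr_ge0 //.
  have w0 i : w i <= w 0 by elim: i => // i; exact: le_trans (w_noninc i).
  have term i : (i < m)%N -> modulus (d i) ^+ 2 * w i <= k.+1%:R^-1 * w 0.
    move=> im; apply: ler_pM; rewrite ?sqr_ge0 ?(ltW (w_gt0 i)) //.
    have h := sg k i (leq_trans im mk).
    apply: le_trans (_ : k.+1%:R^-1 * k.+1%:R^-1 <= _).
      by rewrite expr2; apply: ler_pM => //; exact: modulus_ge0.
    by rewrite ler_piMl ?invr_ge0 // invf_le1 // ler1n.
  rewrite -(big_mkord xpredT (fun i => k.+1%:R^-1 * w 0)).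
  rewrite -(big_mkord xpredT (fun i => modulus (low m d i) ^+ 2 * w i)).
  have k0 : 0 <= k.+1%:R^-1 * w 0 by rewrite mulr_ge0 ?invr_ge0 // ltW.
  have [nm|mn] := leqP n m.
    rewrite [leRHS](big_cat_nat _ nm) //=; apply: le_trans (_ : \sum_(0 <= i < n) k.+1%:R^-1 * w 0 <= _); last first.
      by rewrite lerDl; apply: sumr_ge0.
    rewrite !big_nat; apply: ler_sum => i /andP[_ im]; rewrite /low (leq_trans im nm).
    by apply: term; exact: leq_trans im nm.
  rewrite (big_cat_nat _ (ltnW mn)) //= [X in _ + X](_ : _ = 0) ?addr0; last first.
    by rewrite big_nat big1 // => i /andP[mi _]; rewrite /low ifN -?leqNgt // modulus0 expr0n /= mul0r.
  by rewrite !big_nat; apply: ler_sum => i /andP[_ im]; rewrite /low im; exact: term.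
have nb1 := contr p1 h1 nlow.
have nb2 := hm _ _ _ _ p2 (norm2_le_high m nd) (fun k => @high0 m d k) h2.
apply: (norm2_le_normP hb1); first exact: ltW.
rewrite bE; apply: norm2_le_weaken (norm2_leD nb1 nb2).
have -> : eta * (4 * M ^+ 2) = e ^+ 2 / 4 * (4 * M ^+ 2 / (4 * M ^+ 2 + 1)).
  by rewrite /eta; field; rewrite gt_eqF //; lra.
have : e ^+ 2 / 4 * (4 * M ^+ 2 / (4 * M ^+ 2 + 1)) <= e ^+ 2 / 4.
  by rewrite ler_piMr ?(ltW e4) // ler_pdivrMr; lra.
lra.
Qed.

End Coefficients.

(** * Almost orthogonal reproducing kernels *)
Section Kernel.
Variable R : realType.
Local Notation C := (cplx R).
Implicit Types (x y : R) (m n k M : nat).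
Variable w : nat -> R.
Hypothesis w_gt0 : forall n, 0 < w n.
Hypothesis w_noninc : forall n, w n.+1 <= w n.
Hypothesis w_lower : forall x : R, 0 <= x -> x < 1 -> exists2 e : R, 0 < e & forall n, e * x ^+ n <= w n.
Variable D : R.
Hypothesis D_ge1 : 1 <= D.
Hypothesis w_doubling : forall n, w n <= D * w (2 * n).

Definition kterm x n : R := x ^+ n / w n.

(** Diagonal of the reproducing kernel of the weighted space. *)
Definition kap x : R := limn (series (kterm x)).

Lemma kterm_ge0 x n : 0 <= x -> 0 <= kterm x n.
Proof. by move=> x0; rewrite divr_ge0 ?exprn_ge0 // ltW. Qed.

Lemma kap_cvg x : 0 <= x -> x < 1 -> cvgn (series (kterm x)).
Proof.
move=> x0 x1; pose y := (1 + x) / 2.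
have y0 : 0 < y by rewrite /y; lra.
have y1 : y < 1 by rewrite /y; lra.
have xy : x < y by rewrite /y; lra.
have [e e0 he] := w_lower (ltW y0) y1.
apply: (@le_series_cvg R _ (fun n => e^-1 * (x / y) ^+ n)).
- by move=> n; exact: kterm_ge0.
- move=> n; rewrite /kterm expr_div_n mulrCA.
  apply: ler_wpM2l; first exact: exprn_ge0.
  by rewrite -invfM lef_pV2 ?posrE ?mulr_gt0 ?exprn_gt0.
- by apply: geometric_cvg; [rewrite divr_ge0 // ltW|rewrite ltr_pdivrMr // mul1r].
Qed.

Lemma kpart_le x M : 0 <= x -> x < 1 -> \sum_(n < M) kterm x n <= kap x.
Proof. by move=> x0 x1; apply: nneg_series_le_lim; [move=> n; exact: kterm_ge0|exact: kap_cvg]. Qed.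

Lemma kap_le x (B : R) : 0 <= x -> (forall M, \sum_(n < M) kterm x n <= B) -> kap x <= B.
Proof. by move=> x0 h; apply: nneg_series_lim_le => // n; exact: kterm_ge0. Qed.

Lemma kap_mono x y : 0 <= x -> x <= y -> y < 1 -> kap x <= kap y.
Proof.
move=> x0 xy y1; apply: kap_le => // M; apply: le_trans (kpart_le M (le_trans x0 xy) y1).
by apply: ler_sum => n _; rewrite /kterm ler_wpM2r ?invr_ge0 ?(ltW (w_gt0 _)) //; exact: le_pow.
Qed.

Lemma w_le0 n : w n <= w 0.
Proof. by elim: n => // n; exact: le_trans (w_noninc n). Qed.

(** The weights are at most w 0, so the kernel dominates a geometric series. *)
Lemma kap_large x : 0 <= x -> x < 1 -> (w 0 * (1 - x))^-1 <= kap x.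
Proof.
move=> x0 x1; have x1' : 0 < 1 - x by rewrite subr_gt0.
have h : (fun M => (w 0)^-1 * ((1 - x)^-1 * (1 - x ^+ M))) @ \oo --> (w 0)^-1 * ((1 - x)^-1 * (1 - 0)).
  have c1 : (fun _ : nat => (w 0)^-1) @ \oo --> (w 0)^-1 by exact: cvg_cst.
  have c2 : (fun _ : nat => (1 - x)^-1) @ \oo --> (1 - x)^-1 by exact: cvg_cst.
  have c3 : (fun _ : nat => (1 : R)) @ \oo --> (1 : R) by exact: cvg_cst.
  have c4 : (fun M => x ^+ M) @ \oo --> (0 : R) by apply: cvg_expr; rewrite ger0_norm.
  exact: (cvgM c1 (cvgM c2 (cvgB c3 c4))).
rewrite subr0 mulr1 -invfM in h; apply: (cvgr_to_le h); near=> M.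
apply: le_trans (kpart_le M x0 x1).
have -> : (1 - x)^-1 * (1 - x ^+ M) = \sum_(n < M) x ^+ n.
  apply: (mulfI (lt0r_neq0 x1')); rewrite mulVKf ?gt_eqF //.
  by rewrite -[1 in LHS](expr1n _ M) subrXX; congr (_ * _); apply: eq_bigr => i _; rewrite expr1n mul1r.
rewrite mulr_sumr; apply: ler_sum => n _; rewrite /kterm mulrC; apply: ler_wpM2l; first exact: exprn_ge0.
by rewrite lef_pV2 ?posrE // w_le0.
Unshelve. all: by end_near. Qed.

Lemma kap_gt0 x : 0 <= x -> x < 1 -> 0 < kap x.
Proof.
by move=> x0 x1; apply: lt_le_trans (kap_large x0 x1); rewrite invr_gt0 mulr_gt0 // subr_gt0.
Qed.

Lemma inv_w_doubling n : (w (2 * n))^-1 <= D / w n.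
Proof.
by rewrite ler_pdivlMr // mulrC ler_pdivrMr // w_doubling.
Qed.

(** By doubling, terms 2 n of the kernel at x are at most D times term n
    at x^2; terms of odd index 2 n + 1 are compared with the next even one, with
    a factor 2 as x >= 1/2. *)
Lemma kap_square x : 2^-1 <= x -> x < 1 -> kap x <= 3 * D * kap (x ^+ 2).
Proof.
move=> x2 x1; have x0 : 0 <= x by apply: le_trans x2; rewrite invr_ge0.
have s0 : 0 <= x ^+ 2 by rewrite exprn_ge0.
have s1 : x ^+ 2 < 1 by rewrite exprn_ilt1.
have D0 : 0 <= D by exact: le_trans D_ge1.
have even n : kterm x (2 * n) <= D * kterm (x ^+ 2) n.
  rewrite /kterm exprM mulrCA; apply: ler_wpM2l; first exact: exprn_ge0.
  exact: inv_w_doubling.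
have odd n : kterm x (2 * n).+1 <= 2 * D * kterm (x ^+ 2) n.+1.
  rewrite /kterm.
  apply: le_trans (_ : (2 * x ^+ (2 * n.+1)) * (w (2 * n.+1))^-1 <= _).
    apply: ler_pM; rewrite ?exprn_ge0 ?invr_ge0 ?(ltW (w_gt0 _)) //.
      have e1 : x ^+ (2 * n.+1) = x * x ^+ (2 * n).+1 by rewrite mulnS add2n exprS.
      by rewrite e1 mulrA ler_peMl ?exprn_ge0 //; move: x2; lra.
    by rewrite lef_pV2 ?posrE // mulnS; exact: w_noninc.
  rewrite -exprM -!mulrA ler_pM2l // mulrCA; apply: ler_wpM2l; first exact: exprn_ge0.
  exact: inv_w_doubling.
apply: kap_le => // M.
apply: le_trans (_ : \sum_(n < 2 * M) kterm x n <= _).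
  rewrite -!(big_mkord xpredT (kterm x)) [leRHS](@big_cat_nat _ _ _ M) //=; last by rewrite mul2n -addnn leq_addr.
  by rewrite lerDl; apply: sumr_ge0 => n _; exact: kterm_ge0.
have step : \sum_(n < 2 * M) kterm x n <=
    D * \sum_(n < M) kterm (x ^+ 2) n + 2 * D * \sum_(n < M) kterm (x ^+ 2) n.+1.
  elim: M => [|M IH]; first by rewrite muln0 !big_ord0 !mulr0 addr0.
  rewrite mulnS !add2n !big_ord_recr /=.
  have := even M; have := odd M; move: IH; lra.
apply: le_trans step _.
have h1 := kpart_le M s0 s1.
have h2 : \sum_(n < M) kterm (x ^+ 2) n.+1 <= kap (x ^+ 2).
  apply: le_trans (kpart_le M.+1 s0 s1); rewrite big_ord_recl /= lerDr; exact: kterm_ge0.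
have h3 := ler_wpM2l D0 h1; have h4 := ler_wpM2l D0 h2.
by move: h3 h4; lra.
Qed.

Lemma kap_iter q x : 0 <= x -> x < 1 -> 2^-1 <= x ^+ (2 ^ q) -> kap x <= (3 * D) ^+ q * kap (x ^+ (2 ^ q)).
Proof.
move=> x0 x1; elim: q => [|q IH] h; first by rewrite expr0 mul1r expn0 expr1.
have y0 : 0 <= x ^+ (2 ^ q) by rewrite exprn_ge0.
have y1 : x ^+ (2 ^ q) < 1 by rewrite exprn_ilt1 // -lt0n expn_gt0.
have e : x ^+ (2 ^ q.+1) = (x ^+ (2 ^ q)) ^+ 2 by rewrite expnSr exprM.
have h' : 2^-1 <= x ^+ (2 ^ q).
  by apply: le_trans h _; rewrite e expr2 ler_piMl // ltW.
apply: le_trans (IH h') _; rewrite exprSr -mulrA e; apply: ler_wpM2l.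
  by rewrite exprn_ge0 // mulr_ge0 // (le_trans _ D_ge1).
exact: kap_square.
Qed.

Section Family.
Variables (n : nat) (x : 'I_n -> R) (d : 'I_n -> C).
Hypothesis x_ge0 : forall i, 0 <= x i.
Hypothesis x_lt1 : forall i, x i < 1.
Hypothesis sep : forall i j, i != j ->
  kap (x i * x j) <= 2^-1 ^+ i.+1 * 2^-1 ^+ j.+1 * (Num.sqrt (kap (x i ^+ 2)) * Num.sqrt (kap (x j ^+ 2))).

(** Up to the weight, the m-th coefficient of the combination of the kernels at
    the points x i with coefficients d; energy is the squared norm that this
    combination would have if the kernels were orthogonal. *)
Definition moment m : C := \sum_i d i * rc (x i ^+ m).

Definition energy : R := \sum_i modulus (d i) ^+ 2 * kap (x i ^+ 2).

Lemma sq_dev (z : 'I_n -> C) :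
  `|modulus (\sum_i z i) ^+ 2 - \sum_i modulus (z i) ^+ 2| <=
  \sum_i \sum_(j | j != i) modulus (z i) * modulus (z j).
Proof.
have -> : `|modulus (\sum_i z i) ^+ 2 - \sum_i modulus (z i) ^+ 2| =
    modulus (\sum_i \sum_(j | j != i) z i * (z j)^*).
  rewrite -modulus_rc rcB rc_sum -mul_conj; congr modulus.
  rewrite rmorph_sum mulr_suml -sumrB; apply: eq_bigr => i _.
  by rewrite mulr_sumr (bigD1 i) //= mul_conj [LHS]addrC addKr.
apply: le_trans (le_modulus_sum _ _ _) _; apply: ler_sum => i _.
apply: le_trans (le_modulus_sum _ _ _) _; apply: ler_sum => j _.
by rewrite modulusM modulus_conj.
Qed.

Lemma half_sum k : \sum_(i < k) (2^-1 : R) ^+ i.+1 ^+ 2 <= 3^-1.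
Proof.
suff : \sum_(i < k) (2^-1 : R) ^+ i.+1 ^+ 2 = 3^-1 * (1 - ((2^-1) ^+ k) ^+ 2).
  by move=> ->; rewrite ler_piMr ?invr_ge0 // gerBl sqr_ge0.
elim: k => [|k IH]; first by rewrite big_ord0 expr0 expr1n subrr mulr0.
rewrite big_ord_recr /= IH [2^-1 ^+ k.+1]exprS.
by move: (2^-1 ^+ k) => y; field.
Qed.

(** The separation hypothesis makes the matrix of normalised inner products
    differ from the identity by a matrix with rank one bound u u^T, where u has
    squared length at most 1/3. *)
Lemma offdiag_le : \sum_i \sum_(j | j != i) modulus (d i) * modulus (d j) * kap (x i * x j) <=
  3^-1 * energy.
Proof.
pose u i := modulus (d i) * Num.sqrt (kap (x i ^+ 2)).
have u0 i : 0 <= u i by rewrite mulr_ge0 ?modulus_ge0 ?sqrtr_ge0.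
have h0 i : 0 <= (2^-1 : R) ^+ i by rewrite exprn_ge0 // invr_ge0.
apply: le_trans (_ : (\sum_(i < n) (1 : R) * ((2^-1 : R) ^+ i.+1 * u i)) ^+ 2 <= _).
  rewrite expr2 mulr_suml; apply: ler_sum => i _; rewrite mulr_sumr.
  rewrite [leRHS](bigD1 i) //=; apply: le_trans (_ : \sum_(j | j != i) (1 * ((2^-1 : R) ^+ i.+1 * u i)) * (1 * ((2^-1 : R) ^+ j.+1 * u j)) <= _); last first.
    by rewrite lerDr !mulr_ge0.
  apply: ler_sum => j ji; rewrite eq_sym in ji.
  apply: le_trans (ler_wpM2l _ (sep ji)) _; first by rewrite mulr_ge0 ?modulus_ge0.
  rewrite le_eqVlt; apply/orP; left; apply/eqP; rewrite /u; ring.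
apply: le_trans (cauchy_schwarz _ _ (fun=> ler01)) _.
apply: ler_pM; try by apply: sumr_ge0 => i _; rewrite mul1r sqr_ge0.
  by under eq_bigr do rewrite mul1r; exact: half_sum.
apply: ler_sum => i _; rewrite mul1r /u exprMn sqr_sqrtr //.
by apply: ltW; apply: kap_gt0; rewrite ?exprn_ge0 // exprn_ilt1.
Qed.

Definition kpart m y : R := \sum_(k < m) kterm y k.

Lemma moment_dev M :
  `|\sum_(m < M) modulus (moment m) ^+ 2 / w m - \sum_i modulus (d i) ^+ 2 * kpart M (x i ^+ 2)| <=
  3^-1 * energy.
Proof.
apply: le_trans offdiag_le.
have -> : \sum_i modulus (d i) ^+ 2 * kpart M (x i ^+ 2) =
    \sum_(m < M) (\sum_i modulus (d i * rc (x i ^+ m)) ^+ 2) / w m.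
  rewrite /kpart; under eq_bigr do rewrite mulr_sumr.
  rewrite exchange_big; apply: eq_bigr => m _; rewrite mulr_suml; apply: eq_bigr => i _.
  by rewrite modulusM modulus_rc ger0_norm ?exprn_ge0 // exprMn /kterm -!exprM mulnC !mulrA.
rewrite -sumrB; apply: le_trans (ler_norm_sum _ _ _) _.
apply: le_trans (_ : \sum_(m < M) \sum_i \sum_(j | j != i) modulus (d i) * modulus (d j) * kterm (x i * x j) m <= _).
  apply: ler_sum => m _; rewrite -mulrBl normrM (ger0_norm (_ : 0 <= (w m)^-1)) ?invr_ge0 ?(ltW (w_gt0 _)) //.
  apply: le_trans (ler_wpM2r _ (sq_dev _)) _; first by rewrite invr_ge0 ltW.
  rewrite mulr_suml; apply: ler_sum => i _; rewrite mulr_suml; apply: ler_sum => j _.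
  rewrite !modulusM !modulus_rc !ger0_norm ?exprn_ge0 // /kterm exprMn.
  by rewrite le_eqVlt; apply/orP; left; apply/eqP; ring.
rewrite exchange_big; apply: ler_sum => i _; rewrite exchange_big; apply: ler_sum => j _.
rewrite -mulr_sumr; apply: ler_wpM2l; first by rewrite mulr_ge0 ?modulus_ge0.
apply: kpart_le; first by rewrite mulr_ge0.
by apply: mulr_ilt1.
Qed.

Lemma moment_upper M : \sum_(m < M) modulus (moment m) ^+ 2 / w m <= 4 / 3 * energy.
Proof.
have h := moment_dev M; rewrite ler_norml in h; have /andP[_ h1] := h.
have h2 : \sum_i modulus (d i) ^+ 2 * kpart M (x i ^+ 2) <= energy.
  apply: ler_sum => i _; apply: ler_wpM2l; first exact: sqr_ge0.
  by apply: kpart_le; rewrite ?exprn_ge0 // exprn_ilt1.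
by move: h1 h2; lra.
Qed.

Lemma moment_lower (G : R) :
  (fun M => \sum_(m < M) modulus (moment m) ^+ 2 / w m) @ \oo --> G -> 2 / 3 * energy <= G.
Proof.
move=> hG.
have hE : (fun M => \sum_i modulus (d i) ^+ 2 * kpart M (x i ^+ 2)) @ \oo --> energy.
  rewrite /energy /index_enum; elim: (locked_with _ _) => [|i s IH].
    by under eq_fun do rewrite big_nil; rewrite big_nil; exact: cvg_cst.
  under eq_fun do rewrite big_cons; rewrite big_cons.
  have c : (fun _ : nat => modulus (d i) ^+ 2) @ \oo --> modulus (d i) ^+ 2 by exact: cvg_cst.
  have k : (fun M => kpart M (x i ^+ 2)) @ \oo --> kap (x i ^+ 2).
    have -> : (fun M => kpart M (x i ^+ 2)) = series (kterm (x i ^+ 2)).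
      by apply/funext => M; rewrite seriesE.
    by apply: kap_cvg; rewrite ?exprn_ge0 // exprn_ilt1.
  exact: (cvgD (cvgM c k) IH).
have c3 : (fun _ : nat => 3^-1 * energy) @ \oo --> 3^-1 * energy by exact: cvg_cst.
have h : (fun M => \sum_i modulus (d i) ^+ 2 * kpart M (x i ^+ 2) - 3^-1 * energy) @ \oo --> energy - 3^-1 * energy.
  exact: (cvgB hE c3).
have : energy - 3^-1 * energy <= G.
  apply: (ler_cvg_to h hG); near=> M.
  have := moment_dev M; rewrite ler_norml => /andP[h1 _].
  rewrite lerBlDr -lerBlDl; move: h1; rewrite lerNl opprB; lra.
lra.
Unshelve. all: by end_near. Qed.

End Family.

End Kernel.

Lemma sqr_half (R : realType) : (2^-1 : R) ^+ 2 = 4^-1.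
Proof. by field. Qed.

(** * The lower bound for approximation numbers *)
Section LowerBound.
Variable R : realType.
Local Notation C := (cplx R).
Local Notation fns := (disk R -> C).
Variables (alpha : R) (w : nat -> R).
Hypothesis w_gt0 : forall n, 0 < w n.
Hypothesis w_noninc : forall n, w n.+1 <= w n.
Hypothesis w_lower : forall x : R, 0 <= x -> x < 1 -> exists2 e : R, 0 < e & forall n, e * x ^+ n <= w n.
Hypothesis normE : forall (f : fns) a, pser (ext f) a ->
  bergman_norm alpha f = sqrte (\sum_(0 <= n <oo) (modulus (a n) ^+ 2 * w n)%:E)%E.
Local Notation H := (bergman_space alpha).
Local Notation N := (bergman_norm alpha).
Local Notation kap := (kap w).
Local Notation norm2_le := (norm2_le w).
Variables (phi : disk R -> disk R) (Phi : C -> C).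
Hypothesis phiE : forall z, val (phi z) = Phi (val z).
Hypothesis self : selfmap Phi.

Variables (n : nat) (x y : 'I_n -> R) (lam : R).
Hypothesis x_ge0 : forall i, 0 <= x i.
Hypothesis x_lt1 : forall i, x i < 1.
Hypothesis y_ge0 : forall i, 0 <= y i.
Hypothesis y_lt1 : forall i, y i < 1.
(** Any two normalised kernels have an inner product so small that the kernels
    are almost orthonormal, whatever their number. *)
Definition kernels_apart (v : 'I_n -> R) := forall i j, i != j ->
  kap (v i * v j) <= 2^-1 ^+ i.+1 * 2^-1 ^+ j.+1 * (Num.sqrt (kap (v i ^+ 2)) * Num.sqrt (kap (v j ^+ 2))).
Hypothesis x_sep : kernels_apart x.
Hypothesis y_sep : kernels_apart y.
Hypothesis xy : forall i, Phi (rc (x i)) = rc (y i).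
Hypothesis lam_gt0 : 0 < lam.
Hypothesis lam_le : forall i, lam ^+ 2 * kap (x i ^+ 2) <= kap (y i ^+ 2).

(** Coefficients of the reproducing kernel at the point v. *)
Definition kcoef (v : R) m : C := rc (v ^+ m / w m).

Lemma kernel_ex (v : R) : 0 <= v -> v < 1 -> exists f : fns, pser (ext f) (kcoef v) /\ H f.
Proof.
move=> v0 v1; have h : norm2_le (kcoef v) (kap (v ^+ 2)).
  move=> M; apply: le_trans (kpart_le w_gt0 w_lower M _ _); rewrite ?exprn_ge0 ?exprn_ilt1 //.
  apply: ler_sum => k _; rewrite /kcoef modulus_rc real_normK ?num_real //.
  rewrite /kterm -exprM mulnC exprM le_eqVlt; apply/orP; left; apply/eqP.
  by field; rewrite gt_eqF.
have [f fh] := norm2_le_exists w_gt0 w_lower h; exists f; split => //.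
exact: (norm2_le_H w_gt0 normE fh h).
Qed.

Lemma H_sum (m : nat) (d : 'I_m -> C) (g : 'I_m -> fns) : (forall i, H (g i)) -> H (\sum_i d i *: g i).
Proof.
move=> hg; elim/big_ind: _ => [|f1 f2 h1 h2|i _].
- exact: (H0 w_gt0 normE).
- by rewrite -[f1]scale1r; apply: (H_lin w_gt0 normE).
- by rewrite -[_ *: _]addr0; apply: (H_lin w_gt0 normE) => //; exact: (H0 w_gt0 normE).
Qed.

Lemma bounded_op0 S : bounded_operator H N S -> S 0 = 0.
Proof.
move=> [_ lin _]; have h0 := H0 w_gt0 normE.
have := lin 1 0 0 h0 h0; rewrite !scale1r addr0 => h.
by apply/eqP; rewrite -(inj_eq (addrI (S 0))) addr0 -h.
Qed.

Lemma bounded_op_sum S (m : nat) (d : 'I_m -> C) (g : 'I_m -> fns) : bounded_operator H N S ->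
  (forall i, H (g i)) -> S (\sum_i d i *: g i) = \sum_i d i *: S (g i).
Proof.
move=> Sb hg; have S0 := bounded_op0 Sb; have [_ lin _] := Sb.
elim: m d g hg => [|m IH] d g hg; first by rewrite !big_ord0.
rewrite !big_ord_recl lin; last 2 first.
- exact: hg.
- by apply: (H_sum (fun i => d (lift ord0 i)) (g := fun i => g (lift ord0 i))) => i; exact: hg.
by rewrite (IH (fun i => d (lift ord0 i)) (fun i => g (lift ord0 i))).
Qed.

Lemma pser_sum (m : nat) (d : 'I_m -> C) (g : 'I_m -> fns) (a : 'I_m -> nat -> C) :
  (forall i, pser (ext (g i)) (a i)) -> pser (ext (\sum_i d i *: g i)) (fun k => \sum_i d i * a i k).
Proof.
elim: m d g a => [|m IH] d g a h.
  have z := @pser_poly R (fun=> 0) 0 (fun _ _ => erefl).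
  have -> : (fun k => \sum_(i < 0) d i * a i k) = (fun=> 0 : C) by apply/funext => k; rewrite big_ord0.
  by apply: (@pser_of _ _ _ _ z) => t t1; rewrite !big_ord0 (extE _ t1).
have -> : (fun k => \sum_(i < m.+1) d i * a i k) =
   (fun k => d ord0 * a ord0 k + \sum_(i < m) d (lift ord0 i) * a (lift ord0 i) k).
  by apply/funext => k; rewrite big_ord_recl.
rewrite big_ord_recl; apply: pser_lin; first exact: h.
by apply: (IH (fun i => d (lift ord0 i)) (fun i => g (lift ord0 i))) => i; exact: h.
Qed.

Lemma kernel_vector S : bounded_operator H N S -> rank_lt H S n ->
  forall g : 'I_n -> fns, (forall i, H (g i)) ->
  exists2 d : 'I_n -> C, (exists i, d i != 0) & S (\sum_i d i *: g i) = 0.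
Proof.
move=> Sb [m [e [mn hS]]] g hg.
have /choice[c hc] : forall i : 'I_n, exists c : 'I_m -> C, S (g i) = \sum_k c k *: e k.
  by move=> i; exact: hS.
pose A : 'M[C]_(n, m) := \matrix_(i, k) c i k.
have kn : kermx A != 0.
  rewrite -mxrank_eq0 mxrank_ker subn_eq0 -ltnNge.
  by apply: leq_ltn_trans mn; exact: rank_leq_col.
have [i hi] : exists i, row i (kermx A) != 0.
  apply/existsP; apply: contraR kn; rewrite negb_exists => /forallP h.
  by apply/eqP/row_matrixP => i; rewrite row0; apply/eqP; move: (h i); rewrite negbK.
exists (fun j => kermx A i j).
  apply/existsP; apply: contraR hi; rewrite negb_exists => /forallP h.
  by apply/eqP/rowP => j; rewrite [LHS]mxE [RHS]mxE; apply/eqP; move: (h j); rewrite negbK.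
rewrite (bounded_op_sum _ Sb hg).
under eq_bigr do rewrite hc scaler_sumr.
rewrite exchange_big big1 // => k _.
under eq_bigr do rewrite scalerA.
rewrite -scaler_suml.
have h : (kermx A *m A) i k = 0 by rewrite mulmx_ker mxE.
have -> : \sum_(j < n) kermx A i j * c j k = 0.
  by rewrite -[RHS]h [RHS]mxE; apply: eq_bigr => j _; rewrite [A j k]mxE.
by rewrite scale0r.
Qed.

(** At the points x i the composition takes the values of g at the points y i.
    Pairing both families of values with the coefficients d gives, on one side,
    almost the squared norm of g, and on the other side at most the norm of the
    composition times that of the same combination of kernels at the points
    x i; the ratio of the two norms of combinations is controlled by lam. *)
Lemma comp_lower (d : 'I_n -> C) (g : fns) b (c : R) : energy w y d = 3 / 4 ->
  pser (ext g) (fun m => \sum_i d i * kcoef (y i) m) ->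
  pser (fun z => ext g (Phi z)) b -> norm2_le b c -> lam ^+ 2 / 4 <= c.
Proof.
move=> En gd gb hb; have c0 := norm2_le_ge0 hb.
pose Dy := moment y d; pose Dx := moment x d.
have S_cvg : (fun M => \sum_(m < M) modulus (Dy m) ^+ 2 / w m) @ \oo --> re (\sum_j (d j)^* * ext g (rc (y j))).
  have h : (fun M => \sum_j (d j)^* * series (fun m => (\sum_i d i * kcoef (y i) m) * rc (y j) ^+ m) M) @ \oo -->
      \sum_j (d j)^* * ext g (rc (y j)).
    apply: (@cvg_Csum R _ (fun M j => (d j)^* * series (fun m => (\sum_i d i * kcoef (y i) m) * rc (y j) ^+ m) M)) => j.
    have c1 : (fun _ : nat => (d j)^*) @ \oo --> (d j)^* by exact: cvg_cst.
    by apply: (cvgM c1); apply: gd; exact: rc_lt1.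
  have E : (fun M => \sum_(m < M) modulus (Dy m) ^+ 2 / w m) =
     (fun M => re (\sum_j (d j)^* * series (fun m => (\sum_i d i * kcoef (y i) m) * rc (y j) ^+ m) M)).
    apply/funext => M; rewrite -[LHS]re_rc; congr re.
    rewrite rc_sum; under [RHS]eq_bigr do rewrite seriesCE mulr_sumr.
    rewrite exchange_big; apply: eq_bigr => m _.
    rewrite rcM -mul_conj /Dy /moment rmorph_sum mulr_sumr mulr_suml; apply: eq_bigr => j _.
    have -> : \sum_i d i * kcoef (y i) m = (\sum_i d i * rc (y i ^+ m)) * rc (w m)^-1.
      by rewrite mulr_suml; apply: eq_bigr => i _; rewrite /kcoef rcM mulrA.
    by rewrite rmorphM /= conj_rc rcX; ring.
  rewrite E; exact: (cvg_re _ h).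
set G := re _ in S_cvg.
have G_ge : 2 / 3 * (3 / 4) <= G.
  by rewrite -En; apply: (moment_lower w_gt0 w_noninc w_lower y_ge0 y_lt1 y_sep S_cvg).
have Exy : lam ^+ 2 * energy w x d <= 3 / 4.
  rewrite -En mulr_sumr; apply: ler_sum => i _; rewrite mulrCA; apply: ler_wpM2l; first exact: sqr_ge0.
  exact: lam_le.
have up : modulus (\sum_j (d j)^* * ext g (rc (y j))) ^+ 2 <= c * (4 / 3 * energy w x d).
  have h : (fun M => \sum_j (d j)^* * series (fun m => b m * rc (x j) ^+ m) M) @ \oo -->
      \sum_j (d j)^* * ext g (rc (y j)).
    apply: (@cvg_Csum R _ (fun M j => (d j)^* * series (fun m => b m * rc (x j) ^+ m) M)) => j.
    have c1 : (fun _ : nat => (d j)^*) @ \oo --> (d j)^* by exact: cvg_cst.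
    apply: (cvgM c1); rewrite -xy; apply: gb; exact: rc_lt1.
  have h2 : (fun M => modulus (\sum_j (d j)^* * series (fun m => b m * rc (x j) ^+ m) M)) @ \oo -->
      modulus (\sum_j (d j)^* * ext g (rc (y j))) by apply: cvg_modulus; exact: h.
  have h3 : (fun M => modulus (\sum_j (d j)^* * series (fun m => b m * rc (x j) ^+ m) M) *
      modulus (\sum_j (d j)^* * series (fun m => b m * rc (x j) ^+ m) M)) @ \oo -->
      modulus (\sum_j (d j)^* * ext g (rc (y j))) * modulus (\sum_j (d j)^* * ext g (rc (y j))).
    exact: (cvgM h2 h2).
  rewrite expr2; apply: (cvgr_to_le h3); near=> M.
  have -> : \sum_j (d j)^* * series (fun m => b m * rc (x j) ^+ m) M =
      \sum_(m < M) rc (w m) * (b m * ((Dx m)^* / rc (w m))).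
    under eq_bigr do rewrite seriesCE mulr_sumr.
    rewrite exchange_big; apply: eq_bigr => m _.
    have wm : rc (w m) != 0 by rewrite -modulus_gt0 modulus_rc gtr0_norm.
    have -> : rc (w m) * (b m * ((Dx m)^* / rc (w m))) = b m * (Dx m)^* by field.
    rewrite /Dx /moment rmorph_sum mulr_sumr; apply: eq_bigr => j _.
    by rewrite rmorphM /= conj_rc rcX; ring.
  rewrite -expr2; apply: le_trans (@modulus_sum_sq_le R 'I_M (fun m => w m) (fun m => b m) (fun m => (Dx m)^* / rc (w m)) _) _.
    by move=> m; exact: ltW.
  apply: ler_pM.
  - by apply: sumr_ge0 => m _; rewrite mulr_ge0 ?sqr_ge0 // ltW.
  - by apply: sumr_ge0 => m _; rewrite mulr_ge0 ?sqr_ge0 // ltW.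
  - by under eq_bigr do rewrite mulrC; exact: hb.
  apply: le_trans (moment_upper w_gt0 w_noninc w_lower d x_ge0 x_lt1 x_sep M).
  apply: ler_sum => m _; rewrite modulusM modulusV modulus_conj modulus_rc gtr0_norm //.
  by rewrite le_eqVlt; apply/orP; left; apply/eqP; field; rewrite gt_eqF.
have lo : G ^+ 2 <= modulus (\sum_j (d j)^* * ext g (rc (y j))) ^+ 2.
  rewrite -[X in X <= _]real_normK ?num_real //; apply: le_pow; [exact: normr_ge0|exact: le_re].
have E0 : 0 <= energy w x d.
  apply: sumr_ge0 => i _; rewrite mulr_ge0 ?sqr_ge0 // ltW // (kap_gt0 w_gt0 w_noninc w_lower) ?exprn_ge0 //.
  by rewrite exprn_ilt1.
have h4 : 4^-1 <= c * (4 / 3 * energy w x d).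
  apply: le_trans up; apply: le_trans lo.
  have -> : 4^-1 = (2 / 3 * (3 / 4)) ^+ 2 :> R by field.
  by apply: le_pow => //; lra.
have l0 : 0 <= lam ^+ 2 by rewrite sqr_ge0.
have h5 := ler_wpM2l l0 h4.
have h6 : lam ^+ 2 * (c * (4 / 3 * energy w x d)) <= c * 1.
  have -> : lam ^+ 2 * (c * (4 / 3 * energy w x d)) = c * (4 / 3 * (lam ^+ 2 * energy w x d)) by ring.
  by apply: ler_wpM2l => //; move: Exy; lra.
by move: h5 h6; lra.
Unshelve. all: by end_near. Qed.

(** An operator S of rank below n annihilates some combination of the n kernels
    at the points y i; on it, composition minus S is composition. *)
Theorem approx_lower : (forall f, H f -> H (comp_op phi f)) ->
  ((lam / 2)%:E <= approx_number H N (comp_op phi) n)%E.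
Proof.
move=> compH; apply: le_ereal_inf_tmp => _ [S [Sb Sr] <-].
have /choice[K hK] : forall i : 'I_n, exists f : fns, pser (ext f) (kcoef (y i)) /\ H f.
  by move=> i; exact: kernel_ex.
have [d0 [i0 di0] Sd0] := kernel_vector Sb Sr (fun i => (hK i).2).
have kp i : 0 < kap (y i ^+ 2).
  by apply: (kap_gt0 w_gt0 w_noninc w_lower); rewrite ?exprn_ge0 // exprn_ilt1.
have E0p : 0 < energy w y d0.
  rewrite /energy (bigD1 i0) //=; apply: ltr_wpDr.
    by apply: sumr_ge0 => i _; rewrite mulr_ge0 ?sqr_ge0 // ltW.
  by rewrite mulr_gt0 // exprn_gt0 // modulus_gt0.
pose s := Num.sqrt (3 / 4 / energy w y d0).
have s2 : s ^+ 2 = 3 / 4 / energy w y d0 by rewrite sqr_sqrtr // divr_ge0 ?(ltW E0p).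
pose d i := rc s * d0 i.
have En : energy w y d = 3 / 4.
  rewrite /energy; under eq_bigr do rewrite /d modulusM modulus_rc exprMn real_normK ?num_real // -mulrA.
  by rewrite -mulr_sumr -/(energy w y d0) s2 divfK // gt_eqF.
pose g : fns := \sum_i d i *: K i.
have gd : pser (ext g) (fun m => \sum_i d i * kcoef (y i) m).
  by apply: pser_sum => i; case: (hK i).
have gnb : norm2_le (fun m => \sum_i d i * kcoef (y i) m) (1 ^+ 2).
  move=> M; rewrite expr1n.
  apply: le_trans (_ : \sum_(m < M) modulus (moment y d m) ^+ 2 / w m <= _).
    apply: ler_sum => m _.
    have -> : \sum_i d i * kcoef (y i) m = moment y d m * rc (w m)^-1.
      by rewrite /moment mulr_suml; apply: eq_bigr => i _; rewrite /kcoef rcM mulrA.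
    rewrite modulusM modulus_rc ger0_norm ?invr_ge0 ?(ltW (w_gt0 _)) //.
    by rewrite le_eqVlt; apply/orP; left; apply/eqP; field; rewrite gt_eqF.
  apply: le_trans (moment_upper w_gt0 w_noninc w_lower d y_ge0 y_lt1 y_sep M) _.
  by rewrite En; lra.
have Hg : H g by exact: (norm2_le_H w_gt0 normE gd gnb).
have Ng : (N g <= 1%:E)%E by exact: (norm2_le_normP w_gt0 normE gd ler01 gnb).
have Sg : S g = 0.
  have -> : g = rc s *: (\sum_i d0 i *: K i) + 0.
    by rewrite addr0 scaler_sumr; apply: eq_bigr => i _; rewrite scalerA.
  have [_ lin _] := Sb; rewrite lin ?Sd0 ?scaler0 ?(bounded_op0 Sb) ?addr0 //.
    by apply: H_sum => i; case: (hK i).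
  exact: (H0 w_gt0 normE).
apply: le_trans (_ : N (comp_op phi g) <= _)%E; last first.
  by apply: ereal_sup_ubound; exists g => //=; rewrite Sg subr0.
have [b hb1 hb2] := pser_comp phiE self gd.
have Hcg := compH g Hg.
rewrite leNgt; apply/negP => hlt.
have fin : N (comp_op phi g) \is a fin_num.
  rewrite ge0_fin_numE; last exact: normge0.
  by apply: lt_le_trans hlt _; rewrite leey.
pose c := fine (N (comp_op phi g)).
have c0 : 0 <= c by apply: fine_ge0; exact: normge0.
have cE : (N (comp_op phi g) <= c%:E)%E by rewrite /c fineK.
have cb := norm_norm2_le w_gt0 normE hb1 c0 cE.
have h := comp_lower En gd hb2 cb.
have : c < lam / 2 by rewrite -lte_fin /c fineK.
rewrite -(@ltr_pXn2r _ 2) ?nnegrE ?divr_ge0 ?(ltW lam_gt0) // exprMn => h'.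
by have := le_lt_trans h h'; rewrite sqr_half ltxx.
Qed.

End LowerBound.

(** * Choice of the parameters *)
Section Choice.
Variable R : realType.
Local Notation C := (cplx R).
Variable w : nat -> R.
Hypothesis w_gt0 : forall n, 0 < w n.
Hypothesis w_noninc : forall n, w n.+1 <= w n.
Hypothesis w_lower : forall x : R, 0 <= x -> x < 1 -> exists2 e : R, 0 < e & forall n, e * x ^+ n <= w n.
Variable D : R.
Hypothesis D_ge1 : 1 <= D.
Hypothesis w_doubling : forall n, w n <= D * w (2 * n).
Local Notation kap := (kap w).
Local Notation E := (3 * D).

Variable eps : nat -> R.
Hypothesis eps_pos : forall n, (1 <= n)%N -> 0 < eps n.
Hypothesis eps_noninc : forall m n, (1 <= m)%N -> (m <= n)%N -> eps n <= eps m.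
Hypothesis eps_lim : eps n @[n --> \oo] --> 0.

Lemma E_ge1 : 1 <= E. Proof. by move: D_ge1; lra. Qed.

Definition slow_ok j q := E ^+ q * eps j ^+ 2 <= eps 1 ^+ 2.

(** The largest exponent q <= j for which E^q is at most (eps 1 / eps j)^2: a
    sequence tending to infinity no faster than the decay of eps permits. The
    constant E is the one lost when the kernel is compared at x and x^2. *)
Definition slow j : nat := if j is 0 then 0 else \max_(q < j.+1 | slow_ok j q) q.

Lemma slow_le j : (1 <= j)%N -> E ^+ slow j * eps j ^+ 2 <= eps 1 ^+ 2.
Proof.
case: j => // j _; rewrite /slow.
have ok0 : slow_ok j.+1 (ord0 : 'I_j.+2).
  by rewrite /slow_ok expr0 mul1r; apply: le_pow; [exact: ltW (eps_pos _)|exact: eps_noninc].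
have [i hi ->] := eq_bigmax_cond (fun q : 'I_j.+2 => nat_of_ord q) (ltac:(by apply/card_gt0P; exists ord0) : (0 < #|[pred q : 'I_j.+2 | slow_ok j.+1 q]|)%N).
exact: hi.
Qed.

Lemma slow_ge j q : (1 <= j)%N -> (q <= j)%N -> slow_ok j q -> (q <= slow j)%N.
Proof.
case: j => // j _ qj ok; rewrite /slow.
by apply: (@leq_bigmax_cond _ (fun q : 'I_j.+2 => slow_ok j.+1 q) (fun q : 'I_j.+2 => nat_of_ord q) (Ordinal (qj : (q < j.+2)%N))).
Qed.

Lemma slow_bound j : (slow j <= j)%N.
Proof. by case: j => // j; rewrite /slow; apply/bigmax_leqP => q _; rewrite -ltnS. Qed.

Lemma slow_nd j : (slow j <= slow j.+1)%N.
Proof.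
case: j => // j; apply: slow_ge => //; first by rewrite (leq_trans (slow_bound _)).
rewrite /slow_ok; apply: le_trans (slow_le (ltn0Sn j)).
apply: ler_wpM2l; first by rewrite exprn_ge0 // (le_trans ler01 E_ge1).
by apply: le_pow; [exact: ltW (eps_pos _)|exact: eps_noninc].
Qed.

Lemma slow_unbounded q : exists j, (q <= slow j)%N.
Proof.
have e1 : 0 < eps 1 by exact: eps_pos.
have Eq : 0 < E ^+ q by rewrite exprn_gt0 // (lt_le_trans ltr01 E_ge1).
have d0 : 0 < eps 1 / E ^+ q by rewrite divr_gt0.
have /cvgrPdist_le/(_ _ d0)[N _ hN] := eps_lim.
pose j := (maxn N q).+1; exists j; apply: slow_ge => //; first by rewrite /j ltnW // ltnS leq_maxr.
have /= := hN j (leqW (leq_maxl _ _)); rewrite sub0r normrN gtr0_norm ?eps_pos // => h.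
rewrite /slow_ok; apply: le_trans (_ : E ^+ q * (eps 1 / E ^+ q) ^+ 2 <= _).
  by apply: ler_wpM2l; [exact: ltW|apply: le_pow => //; exact: ltW (eps_pos _)].
have -> : E ^+ q * (eps 1 / E ^+ q) ^+ 2 = eps 1 ^+ 2 * (E ^+ q)^-1.
  by move: (E ^+ q) Eq => e e0; field; rewrite gt_eqF.
rewrite ler_piMr ?sqr_ge0 // invf_le1 //; exact: exprn_ege1 E_ge1.
Qed.

(** Controls the factor by which the symbol increases the distance from the j-th
    test point to the boundary. *)
Definition ell j : R := (2 ^ slow j)%:R.

Lemma ell_ge1 j : 1 <= ell j.
Proof. by rewrite ler1n expn_gt0. Qed.

Lemma ell_nd j : ell j <= ell j.+1.
Proof. by rewrite ler_nat leq_exp2l // slow_nd. Qed.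

Definition mass j : R := if j is i.+1 then ell i.+1 - ell i else 1.

Lemma mass_ge0 j : 0 <= mass j.
Proof. by case: j => [|j] /=; rewrite ?ler01 // subr_ge0 ell_nd. Qed.

Lemma mass_sum i : \sum_(j < i.+1) mass j = ell i.
Proof.
elim: i => [|i IH]; first by rewrite big_ord_recl big_ord0 addr0 /= /ell /slow expn0.
by rewrite big_ord_recr IH /= addrC subrK.
Qed.

Lemma ell_unbounded (K : R) : exists j, K <= ell j.
Proof.
have [n hn] : exists n : nat, K <= n%:R.
  by exists (Num.truncn `|K|).+1; apply: le_trans (ler_norm _) _; rewrite ltW // truncnS_gt.
have [j hj] := slow_unbounded n; exists j; apply: le_trans hn _; rewrite ler_nat.
by apply: leq_trans (ltnW (ltn_expl n (isT : 1 < 2)%N)) _; rewrite leq_exp2l.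
Qed.

(** Requirements on the next parameter s after t: the tail of the sum of
    mass * pole is dominated by the previous pole, s is small relative to ell,
    and the kernel at the new test point is huge compared with the kernel at the
    previous one. *)
Definition next_ok j (t s : R) := [/\ 0 < s, (mass j + 1) * s <= t / 2,
  (2 ^ (slow j + 3))%:R * s <= 2^-1 &
  4 * ell j * s * (w 0 ^+ 2 * 16 ^+ j.+1 * kap (1 - t) ^+ 2) <= 1].

Lemma next_ex j t : 0 < t -> t <= 1 -> exists s, next_ok j t s.
Proof.
move=> t0 t1; have k0 : 0 < kap (1 - t) by apply: kap_gt0 => //; lra.
have m0 : 0 < mass j + 1 by rewrite ltr_wpDl // mass_ge0.
have n0 : 0 < (2 ^ (slow j + 3))%:R :> R by rewrite ltr0n expn_gt0.
have l0 : 0 < ell j by exact: lt_le_trans (ell_ge1 j).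
have B0 : 0 < w 0 ^+ 2 * 16 ^+ j.+1 * kap (1 - t) ^+ 2 by rewrite !mulr_gt0 ?exprn_gt0.
have c0 : 0 < 4 * ell j * (w 0 ^+ 2 * 16 ^+ j.+1 * kap (1 - t) ^+ 2) by rewrite !mulr_gt0 ?exprn_gt0.
set B := w 0 ^+ 2 * 16 ^+ j.+1 * kap (1 - t) ^+ 2 in B0 c0 *.
pose s1 := t / 2 / (mass j + 1); pose s2 : R := 2^-1 / (2 ^ (slow j + 3))%:R.
pose s3 := (4 * ell j * B)^-1.
have p1 : 0 < s1 by rewrite !divr_gt0.
have p2 : 0 < s2 by rewrite divr_gt0 // invr_gt0.
have p3 : 0 < s3 by rewrite invr_gt0.
exists (Num.min s1 (Num.min s2 s3)); split.
- by rewrite !lt_min p1 p2 p3.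
- by rewrite mulrC -ler_pdivlMr // ge_min lexx.
- by rewrite mulrC -ler_pdivlMr // !ge_min lexx orbT.
rewrite mulrAC -ler_pdivlMl // mulr1 -/B !ge_min.
by rewrite -/s3 lexx !orbT.
Qed.

Lemma pole_step_ex (j : nat) (t : {t : R | 0 < t /\ t <= 1}) :
  exists s : {s : R | 0 < s /\ s <= 1}, next_ok j.+1 (sval t) (sval s).
Proof.
case: t => t [t0 t1]; have [s h] := next_ex j.+1 t0 t1.
have [s0 h1 _ _] := h.
have m1 : s <= (mass j.+1 + 1) * s by rewrite ler_peMl ?(ltW s0) // lerDr mass_ge0.
have s1 : s <= 1 by move: h1 t1 m1; lra.
by exists (exist _ s (conj s0 s1)).
Qed.

Definition pole_step j t := sval (cid (pole_step_ex j t)).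

Lemma pole0_ok : 0 < (1 : R) /\ (1 : R) <= 1. Proof. by rewrite ltr01 lexx. Qed.

Fixpoint pole_sig j : {t : R | 0 < t /\ t <= 1} :=
  if j is i.+1 then pole_step i (pole_sig i) else exist _ 1 pole0_ok.

Definition pole j : R := sval (pole_sig j).

Lemma pole_gt0 j : 0 < pole j. Proof. by have [] := proj2_sig (pole_sig j). Qed.
Lemma pole_le1 j : pole j <= 1. Proof. by have [] := proj2_sig (pole_sig j). Qed.
Lemma pole_0 : pole 0 = 1. Proof. by []. Qed.

Lemma pole_next j : next_ok j.+1 (pole j) (pole j.+1).
Proof. exact: (svalP (cid (pole_step_ex j (pole_sig j)))). Qed.

Lemma pole_half j : pole j.+1 <= pole j / 2.
Proof.
have [s0 h1 _ _] := pole_next j; apply: le_trans h1.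
by rewrite ler_peMl ?(ltW s0) // lerDr mass_ge0.
Qed.

Lemma pole_noninc i j : (i <= j)%N -> pole j <= pole i.
Proof.
move=> ij; rewrite -(subnK ij); elim: (j - i)%N => // k IH; apply: le_trans IH.
by have := pole_half (k + i); have := pole_gt0 (k + i); rewrite addSn; lra.
Qed.

Lemma mass_pole j : mass j.+1 * pole j.+1 <= pole j - pole j.+1.
Proof.
have [s0 h1 _ _] := pole_next j; have := pole_half j; have := pole_gt0 j.
by move: h1 s0; rewrite mulrDl mul1r; lra.
Qed.

Lemma mass_tail i J : \sum_(i.+1 <= j < i.+1 + J) mass j * pole j <= pole i.
Proof.
suff : \sum_(i.+1 <= j < i.+1 + J) mass j * pole j <= pole i - pole (i + J).
  by have := pole_gt0 (i + J); lra.
elim: J => [|J IH]; first by rewrite !addn0 big_geq // subrr.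
have -> : \sum_(i.+1 <= j < i.+1 + J.+1) mass j * pole j =
    \sum_(i.+1 <= j < i.+1 + J) mass j * pole j + mass (i + J).+1 * pole (i + J).+1.
  by rewrite addnS big_nat_recr // addSn ltnS leq_addr.
have h := mass_pole (i + J); rewrite (addnS i J); move: IH h; lra.
Qed.

Lemma mass_pole_ge0 j : 0 <= mass j * pole j.
Proof. by rewrite mulr_ge0 ?mass_ge0 // ltW // pole_gt0. Qed.

Lemma total_le J : \sum_(j < J) mass j * pole j <= 2.
Proof.
case: J => [|J]; first by rewrite big_ord0.
rewrite -(big_mkord xpredT (fun j => mass j * pole j)) big_ltn // pole_0 mulr1 /=.
by have := mass_tail 0 J; rewrite add1n pole_0; lra.
Qed.

Definition total : R := limn (series (fun j => mass j * pole j)).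

Lemma total_cvg : cvgn (series (fun j => mass j * pole j)).
Proof. by apply: (nneg_series_cvg (B := 2)) => [j|J]; [exact: mass_pole_ge0|exact: total_le]. Qed.

Lemma total_ge1 : 1 <= total.
Proof.
have := nneg_series_le_lim 1 mass_pole_ge0 total_cvg.
by rewrite big_ord_recl big_ord0 addr0 /= pole_0 mulr1.
Qed.

Lemma total_gt0 : 0 < total. Proof. exact: lt_le_trans total_ge1. Qed.

Definition wgt j : R := total^-1 * (mass j * pole j).

Lemma wgt_ge0 j : 0 <= wgt j.
Proof. by rewrite mulr_ge0 ?invr_ge0 ?mass_pole_ge0 // ltW // total_gt0. Qed.

Lemma wgt_0 : 0 < wgt 0.
Proof. by rewrite /wgt pole_0 !mulr1 invr_gt0 total_gt0. Qed.

Lemma wgt_sum : series wgt @ \oo --> (1 : R).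
Proof.
have -> : series wgt = (fun J => total^-1 * series (fun j => mass j * pole j) J).
  by apply/funext => J; rewrite !seriesE mulr_sumr.
have c1 : (fun _ : nat => total^-1) @ \oo --> total^-1 by exact: cvg_cst.
by rewrite -[X in _ --> X](mulVf (lt0r_neq0 total_gt0)); exact: (cvgM c1 total_cvg).
Qed.

Lemma wgt_le j : wgt j <= mass j * pole j.
Proof. by rewrite ler_piMl ?mass_pole_ge0 // invf_le1 ?total_gt0 // total_ge1. Qed.

Lemma wgt_pole J : \sum_(j < J.+1) wgt j / pole j = total^-1 * ell J.
Proof.
rewrite -mass_sum mulr_sumr; apply: eq_bigr => j _; rewrite /wgt.
by field; rewrite gt_eqF ?total_gt0 // gt_eqF // pole_gt0.
Qed.

Lemma wgt_div (K : R) : exists J, K <= \sum_(j < J) wgt j / pole j.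
Proof.
have [j hj] := ell_unbounded (K * total); exists j.+1.
by rewrite wgt_pole mulrC ler_pdivlMr // total_gt0.
Qed.

Lemma wgt_nontrivial : exists2 j, 0 < wgt j & pole j < 1.
Proof.
have [j hj] := slow_unbounded 1.
have [i hi] : exists i, 0 < mass i.+1.
  apply: contrapT => hn; have m0 i : ell i.+1 <= ell i.
    by rewrite leNgt; apply/negP => h; apply: hn; exists i; rewrite /= subr_gt0.
  have : ell j <= ell 0 by elim: (j) => // k; exact: le_trans (m0 k).
  by rewrite /ell ler_nat /= expn0 leqNgt -{1}(expn0 2) ltn_exp2l // hj.
exists i.+1; first by rewrite /wgt mulr_gt0 ?invr_gt0 ?total_gt0 // mulr_gt0 // pole_gt0.
have := pole_half i; have := pole_gt0 i; have := pole_le1 i; lra.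
Qed.

Local Notation phiR := (phiR wgt pole).

Definition node j : R := 1 - pole j.
Definition image j : R := phiR (node j).

Lemma node_ge0 j : 0 <= node j. Proof. by rewrite subr_ge0 pole_le1. Qed.
Lemma node_lt1 j : node j < 1. Proof. by rewrite gtrBl pole_gt0. Qed.

Lemma image_ge0 j : 0 <= image j.
Proof. by apply: (phiR_ge0 wgt_ge0 pole_gt0 pole_le1 wgt_sum); [exact: node_ge0|exact: node_lt1]. Qed.

Lemma image_le j : image j <= node j.
Proof. by apply: (phiR_le wgt_ge0 pole_gt0 pole_le1 wgt_sum); [exact: node_ge0|exact: node_lt1]. Qed.

Lemma image_lt1 j : image j < 1.
Proof. exact: le_lt_trans (image_le j) (node_lt1 j). Qed.

(** In the formula for the boundary distance the terms up to i contribute at most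
    the sum ell i of the masses, and the later ones at most 1. *)
Lemma image_gap i : 1 - image i <= pole i * (ell i + 1).
Proof.
have -> : pole i = 1 - node i by rewrite /node subKr.
apply: (gap_le wgt_ge0 pole_gt0 pole_le1 wgt_sum (node_ge0 i) (node_lt1 i)) => J.
have ti := pole_gt0 i.
have den j : pole i <= 1 - (1 - pole j) * node i /\ pole j <= 1 - (1 - pole j) * node i.
  rewrite /node; have h1 : 0 <= pole j * (1 - pole i) by rewrite mulr_ge0 ?subr_ge0 ?pole_le1 // ltW // pole_gt0.
  have h2 : 0 <= pole i * (1 - pole j) by rewrite mulr_ge0 ?subr_ge0 ?pole_le1 // ltW.
  by split; lra.
have term j : wgt j / (1 - (1 - pole j) * node i) <= (if (j <= i)%N then mass j else mass j * pole j / pole i).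
  have [d1 d2] := den j; have d0 : 0 < 1 - (1 - pole j) * node i by exact: lt_le_trans d1.
  apply: le_trans (_ : mass j * pole j / (1 - (1 - pole j) * node i) <= _).
    by apply: ler_wpM2r; [rewrite invr_ge0 ltW|exact: wgt_le].
  case: leqP => _; last by apply: ler_wpM2l; [exact: mass_pole_ge0|rewrite lef_pV2 ?posrE].
  rewrite ler_pdivrMr //; apply: ler_wpM2l => //; exact: mass_ge0.
pose u j := if (j <= i)%N then mass j else mass j * pole j / pole i.
have u0 j : 0 <= u j.
  by rewrite /u; case: ifP => _; [exact: mass_ge0|rewrite divr_ge0 ?mass_pole_ge0 // ltW].
apply: le_trans (_ : \sum_(j < J) u j <= _); first by apply: ler_sum => j _; exact: term.
apply: le_trans (_ : \sum_(0 <= j < i.+1 + J) u j <= _).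
  rewrite -(big_mkord xpredT u) [leRHS](@big_cat_nat _ _ _ J) //=; last exact: leq_addl.
  by rewrite lerDl; apply: sumr_ge0.
rewrite (@big_cat_nat _ _ _ i.+1) //=; last exact: leq_addr.
apply: lerD.
  rewrite -mass_sum -(big_mkord xpredT mass) !big_nat le_eqVlt; apply/orP; left; apply/eqP.
  by apply: eq_bigr => j /andP[_ ji]; rewrite /u -ltnS ji.
rewrite -[leRHS](mulfV (lt0r_neq0 ti)).
apply: le_trans (_ : (\sum_(i.+1 <= j < i.+1 + J) mass j * pole j) / pole i <= _).
  rewrite mulr_suml !big_nat le_eqVlt; apply/orP; left; apply/eqP.
  by apply: eq_bigr => j /andP[ij _]; rewrite /u leqNgt ij.
by apply: ler_wpM2r; [rewrite invr_ge0 ltW|exact: mass_tail].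
Qed.

(** A lower bound for the square of the image point that is comparable with a
    power of the test point. *)
Definition base j : R := 1 - 4 * ell j * pole j.

Lemma base_small j : (1 <= j)%N -> 8 * ell j * pole j <= 2^-1.
Proof.
case: j => // j _; have [_ _ h _] := pole_next j.
by move: h; rewrite expnD natrM -/(ell j.+1) mulrAC (mulrC (ell _ * _)) mulrA.
Qed.

Lemma base_ge0 j : (1 <= j)%N -> 2^-1 <= base j.
Proof. by move=> /base_small; rewrite /base; lra. Qed.

Lemma base_lt1 j : base j < 1.
Proof. by rewrite gtrBl !mulr_gt0 ?pole_gt0 // (lt_le_trans _ (ell_ge1 j)). Qed.

Lemma base_le_image j : base j <= image j ^+ 2.
Proof.
have h1 := image_gap j; have h2 := ell_ge1 j; have t0 := pole_gt0 j.
have h3 : pole j * (ell j + 1) <= 2 * ell j * pole j.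
  have : 0 <= pole j * (ell j - 1) by rewrite mulr_ge0 ?subr_ge0 // ltW.
  lra.
have : 0 <= (1 - image j) * (1 - image j) by rewrite mulr_ge0 // subr_ge0 ltW // image_lt1.
by rewrite /base expr2; move: h1 h3; lra.
Qed.

Lemma kap_image_ge j : (1 <= j)%N -> kap (base j) <= kap (image j ^+ 2).
Proof.
move=> j1; apply: (kap_mono w_gt0 w_lower); last by rewrite exprn_ilt1 ?image_ge0 ?image_lt1.
  by apply: le_trans (base_ge0 j1); rewrite invr_ge0.
exact: base_le_image.
Qed.

Lemma kap_node_le j : kap (node j ^+ 2) <= kap (node j).
Proof.
apply: (kap_mono w_gt0 w_lower); rewrite ?exprn_ge0 ?node_ge0 ?node_lt1 //.
by rewrite expr2 ler_piMl ?node_ge0 // ltW // node_lt1.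
Qed.

Lemma pow_ge (t : R) n : 0 <= t -> t <= 1 -> 1 - n%:R * t <= (1 - t) ^+ n.
Proof.
move=> t0 t1; elim: n => [|n IH]; first by rewrite mul0r subr0 expr0.
rewrite exprSr; apply: le_trans (ler_wpM2r _ IH); last by rewrite subr_ge0.
have : 0 <= n%:R * t * t by rewrite !mulr_ge0.
by rewrite -natr1; lra.
Qed.

Lemma pow_le (t : R) n : 0 <= t -> t <= 1 -> n%:R * t <= 1 -> (1 - t) ^+ n <= 1 - n%:R * t / 2.
Proof.
move=> t0 t1 nt.
have h1 : 1 + n%:R * t <= (1 + t) ^+ n.
  elim: n {nt} => [|n IH]; first by rewrite mul0r addr0 expr0.
  rewrite exprSr; apply: le_trans (ler_wpM2r _ IH); last by rewrite addr_ge0.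
  have : 0 <= n%:R * t * t by rewrite !mulr_ge0.
  by rewrite -natr1; lra.
have x0 : 0 <= n%:R * t by rewrite mulr_ge0.
have h2 : (1 - t) ^+ n * (1 + n%:R * t) <= 1.
  apply: le_trans (_ : (1 - t) ^+ n * (1 + t) ^+ n <= _).
    by apply: ler_wpM2l => //; rewrite exprn_ge0 // subr_ge0.
  rewrite -exprMn exprn_ile1 //; first by rewrite mulr_ge0 ?subr_ge0 // addr_ge0.
  by have := sqr_ge0 t; rewrite expr2; lra.
have p0 : 0 < 1 + n%:R * t by rewrite ltr_pwDl.
rewrite -(ler_pM2r p0); apply: le_trans h2 _.
have : 0 <= (n%:R * t) * (1 - n%:R * t) by rewrite mulr_ge0 // subr_ge0.
by lra.
Qed.

(** Raising the test point to the power 2^(slow j + 3) moves it below the square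
    of its image, and each squaring costs a factor E in the kernel. *)
Lemma kap_ratio j : (1 <= j)%N -> kap (node j) <= E ^+ (slow j + 3) * kap (image j ^+ 2).
Proof.
move=> j1; set q := (slow j + 3)%N.
have nE : (2 ^ q)%:R * pole j = 8 * ell j * pole j.
  by rewrite /q expnD natrM -/(ell j) mulrC (mulrC (ell j)) mulrC.
have small := base_small j1.
have t0 := ltW (pole_gt0 j); have t1 := pole_le1 j.
have lo : 2^-1 <= node j ^+ (2 ^ q).
  by apply: le_trans (pow_ge (2 ^ q) t0 t1); rewrite nE; move: small; lra.
apply: le_trans (kap_iter w_gt0 w_noninc w_lower D_ge1 w_doubling (node_ge0 j) (node_lt1 j) lo) _.
apply: ler_wpM2l; first by rewrite exprn_ge0 // (le_trans ler01 E_ge1).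
apply: le_trans (kap_image_ge j1); apply: (kap_mono w_gt0 w_lower).
- by rewrite exprn_ge0 // node_ge0.
- have h : (2 ^ q)%:R * pole j <= 1 by rewrite nE; move: small; lra.
  by apply: le_trans (pow_le t0 t1 h) _; rewrite nE /base; lra.
- exact: base_lt1.
Qed.

(** The last requirement in the choice of the pole, through the lower bound for
    the kernel by a geometric series. *)
Lemma kap_huge j : w 0 * 16 ^+ j.+2 * kap (node j) ^+ 2 <= kap (image j.+1 ^+ 2).
Proof.
have [s0 _ _ h] := pole_next j.
have j1 : (1 <= j.+1)%N by [].
apply: le_trans (kap_image_ge j1).
have b0 : 0 <= base j.+1 by apply: le_trans (base_ge0 j1); rewrite invr_ge0.
apply: le_trans (kap_large w_gt0 w_noninc w_lower b0 (base_lt1 j.+1)).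
have l0 : 0 < ell j.+1 by exact: lt_le_trans (ell_ge1 _).
have d0 : 0 < 4 * ell j.+1 * pole j.+1 by rewrite !mulr_gt0.
have p0 : 0 < w 0 * (4 * ell j.+1 * pole j.+1) by rewrite mulr_gt0.
rewrite /base subKr -[leRHS]mul1r ler_pdivlMr //.
apply: le_trans h; rewrite -/(node j); move: (16 ^+ j.+2) (kap (node j) ^+ 2) => A B.
by rewrite le_eqVlt; apply/orP; left; apply/eqP; ring.
Qed.

Lemma kap_sq_ge (u : R) : 0 <= u -> u < 1 -> (w 0)^-1 <= kap (u ^+ 2).
Proof.
move=> u0 u1; have v0 : 0 <= u ^+ 2 by rewrite exprn_ge0.
have v1 : u ^+ 2 < 1 by rewrite exprn_ilt1.
apply: le_trans (kap_large w_gt0 w_noninc w_lower v0 v1); rewrite lef_pV2 ?posrE ?mulr_gt0 ?subr_gt0 ?exprn_ilt1 //.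
by rewrite ler_piMr ?(ltW (w_gt0 0)) // gerBl exprn_ge0.
Qed.

Lemma pow16 n : (16 : R) ^+ n = (4 ^+ n) ^+ 2.
Proof. by rewrite -exprM mulnC exprM; congr (_ ^+ _); ring. Qed.

(** A kernel value at a mixed product is bounded by the earlier diagonal value,
    which is negligible against the later one. *)
Lemma sep_pair (u u' K : R) i j : 0 <= u -> u < 1 -> (i < j)%N ->
  0 <= K -> kap (u * u') <= K -> w 0 * 16 ^+ j.+2 * K ^+ 2 <= kap (u' ^+ 2) ->
  kap (u * u') <= 2^-1 ^+ i.+1 * 2^-1 ^+ j.+1 * (Num.sqrt (kap (u ^+ 2)) * Num.sqrt (kap (u' ^+ 2))).
Proof.
move=> u0 u1 ij K0 h1 h2; apply: le_trans h1 _.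
have k1 := kap_sq_ge u0 u1.
have k1' : 0 <= kap (u ^+ 2) by apply: le_trans k1; rewrite invr_ge0 ltW.
have h3 : 4 ^+ j.+2 * K <= Num.sqrt (kap (u ^+ 2)) * Num.sqrt (kap (u' ^+ 2)).
  have q0 : 0 <= 4 ^+ j.+2 * K by apply: mulr_ge0 => //; exact: exprn_ge0.
  rewrite -sqrtrM // -(@ler_pXn2r _ 2) ?nnegrE ?sqrtr_ge0 //.
  have h4 : 0 <= w 0 * 16 ^+ j.+2 * K ^+ 2 by apply: mulr_ge0; [apply: mulr_ge0; [exact: ltW|exact: exprn_ge0]|exact: sqr_ge0].
  rewrite sqr_sqrtr; last by rewrite mulr_ge0 // (le_trans h4).
  apply: le_trans (ler_pM _ h4 k1 h2); last by rewrite invr_ge0 ltW.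
  have -> : (w 0)^-1 * (w 0 * 16 ^+ j.+2 * K ^+ 2) = 16 ^+ j.+2 * K ^+ 2.
    by rewrite -mulrA mulKf // gt_eqF.
  by rewrite exprMn pow16.
have p0 : 0 <= 2^-1 ^+ i.+1 * 2^-1 ^+ j.+1 :> R by rewrite mulr_ge0 // exprn_ge0 // invr_ge0.
apply: le_trans (ler_wpM2l p0 h3); rewrite mulrA ler_peMl // -exprD exprVn mulrC.
rewrite ler_pdivlMr ?exprn_gt0 // mul1r.
have -> : (4 : R) = 2 ^+ 2 by rewrite -natrX.
rewrite -exprM; apply: ler_weXn2l; first by rewrite ler1n.
by rewrite mul2n -addnn leq_add // ltnW // ltnW // ltnS ltnW // ltnS ltnW.
Qed.

(** The index 0 is skipped: there pole 0 = 1 and the test point is the origin. *)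
Definition test_points n (i : 'I_n) := node i.+1.
Definition test_images n (i : 'I_n) := image i.+1.

Lemma node_mono i j : (i <= j)%N -> node i <= node j.
Proof. by move=> ij; rewrite lerD2l lerN2 pole_noninc. Qed.

Lemma kap_node_mono i j : (i <= j)%N -> kap (node i) <= kap (node j).
Proof. by move=> ij; apply: (kap_mono w_gt0 w_lower); rewrite ?node_ge0 ?node_lt1 // node_mono. Qed.

Lemma kap_huge_le i j : (i < j)%N -> w 0 * 16 ^+ j.+2 * kap (node i.+1) ^+ 2 <= kap (image j.+1 ^+ 2).
Proof.
move=> ij; apply: le_trans (kap_huge j); apply: ler_wpM2l.
  by rewrite mulr_ge0 ?exprn_ge0 // ltW.
apply: le_pow; last exact: kap_node_mono.
by apply: ltW; apply: (kap_gt0 w_gt0 w_noninc w_lower); rewrite ?node_ge0 ?node_lt1.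
Qed.

Lemma kap_node_ge0 i : 0 <= kap (node i).
Proof. by apply: ltW; apply: (kap_gt0 w_gt0 w_noninc w_lower); rewrite ?node_ge0 ?node_lt1. Qed.

Lemma sep_general n (v : nat -> R) : (forall i, 0 <= v i) -> (forall i, v i < 1) ->
  (forall i, v i <= node i) -> (forall i, kap (image i ^+ 2) <= kap (v i ^+ 2)) ->
  forall i j : 'I_n, i != j -> kap (v i.+1 * v j.+1) <= 2^-1 ^+ i.+1 * 2^-1 ^+ j.+1 *
    (Num.sqrt (kap (v i.+1 ^+ 2)) * Num.sqrt (kap (v j.+1 ^+ 2))).
Proof.
move=> v0 v1 vn iv.
have key i j : (i < j)%N -> kap (v i.+1 * v j.+1) <= 2^-1 ^+ i.+1 * 2^-1 ^+ j.+1 *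
    (Num.sqrt (kap (v i.+1 ^+ 2)) * Num.sqrt (kap (v j.+1 ^+ 2))).
  move=> ij; apply: (sep_pair (K := kap (node i.+1))) => //.
  - exact: kap_node_ge0.
  - apply: (kap_mono w_gt0 w_lower); rewrite ?mulr_ge0 ?node_lt1 //.
    by apply: le_trans (vn i.+1); rewrite ler_piMr // ltW.
  - by apply: le_trans (iv j.+1); exact: kap_huge_le.
move=> i j; rewrite neq_ltn => /orP[ij|ji]; first exact: key.
have := key j i ji; rewrite mulrC (mulrC (2^-1 ^+ j.+1)) (mulrC (Num.sqrt (kap (v j.+1 ^+ 2)))) //.
Qed.

Lemma test_points_sep n : kernels_apart w (@test_points n).
Proof.
apply: (@sep_general n node) => [i|i|i|i]; rewrite ?node_ge0 ?node_lt1 //.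
apply: (kap_mono w_gt0 w_lower); rewrite ?exprn_ge0 ?image_ge0 ?exprn_ilt1 ?node_ge0 ?node_lt1 //.
by apply: le_pow; [exact: image_ge0|exact: image_le].
Qed.

Lemma test_images_sep n : kernels_apart w (@test_images n).
Proof. by apply: (@sep_general n image) => i; rewrite ?image_ge0 ?image_lt1 ?image_le. Qed.

Definition lam n : R := (E ^+ 2 * eps 1)^-1 * eps n.

Lemma lam_gt0 n : (1 <= n)%N -> 0 < lam n.
Proof.
move=> n1; rewrite mulr_gt0 ?eps_pos // invr_gt0 mulr_gt0 ?eps_pos // exprn_gt0 //.
exact: lt_le_trans E_ge1.
Qed.

Lemma lam_kap n (i : 'I_n) : lam n ^+ 2 * kap (test_points i ^+ 2) <= kap (test_images i ^+ 2).
Proof.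
have E0 : 0 < E by exact: lt_le_trans E_ge1.
have e1 : 0 < eps 1 by exact: eps_pos.
have i1 : (1 <= i.+1)%N by [].
have h1 := kap_ratio i1; have h2 := kap_node_le i.+1; have h3 := slow_le i1.
have h4 : eps n ^+ 2 <= eps i.+1 ^+ 2.
  by apply: le_pow; [apply: ltW; apply: eps_pos; exact: leq_ltn_trans (ltn_ord i)|exact: eps_noninc].
have k0 : 0 <= kap (image i.+1 ^+ 2).
  by apply: ltW; apply: (kap_gt0 w_gt0 w_noninc w_lower); rewrite ?exprn_ge0 ?image_ge0 ?exprn_ilt1 ?image_ge0 ?image_lt1.
apply: le_trans (ler_wpM2l (sqr_ge0 _) (le_trans h2 h1)) _.
rewrite -/(test_images i) mulrA; apply: ler_piMl => //.
have l2 : lam n ^+ 2 * (E ^+ 4 * eps 1 ^+ 2) = eps n ^+ 2.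
  by rewrite /lam; field; rewrite !gt_eqF // (lt_le_trans _ D_ge1).
have p0 : 0 < E ^+ 4 * eps 1 ^+ 2 by rewrite mulr_gt0 // exprn_gt0.
rewrite -(ler_pM2r p0) mul1r mulrAC l2 exprD mulrA.
apply: le_trans (_ : eps 1 ^+ 2 * E ^+ 3 <= _).
  apply: ler_wpM2r; first by rewrite exprn_ge0 // ltW.
  apply: le_trans h3; rewrite mulrC; apply: ler_wpM2l => //.
  by rewrite exprn_ge0 // ltW.
rewrite mulrC; apply: ler_wpM2r; first exact: sqr_ge0.
by apply: ler_weXn2l => //; exact: E_ge1.
Qed.

End Choice.

(** * The weights of the Hardy and Bergman norms *)
Section Weights.
Variable R : realType.
Local Notation C := (cplx R).
Implicit Types (a b : nat -> C) (F : C -> C).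
Variable alpha : R.

(** The squared norm of the monomial of degree n. *)
Definition wt n : R :=
  if alpha == -1 then 1 else (alpha + 1) * (pi^-1 * (disk_area R * mom alpha n)).

Hypothesis alpha_ge : -1 <= alpha.

Lemma alphaP : alpha = -1 \/ -1 < alpha.
Proof. by move: alpha_ge; rewrite le_eqVlt => /orP[/eqP->|]; [left|right]. Qed.

Lemma wt_hardy : alpha = -1 -> forall n, wt n = 1.
Proof. by move=> h n; rewrite /wt h eqxx. Qed.

Definition wt_scale : R := (alpha + 1) * (pi^-1 * disk_area R).

Lemma wt_bergman : -1 < alpha -> forall n, wt n = wt_scale * mom alpha n.
Proof. by move=> h n; rewrite /wt gt_eqF // /wt_scale !mulrA. Qed.

Lemma wt_scale_gt0 : -1 < alpha -> 0 < wt_scale.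
Proof.
move=> h; rewrite mulr_gt0 //; first by rewrite -ltrBlDr sub0r.
by rewrite mulr_gt0 ?disk_area_gt0 // invr_gt0 pi_gt0.
Qed.

Lemma wt_gt0 n : 0 < wt n.
Proof.
have [h|h] := alphaP; first by rewrite wt_hardy.
by rewrite wt_bergman // mulr_gt0 ?wt_scale_gt0 // mom_gt0.
Qed.

Lemma wt_noninc n : wt n.+1 <= wt n.
Proof.
have [h|h] := alphaP; first by rewrite !wt_hardy.
by rewrite !wt_bergman //; apply: ler_wpM2l; [exact: ltW (wt_scale_gt0 h)|exact: mom_noninc].
Qed.

Lemma wt_lower (x : R) : 0 <= x -> x < 1 -> exists2 e : R, 0 < e & forall n, e * x ^+ n <= wt n.
Proof.
move=> x0 x1; have [h|h] := alphaP.
  by exists 1 => // n; rewrite wt_hardy // mul1r exprn_ile1 // ltW.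
have s0 := wt_scale_gt0 h.
exists (wt_scale * ((1 - x) `^ (alpha + 1) * mom alpha 0)).
  have g0 : 0 < (1 - x) `^ (alpha + 1) by rewrite powR_gt0 // subr_gt0.
  by rewrite mulr_gt0 // mulr_gt0 // mom_gt0.
move=> n; rewrite wt_bergman // -mulrA; apply: ler_wpM2l; first exact: ltW.
by rewrite mulrC; exact: mom_lower.
Qed.

Lemma wt_doubling : exists2 D : R, 1 <= D & forall n, wt n <= D * wt (2 * n).
Proof.
have [h|h] := alphaP; first by exists 1 => // n; rewrite !wt_hardy // mulr1.
exists (2 `^ (alpha + 1)).
  by rewrite -[leLHS](powRr0 2); apply: ler_powR; [rewrite ler1n|rewrite -lerBlDr sub0r].
move=> n; rewrite !wt_bergman // mulrCA; apply: ler_wpM2l; first exact: ltW (wt_scale_gt0 h).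
exact: mom_doubling.
Qed.

Lemma wt_normE (f : disk R -> C) a : pser (ext f) a ->
  bergman_norm alpha f = sqrte (\sum_(0 <= n <oo) (modulus (a n) ^+ 2 * wt n)%:E)%E.
Proof.
move=> fa; rewrite /bergman_norm; have [h|h] := alphaP.
  have -> : (alpha == -1) = true by rewrite h eqxx.
  rewrite /hardy_norm2 (taylorE fa); congr sqrte; apply: eq_eseriesr => n _.
  by rewrite wt_hardy // mulr1.
rewrite gt_eqF // (bergman_norm2E h fa); congr sqrte; apply: eq_eseriesr => n _.
by rewrite /wt gt_eqF.
Qed.

Lemma M2_esum a (t : R) : abs_coef a -> 0 <= t -> t < 1 ->
  ((M2 a t)%:E <= \sum_(0 <= k <oo) (modulus (a k) ^+ 2 * t ^+ k)%:E)%E.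
Proof.
move=> aa t0 t1; set S := (X in (_ <= X)%E).
have part N : ((M2part a t N)%:E <= S)%E.
  rewrite /M2part -sumEFin -(big_mkord xpredT (fun k => (modulus (a k) ^+ 2 * t ^+ k)%:E)).
  by apply: nneseries_lim_ge => k _ _; rewrite lee_fin mulr_ge0 ?sqr_ge0 ?exprn_ge0.
move: part; case: S => [s||] part; last 2 first.
- by rewrite leey.
- by have := part 0; rewrite leeNy_eq.
rewrite lee_fin; apply: (cvgr_to_le (M2part_cvg aa t0 t1)).
by near=> N; have := part N; rewrite lee_fin.
Unshelve. all: by end_near. Qed.

(** Integrating a bound on all circles against the weight gives a bound in norm;
    B t is the squared radius of a circle enclosing the image of the circle
    |z|^2 = t. *)
Lemma circles_to_norm (B : R -> R) (A : R) a b c : -1 < alpha -> 0 <= A ->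
  (forall t, 0 <= t -> t < 1 -> 0 <= B t) -> (forall t, 0 <= t -> t < 1 -> B t < 1) ->
  measurable_fun [set: measurableTypeR R] (B : measurableTypeR R -> measurableTypeR R) ->
  (forall k, a k = 0 \/ (wint alpha (ico 0 1) (fun t => (B t ^+ k)%R) <= (A * mom alpha k)%:E)%E) ->
  abs_coef a -> (forall t N, 0 <= t -> t < 1 -> M2part b t N <= M2 a (B t)) ->
  norm2_le wt a c -> norm2_le wt b (A * c).
Proof.
move=> h A0 B0 B1 mB hB aa hM ha n.
have s0 := wt_scale_gt0 h.
pose p k : R := modulus (b k) ^+ 2; pose q k : R := modulus (a k) ^+ 2.
have p0 k : 0 <= p k by exact: sqr_ge0.
have q0 k : 0 <= q k by exact: sqr_ge0.
have tot : (\sum_(0 <= k <oo) (q k * mom alpha k)%:E <= (c / wt_scale)%:E)%E.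
  apply: lime_le.
    by apply: is_cvg_ereal_nneg_natsum => k _; rewrite lee_fin mulr_ge0 // ltW // mom_gt0.
  near=> N; rewrite sumEFin lee_fin big_mkord ler_pdivlMr //; apply: le_trans (ha N).
  rewrite mulr_suml le_eqVlt; apply/orP; left; apply/eqP; apply: eq_bigr => k _.
  by rewrite wt_bergman // /q; ring.
have maj : (\sum_(0 <= k <oo) (p k * mom alpha k)%:E <=
    \sum_(0 <= k <oo) ((q k)%:E * wint alpha (ico 0 1) (fun t => (B t ^+ k)%R)))%E.
  apply: (wint_majorize h p0 q0 B0 mB) => t N t0 t1.
  apply: le_trans (M2_esum aa (B0 t t0 t1) (B1 t t0 t1)).
  by rewrite lee_fin; exact: hM.
have term : (\sum_(0 <= k <oo) ((q k)%:E * wint alpha (ico 0 1) (fun t => (B t ^+ k)%R)) <=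
    \sum_(0 <= k <oo) (A%:E * (q k * mom alpha k)%:E))%E.
  apply: lee_nneseries => k.
    move=> _ _; apply: mule_ge0; first by rewrite lee_fin.
    by apply: wint_ge0 => t /icoP[t0 t1]; rewrite exprn_ge0 // B0.
  move=> _; have [ak|hk] := hB k.
    by rewrite /q ak modulus0 expr0n /= mul0e mul0r mule0.
  apply: le_trans (_ : (q k)%:E * (A * mom alpha k)%:E <= _)%E.
    by apply: lee_wpmul2l => //; rewrite lee_fin.
  by rewrite -!EFinM mulrCA.
have fin : ((\sum_(k < n) p k * mom alpha k)%:E <= (A * (c / wt_scale))%:E)%E.
  apply: le_trans (_ : \sum_(0 <= k <oo) (p k * mom alpha k)%:E <= _)%E.
    rewrite -sumEFin -(big_mkord xpredT (fun k => (p k * mom alpha k)%:E)).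
    by apply: nneseries_lim_ge => k _ _; rewrite lee_fin mulr_ge0 // ltW // mom_gt0.
  apply: le_trans maj _; apply: le_trans term _.
  rewrite nneseriesZl; last by move=> k _; rewrite lee_fin mulr_ge0 // ltW // mom_gt0.
  by rewrite EFinM; apply: lee_wpmul2l => //; rewrite lee_fin.
move: fin; rewrite lee_fin mulrA ler_pdivlMr // => fin; apply: le_trans fin.
rewrite mulr_suml le_eqVlt; apply/orP; left; apply/eqP; apply: eq_bigr => k _.
by rewrite wt_bergman // /p; ring.
Unshelve. all: by end_near. Qed.

Variables p t : nat -> R.
Hypothesis p_ge0 : forall j, 0 <= p j.
Hypothesis t_gt0 : forall j, 0 < t j.
Hypothesis t_le1 : forall j, t j <= 1.
Hypothesis t_noninc : forall i j, (i <= j)%N -> t j <= t i.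
Hypothesis p_sum : series p @ \oo --> (1 : R).
Local Notation Phi := (phi p t).

(** The modulus of the symbol is at most phiR (sqrt x) on the circle of squared
    radius x, so Littlewood's principle applies with the radius sqrt y. *)
Lemma comp_circle F a b (x y : R) N : 0 <= x -> x < 1 -> y < 1 ->
  (phiR p t (Num.sqrt x)) ^+ 2 <= y -> pser F a -> pser (fun z => F (Phi z)) b ->
  M2part b x N <= M2 a y.
Proof.
move=> x0 x1 y1 xy Fa Gb; set r := Num.sqrt x in xy.
have r0 : 0 <= r by exact: sqrtr_ge0.
have r2 : r ^+ 2 = x by rewrite sqr_sqrtr.
have r1 : r < 1 by rewrite -(@ltr_pXn2r _ 2) ?nnegrE // r2 expr1n.
have R0 : 0 <= phiR p t r by exact: (phiR_ge0 p_ge0 t_gt0 t_le1 p_sum r0 r1).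
have y0 : 0 <= y by apply: le_trans xy; exact: exprn_ge0.
set s := Num.sqrt y.
have s2 : s ^+ 2 = y by rewrite sqr_sqrtr.
have s1 : s < 1 by rewrite -(@ltr_pXn2r _ 2) ?nnegrE ?sqrtr_ge0 // s2 expr1n.
have rs : phiR p t r <= s by rewrite -(@ler_pXn2r _ 2) ?nnegrE ?sqrtr_ge0 // s2.
rewrite -r2 -s2; apply: (littlewood N (phi_selfmap p_ge0 t_gt0 t_le1 p_sum)
  (phi0 p_ge0 t_gt0 t_le1 p_sum) r0 r1 _ s1 Fa Gb) => z zr.
apply: le_trans (phi_le_phiR p_ge0 t_gt0 t_le1 p_sum _) _; by rewrite zr.
Qed.

Lemma phiR_sqrt_le (x : R) : 0 <= x -> x < 1 -> (phiR p t (Num.sqrt x)) ^+ 2 <= x.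
Proof.
move=> x0 x1; have r1 : Num.sqrt x < 1.
  by rewrite -(@ltr_pXn2r _ 2) ?nnegrE ?sqrtr_ge0 // sqr_sqrtr // expr1n.
rewrite -[leRHS](sqr_sqrtr x0); apply: le_pow.
  exact: (phiR_ge0 p_ge0 t_gt0 t_le1 p_sum (sqrtr_ge0 _) r1).
exact: (phiR_le p_ge0 t_gt0 t_le1 p_sum (sqrtr_ge0 _) r1).
Qed.

(** By Schwarz's lemma each circle is mapped inside itself. For the Hardy norm
    the radius tends to 1. *)
Lemma comp_contraction F a b c : pser F a -> pser (fun z => F (Phi z)) b -> norm2_le wt a c -> norm2_le wt b c.
Proof.
move=> Fa Gb ha; have aa := pser_abs Fa.
have bound (x : R) N : 0 <= x -> x < 1 -> M2part b x N <= M2 a x.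
  by move=> x0 x1; apply: (comp_circle N x0 x1 x1 _ Fa Gb); exact: phiR_sqrt_le.
have [h|h] := alphaP; last first.
  rewrite -[c]mul1r; apply: (@circles_to_norm id 1 a b c h) => //.
  by move=> k; right; rewrite momE // mul1r.
move=> n; under eq_bigr do rewrite wt_hardy // mulr1.
apply: (@M2part_limit R) => r r0 r1.
have x0 : 0 <= r ^+ 2 by exact: exprn_ge0.
have x1 : r ^+ 2 < 1 by rewrite exprn_ilt1.
apply: le_trans (bound _ n x0 x1) _; apply: (cvgr_to_le (M2part_cvg aa x0 x1)); near=> N.
apply: le_trans (ha N); apply: ler_sum => k _; rewrite wt_hardy //.
by apply: ler_wpM2l; [exact: sqr_ge0|exact: exprn_ile1 (ltW x1)].
Unshelve. all: by end_near. Qed.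

Hypothesis t_div : forall K : R, exists J, K <= \sum_(j < J) p j / t j.
Hypothesis nontriv : exists2 j, 0 < p j & t j < 1.

Lemma powR_inv_small (s e : R) : 0 < s -> 0 < e -> exists2 L : R, 1 <= L & (L `^ s)^-1 <= e.
Proof.
move=> s0 e0; exists (Num.max 1 (e^-1 `^ s^-1)); first by rewrite le_max lexx.
have i0 : 0 < e^-1 by rewrite invr_gt0.
have m0 : 0 < Num.max 1 (e^-1 `^ s^-1) by rewrite lt_max ltr01.
rewrite -[leRHS]invrK lef_pV2 ?posrE ?powR_gt0 //.
have {1}-> : e^-1 = (e^-1 `^ s^-1) `^ s by rewrite -powRrM mulVf ?gt_eqF // powRr1 // ltW.
apply: ge0_ler_powR; rewrite ?nnegrE ?powR_ge0 ?(ltW s0) ?(ltW m0) //.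
by rewrite le_max lexx orbT.
Qed.

(** Near the boundary the symbol multiplies the distance to the boundary by an
    arbitrarily large factor L, which gains the factor L^-(alpha + 1) in the
    squared norm; away from the boundary monomials of high degree are small. *)
Lemma comp_small_bergman (eta : R) : -1 < alpha -> 0 < eta ->
  exists m, forall F a b c, pser F a -> norm2_le wt a c -> (forall k, (k < m)%N -> a k = 0) ->
    pser (fun z => F (Phi z)) b -> norm2_le wt b (eta * c).
Proof.
move=> h eta0; have s0 : 0 < alpha + 1 by rewrite -ltrBlDr sub0r.
have e2 : 0 < eta / 2 by rewrite divr_gt0.
have [L L1 hL] := powR_inv_small s0 e2.
have [r0 [r00 r01 hr]] := gap_blowup p_ge0 t_gt0 t_le1 t_noninc p_sum (2 * L) t_div.
have L0 : 0 < L by exact: lt_le_trans L1.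
pose T0 := r0 ^+ 2.
have T00 : 0 <= T0 by exact: exprn_ge0.
have T01 : T0 < 1 by rewrite exprn_ilt1.
pose B (x : R) := if x < T0 then T0 else 1 - L * (1 - x).
have key x : T0 <= x -> x < 1 -> (phiR p t (Num.sqrt x)) ^+ 2 <= 1 - L * (1 - x).
  move=> Tx x1; have x0 := le_trans T00 Tx; set r := Num.sqrt x.
  have rr : r ^+ 2 = x by rewrite sqr_sqrtr.
  have rge : 0 <= r by exact: sqrtr_ge0.
  have r1 : r < 1 by rewrite -(@ltr_pXn2r _ 2) ?nnegrE // rr expr1n.
  have r0r : r0 <= r by rewrite -(@ler_pXn2r _ 2) ?nnegrE // rr.
  have g := hr r r0r r1.
  have q0 : 0 <= phiR p t r by exact: (phiR_ge0 p_ge0 t_gt0 t_le1 p_sum rge r1).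
  have q1 : phiR p t r <= r by exact: (phiR_le p_ge0 t_gt0 t_le1 p_sum rge r1).
  have h1 : phiR p t r ^+ 2 <= phiR p t r by rewrite expr2 ler_piMl // (le_trans q1) // ltW.
  have h2 : 0 <= L * ((1 - r) * (1 - r)) by rewrite !mulr_ge0 ?(ltW L0) // subr_ge0 ltW.
  by rewrite -rr expr2; move: h1 h2 g; rewrite expr2; lra.
have BT0 : 0 <= 1 - L * (1 - T0) by apply: le_trans (key T0 (lexx _) T01); exact: sqr_ge0.
have B0 x : 0 <= x -> x < 1 -> 0 <= B x.
  move=> x0 x1; rewrite /B; case: ltrP => // Tx.
  by apply: le_trans (key x Tx x1); exact: sqr_ge0.
have B1 x : 0 <= x -> x < 1 -> B x < 1.
  move=> x0 x1; have h1 : 1 - L * (1 - x) < 1 by rewrite gtrBl mulr_gt0 // subr_gt0.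
  by rewrite /B; case: ifP.
have mB : measurable_fun [set: measurableTypeR R] (B : measurableTypeR R -> measurableTypeR R).
  apply: measurable_fun_ifT; [exact: measurable_fun_ltr|exact: measurable_cst|].
  apply: measurable_funB; first exact: measurable_cst.
  apply: measurable_funM; first exact: measurable_cst.
  by apply: measurable_funB; [exact: measurable_cst|exact: measurable_id].
pose x := (1 + T0) / 2.
have x0 : 0 < x by rewrite /x; lra.
have x1 : x < 1 by rewrite /x; lra.
have Tx : T0 < x by rewrite /x; lra.
pose g := (1 - x) `^ (alpha + 1).
have g0 : 0 < g by rewrite powR_gt0 // subr_gt0.
have [m hm] : exists m, forall k, (m <= k)%N -> (T0 / x) ^+ k <= eta / 2 * g.
  have q1 : `|T0 / x| < 1.
    have Tx0 : 0 <= T0 / x by apply: divr_ge0 => //; exact: ltW.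
    by rewrite ger0_norm // ltr_pdivrMr // mul1r.
  have e0 : 0 < eta / 2 * g by rewrite mulr_gt0.
  have := cvg_expr q1; move=> /cvgrPdist_le/(_ _ e0)[N _ hN]; exists N => k Nk.
  by have /= := hN k Nk; rewrite sub0r normrN ger0_norm // exprn_ge0 //; apply: divr_ge0 => //; exact: ltW.
exists m => F a b c Fa ha a0 Gb.
apply: (@circles_to_norm B eta a b c h (ltW eta0) B0 B1 mB _ (pser_abs Fa) _ ha).
- move=> k; have [km|mk] := ltnP k m; first by left; exact: a0.
  right; apply: le_trans (wint_majorant h k L1 T00 T01 mB _ _ BT0) _.
  + by move=> y yT; rewrite /B yT.
  + by move=> y Ty; rewrite /B ltNge Ty.
  have low := mom_lower h k (ltW x0) x1; rewrite -/g in low.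
  have m0 : 0 < mom alpha 0 by exact: mom_gt0.
  have mk0 : 0 < mom alpha k by exact: mom_gt0.
  have h1 : T0 ^+ k * mom alpha 0 <= eta / 2 * mom alpha k.
    have := hm k mk; rewrite expr_div_n ler_pdivrMr ?exprn_gt0 // => h2.
    apply: le_trans (ler_wpM2r (ltW m0) h2) _.
    apply: le_trans (ler_wpM2l (ltW e2) low).
    by rewrite le_eqVlt; apply/orP; left; apply/eqP; ring.
  have h2 : (L `^ (alpha + 1))^-1 * mom alpha k <= eta / 2 * mom alpha k.
    by apply: ler_wpM2r => //; exact: ltW.
  by rewrite lee_fin; move: h1 h2; lra.
- move=> y N y0 y1; apply: (comp_circle N y0 y1 (B1 y y0 y1) _ Fa Gb).
  rewrite /B; case: ltrP => Ty; last exact: key.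
  by apply: le_trans (phiR_sqrt_le y0 y1) _; exact: ltW.
Qed.

Lemma comp_small (eta : R) : 0 < eta ->
  exists m, forall F a b c, pser F a -> norm2_le wt a c -> (forall k, (k < m)%N -> a k = 0) ->
    pser (fun z => F (Phi z)) b -> norm2_le wt b (eta * c).
Proof.
move=> eta0; have [h|h] := alphaP; last exact: comp_small_bergman.
have [m hm] := hardy_small p_ge0 t_gt0 t_le1 t_noninc p_sum t_div nontriv eta0.
exists m => F a b c Fa ha a0 Gb n.
under eq_bigr do rewrite wt_hardy // mulr1.
apply: (hm F a b c Fa _ a0 Gb) => N.
by have := ha N; under eq_bigr do rewrite wt_hardy // mulr1.
Qed.

End Weights.

Theorem theorem4p1 (R : realType) (alpha : R) (eps : nat -> R)
  (alpha_ge : -1 <= alpha)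
  (eps_pos : forall n, (1 <= n)%N -> 0 < eps n)
  (eps_noninc : forall m n, (1 <= m)%N -> (m <= n)%N -> eps n <= eps m)
  (eps_lim : eps n @[n --> \oo] --> 0) :
  exists phi : disk R -> disk R,
    let a n := approx_number (bergman_space alpha) (bergman_norm alpha) (comp_op phi) n in
    schur phi /\ injective phi /\ phi (disk0 R) = disk0 R /\
    compact_operator (bergman_space alpha) (bergman_norm alpha) (comp_op phi) /\
    (a n @[n --> \oo] --> 0%E) /\
    (0 < limn_einf (fun n => a n * ((eps n)^-1)%:E))%E /\
    (exists2 delta : R, 0 < delta &
       forall n, (1 <= n)%N -> ((delta * eps n)%:E <= a n)%E).
Proof.
pose w := wt alpha.
have w_gt0 : forall n, 0 < w n := wt_gt0 alpha_ge.
have w_noninc : forall n, w n.+1 <= w n := wt_noninc alpha_ge.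
have w_lower := wt_lower alpha_ge.
have normE := @wt_normE R alpha alpha_ge.
have [D D1 w_doubling] := wt_doubling alpha_ge.
pose p := wgt w_gt0 w_noninc w_lower D1 eps_pos eps_noninc.
pose t := pole w_gt0 w_noninc w_lower D1 eps_pos eps_noninc.
have p0 : forall j, 0 <= p j by move=> j; exact: wgt_ge0.
have t0 : forall j, 0 < t j by move=> j; exact: pole_gt0.
have t1 : forall j, t j <= 1 by move=> j; exact: pole_le1.
have tn : forall i j, (i <= j)%N -> t j <= t i by move=> i j; exact: pole_noninc.
have ps : series p @ \oo --> (1 : R) by exact: (@wgt_sum R w w_gt0 w_noninc w_lower D D1 eps eps_pos eps_noninc).
have td : forall K : R, exists J, K <= \sum_(j < J) p j / t j by exact: (wgt_div w_gt0 w_noninc w_lower D1 eps_pos eps_noninc eps_lim).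
have nt : exists2 j, 0 < p j & t j < 1 by exact: (wgt_nontrivial w_gt0 w_noninc w_lower D1 eps_pos eps_noninc eps_lim).
have self := phi_selfmap p0 t0 t1 ps.
pose Phi : cplx R -> cplx R := phi p t.
pose phi (z : disk R) : disk R := mkdisk (self.2 (val z) (diskP z)).
have phiE z : val (phi z) = Phi (val z) by [].
have inj : injective phi.
  move=> z z' /(congr1 val); rewrite !phiE => h; apply: val_inj.
  apply: (phi_inj p0 t0 t1 _ _ ps nt (diskP z) (diskP z') h); first exact: pole_0.
  exact: wgt_0.
have contr := @comp_contraction R alpha alpha_ge p t p0 t0 t1 ps.
have small := @comp_small R alpha alpha_ge p t p0 t0 t1 tn ps td nt.
have lower n : (1 <= n)%N -> ((lam D eps n / 2)%:E <=
    approx_number (bergman_space alpha) (bergman_norm alpha) (comp_op phi) n)%E.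
  move=> n1; apply: (approx_lower w_gt0 w_noninc w_lower normE phiE self
    (x := @test_points R w w_gt0 w_noninc w_lower D D1 eps eps_pos eps_noninc n)
    (y := @test_images R w w_gt0 w_noninc w_lower D D1 eps eps_pos eps_noninc n)).
  - by move=> i; exact: node_ge0.
  - by move=> i; exact: node_lt1.
  - by move=> i; exact: image_ge0.
  - by move=> i; exact: image_lt1.
  - exact: test_points_sep.
  - exact: test_images_sep.
  - by move=> i; apply: (phi_rc p0 t0 t1 ps); [exact: node_ge0|exact: node_lt1].
  - exact: lam_gt0.
  - by move=> i; exact: lam_kap.
  - move=> f Hf; exact: (comp_H w_gt0 normE phiE self contr Hf).
pose delta := (( 3 * D) ^+ 2 * eps 1)^-1 / 2.
have d0 : 0 < delta.
  rewrite divr_gt0 // invr_gt0 mulr_gt0 ?eps_pos // exprn_gt0 // mulr_gt0 //.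
  by apply: lt_le_trans (D1).
have bound n : (1 <= n)%N -> ((delta * eps n)%:E <=
    approx_number (bergman_space alpha) (bergman_norm alpha) (comp_op phi) n)%E.
  by move=> n1; apply: le_trans (lower n n1); rewrite lee_fin /lam /delta mulrAC.
exists phi => a; split; [|split; [|split; [|split; [|split; [|split]]]]].
- split.
    move=> z; have := self.1 (val z) (diskP z).
    have [b hb] := hol_pser self.1.
    move=> _; apply: (pser_hol (a := b)); last exact: diskP.
    by apply: (@pser_of _ _ _ _ hb) => y y1; rewrite (extE _ y1).
  move=> [c hc]; have m2 : modulus (rc (2^-1 : R)) < 1 by rewrite modulus_rc gtr0_norm // invf_lt1 // ltr1n.
  have := inj (disk0 R) (mkdisk m2); rewrite !hc => /(_ erefl) /(congr1 val) /=.
  by move/(congr1 (@modulus R)); rewrite modulus0 modulus_rc gtr0_norm // => /esym/eqP; rewrite invr_eq0 pnatr_eq0.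
- exact: inj.
- by apply: val_inj; rewrite phiE; exact: (phi0 p0 t0 t1 ps).
- exact: (comp_compact w_gt0 w_noninc w_lower normE phiE self contr small).
- exact: (approx_cvg0 w_gt0 normE phiE self contr small).
- apply: (@lt_le_trans _ _ delta%:E); first by rewrite lte_fin.
  rewrite limn_einf_lim; apply: lime_ge; first exact: is_cvg_einfs.
  near=> n; apply: le_ereal_inf_tmp => _ [k /= nk <-].
  have k1 : (1 <= k)%N by apply: leq_trans nk; near: n; exact: nbhs_infty_ge.
  have ek := eps_pos k k1.
  apply: le_trans (_ : (delta * eps k)%:E * ((eps k)^-1)%:E <= _)%E.
    by rewrite -EFinM mulfK // gt_eqF.
  by apply: lee_wpmul2r; [rewrite lee_fin invr_ge0 ltW|exact: bound].
- by exists delta.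
Unshelve. all: by end_near. Qed.
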